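(* Let $(X,\langle\cdot,\cdot\rangle)$ be a Hilbert space, let $B:\mathfrak D(B)\to X$ be the generator of a strongly continuous semigroup on $X$, let $\zeta:[-1,0]\to L(X)$ be of bounded variation, and let $\Phi: W^{1,2}([-1,0];X)\to X$ be the bounded linear operator $\Phi f=\int_{-1}^0 d\zeta(s)\, f(s)$. Let $A$ be the operator on $\mathcal E^2:=X\times L^2([-1,0];X)$ given by $$A\begin{pmatrix} x\\ f\end{pmatrix}=\begin{pmatrix} Bx+\Phi f\\ \frac{d}{d\sigma}f\end{pmatrix},\qquad \mathfrak D(A)=\left\{\begin{pmatrix} x\\ f\end{pmatrix}\in \mathfrak D(B)\times W^{1,2}([-1,0];X): f(0)=x\right\}.$$ Suppose that $B$ is the generator of a generalized contraction semigroup on $X$. Then there exists an inner product on $\mathcal E^2$, equivalent to the canonical one, such that $A$ is the generator of a generalized contraction semigroup on $\mathcal E^2$ with respect to the norm induced by this inner product.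
   Context: $L(X)$ denotes the bounded linear operators on $X$ with the operator norm. $W^{1,2}([-1,0];X)$ is the Sobolev space of (classes of) functions in $L^2([-1,0];X)$ with weak derivative in $L^2([-1,0];X)$; its elements are identified with their continuous representatives. The integral $\int_{-1}^0 d\zeta(s)f(s)$ of a continuous function $f$ is a Lebesgue-Stieltjes integral; for continuous integrands it is understood to agree with the Riemann-Stieltjes integral over the closed interval $[-1,0]$, so jumps of $\zeta$ at the end points are included. A strongly continuous semigroup $(T(t))_{t\ge0}$ on a Banach space $(Y,\|\cdot\|)$ is called a generalized contraction (semigroup) if there exists $\mu\in\mathbb R$ such that $\|T(t)\|\le e^{\mu t}$ for all $t\ge0$. The canonical inner product on $X\times L^2([-1,0];X)$ is $\langle c,d\rangle+\int_{-1}^0\langle f(s),g(s)\rangle\,ds$. Two inner products are equivalent if they induce equivalent norms. *)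

(* Defs.v *)
From HB Require Import structures.
From mathcomp Require Import all_boot all_order all_algebra.
From mathcomp Require Import all_classical all_reals all_analysis.
From mathcomp Require Import sesquilinear generic_quotient ring_quotient.
From mathcomp Require Import complex measurable_realfun.
From mathcomp Require Import lra.
Set Implicit Arguments.
Unset Strict Implicit.
Unset Printing Implicit Defensive.
Import Order.TTheory GRing.Theory Num.Theory.
Import numFieldNormedType.Exports.

Local Open Scope classical_set_scope.
Local Open Scope ring_scope.

(* The scalar field of a Hilbert space: a field with an involution, a copy of
   the reals and a real part.  The three laws pin it down, up to isomorphism,
   to the reals (trivial involution) or the complex numbers (conjugation);
   both are instances, see [real_scalars] and [complex_scalars]. *)
Record scalars (R : realType) := Scalars {
  sfield :> numFieldType ;
  sconj : involutive_rmorphism sfield ;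
  ofR : {rmorphism R -> sfield} ;
  re : sfield -> R ;
  ler_ofR : {mono ofR : a b / a <= b} ;
  normK_sconj : forall z : sfield, `|z| ^+ 2 = z * sconj z ;
  add_sconj : forall z : sfield, z + sconj z = ofR (re z *+ 2)
}.
Arguments ofR {R s}.
Arguments re {R s}.

Section ScalarInstances.
Variable R : realType.

Fact real_scalars_normK (z : R) : `|z| ^+ 2 = z * z.
Proof. by rewrite real_normK ?num_real// expr2. Qed.

Definition real_scalars : scalars R :=
  @Scalars R R idfun idfun id (fun _ _ => erefl) real_scalars_normK
    (fun z => esym (mulr2n z)).

Fact complex_add_conj (z : R[i]) :
  z + Num.conj z = (complex.Re z *+ 2)%:C%C.
Proof.
by rewrite [LHS]addcJ mulr_natl -rmorphMn.
Qed.

Definition complex_scalars : scalars R :=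
  @Scalars R R[i] (@Num.conj R[i]) (@real_complex R) (@complex.Re R)
    (@lecR R) (@normCK R[i]) complex_add_conj.

End ScalarInstances.

Section ScalarTheory.
Context {R : realType} {K : scalars R}.

Fact re_normK (z : K) : ofR (re `|z|) = `|z|.
Proof.
have cz : sconj K `|z| = `|z|.
  have [->|z0] := eqVneq z 0; first by rewrite normr0 rmorph0.
  have z0' : `|z| != 0 by rewrite normr_eq0.
  by apply: (mulfI z0'); rewrite -normK_sconj normr_id expr2.
have := add_sconj `|z|; rewrite cz -mulr2n rmorphMn /=.
by move/eqP; rewrite -subr_eq0 -mulrnBl mulrn_eq0 subr_eq0 => /eqP <-.
Qed.

End ScalarTheory.

Section RealNorm.
Context {R : realType} {K : scalars R} {V : normedModType K}.
Implicit Types x y : V.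

(* The norm of V takes its values in K; this is the same norm read in R. *)
Definition nrm x : R := re `|x|.

Fact ofR_nrm x : ofR (nrm x) = `|x| :> K.
Proof. by rewrite /nrm -[`|x|]normr_id re_normK. Qed.

Fact nrm_ge0 x : 0 <= nrm x.
Proof. by rewrite -(@ler_ofR R K) ofR_nrm rmorph0. Qed.

Fact nrmD x y : nrm (x + y) <= nrm x + nrm y.
Proof. by rewrite -(@ler_ofR R K) rmorphD/= !ofR_nrm ler_normD. Qed.

Fact nrmN x : nrm (- x) = nrm x.
Proof. by rewrite /nrm normrN. Qed.

Fact nrmZ a x : nrm (a *: x) = re `|a| * nrm x.
Proof.
by apply: (fmorph_inj (@ofR R K)); rewrite rmorphM/= !ofR_nrm re_normK normrZ.
Qed.

Fact nrm0 : nrm (0 : V) = 0.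
Proof. by apply: (fmorph_inj (@ofR R K)); rewrite ofR_nrm normr0 rmorph0. Qed.

Fact nrm_cvg (u : nat -> V) x :
  u @ \oo --> x -> nrm (u n) @[n --> \oo] --> nrm x.
Proof.
move=> ux; apply/cvgrPdist_le => e e0.
have e0' : 0 < ofR e :> K.
  by rewrite lt_neqAle eq_sym fmorph_eq0 gt_eqF//= -(rmorph0 (@ofR R K)) ler_ofR ltW.
move/cvgrPdist_le: ux => /(_ _ e0'); apply: filterS => n.
rewrite -ofR_nrm ler_ofR; apply: le_trans.
have h1 := nrmD (x - u n) (u n); have h2 := nrmD (u n - x) x.
rewrite subrK in h1; rewrite subrK -[nrm (u n - x)]nrmN opprB in h2.
by rewrite ler_norml; apply/andP; split; lra.
Qed.

End RealNorm.

Section Bochner.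
Context {R : realType} {K : scalars R} {V : normedModType K}.
Notation mu := (@lebesgue_measure R).
Notation I := (`[-1, 0]%classic : set R).
Implicit Types (f g : R -> V) (v : V).

Definition simple f :=
  finite_set (range f) /\ forall v, measurable (f @^-1` [set v]).

Definition simple_integral f : V :=
  \sum_(v \in range f) ofR (fine (mu (f @^-1` [set v] `&` I))) *: v.

(* Pointwise limits everywhere, not just almost everywhere: lebesgue_measure
   lives on Borel sets, and each almost everywhere class has such a
   representative. *)
Definition strongly_measurable f :=
  exists2 u : nat -> R -> V, (forall n, simple (u n)) &
    forall t, I t -> u n t @[n --> \oo] --> f t.

Definition is_bochner f v :=
  strongly_measurable f /\
  exists u : nat -> R -> V, [/\ forall n, simple (u n),
    (\int[mu]_(t in I) (nrm (f t - u n t))%:E)%E @[n --> \oo] --> 0%E &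
    simple_integral (u n) @[n --> \oo] --> v].

Definition bochner f : V := xget 0 [set v | is_bochner f v].

Definition square_integrable f :=
  strongly_measurable f /\ (\int[mu]_(t in I) (nrm (f t) ^+ 2)%:E < +oo)%E.

Definition sqint : {pred R -> V} := mem [set f | square_integrable f].

Fact simple_comp2 (h : V -> V -> V) f g :
  simple f -> simple g -> simple (fun t => h (f t) (g t)).
Proof.
move=> [ff mf] [fg mg]; split.
  apply: (sub_finite_set _ (finite_image2 h ff fg)) => _ [t _ <-].
  by exists (f t) => //; exists (g t).
move=> v.
have -> : (fun t => h (f t) (g t)) @^-1` [set v] =
    \bigcup_(a in range f) \bigcup_(b in range g `&` [set b | h a b = v])
      (f @^-1` [set a] `&` g @^-1` [set b]).
  apply/seteqP; split=> t /=.
    by move=> <-; exists (f t) => //; exists (g t).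
  by move=> [_ [r _ <-]] [_ [[r' _ <-] /= <-]] [-> ->].
apply: fin_bigcup_measurable => // a _; apply: fin_bigcup_measurable.
  exact: (sub_finite_set _ fg).
by move=> b _; apply: measurableI.
Qed.

Fact simple_measurable (h : V -> R) f :
  simple f -> measurable_fun I (fun t => h (f t)).
Proof.
move=> [ff mf] mI Y _.
apply: measurableI => //.
have -> : (fun t => h (f t)) @^-1` Y =
    \bigcup_(a in range f `&` h @^-1` Y) (f @^-1` [set a]).
  apply/seteqP; split=> t /=; first by move=> Yt; exists (f t).
  by move=> [_ [[r _ <-] /= hY] ->].
by apply: fin_bigcup_measurable => //; exact: (sub_finite_set _ ff).
Qed.

Fact strongly_measurable_nrm f :
  strongly_measurable f -> measurable_fun I (fun t => nrm (f t)).
Proof.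
move=> [u su uf]; apply: (@measurable_fun_cvg _ _ _ _
  (fun n t => nrm (u n t))).
  by move=> n; exact: simple_measurable.
by move=> t It; apply: nrm_cvg; exact: uf.
Qed.

Fact simple_cst v : simple (cst v).
Proof.
split; first by apply: (sub_finite_set _ (finite_set1 v)) => _ [t _ <-].
by move=> w; rewrite preimage_cst; case: ifP.
Qed.

Fact sqint_submod : submod_closed sqint.
Proof.
split.
  apply: mem_set; split; first by exists (fun _ => cst 0) => // *;
    [exact: simple_cst | exact: cvg_cst].
  by rewrite integral0_eq ?ltry// => t _; rewrite nrm0 expr0n.
move=> a f g /set_mem[mf If] /set_mem[mg Ig]; apply: mem_set.
have mfg : strongly_measurable (a *: f + g).
  have [u su uf] := mf; have [w sw wg] := mg.
  exists (fun n => a *: u n + w n).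
    by move=> n; apply: (simple_comp2 (fun x y => a *: x + y)).
  by move=> t It; apply: cvgD; [apply: cvgZl_tmp => //; exact: uf | exact: wg].
split => //; set c := 2 * re `|a| ^+ 2.
have c0 : 0 <= c by rewrite mulr_ge0// sqr_ge0.
have msq h : strongly_measurable h ->
    measurable_fun I (fun t => (nrm (h t) ^+ 2)%:E).
  by move=> mh; apply/measurable_EFinP/measurable_funX; exact: strongly_measurable_nrm.
have sq0 (h : R -> V) t : (0 <= (nrm (h t) ^+ 2)%:E)%E by rewrite lee_fin sqr_ge0.
apply: (@le_lt_trans _ _ (\int[mu]_(t in I)
    (c%:E * (nrm (f t) ^+ 2)%:E + 2%:E * (nrm (g t) ^+ 2)%:E))%E).
  apply: ge0_le_integral => //; first exact: (msq (a *: f + g)).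
    by apply: emeasurable_funD; apply: measurable_funeM; exact: msq.
  move=> t _; rewrite -!EFinM -EFinD lee_fin.
  have h0 := nrm_ge0 (a *: f t + g t).
  have := nrmD (a *: f t) (g t); rewrite nrmZ; set p := re `|a| * _ => h1.
  have -> : c * nrm (f t) ^+ 2 = 2 * p ^+ 2 by rewrite /c /p exprMn -mulrA.
  apply: (@le_trans _ _ ((p + nrm (g t)) ^+ 2)).
    by rewrite lerXn2r ?nnegrE// (le_trans h0 h1).
  by have := sqr_ge0 (p - nrm (g t)); rewrite sqrrB sqrrD; lra.
rewrite ge0_integralD//.
- rewrite !ge0_integralZl_EFin//; [|exact: msq|exact: msq].
  by rewrite lte_add_pinfty// lte_mul_pinfty.
- by move=> t _; rewrite mule_ge0.
- by apply: measurable_funeM; exact: msq.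
- by move=> t _; rewrite mule_ge0.
- by apply: measurable_funeM; exact: msq.
Qed.

HB.instance Definition _ :=
  GRing.isSubmodClosed.Build K (R -> V) sqint
    sqint_submod.

End Bochner.

Section L2.
Context {R : realType} {K : scalars R}.
Notation mu := (@lebesgue_measure R).
Notation I := (`[-1, 0]%classic : set R).

Record L2fun (V : normedModType K) := MkL2fun {
  l2fun :> R -> V ; _ : l2fun \in sqint }.

HB.instance Definition _ V := [isSub for @l2fun V].
HB.instance Definition _ V := [Choice of L2fun V by <:].
HB.instance Definition _ V := [SubChoice_isSubLmodule of L2fun V by <:].

Fact L2funB V (f g : L2fun V) t : (f - g) t = f t - g t.
Proof. by rewrite -[LHS]/((val (f - g) : R -> V) t) raddfB. Qed.

Fact L2funZ V a (f : L2fun V) t : (a *: f) t = a *: f t.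
Proof. by rewrite -[LHS]/((val (a *: f) : R -> V) t) linearZ. Qed.

Definition L2null V : {pred L2fun V} :=
  mem [set f : L2fun V | {ae mu, forall t, I t -> f t = 0}].

Fact L2null_zmod V : zmod_closed (@L2null V).
Proof.
split; first by apply: mem_set; apply: aeW.
move=> f g /set_mem f0 /set_mem g0; apply: mem_set.
apply: (@filterS2 _ (almost_everywhere mu) _ _ _ _ _ f0 g0) => t {}f0 {}g0 It.
by rewrite L2funB f0// g0// subr0.
Qed.

HB.instance Definition _ V :=
  GRing.isZmodClosed.Build (L2fun V) (@L2null V) (@L2null_zmod V).

(* L^2([-1,0];V): square integrable functions modulo equality almost
   everywhere on [-1,0]. *)
Definition L2 V : Type := Quotient.quot (@L2null V).
HB.instance Definition _ V := GRing.Zmodule.on (L2 V).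
HB.instance Definition _ V := EqQuotient.on (L2 V).

Section Lmodule.
Variable V : normedModType K.
Local Open Scope quotient_scope.

Definition L2scale (a : K) (f : L2 V) : L2 V := \pi_(L2 V) (a *: repr f).

Fact L2scale_pi a (f : L2fun V) : L2scale a (\pi_(L2 V) f) = \pi_(L2 V) (a *: f).
Proof.
apply/eqmodP => /=; rewrite /Quotient.equiv -scalerBr; apply: mem_set.
have : repr (\pi_(L2 V) f) = f %[mod L2 V] by rewrite reprK.
move=> /eqmodP /set_mem.
apply: (@filterS _ (almost_everywhere mu)) => t + It.
by move=> /(_ It) h; rewrite L2funZ h scaler0.
Qed.

Fact L2scaleA a b f : L2scale a (L2scale b f) = L2scale (a * b) f.
Proof. by rewrite -[f]reprK !L2scale_pi reprK scalerA. Qed.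

Fact L2scale1 : left_id 1 L2scale.
Proof. by move=> f; rewrite -[f]reprK L2scale_pi scale1r. Qed.

Fact L2scaleDr : right_distributive L2scale +%R.
Proof.
move=> a f g; rewrite -[f]reprK -[g]reprK -[X in L2scale _ X]raddfD.
by rewrite !L2scale_pi scalerDr raddfD.
Qed.

Fact L2scaleDl f : {morph L2scale^~ f : a b / a + b}.
Proof.
by move=> a b; rewrite -[f]reprK !L2scale_pi scalerDl raddfD.
Qed.

HB.instance Definition _ := GRing.Zmodule_isLmodule.Build K (L2 V)
  L2scaleA L2scale1 L2scaleDr L2scaleDl.

Definition L2rep (f : L2 V) : R -> V := repr f.

End Lmodule.
End L2.

Section Sobolev.
Context {R : realType} {K : scalars R} {X : normedModType K}.
Notation mu := (@lebesgue_measure R).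
Notation I := (`[-1, 0]%classic : set R).
Implicit Types f g : L2 X.

Definition test_function (phi : R -> R) :=
  (forall n x, derivable (phi^`(n)%classic) x 1) /\
  exists a b : R, [/\ -1 < a, b < 0 & forall x, phi x != 0 -> a <= x <= b].

Definition weak_derivative f g := forall phi : R -> R, test_function phi ->
  bochner (fun t => ofR (phi^`()%classic t) *: L2rep f t) =
  - bochner (fun t => ofR (phi t) *: L2rep g t).

Definition W12 : set (L2 X) := [set f | exists g, weak_derivative f g].

Definition wderiv f : L2 X := xget 0 [set g | weak_derivative f g].

(* The continuous representative of f; only its values on [-1,0] matter. *)
Definition crep f : R -> X := xget (cst 0) [set h : R -> X |
  {within I, continuous h} /\
  {ae mu, forall t, I t -> L2rep f t = h t}].

End Sobolev.

Section Semigroups.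
Context {R : realType} {K : scalars R} {Y : lmodType K}.
Implicit Types (N : Y -> R) (T : R -> Y -> Y).

Definition bounded_operator N (L : Y -> Y) :=
  linear L /\ exists M : R, forall y, N (L y) <= M * N y.

Definition opnorm N (L : Y -> Y) : R := sup [set N (L y) | y in [set y | N y <= 1]].

Record c0_semigroup N T : Prop := C0Semigroup {
  c0_bounded : forall t, 0 <= t -> bounded_operator N (T t) ;
  c0_id : forall y, T 0 y = y ;
  c0_add : forall s t, 0 <= s -> 0 <= t -> forall y, T (s + t) y = T s (T t y) ;
  c0_continuous : forall y s, 0 <= s ->
    N (T t y - T s y) @[t --> within [set t | 0 <= t] (nbhs s)] --> (0 : R)
}.

(* An unbounded operator: the values of [oapp] outside [dom] are irrelevant. *)
Record operator := Operator { dom : set Y ; oapp : Y -> Y }.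

(* Equality of the graphs of G and of the right derivative of T at 0. *)
Definition generator N T (G : operator) := forall y z,
  (dom G y /\ oapp G y = z) <->
  N (ofR h^-1 *: (T h y - y) - z) @[h --> 0^'+] --> (0 : R).

Definition generates_c0_semigroup N (G : operator) :=
  exists2 T, c0_semigroup N T & generator N T G.

Definition generates_generalized_contraction_semigroup N (G : operator) :=
  exists T, [/\ c0_semigroup N T, generator N T G &
    exists m : R, forall t, 0 <= t -> opnorm N (T t) <= expR (m * t)].

Definition ipnorm (ip : Y -> Y -> K) (y : Y) : R := Num.sqrt (re (ip y y)).

Definition equivalent_inner_products (ip ip' : Y -> Y -> K) :=
  exists c C : R, [/\ 0 < c, 0 < C &
    forall y, c * ipnorm ip y <= ipnorm ip' y <= C * ipnorm ip y].

End Semigroups.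
Arguments operator {R K} Y.

Section Stieltjes.
Context {R : realType} {K : scalars R} {X : normedModType K}.
Implicit Types zeta : R -> X -> X.

Definition op_variation zeta (s : seq R) : R :=
  let p := nth 0 (-1 :: s) in
  \sum_(0 <= i < size s) opnorm nrm (zeta (p i.+1) - zeta (p i)).

Definition op_bounded_variation zeta :=
  has_ubound [set op_variation zeta s | s in itv_partition (-1) 0].

(* Riemann-Stieltjes limit over tagged partitions of the closed interval, so
   that jumps of zeta at both end points contribute. *)
Definition is_stieltjes zeta (f : R -> X) (v : X) := forall e : R, 0 < e ->
  exists2 d : R, 0 < d & forall (s : seq R) (xi : nat -> R),
    let p := nth 0 (-1 :: s) in
    itv_partition (-1) 0 s ->
    (forall i, (i < size s)%N ->
      p i.+1 - p i < d /\ p i <= xi i <= p i.+1) ->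
    nrm (\sum_(0 <= i < size s) (zeta (p i.+1) - zeta (p i)) (f (xi i)) - v) < e.

Definition stieltjes zeta (f : R -> X) : X := xget 0 [set v | is_stieltjes zeta f v].

End Stieltjes.

Section Delay.
Context {R : realType} {K : scalars R} {X : normedModType K}.

Definition canonical_ip (ip : X -> X -> K) (u v : X * L2 X) : K :=
  ip u.1 v.1 + bochner (fun t => ip (L2rep u.2 t) (L2rep v.2 t) : K^o).

Definition Phi (zeta : R -> X -> X) (f : L2 X) : X := stieltjes zeta (crep f).

Definition delay_operator (B : operator X) (zeta : R -> X -> X) :
    operator (X * L2 X)%type :=
  {| dom := [set u | [/\ dom B u.1, W12 u.2 & crep u.2 0 = u.1]] ;
     oapp := fun u => (oapp B u.1 + Phi zeta u.2, wderiv u.2) |}.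

End Delay.

(* Main.v *)
(** Let [V] be the variation function of [zeta] and weight the second component of
    the canonical inner product by [tau = 1 + V].  For [(x, f)] in the domain, the
    integral of [2 tau re <f', f>] splits into [|x|^2 - |f(-1)|^2] and
    [\int V (|f|^2)'].  By Young's inequality and integration by parts,
    [2 |Phi f| |x| <= \int (|x|^2 + |f|^2) dV = 2 V(0) |x|^2 - \int V (|f|^2)'],
    and the last integral is exactly the one produced by the weight, so the two
    cancel and [A - mu] is dissipative for some [mu].  The equation
    [lam u - A u = w] is solved by variation of constants in the second component
    and, in the first, by a fixed point of norm at most 1/2 through the resolvent
    of [B], itself obtained by averaging the semigroup over [0,1].  The
    Lumer-Phillips theorem for Hilbert spaces then yields the semigroup, as a limit
    of backward Euler schemes. *)
From HB Require Import structures.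
Require Import Defs.
From mathcomp Require Import all_boot all_order all_algebra.
From mathcomp Require Import all_classical all_reals all_analysis.
From mathcomp Require Import sesquilinear.
From mathcomp Require Import measurable_realfun ring lra.
From mathcomp Require finmap.
Set Implicit Arguments.
Unset Strict Implicit.
Unset Printing Implicit Defensive.
Import Order.TTheory GRing.Theory Num.Theory.
Import numFieldNormedType.Exports.
Local Open Scope classical_set_scope.
Local Open Scope ring_scope.

(** * Scalars and real inner products *)

(** The obstacle is [Phi]: it sees values of [f] at single points and is in general unbounded in the
    norm of $L^2$, so it is no bounded perturbation, and the canonical product in general leaves [A]
    without any dissipativity bound. A weight that grows wherever [zeta] varies makes transport
    dissipate exactly $|f|^2\,dV$, which is what pays for [Phi]. The summand 1 keeps the new norm
    above the canonical one and yields the boundary terms. As [V] may jump, the weight is never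
    differentiated: integration by parts puts the derivative on the absolutely continuous function
    $|f|^2$.

    Vector identities are tested against vectors through the real form $\mathrm{re}\langle
    x,y\rangle$, which reduces them to real integrals and treats real and complex scalars at once.
    Sobolev functions are handled as a primitive together with its integrand.

    The factor 1/2 arises as follows: for large [lam] the resolvent of [B] has norm at most
    $1/(2V(0)+2)$, while [Phi] maps $e^{\lambda\cdot}x$ to a vector of norm at most $V(0)|x|$. The
    density of the domain of [A] is derived from dissipativity and the range condition by an
    orthogonality argument. *)

Section Scalars.
Context {R : realType} {K : scalars R}.
Implicit Types (z w : K) (a b : R).

Lemma sconj_normr z : sconj K `|z| = `|z|.
Proof.
have [->|z0] := eqVneq z 0; first by rewrite normr0 rmorph0.
have z0' : `|z| != 0 by rewrite normr_eq0.
by apply: (mulfI z0'); rewrite -normK_sconj normr_id expr2.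
Qed.

Lemma sconj_ofR a : sconj K (ofR a) = ofR a.
Proof.
have pos b : 0 <= b -> sconj K (ofR b) = ofR b.
  move=> b0; have b0' : 0 <= ofR b :> K by rewrite -(rmorph0 (@ofR R K)) ler_ofR.
  by rewrite -(ger0_norm b0') sconj_normr.
have [/pos//|/ltW] := leP 0 a; rewrite -oppr_ge0 => /pos.
by rewrite !rmorphN /= => /oppr_inj.
Qed.

Lemma add_sconjE z : z + sconj K z = ofR (2 * re z).
Proof. by rewrite add_sconj mulr_natl. Qed.

Lemma re_eq z a : z + sconj K z = ofR (2 * a) -> re z = a.
Proof. by rewrite add_sconjE => /fmorph_inj; lra. Qed.

Lemma re_ofR a : re (ofR a : K) = a.
Proof. by apply: re_eq; rewrite sconj_ofR -rmorphD; congr (ofR _); lra. Qed.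

Lemma reD z w : re (z + w) = re z + re w.
Proof.
apply: re_eq; rewrite [sconj K _]rmorphD /= addrACA !add_sconjE -rmorphD.
by congr (ofR _); lra.
Qed.

Lemma re_ofRM a z : re (ofR a * z) = a * re z.
Proof.
apply: re_eq; rewrite [sconj K _]rmorphM /= sconj_ofR -mulrDr add_sconjE -rmorphM.
by congr (ofR _); lra.
Qed.

Lemma reN z : re (- z) = - re z.
Proof. by rewrite -mulN1r -(rmorphN1 (@ofR R K)) re_ofRM mulN1r. Qed.

Lemma re0 : re (0 : K) = 0.
Proof. by rewrite -(rmorph0 (@ofR R K)) re_ofR. Qed.

Lemma re_sconj z : re (sconj K z) = re z.
Proof. by apply: re_eq; rewrite rmorphK addrC add_sconjE. Qed.

Lemma mul_sconj z : z * sconj K z = ofR (re `|z| ^+ 2).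
Proof. by rewrite -normK_sconj rmorphXn /= re_normK. Qed.

Lemma re_norm_ge0 z : 0 <= re `|z|.
Proof. by rewrite -(@ler_ofR R K) re_normK rmorph0. Qed.

(** [z - sconj K z] stands in for twice the imaginary part: its square is minus the square of its
    modulus, and [4 * re z ^+ 2] is [4 * (z * sconj K z)] plus that square. *)
Lemma sqr_re_le z : re z ^+ 2 <= re `|z| ^+ 2.
Proof.
rewrite -(@ler_ofR R K) -mul_sconj.
have E : (z - sconj K z) ^+ 2 = - ofR (re `|z - sconj K z| ^+ 2).
  by rewrite -mul_sconj [sconj K (_ - _)]rmorphB /= rmorphK -mulrN opprB expr2.
have F : 4%:R * ofR (re z ^+ 2) =
    4%:R * (z * sconj K z) + (z - sconj K z) ^+ 2.
  transitivity ((z + sconj K z) ^+ 2); last by ring.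
  by rewrite add_sconjE -rmorphXn -(rmorph_nat (@ofR R K)) -rmorphM; congr (ofR _); ring.
rewrite -(@ler_pM2l _ (4%:R : K)) // F gerDl E oppr_le0.
by rewrite -(rmorph0 (@ofR R K)) ler_ofR sqr_ge0.
Qed.

Lemma ler_re_norm z : `|re z| <= re `|z|.
Proof. by rewrite -ler_sqr ?nnegrE ?re_norm_ge0 // real_normK ?num_real // sqr_re_le. Qed.

Lemma re_normM z w : re `|z * w| = re `|z| * re `|w|.
Proof.
apply: (fmorph_inj (@ofR R K)).
by rewrite rmorphM /= !re_normK normrM.
Qed.

Lemma re_normD z w : re `|z + w| <= re `|z| + re `|w|.
Proof.
by rewrite -(@ler_ofR R K) [leRHS]rmorphD /= !re_normK ler_normD.
Qed.

Lemma ofR_ge0 a : (0 <= ofR a :> K) = (0 <= a).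
Proof. by rewrite -(rmorph0 (@ofR R K)) ler_ofR. Qed.

Lemma re_norm_ofR a : re `|ofR a : K| = `|a|.
Proof.
apply/eqP; rewrite -(@eqrXn2 _ 2) ?re_norm_ge0 //; apply/eqP.
apply: (fmorph_inj (@ofR R K)).
by rewrite -mul_sconj sconj_ofR -rmorphM -expr2 real_normK ?num_real.
Qed.

(* Either [K] is a copy of the reals or it contains an imaginary unit [i]. *)
Lemma scalars_decomp : exists i : K, forall z, exists b,
  [/\ z = ofR (re z) + ofR b * i, `|b| <= re `|z| & b = re (z * - i)].
Proof.
have [[z0 hz0]|h] := pselect (exists z : K, sconj K z != z); last first.
  exists 0 => z; exists 0; rewrite normr0 re_norm_ge0 oppr0 !mulr0 re0; split => //.
  have hz : sconj K z = z by apply/eqP/negPn/negP => h'; apply: h; exists z.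
  have := add_sconjE z; rewrite hz => h2; rewrite addr0.
  apply: (mulfI (negbT (pnatr_eq0 K 2))); rewrite mulr_natl mulr2n h2.
  by rewrite -(rmorph_nat (@ofR R K)) -rmorphM.
(* [w] is purely imaginary and nonzero, so dividing it by its modulus gives an element [i] with
   [i * i = -1]. *)
set w := z0 - sconj K z0; have w0 : w != 0 by rewrite subr_eq0 eq_sym.
have cw : sconj K w = - w by rewrite /w rmorphB /= rmorphK opprB.
set r := re `|w|; have r0 : ofR r != 0 :> K by rewrite re_normK normr_eq0.
pose i := w / ofR r.
have ci : sconj K i = - i by rewrite /i fmorph_div /= cw sconj_ofR mulNr.
have ii : i * i = -1.
  have : w * w = - ofR r ^+ 2.
    by rewrite -[X in _ * X]opprK -cw mulrN mul_sconj rmorphXn.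
  by rewrite /i mulrACA -expr2 => ->; rewrite mulNr -invfM -expr2 mulfV // expf_neq0.
have ni : re `|i| = 1.
  have /eqP := mul_sconj i; rewrite ci mulrN ii opprK -(rmorph1 (@ofR R K)).
  rewrite (inj_eq (fmorph_inj _)) eq_sym => /eqP; rewrite -[RHS](expr1n _ 2).
  by move/eqP; rewrite eqrXn2 ?re_norm_ge0 // => /eqP.
exists i => z; exists (re (z * - i)); split => //; last first.
  by apply: le_trans (ler_re_norm _) _; rewrite re_normM normrN ni mulr1.
have two0 : (2%:R : K) != 0 by rewrite pnatr_eq0.
apply: (mulfI two0); rewrite mulrDr mulrA.
rewrite -(rmorph_nat (@ofR R K)) -!rmorphM /= -!add_sconjE.
have -> : sconj K (z * - i) = sconj K z * i by rewrite rmorphM rmorphN /= ci opprK.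
have -> : (z * - i + sconj K z * i) * i = (sconj K z - z) * (i * i) by ring.
by rewrite ii rmorph_nat; ring.
Qed.

(** Completeness of [K] comes from that of [R]: by [scalars_decomp] a Cauchy sequence has Cauchy
    coordinates with respect to a fixed [i]. *)
Lemma scalars_complete (z : nat -> K) :
  (forall e : R, 0 < e -> exists n0, forall m n, (n0 <= m)%N -> (n0 <= n)%N ->
     re `|z m - z n| <= e) ->
  exists l, forall e : R, 0 < e -> exists n0, forall n, (n0 <= n)%N ->
     re `|z n - l| <= e.
Proof.
move=> cz; have [i hi] := scalars_decomp.
have cvgR (u : nat -> R) : (forall m n, `|u m - u n| <= re `|z m - z n|) ->
    exists l, forall e : R, 0 < e -> exists n0, forall n, (n0 <= n)%N -> `|u n - l| <= e.
  move=> uz; have : cvg (u @ \oo).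
    apply/cauchy_cvgP/cauchy_exP => e e0.
    have [n0 hn0] := cz _ (divr_gt0 e0 (ltr0Sn R 1)).
    exists (u n0); exists n0 => // n /= nn; rewrite /ball /=.
    apply: le_lt_trans (uz _ _) _.
    by apply: le_lt_trans (hn0 _ _ (leqnn _) nn) _; lra.
  move=> /cvg_ex[l /cvgrPdist_le ul]; exists l => e /ul[n0 _ hn0].
  by exists n0 => n /hn0 /=; rewrite distrC.
have [a ha] : exists a, forall e : R, 0 < e -> exists n0, forall n, (n0 <= n)%N ->
    `|re (z n) - a| <= e.
  by apply: cvgR => m n; rewrite -reN -reD ler_re_norm.
pose y n := re (z n * - i).
have [b hb] : exists b, forall e : R, 0 < e -> exists n0, forall n, (n0 <= n)%N ->
    `|y n - b| <= e.
  apply: cvgR => m n; rewrite /y -reN -reD -mulNr -mulrDl.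
  by have [c [_ + <-]] := hi (z m - z n).
exists (ofR a + ofR b * i) => e e0.
have c0 : 0 < 1 + re `|i| by have := re_norm_ge0 i; lra.
have e1 : 0 < e / (1 + re `|i|) by rewrite divr_gt0.
have [n1 h1] := ha _ e1; have [n2 h2] := hb _ e1.
exists (maxn n1 n2) => n; rewrite geq_max => /andP[/h1 {}h1 /h2 {}h2].
have [c [zn _ cE]] := hi (z n).
have -> : z n - (ofR a + ofR b * i) = ofR (re (z n) - a) + ofR (y n - b) * i.
  by rewrite {1}zn !rmorphB /= /y -cE; ring.
apply: le_trans (re_normD _ _) _.
rewrite re_normM !re_norm_ofR -[leRHS](@divfK _ (1 + re `|i|)) ?gt_eqF //.
rewrite mulrDr mulr1 lerD // ler_wpM2r // re_norm_ge0 //.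
Qed.

End Scalars.

Lemma subrACA (V : zmodType) (a b c d : V) : a - b - (c - d) = a - c - (b - d).
Proof. by rewrite !opprB [LHS]addrACA [RHS]addrACA; congr (_ + _); rewrite addrC. Qed.

Lemma eq_ler (R : numDomainType) (x y : R) : x = y -> x <= y.
Proof. by move->. Qed.

Lemma cvg_right0P (R : realType) (f : R -> R) : f h @[h --> 0^'+] --> (0 : R) <->
  forall e : R, 0 < e -> exists2 d, 0 < d & forall t, 0 < t < d -> `|f t| <= e.
Proof.
split=> [/cvgrPdist_le h e /h|h].
  rewrite /at_right near_withinE => /nbhs_ballP[d /= d0 hd].
  exists d => // t /andP[t0 td]; rewrite -normrN -sub0r; apply: hd => //.
  by rewrite /ball /= sub0r normrN gtr0_norm.
apply/cvgrPdist_le => e /h[d d0 hd]; rewrite /at_right near_withinE.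
apply/nbhs_ballP; exists d => //= t; rewrite /ball /= sub0r normrN => td t0.
by rewrite sub0r normrN; apply: hd; rewrite t0 -(gtr0_norm t0).
Qed.

Section RealInnerProduct.
Context {R : realType} {K : scalars R} {Y : lmodType K}.
Implicit Types (x y z : Y) (a b c : R).

(** The real part of an inner product over [K], kept as a form bilinear over [R] only. [rip_sqrZ]
    retains the compatibility with [K]: it makes [qnorm] homogeneous and, by polarization, turns
    multiplication by [k] into a similarity. *)
Record real_ip (q : Y -> Y -> R) : Prop := RealIp {
  rip_sym : forall x y, q x y = q y x ;
  ripDl : forall x y z, q (x + y) z = q x z + q y z ;
  ripZl : forall a x y, q (ofR a *: x) y = a * q x y ;
  rip_sqrZ : forall (k : K) x, q (k *: x) (k *: x) = re `|k| ^+ 2 * q x x ;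
  rip_gt0 : forall x, x != 0 -> 0 < q x x }.

Definition qnorm (q : Y -> Y -> R) y := Num.sqrt (q y y).

(** Convergence is spelled out for a bare function [N], because the product of [X] with [L2 X] is
    handled as a mere module, without a topology. *)
Definition nlim (N : Y -> R) (u : nat -> Y) l :=
  forall e : R, 0 < e -> exists n0, forall n, (n0 <= n)%N -> N (u n - l) <= e.

Definition ncauchy (N : Y -> R) (u : nat -> Y) :=
  forall e : R, 0 < e -> exists n0, forall m n, (n0 <= m)%N -> (n0 <= n)%N ->
    N (u m - u n) <= e.

Definition ncomplete (N : Y -> R) := forall u, ncauchy N u -> exists l, nlim N u l.

Section Theory.
Variables (q : Y -> Y -> R) (hq : real_ip q).
Local Notation N := (qnorm q).

Lemma rip0l y : q 0 y = 0.
Proof. by rewrite -(scale0r (0 : Y)) -(rmorph0 (@ofR R K)) ripZl // mul0r. Qed.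
Lemma ripDr x y z : q x (y + z) = q x y + q x z.
Proof. by rewrite rip_sym // ripDl // !(rip_sym hq x). Qed.
Lemma ripZr a x y : q x (ofR a *: y) = a * q x y.
Proof. by rewrite rip_sym // ripZl // (rip_sym hq x). Qed.
Lemma ripNl x y : q (- x) y = - q x y.
Proof. by rewrite -scaleN1r -(rmorphN1 (@ofR R K)) ripZl // mulN1r. Qed.
Lemma ripNr x y : q x (- y) = - q x y.
Proof. by rewrite rip_sym // ripNl // (rip_sym hq x). Qed.
Lemma ripBl x y z : q (x - y) z = q x z - q y z.
Proof. by rewrite ripDl // ripNl. Qed.
Lemma ripBr x y z : q x (y - z) = q x y - q x z.
Proof. by rewrite ripDr // ripNr. Qed.
Lemma rip_ge0 x : 0 <= q x x.
Proof. by have [->|/(rip_gt0 hq)/ltW//] := eqVneq x 0; rewrite rip0l. Qed.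
Lemma qnorm_ge0 x : 0 <= N x. Proof. exact: sqrtr_ge0. Qed.
Lemma sqr_qnorm x : N x ^+ 2 = q x x. Proof. by rewrite sqr_sqrtr // rip_ge0. Qed.
Lemma qnorm0 : N 0 = 0. Proof. by rewrite /qnorm rip0l sqrtr0. Qed.
Lemma qnorm0_eq0 x : N x = 0 -> x = 0.
Proof.
move=> N0; apply/eqP/negPn/negP => /(rip_gt0 hq).
by rewrite -sqr_qnorm N0 expr0n ltxx.
Qed.
Lemma qnormN x : N (- x) = N x.
Proof. by rewrite /qnorm ripNl ripNr opprK. Qed.
Lemma qnorm_sub x y : N (x - y) = N (y - x).
Proof. by rewrite -qnormN opprB. Qed.
Lemma qnormZ (k : K) x : N (k *: x) = re `|k| * N x.
Proof.
rewrite /qnorm rip_sqrZ // sqrtrM ?sqr_ge0 // sqrtr_sqr ger0_norm //.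
exact: re_norm_ge0.
Qed.
Lemma qnorm_ofRZ a x : N (ofR a *: x) = `|a| * N x.
Proof. by rewrite qnormZ re_norm_ofR. Qed.

Lemma rip_cs x y : `|q x y| <= N x * N y.
Proof.
have [->|y0] := eqVneq y 0; first by rewrite rip_sym // rip0l normr0 qnorm0 mulr0.
have qy := rip_gt0 hq y0.
rewrite -ler_sqr ?nnegrE ?mulr_ge0 ?qnorm_ge0 //.
rewrite real_normK ?num_real // exprMn !sqr_qnorm.
have := rip_ge0 (x - ofR (q x y / q y y) *: y).
rewrite ripBl !ripBr !ripZl // !ripZr (rip_sym hq y x).
set b := q x y; set c := q y y => h.
have -> : q x x * c = (q x x - b / c * b - (b / c * b - b / c * (b / c * c))) * c + b ^+ 2.
  by field; rewrite gt_eqF.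
by rewrite lerDr mulr_ge0 // ltW.
Qed.

Lemma rip_le x y : q x y <= N x * N y.
Proof. exact: le_trans (ler_norm _) (rip_cs _ _). Qed.

Lemma qnormD x y : N (x + y) <= N x + N y.
Proof.
have h1 := qnorm_ge0 x; have h2 := qnorm_ge0 y.
rewrite -ler_sqr ?nnegrE ?qnorm_ge0 ?addr_ge0 // sqr_qnorm sqrrD !sqr_qnorm.
rewrite ripDl // !ripDr (rip_sym hq y x); have := rip_le x y; lra.
Qed.

Lemma qnormB x y z : N (x - y) <= N (x - z) + N (z - y).
Proof. by rewrite -{1}(subrK z x) -addrA; exact: qnormD. Qed.

Lemma qnorm_le x y : N x <= N y + N (x - y).
Proof. by rewrite -{1}(subrK y x) [leRHS]addrC; exact: qnormD. Qed.

Lemma nlim_cst x : nlim N (fun=> x) x.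
Proof. by move=> e e0; exists 0%N => n _; rewrite subrr qnorm0 ltW. Qed.

Lemma nlimD u v x y : nlim N u x -> nlim N v y -> nlim N (fun n => u n + v n) (x + y).
Proof.
move=> ux vy e e0; have e2 : 0 < e / 2 by lra.
have [n1 h1] := ux _ e2; have [n2 h2] := vy _ e2.
exists (maxn n1 n2) => n; rewrite geq_max => /andP[/h1 {}h1 /h2 {}h2].
rewrite opprD addrACA; apply: le_trans (qnormD _ _) _; lra.
Qed.

Lemma nlim_bnd (f : Y -> Y) C u x : 0 <= C -> (forall y z, f (y - z) = f y - f z) ->
  (forall y, N (f y) <= C * N y) -> nlim N u x -> nlim N (fun n => f (u n)) (f x).
Proof.
move=> C0 fB fC ux e e0; have e1 : 0 < e / (C + 1) by rewrite divr_gt0 //; lra.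
have [n0 h] := ux _ e1; exists n0 => n /h {}h; rewrite -fB.
apply: le_trans (fC _) _; apply: (@le_trans _ _ ((C + 1) * (e / (C + 1)))).
  by rewrite ler_pM ?qnorm_ge0 //; lra.
by rewrite mulrCA divff ?mulr1 // gt_eqF; lra.
Qed.

Lemma nlimB u v x y : nlim N u x -> nlim N v y -> nlim N (fun n => u n - v n) (x - y).
Proof.
move=> ux vy; apply: nlimD => //.
by apply: (@nlim_bnd -%R 1 v y) => // [z w|z]; rewrite ?opprD // qnormN mul1r.
Qed.

Lemma nlimZ (k : K) u x : nlim N u x -> nlim N (fun n => k *: u n) (k *: x).
Proof.
apply: (@nlim_bnd _ (re `|k|)) => [|y z|y]; first exact: re_norm_ge0.
  by rewrite scalerBr.
by rewrite qnormZ.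
Qed.

Lemma nlim_le u x C : nlim N u x -> (exists n0, forall n, (n0 <= n)%N -> N (u n) <= C) ->
  N x <= C.
Proof.
move=> ux [n1 hC]; apply/ler_addgt0Pr => e e0; have [n2 h2] := ux _ e0.
have := h2 _ (leq_maxr n1 n2); have := hC _ (leq_maxl n1 n2).
rewrite qnorm_sub; have := qnorm_le x (u (maxn n1 n2)); lra.
Qed.

Lemma nlim_unique u x y : nlim N u x -> nlim N u y -> x = y.
Proof.
move=> ux uy; apply/eqP; rewrite -subr_eq0; apply/eqP/qnorm0_eq0/le_anti.
rewrite qnorm_ge0 andbT; apply/ler_addgt0Pr => e e0; have e2 : 0 < e / 2 by lra.
have [n1 h1] := ux _ e2; have [n2 h2] := uy _ e2.
have := h1 _ (leq_maxl n1 n2); have := h2 _ (leq_maxr n1 n2).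
have := qnormB x y (u (maxn n1 n2)); rewrite (qnorm_sub x (u _)); lra.
Qed.

Lemma nlim_sub u v x : nlim N u x -> nlim N (fun n => u n - v n) 0 -> nlim N v x.
Proof.
move=> ux uv e e0; have e2 : 0 < e / 2 by lra.
have [n1 h1] := ux _ e2; have [n2 h2] := uv _ e2.
exists (maxn n1 n2) => n; rewrite geq_max => /andP[/h1 {}h1 /h2].
rewrite subr0 => {}h2; have := qnormB (v n) x (u n); have := qnorm_sub (v n) (u n); lra.
Qed.

Lemma geometric_ncauchy u C c : 0 <= C -> 0 <= c < 1 ->
  (exists n0, forall n, (n0 <= n)%N -> N (u n.+1 - u n) <= C * c ^+ n) -> ncauchy N u.
Proof.
move=> C0 /andP[c0 c1] [n0 h].
(* Bounding by the exact partial sum of the geometric series, rather than by its limit, lets the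
   induction on [k] close. *)
have tail n k : (n0 <= n)%N -> N (u (n + k)%N - u n) <= C * c ^+ n / (1 - c) * (1 - c ^+ k).
  move=> nn; elim: k => [|k IH]; first by rewrite addn0 subrr qnorm0 expr0 subrr mulr0.
  apply: le_trans (qnormB _ _ (u (n + k)%N)) _; rewrite addnS.
  have := h (n + k)%N (leq_trans nn (leq_addr _ _)).
  have -> : C * c ^+ n / (1 - c) * (1 - c ^+ k.+1) =
    C * c ^+ (n + k) + C * c ^+ n / (1 - c) * (1 - c ^+ k).
    by rewrite exprS exprD; field; rewrite subr_eq0 gt_eqF.
  by move=> h1; apply: lerD.
have c1' : 0 < 1 - c by lra.
move=> e e0; have e1 : 0 < e / 2 * (1 - c) / (C + 1).
  by rewrite divr_gt0 ?mulr_gt0 ?divr_gt0 //; lra.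
have : c ^+ n @[n --> \oo] --> (0 : R) by apply: cvg_expr; rewrite ger0_norm.
move=> /cvgrPdist_le/(_ _ e1)[n1 _ hn1].
have key n k : (maxn n0 n1 <= n)%N -> N (u (n + k)%N - u n) <= e / 2.
  rewrite geq_max => /andP[a1 a2]; apply: le_trans (tail _ _ a1) _.
  have := hn1 _ a2; rewrite /= sub0r normrN ger0_norm ?exprn_ge0 // => h1.
  apply: (@le_trans _ _ (C * c ^+ n / (1 - c))).
    rewrite ler_piMr ?divr_ge0 ?mulr_ge0 ?exprn_ge0 //; first exact: ltW.
    by rewrite lerBlDr lerDl exprn_ge0.
  rewrite ler_pdivrMr //.
  apply: (@le_trans _ _ ((C + 1) * c ^+ n)); first by rewrite ler_wpM2r ?exprn_ge0 //; lra.
  by rewrite mulrC -ler_pdivlMr //; lra.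
exists (maxn n0 n1) => m n hm hn.
have := key (maxn n0 n1) (m - maxn n0 n1)%N (leqnn _); rewrite subnKC //.
have := key (maxn n0 n1) (n - maxn n0 n1)%N (leqnn _); rewrite subnKC //.
have := qnormB (u m) (u n) (u (maxn n0 n1)); have := qnorm_sub (u n) (u (maxn n0 n1)); lra.
Qed.

End Theory.

Lemma real_ip_dot (ip : {dot Y for sconj K}) : real_ip (fun x y => re (ip x y)).
Proof.
have sym x y : ip x y = sconj K (ip y x).
  by have := @hermitian_subproof K Y false (sconj K) ip x y; rewrite expr0 mul1r.
split.
- by move=> x y; rewrite sym re_sconj.
- by move=> x y z; rewrite linearDl reD.
- by move=> a x y; rewrite linearZl_LR /= re_ofRM.
- move=> k x; rewrite linearZl_LR /= linearZr_LR /= mulrA.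
  by rewrite mul_sconj re_ofRM.
- move=> x x0; rewrite lt_neqAle.
  have h : 0 < ip x x by apply: neq0_dnorm_gt0.
  have E : ip x x = ofR (re (ip x x)).
    rewrite -(ger0_norm (ltW h)) -[`|_|]re_normK re_ofR //.
  move: h; rewrite E -(rmorph0 (@ofR R K)) !re_ofR lt_neqAle ler_ofR.
  by rewrite (inj_eq (fmorph_inj _)) => /andP[-> ->].
Qed.

End RealInnerProduct.

(** * The Lumer-Phillips theorem in a Hilbert space *)

(** Multiply by [1 - x]: from [1 - x <= expR (- x)] comes [expR x * (1 - x) <= 1], and
    [1 <= (1 + 2 * x) * (1 - x)] up to [x = 1 / 2]. *)
Lemma expR_le_1D2x (R : realType) (x : R) : 0 <= x -> x <= 1 / 2 -> expR x <= 1 + 2 * x.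
Proof.
move=> x0 x1; have E : expR x * (1 - x) <= 1.
  have := ler_wpM2l (expR_ge0 x) (expR_ge1Dx (- x)).
  by rewrite -expRD subrr expR0.
have : expR x * (1 - x) <= (1 + 2 * x) * (1 - x) by apply: le_trans E _; nra.
by rewrite ler_pM2r //; lra.
Qed.

Section Generation.
Context {R : realType} {K : scalars R} {Y : lmodType K}.
Variables (q : Y -> Y -> R) (hq : real_ip q).
Local Notation N := (qnorm q).
Hypothesis N_complete : ncomplete N.
Variable A : operator Y.
Local Notation D := (dom A).
Local Notation L := (Defs.oapp A).
Hypothesis A_linear : forall (k : K) y z, D y -> D z ->
  D (k *: y + z) /\ L (k *: y + z) = k *: L y + L z.
Variables m h1 : R.
Hypotheses (m_ge0 : 0 <= m) (h1_gt0 : 0 < h1) (h1m : h1 * m <= 1 / 2).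
Hypothesis A_dissipative : forall y, D y -> q (L y) y <= m * q y y.
Hypothesis A_range : forall h y, 0 < h <= h1 -> exists2 z, D z & z - ofR h *: L z = y.
Implicit Types (x y z : Y) (s t h : R).

Local Notation r := (2 * m).

Let D0 : D 0.
Proof.
have [z Dz _] := @A_range h1 0 (andb_true_intro (conj h1_gt0 (lexx h1))).
by have [] := A_linear (-1) Dz Dz; rewrite scaleN1r addNr.
Qed.

Let L0 : L 0 = 0.
Proof. by have [_] := A_linear (-1) D0 D0; rewrite !scaleN1r !addNr. Qed.

Let DZ (k : K) y : D y -> D (k *: y).
Proof. by move=> Dy; have [] := A_linear k Dy D0; rewrite addr0. Qed.

Let LZ (k : K) y : D y -> L (k *: y) = k *: L y.
Proof. by move=> Dy; have [_] := A_linear k Dy D0; rewrite !addr0 L0 addr0. Qed.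

Let DD y z : D y -> D z -> D (y + z).
Proof. by move=> Dy Dz; have [] := A_linear 1 Dy Dz; rewrite scale1r. Qed.

Let LD y z : D y -> D z -> L (y + z) = L y + L z.
Proof. by move=> Dy Dz; have [_] := A_linear 1 Dy Dz; rewrite !scale1r. Qed.

Let DB y z : D y -> D z -> D (y - z).
Proof. by move=> Dy Dz; rewrite -scaleN1r; apply: DD => //; exact: DZ. Qed.

Let LB y z : D y -> D z -> L (y - z) = L y - L z.
Proof.
by move=> Dy Dz; have [_] := A_linear (-1) Dz Dy; rewrite !scaleN1r ![- _ + _]addrC.
Qed.

(** Pairing the residual [z - ofR h *: L z] with [z] bounds its norm below by [(1 - h * m) * N z];
    as [h * m <= 1 / 2], the inverse of [1 - h * m] is at most [1 + r * h]. Uniqueness of the Euler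
    step and stability of the scheme both rest on this. *)
Let dissipative_le h z : 0 <= h <= h1 -> D z ->
  N z <= (1 + r * h) * N (z - ofR h *: L z).
Proof.
move=> /andP[h0 hh] Dz; set w := z - _.
have hm : h * m <= 1 / 2 by apply: le_trans h1m; rewrite ler_wpM2r.
have hm0 : 0 <= h * m by rewrite mulr_ge0.
have Nz := qnorm_ge0 q z; have Nw := qnorm_ge0 q w.
have e1 : (1 - h * m) * N z ^+ 2 <= N w * N z.
  apply: le_trans (rip_le hq w z); rewrite /w ripBl // ripZl // (sqr_qnorm hq).
  have := ler_wpM2l h0 (A_dissipative Dz); rewrite mulrA; lra.
have e2 : (1 - h * m) * N z <= N w.
  have [z0|z0] := ltP 0 (N z); last first.
    by have -> : N z = 0 by [apply/le_anti; rewrite Nz z0]; rewrite mulr0.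
  by rewrite -(ler_pM2r z0) -mulrA -expr2.
have e3 : 1 <= (1 + r * h) * (1 - h * m) by nra.
apply: (@le_trans _ _ ((1 + r * h) * ((1 - h * m) * N z))).
  by rewrite mulrA ler_peMl.
by rewrite ler_wpM2l //; nra.
Qed.

(* Backward Euler step. *)
Let J h y := if h == 0 then y else xget 0 [set z | D z /\ z - ofR h *: L z = y].

(** The separate value at [h = 0] extends the estimates below to degenerate steps, and hence the
    scheme to time zero. *)
Let J0 y : J 0 y = y. Proof. by rewrite /J eqxx. Qed.

Let JP h y : 0 < h <= h1 -> D (J h y) /\ J h y - ofR h *: L (J h y) = y.
Proof.
move=> hh; rewrite /J gt_eqF; last by case/andP: hh.
have [z Dz zy] := A_range y hh.
by apply: (@xgetPex _ 0 [set z | D z /\ z - ofR h *: L z = y]); exists z.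
Qed.

Let Junique h z : 0 < h <= h1 -> D z -> J h (z - ofR h *: L z) = z.
Proof.
move=> hh Dz; have [Dj ej] := JP (z - ofR h *: L z) hh.
apply/eqP; rewrite -subr_eq0; apply/eqP/(qnorm0_eq0 hq)/le_anti.
rewrite qnorm_ge0 andbT.
have /andP[h0 hle] := hh.
have := @dissipative_le h _ _ (DB Dj Dz); rewrite (ltW h0) hle => /(_ isT).
by rewrite LB // scalerBr subrACA ej subrr (qnorm0 hq) mulr0.
Qed.

Let J_le h y : 0 <= h <= h1 -> N (J h y) <= expR (r * h) * N y.
Proof.
move=> /andP[]; rewrite le_eqVlt => /predU1P[<- _|h0 hh].
  by rewrite J0 mulr0 expR0 mul1r.
have hh' : 0 < h <= h1 by rewrite h0 hh.
have [Dj ej] := JP y hh'.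
have := @dissipative_le h _ _ Dj; rewrite (ltW h0) hh => /(_ isT); rewrite ej.
move/le_trans; apply; rewrite ler_wpM2r ?qnorm_ge0 //; exact: expR_ge1Dx.
Qed.

Let J_linear h (k : K) y z : 0 <= h <= h1 -> J h (k *: y + z) = k *: J h y + J h z.
Proof.
move=> /andP[]; rewrite le_eqVlt => /predU1P[<- _|h0 hh]; first by rewrite !J0.
have hh' : 0 < h <= h1 by rewrite h0 hh.
have [Dy ey] := JP y hh'; have [Dz ez] := JP z hh'.
have [Dk Lk] := A_linear k Dy Dz.
rewrite -[RHS](Junique hh' Dk) Lk -{1}ey -{1}ez; congr (J h _).
by rewrite scalerBr scalerDr addrACA -opprD !scalerA [k * _]mulrC.
Qed.

(** On the range of [J h] the operator is a difference quotient, [L (J h y) = (J h y - y) / h],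
    which lies in [D] once [y] does; uniqueness of the step identifies it with [J h (L y)]. *)
Let JD h y : 0 <= h <= h1 -> D y -> D (J h y) /\ L (J h y) = J h (L y).
Proof.
move=> /andP[]; rewrite le_eqVlt => /predU1P[<- _|h0 hh] Dy; first by rewrite !J0.
have hh' : 0 < h <= h1 by rewrite h0 hh.
have [Dj ej] := JP y hh'; split => //.
have h0' : ofR h != 0 :> K by rewrite fmorph_eq0 gt_eqF.
have E : L (J h y) = (ofR h)^-1 *: (J h y - y).
  by rewrite -[X in _ *: (_ - X)]ej subKr scalerA mulVf // scale1r.
have DLj : D (L (J h y)) by rewrite E; apply: DZ; exact: DB.
rewrite -[LHS](Junique hh' DLj); congr (J h _).
by rewrite -LZ // -LB ?ej //; exact: DZ.
Qed.

Let J_step h y : 0 <= h <= h1 -> D y -> J h y - y = ofR h *: J h (L y).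
Proof.
move=> /andP[]; rewrite le_eqVlt => /predU1P[<- _|h0 hh] Dy.
  by rewrite !J0 subrr rmorph0 scale0r.
have hh' : 0 < h <= h1 by rewrite h0 hh.
have [Dj ej] := JP y hh'.
have [|_ <-] := @JD h y _ Dy; first by rewrite ltW.
by rewrite -{2}ej opprB addrC subrK.
Qed.

(** With [z = J t y], applying [J s] to [y = z - t L z] and moving [L] across [J s] shows that
    [J s z] solves the step of length [t] that starts from [J s y]. *)
Let J_comm s t y : 0 <= s <= h1 -> 0 <= t <= h1 -> J s (J t y) = J t (J s y).
Proof.
move=> ss tt; have := ss; have := tt.
move=> /andP[]; rewrite le_eqVlt => /predU1P[<- _|t0 th]; first by rewrite !J0.
move=> /andP[]; rewrite le_eqVlt => /predU1P[<- _|s0 sh]; first by rewrite !J0.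
have tt' : 0 < t <= h1 by rewrite t0 th.
have ss' : 0 < s <= h1 by rewrite s0 sh.
have [Dy ey] := JP y tt'.
have [Dj Lj] := JD ss Dy.
by rewrite -{2}ey -scaleN1r addrC !scalerA J_linear // addrC mulN1r scaleNr
  -Lj Junique.
Qed.

Local Notation D2 := (fun y => D y /\ D (L y)).

(** The product of [1 - t L] and [1 - s L] is [1 - (s + t) L] plus [s t L^2]. Two steps thus differ
    from a single one of the combined length only to second order, which is the source of the
    convergence rates below. *)
Let J_split s t y : 0 <= s -> 0 <= t -> s + t <= h1 -> D2 y ->
  J s (J t y) - J (s + t) y = - (ofR (s * t) *: J s (J t (J (s + t) (L (L y))))).
Proof.
move=> s0 t0 st [Dy DLy].
have ss : 0 <= s <= h1 by rewrite s0; lra.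
have tt : 0 <= t <= h1 by rewrite t0; lra.
have su : 0 <= s + t <= h1 by rewrite addr_ge0.
have [Du Lu] := JD su Dy; have [DLu LLu] := JD su DLy.
rewrite -Lu in DLu LLu.
set u := J (s + t) y in Du Lu DLu LLu *.
have J_sub h x z : 0 <= h <= h1 -> J h (x - z) = J h x - J h z.
  by move=> hh; rewrite addrC -scaleN1r J_linear // scaleN1r addrC.
have inv h x : 0 <= h <= h1 -> D x -> J h (x - ofR h *: L x) = x.
  move=> /andP[]; rewrite le_eqVlt => /predU1P[<- _|h0 hh] Dx.
    by rewrite rmorph0 scale0r subr0 J0.
  by apply: Junique => //; rewrite h0.
have uE : u - y = ofR (s + t) *: L u by rewrite Lu -J_step.
have Dv : D (u - ofR s *: L u) by apply: DB => //; exact: DZ.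
have yE : y = (u - ofR s *: L u) - ofR t *: L (u - ofR s *: L u)
            - ofR (s * t) *: L (L u).
  rewrite LB ?LZ //; last exact: DZ.
  rewrite scalerBr scalerA -!rmorphM [t * s]mulrC.
  rewrite -[RHS]addrA -opprD subrK -addrA -opprD -scalerDl -rmorphD -uE.
  by rewrite subKr.
have JZ h (k : K) x : 0 <= h <= h1 -> J h (k *: x) = k *: J h x.
  move=> hh; rewrite -[k *: x]addr0 J_linear //.
  have -> : J h 0 = 0 by have := J_sub h 0 0 hh; rewrite !subrr.
  by rewrite addr0.
rewrite -LLu {1}yE (J_sub t) // inv // (J_sub s) // inv // addrAC subrr add0r !JZ //.
Qed.

Let J_subr h x z : 0 <= h <= h1 -> J h (x - z) = J h x - J h z.
Proof. by move=> hh; rewrite addrC -scaleN1r J_linear // scaleN1r addrC. Qed.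

Let iter_J_le h n y : 0 <= h <= h1 ->
  N (iter n (J h) y) <= expR (r * h * n%:R) * N y.
Proof.
move=> hh; elim: n => [|n IH]; first by rewrite mulr0 expR0 mul1r.
rewrite iterS; apply: le_trans (J_le _ hh) _.
by rewrite -[n.+1%:R]natr1 mulrDr mulr1 expRD [_ * expR (r * h)]mulrC -[_ * N y]mulrA ler_wpM2l ?expR_ge0.
Qed.

Let iter_J_linear h n (k : K) y z : 0 <= h <= h1 ->
  iter n (J h) (k *: y + z) = k *: iter n (J h) y + iter n (J h) z.
Proof. by move=> hh; elim: n => //= n ->; rewrite J_linear. Qed.

Let iter_J_sub h n y z : 0 <= h <= h1 ->
  iter n (J h) (y - z) = iter n (J h) y - iter n (J h) z.
Proof. by move=> hh; elim: n => //= n ->; rewrite J_subr. Qed.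

Let iter_J_D h n y : 0 <= h <= h1 -> D y ->
  D (iter n (J h) y) /\ L (iter n (J h) y) = iter n (J h) (L y).
Proof.
move=> hh Dy; elim: n => //= n [Dn <-]; exact: JD.
Qed.

Let iter_J_step h n y : 0 <= h <= h1 -> D y ->
  N (iter n (J h) y - y) <= n%:R * h * expR (r * h * n%:R) * N (L y).
Proof.
move=> hh Dy; have /andP[h0 _] := hh.
have r0 : 0 <= r * h by rewrite !mulr_ge0.
elim: n => [|n IH]; first by rewrite subrr (qnorm0 hq) !mul0r.
apply: le_trans (qnormB hq _ _ (iter n (J h) y)) _.
rewrite iterSr -iter_J_sub // J_step //.
have a1 := iter_J_le n (ofR h *: J h (L y)) hh.
rewrite (qnorm_ofRZ hq) (ger0_norm h0) in a1.
have a2 := J_le (L y) hh.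
have a3 : expR (r * h * n%:R) <= expR (r * h * n.+1%:R).
  by rewrite ler_expR ler_wpM2l // ler_nat.
have a4 : expR (r * h * n.+1%:R) = expR (r * h * n%:R) * expR (r * h).
  by rewrite -expRD -[n.+1%:R]natr1 mulrDr mulr1.
apply: (@le_trans _ _ (h * expR (r * h * n.+1%:R) * N (L y) +
    n%:R * h * expR (r * h * n.+1%:R) * N (L y))); last first.
  by rewrite -[n.+1%:R]natr1; set a := N _; set b := expR _; apply/eq_ler; ring.
apply: lerD; last first.
  apply: le_trans IH _; rewrite ler_wpM2r ?qnorm_ge0 // ler_wpM2l //.
  by rewrite mulr_ge0.
apply: le_trans a1 _; rewrite a4 -!mulrA mulrCA ler_wpM2l // ler_wpM2l ?expR_ge0 //.
by rewrite [2 * _]mulrA.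
Qed.

(** From [n] to [n.+1] the remainder grows by [h] times [iter n.+1 (J h) (L y) - L y], which
    [iter_J_step] bounds by a multiple of [n.+1%:R * h]. *)
Let iter_J_taylor h n y : 0 <= h <= h1 -> D2 y ->
  N (iter n (J h) y - y - ofR (n%:R * h) *: L y) <=
  (n%:R * h) ^+ 2 * expR (r * h * n%:R) * N (L (L y)).
Proof.
move=> hh [Dy DLy]; have /andP[h0 _] := hh.
have r0 : 0 <= r * h by rewrite !mulr_ge0.
elim: n => [|n IH].
  by rewrite subrr mul0r rmorph0 scale0r subrr (qnorm0 hq) expr0n !mul0r.
have [Dn Ln] := iter_J_D n hh Dy.
have -> : iter n.+1 (J h) y - y - ofR (n.+1%:R * h) *: L y =
   (iter n (J h) y - y - ofR (n%:R * h) *: L y) +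
   ofR h *: (iter n.+1 (J h) (L y) - L y).
  have -> : iter n.+1 (J h) (L y) = J h (L (iter n (J h) y)) by rewrite iterS Ln.
  rewrite scalerBr -J_step // iterS -[n.+1%:R]natr1 mulrDl mul1r rmorphD scalerDl.
  rewrite [RHS]addrACA opprD; congr (_ + _).
  by rewrite [RHS]addrC addrA subrK.
apply: le_trans (qnormD hq _ _) _.
rewrite (qnorm_ofRZ hq) (ger0_norm h0).
have a3 : expR (r * h * n%:R) <= expR (r * h * n.+1%:R).
  by rewrite ler_expR ler_wpM2l // ler_nat.
have a5 := ler_wpM2l h0 (iter_J_step n.+1 hh DLy).
apply: (@le_trans _ _ ((n%:R * h) ^+ 2 * expR (r * h * n.+1%:R) * N (L (L y)) +
  h * (n.+1%:R * h * expR (r * h * n.+1%:R) * N (L (L y))))).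
  apply: lerD a5; apply: le_trans IH _.
  by rewrite ler_wpM2r ?qnorm_ge0 // ler_wpM2l // sqr_ge0.
set a := N _; set b := expR _; have a0 : 0 <= a by rewrite qnorm_ge0.
have b0 : 0 <= b by rewrite expR_ge0.
rewrite -[n.+1%:R]natr1; set k := n%:R; have k0 : 0 <= k by rewrite /k.
rewrite -subr_ge0.
have -> : ((k + 1) * h) ^+ 2 * b * a - ((k * h) ^+ 2 * b * a + h * ((k + 1) * h * b * a))
  = k * h * h * b * a by ring.
by rewrite !mulr_ge0.
Qed.

(** By commutation the double iterate consists of [n] pairs of steps. They are merged one at a time,
    and each merging error from [J_split] is carried along by stable iterates. The [2] in the
    exponent pays for the three resolvents in that error, of total length [2 * (s + t)]. *)
Let iter_J_split s t n y : 0 <= s -> 0 <= t -> s + t <= h1 -> D2 y ->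
  N (iter n (J s) (iter n (J t) y) - iter n (J (s + t)) y) <=
  n%:R * (s * t) * expR (r * (s + t) * (n%:R + 2)) * N (L (L y)).
Proof.
move=> s0 t0 st; have ss : 0 <= s <= h1 by rewrite s0; lra.
have tt : 0 <= t <= h1 by rewrite t0; lra.
have su : 0 <= s + t <= h1 by rewrite addr_ge0.
have r0 : 0 <= r * (s + t) by rewrite !mulr_ge0 ?addr_ge0.
elim: n y => [|n IH] y D2y; first by rewrite subrr (qnorm0 hq) !mul0r.
have [Dy DLy] := D2y.
have comm k z : iter k (J s) (J t z) = J t (iter k (J s) z).
  by elim: k => //= k ->; rewrite J_comm.
have [DQ LQ] := JD su Dy; have [DLQ LLQ] := JD su DLy.
have D2Q : D2 (J (s + t) y) by rewrite LQ.
have -> : iter n.+1 (J s) (iter n.+1 (J t) y) = iter n (J s) (iter n (J t) (J s (J t y))).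
  have comm' k z : iter k (J t) (J s z) = J s (iter k (J t) z).
    by elim: k => //= k ->; rewrite J_comm.
  by rewrite [in RHS]comm' -iterSr; congr (iter _ _ _); rewrite -iterSr.
rewrite [iter n.+1 (J (s + t)) y]iterSr.
apply: le_trans (qnormB hq _ _ (iter n (J s) (iter n (J t) (J (s + t) y)))) _.
rewrite -iter_J_sub // -iter_J_sub // J_split //.
set w := J (s + t) (L (L y)).
have b1 : N (iter n (J s) (iter n (J t) (- (ofR (s * t) *: J s (J t w))))) <=
  s * t * expR (r * (s + t) * (n.+1%:R + 2)) * N (L (L y)).
  apply: le_trans (iter_J_le _ _ ss) _.
  have := iter_J_le n (- (ofR (s * t) *: J s (J t w))) tt.
  rewrite qnormN // (qnorm_ofRZ hq) ger0_norm ?mulr_ge0 // => c1.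
  have c2 := J_le (J t w) ss; have c3 := J_le w tt.
  have c4 := J_le (L (L y)) su; rewrite -/w in c4.
  have c5 : N (J s (J t w)) <= expR (r * s) * (expR (r * t) * (expR (r * (s + t)) * N (L (L y)))).
    apply: le_trans c2 _; rewrite ler_wpM2l ?expR_ge0 //; apply: le_trans c3 _.
    by rewrite ler_wpM2l ?expR_ge0.
  apply: (@le_trans _ _ (expR (r * s * n%:R) * (expR (r * t * n%:R) * (s * t *
    (expR (r * s) * (expR (r * t) * (expR (r * (s + t)) * N (L (L y))))))))).
    rewrite ler_wpM2l ?expR_ge0 //; apply: le_trans c1 _.
    by rewrite ler_wpM2l ?expR_ge0 // ler_wpM2l ?mulr_ge0.
  rewrite !mulrA ler_wpM2r ?qnorm_ge0 //.
  have -> : expR (r * s * n%:R) * expR (r * t * n%:R) * s * t * expR (r * s) * expR (r * t)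
    * expR (r * (s + t)) = s * t * (expR (r * s * n%:R) * expR (r * t * n%:R) * expR (r * s)
    * expR (r * t) * expR (r * (s + t))) by ring.
  rewrite ler_wpM2l ?mulr_ge0 // -!expRD ler_expR -[n.+1%:R]natr1; set k := n%:R; nra.
have b2 : N (iter n (J s) (iter n (J t) (J (s + t) y)) - iter n (J (s + t)) (J (s + t) y)) <=
  n%:R * (s * t) * expR (r * (s + t) * (n.+1%:R + 2)) * N (L (L y)).
  apply: le_trans (IH _ D2Q) _; rewrite LQ LLQ.
  have c4 := J_le (L (L y)) su.
  have -> : r * (s + t) * (n.+1%:R + 2) = r * (s + t) * (n%:R + 2) + r * (s + t).
    by rewrite -[n.+1%:R]natr1; ring.
  rewrite expRD; set E := expR (_ * (_ + 2)); set F := expR (r * _) in c4 *.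
  have E0 : 0 <= E by exact: expR_ge0.
  by rewrite -[_ * (E * F) * _]mulrA -[E * F * _]mulrA -[_ * E * _]mulrA !ler_wpM2l // !mulr_ge0.
apply: le_trans (lerD b1 b2) _; rewrite -[n.+1%:R]natr1.
set a := N _; set b := expR _; set k := n%:R; apply/eq_ler; ring.
Qed.

(* Hilbert-space step: the residuals of a minimizing sequence in [D] converge
   to some [r0] with [J h1 r0 = 0], hence to [0]. *)
Let D_dense y e : 0 < e -> exists2 z, D z & N (y - z) <= e.
Proof.
move=> e0; pose S := [set a : R | exists2 z, D z & a = q (y - z) (y - z)].
have S0 : S !=set0 by exists (q (y - 0) (y - 0)), 0.
have Slb : has_lbound S by exists 0 => _ [z _ ->]; exact: rip_ge0.
have Sinf : has_inf S by [].
pose d := inf S.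
have dle z : D z -> d <= q (y - z) (y - z).
  by move=> Dz; apply: ge_inf => //; exists z.
have hh1 : 0 < h1 <= h1 by rewrite h1_gt0 lexx.
have hh1' : 0 <= h1 <= h1 by rewrite ltW //= lexx.
have /choice[w hw] n : exists w, D w /\ q (y - w) (y - w) < d + (1 / 2) ^+ n.
  have e1 : 0 < (1 / 2 : R) ^+ n by rewrite exprn_gt0 //; lra.
  have [_ [w Dw ->] hw] := inf_adherent e1 Sinf.
  by exists w.
(* near-minimality makes the residual almost orthogonal to [D] *)
have ortho n v : D v -> q (y - w n) v ^+ 2 <= (1 / 2) ^+ n * q v v.
  move=> Dv; have [Dw wn] := hw n.
  have [->|v0] := eqVneq v 0; first by rewrite rip_sym // !rip0l // expr0n mulr0.
  have qv := rip_gt0 hq v0.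
  have := dle _ (DD Dw (DZ (ofR (q (y - w n) v / q v v)) Dv)).
  rewrite opprD addrA; move: (y - w n) wn => u wn.
  rewrite (ripBl hq) !(ripBr hq) !(ripZl hq) !(ripZr hq) (rip_sym hq v u).
  set b := q u v; set c := q v v in qv *; set a := q u u in wn *.
  have -> : a - b / c * b - (b / c * b - b / c * (b / c * c)) = a - b ^+ 2 / c.
    by field; rewrite gt_eqF.
  move=> h; have : b ^+ 2 / c <= (1 / 2) ^+ n by lra.
  by rewrite ler_pdivrMr.
(* Parallelogram law: the midpoint of [w n] and [w k] lies in [D], so its squared distance to [y] is
   at least the infimum, and this forces the two points together. *)
have diff_le n k : (n <= k)%N -> q (w n - w k) (w n - w k) <= 4 * (1 / 2) ^+ n.
  move=> nk; have [Dn wn] := hw n; have [Dk wk] := hw k.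
  have half : D (ofR (1 / 2) *: (w n + w k)) by apply: DZ; exact: DD.
  have := dle _ half.
  have -> : y - ofR (1 / 2) *: (w n + w k) = ofR (1 / 2) *: ((y - w n) + (y - w k)).
    rewrite addrACA -opprD scalerBr; congr (_ - _).
    rewrite -[y + y]mulr2n -[y *+ 2]scaler_nat scalerA -(rmorph_nat (@ofR R K)) -rmorphM.
    by rewrite (_ : 1 / 2 * 2%:R = 1) ?rmorph1 ?scale1r //; lra.
  have -> : w n - w k = (y - w k) - (y - w n) by rewrite subrACA subrr sub0r opprB.
  move: (y - w n) (y - w k) wn wk => u1 u2 wn wk.
  rewrite (ripZl hq) (ripZr hq) !(ripDl hq) !(ripDr hq) !(ripNl hq) !(ripNr hq).
  rewrite (rip_sym hq u2 u1).
  have le2 : (1 / 2 : R) ^+ k <= (1 / 2) ^+ n.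
    by rewrite -(subnK nk) exprD ler_piMl ?exprn_ge0 ?exprn_ile1 //; lra.
  lra.
have cw : ncauchy N (fun n => y - w n).
  move=> e1 e10; have e2 : 0 < (e1 / 2) ^+ 2 by rewrite exprn_gt0 //; lra.
  have : (1 / 2 : R) ^+ n @[n --> \oo] --> (0 : R) by apply: cvg_expr; rewrite ger0_norm; lra.
  have e3 : 0 < (e1 / 2) ^+ 2 / 4 by lra.
  move=> /cvgrPdist_le/(_ _ e3)[n1 _ hn1].
  have key n : (n1 <= n)%N -> N (y - w n1 - (y - w n)) <= e1 / 2.
    move=> nn; rewrite -ler_sqr ?nnegrE ?qnorm_ge0 //; last lra.
    rewrite (sqr_qnorm hq) subrACA subrr sub0r (ripNl hq) (ripNr hq) opprK.
    apply: le_trans (diff_le _ _ nn) _.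
    have := hn1 n1 (leqnn _); rewrite /= sub0r normrN ger0_norm ?exprn_ge0 //; lra.
  exists n1 => a b /key ha /key hb.
  have := qnormB hq (y - w a) (y - w b) (y - w n1).
  have := qnorm_sub hq (y - w a) (y - w n1); lra.
have [r0 hr0] := N_complete cw.
have J1 : nlim N (fun n => J h1 (y - w n)) (J h1 r0).
  apply: (nlim_bnd (C := expR (r * h1)) _ _ _ hr0) => [|a b|a]; [exact: expR_ge0|exact: J_subr|exact: J_le].
(* The vector [v = J h1 (y - w n)] lies in [D], hence is almost orthogonal to the residual. But the
   residual equals [v - h1 L v], and its pairing with [v] is at least half the square of [N v]. *)
have J2 : nlim N (fun n => J h1 (y - w n)) 0.
  move=> e1 e10.
  have e2 : 0 < (e1 / 2) ^+ 2 by rewrite exprn_gt0 //; lra.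
  have : (1 / 2 : R) ^+ n @[n --> \oo] --> (0 : R) by apply: cvg_expr; rewrite ger0_norm; lra.
  move=> /cvgrPdist_le/(_ _ e2)[n1 _ hn1]; exists n1 => n nn; rewrite subr0.
  have [Dj ej] := JP (y - w n) hh1; set v := J h1 (y - w n) in Dj ej *.
  have Nv := qnorm_ge0 q v.
  have := ortho n v Dj; rewrite -(sqr_qnorm hq) => o1.
  have o2 : (1 / 2) ^+ n <= (e1 / 2) ^+ 2.
    by have := hn1 n nn; rewrite /= sub0r normrN ger0_norm ?exprn_ge0 //; lra.
  have o3 : q (y - w n) v <= e1 / 2 * N v.
    apply: le_trans (ler_norm _) _.
    rewrite -ler_sqr ?nnegrE ?mulr_ge0 //; last lra.
    rewrite real_normK ?num_real // exprMn; apply: le_trans o1 _.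
    by rewrite ler_wpM2r // sqr_ge0.
  have o4 : 1 / 2 * N v ^+ 2 <= q (y - w n) v.
    rewrite -ej (ripBl hq) (ripZl hq) (sqr_qnorm hq).
    have := ler_wpM2l (ltW h1_gt0) (A_dissipative Dj).
    have := ler_wpM2r (rip_ge0 hq v) h1m; rewrite mulrA; lra.
  have o5 : N v * N v <= e1 * N v by rewrite -expr2; lra.
  have [v0|] := ltP 0 (N v); last by move/le_trans; apply; exact: ltW.
  by rewrite -(ler_pM2r v0).
have Jr0 := nlim_unique hq J1 J2.
have r00 : r0 = 0.
  by have [_] := JP r0 hh1; rewrite Jr0 L0 scaler0 subr0.
have [n hn] := hr0 _ e0; exists (w n); first by have [] := hw n.
by have := hn n (leqnn _); rewrite r00 subr0.
Qed.

Let J_contD z e : 0 < e -> D z -> exists2 h, 0 < h <= h1 & N (J h z - z) <= e.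
Proof.
move=> e0 Dz.
pose C := expR (r * h1) * N (L z).
have C0 : 0 <= C by rewrite mulr_ge0 ?expR_ge0 ?qnorm_ge0.
pose h := Num.min h1 (e / (C + 1)).
have h0 : 0 < h by rewrite lt_min h1_gt0 divr_gt0 //; lra.
have hh : 0 < h <= h1 by rewrite h0 /h ge_min lexx.
have hh' : 0 <= h <= h1 by case/andP: hh => /ltW->.
exists h => //; rewrite J_step // (qnorm_ofRZ hq) (gtr0_norm h0).
have a1 : N (J h (L z)) <= C.
  apply: le_trans (J_le _ hh') _; rewrite ler_wpM2r ?qnorm_ge0 // ler_expR ler_wpM2l //.
    by rewrite mulr_ge0.
  by case/andP: hh.
have a2 : h <= e / (C + 1) by rewrite /h ge_min lexx orbT.
apply: (@le_trans _ _ (e / (C + 1) * (C + 1))); last by rewrite divfK // gt_eqF //; lra.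
by apply: ler_pM => //; rewrite ?qnorm_ge0 ?(ltW h0) //; lra.
Qed.

Let D2_dense y e : 0 < e -> exists2 z, D2 z & N (y - z) <= e.
Proof.
move=> e0; have e2 : 0 < e / 2 by lra.
have [z Dz yz] := D_dense y e2.
have [h hh hz] := J_contD e2 Dz.
have hh' : 0 <= h <= h1 by case/andP: hh => /ltW->.
have [Dj ej] := JD hh' Dz; have [DLz _] := JP (L z) hh.
exists (J h z); first by rewrite ej.
have := qnormB hq y (J h z) z; have := qnorm_sub hq (J h z) z; lra.
Qed.

Let J_cont y e : 0 < e -> exists2 h, 0 < h <= h1 & N (J h y - y) <= e.
Proof.
move=> e0; pose C := expR (r * h1) + 1.
have C0 : 0 < C by rewrite addr_gt0 ?expR_gt0.
have e1 : 0 < e / 2 / C by rewrite !divr_gt0.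
have e2 : 0 < e / 2 by lra.
have [z Dz yz] := D_dense y e1; have [h hh hz] := J_contD e2 Dz.
have hh' : 0 <= h <= h1 by case/andP: hh => /ltW->.
exists h => //.
have -> : J h y - y = (J h (y - z) - (y - z)) + (J h z - z).
  by rewrite J_subr // subrACA subrK.
apply: le_trans (qnormD hq _ _) _.
suff : N (J h (y - z) - (y - z)) <= e / 2 by lra.
apply: le_trans (qnormB hq _ _ 0) _; rewrite subr0 sub0r (qnormN hq).
apply: (@le_trans _ _ (C * N (y - z))); last by rewrite mulrC -ler_pdivlMr.
rewrite /C mulrDl mul1r lerD2r; apply: le_trans (J_le _ hh') _.
rewrite ler_wpM2r ?qnorm_ge0 // ler_expR ler_wpM2l ?mulr_ge0 //.
by case/andP: hh.
Qed.

(** Dyadic subdivision: passing from [n] to [n.+1] cuts every step into two equal halves, so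
    [iter_J_split] compares consecutive terms. *)
Let Tn t y n := iter (2 ^ n) (J (t / 2 ^+ n)) y.

Let Tn_small t : 0 <= t -> exists n0, forall n, (n0 <= n)%N -> 0 <= t / 2 ^+ n <= h1.
Proof.
move=> t0; have e0 : 0 < h1 / (t + 1) by rewrite divr_gt0 //; lra.
have : (1 / 2 : R) ^+ n @[n --> \oo] --> (0 : R) by apply: cvg_expr; rewrite ger0_norm; lra.
move=> /cvgrPdist_le/(_ _ e0)[n0 _ hn0]; exists n0 => n /hn0 /=.
rewrite sub0r normrN ger0_norm ?exprn_ge0 // expr_div_n expr1n => hn.
rewrite divr_ge0 ?exprn_ge0 //=.
apply: (@le_trans _ _ ((t + 1) * (1 / 2 ^+ n))).
  by rewrite mul1r ler_wpM2r ?invr_ge0 ?exprn_ge0 //; lra.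
by rewrite mulrC -ler_pdivlMr //; lra.
Qed.

Let Tn_scale t n : (2 ^ n)%:R * (t / 2 ^+ n) = t.
Proof. by rewrite natrX mulrC divfK // expf_neq0. Qed.

Let Tn_le t y : 0 <= t -> exists n0, forall n, (n0 <= n)%N ->
  N (Tn t y n) <= expR (r * t) * N y.
Proof.
move=> /Tn_small[n0 h]; exists n0 => n /h hn; apply: le_trans (iter_J_le _ _ hn) _.
by rewrite -mulrA [_ / _ * _]mulrC Tn_scale.
Qed.

Let Tn_cauchy2 t y : 0 <= t -> D2 y -> ncauchy N (Tn t y).
Proof.
(* Merging [2 ^ n] pairs of steps of length [t / 2 ^ n.+1] costs a multiple of
   [t ^+ 2 / (4 * 2 ^ n)], hence the ratio [1 / 2]. In the exponent the total time [t] is lengthened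
   by [2 * t / 2 ^ n], at most [2 * t]; this gives [3 * t]. *)
move=> t0 D2y; pose C := t ^+ 2 * expR (r * (3 * t)) * N (L (L y)).
apply: (@geometric_ncauchy _ _ _ _ hq _ C (1 / 2)).
- by rewrite !mulr_ge0 ?expR_ge0 ?qnorm_ge0 ?sqr_ge0.
- by lra.
have [n0 h] := Tn_small t0; exists n0 => n nn.
have /andP[a0 a1] := h n nn; set s := t / 2 ^+ n.+1.
have s0 : 0 <= s by rewrite divr_ge0 ?exprn_ge0.
have ss : s + s = t / 2 ^+ n by rewrite /s exprS; field; rewrite expf_neq0.
have ss1 : s + s <= h1 by rewrite ss.
have -> : Tn t y n.+1 = iter (2 ^ n) (J s) (iter (2 ^ n) (J s) y).
  by rewrite -iterD addnn -mul2n -expnS.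
rewrite /Tn -ss; apply: le_trans (iter_J_split _ s0 s0 ss1 D2y) _.
rewrite /C mulrAC; rewrite [X in _ <= X](_ : _ = t ^+ 2 * (1 / 2) ^+ n *
   expR (r * (3 * t)) * N (L (L y))); last by ring.
rewrite mulrAC ler_wpM2r ?qnorm_ge0 // ler_pM ?expR_ge0 ?mulr_ge0 //.
  have -> : (2 ^ n)%:R * (s * s) = t ^+ 2 * (1 / 2) ^+ n / 4.
    by rewrite /s natrX exprS expr_div_n expr1n; field; rewrite expf_neq0.
  rewrite ler_pdivrMr // ler_peMr ?mulr_ge0 ?sqr_ge0 ?exprn_ge0 //; lra.
rewrite ler_expR -[r * _ * _]mulrA ler_wpM2l ?mulr_ge0 // ss.
have st : t / 2 ^+ n <= t by rewrite ler_pdivrMr ?exprn_gt0 // ler_peMr // exprn_ege1 //; lra.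
have : t / 2 ^+ n * (2 ^ n)%:R = t by rewrite mulrC Tn_scale.
rewrite mulrDr; lra.
Qed.

Let Tn_sub t y z : 0 <= t -> exists n0, forall n, (n0 <= n)%N ->
  Tn t y n - Tn t z n = Tn t (y - z) n.
Proof.
by move=> /Tn_small[n0 h]; exists n0 => n /h hn; rewrite /Tn iter_J_sub.
Qed.

(** [D2] is dense and the approximations are eventually bounded uniformly in [n], so the Cauchy
    property passes from [D2] to the whole space. *)
Let Tn_cauchy t y : 0 <= t -> ncauchy N (Tn t y).
Proof.
move=> t0 e e0; pose C := expR (r * t).
have C0 : 0 < C by exact: expR_gt0.
have e1 : 0 < e / 3 / C by rewrite !divr_gt0.
have [z D2z yz] := D2_dense y e1.
have [n1 h1'] := Tn_le (y - z) t0; have [n2 h2] := Tn_sub y z t0.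
have e3 : 0 < e / 3 by lra.
have [n3 h3] := Tn_cauchy2 t0 D2z e3.
exists (maxn n1 (maxn n2 n3)) => a b.
rewrite !geq_max => /andP[a1 /andP[a2 a3]] /andP[b1 /andP[b2 b3]].
have small n : (n1 <= n)%N -> (n2 <= n)%N -> N (Tn t y n - Tn t z n) <= e / 3.
  move=> c1 c2; rewrite h2 //; apply: le_trans (h1' _ c1) _.
  by rewrite mulrC -ler_pdivlMr.
have := qnormB hq (Tn t y a) (Tn t y b) (Tn t z a).
have := qnormB hq (Tn t z a) (Tn t y b) (Tn t z b).
have := h3 a b a3 b3; have := small a a1 a2; have := small b b1 b2.
have := qnorm_sub hq (Tn t y b) (Tn t z b); lra.
Qed.

Let T t y := xget 0 [set l | nlim N (Tn t y) l].

Let T_lim t y : 0 <= t -> nlim N (Tn t y) (T t y).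
Proof.
move=> t0; have [l hl] := N_complete (Tn_cauchy y t0).
by apply: (@xgetPex _ 0 [set l | nlim N (Tn t y) l]); exists l.
Qed.

Let T_le t y : 0 <= t -> N (T t y) <= expR (r * t) * N y.
Proof. by move=> t0; apply: nlim_le (T_lim y t0) (Tn_le y t0). Qed.

Let T_linear t (k : K) y z : 0 <= t -> T t (k *: y + z) = k *: T t y + T t z.
Proof.
move=> t0; apply: (nlim_unique hq (T_lim _ t0)).
apply: nlim_sub => //.
  by apply: nlimD => //; [apply: nlimZ => //; exact: T_lim | exact: T_lim].
have [n0 h] := Tn_small t0.
move=> e e0; exists n0 => n /h hn.
by rewrite /Tn iter_J_linear // subrr subr0 qnorm0 // ltW.
Qed.

Let T_sub t y z : 0 <= t -> T t (y - z) = T t y - T t z.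
Proof. by move=> t0; rewrite addrC -scaleN1r T_linear // scaleN1r addrC. Qed.

Let T_step t y : 0 <= t -> D y -> N (T t y - y) <= t * expR (r * t) * N (L y).
Proof.
move=> t0 Dy; have [n0 h] := Tn_small t0.
apply: nlim_le (nlimB hq (T_lim y t0) (nlim_cst hq y)) _ => //.
exists n0 => n /h hn; apply: le_trans (iter_J_step _ hn Dy) _.
by rewrite Tn_scale -[r * _ * _]mulrA [_ / _ * _]mulrC Tn_scale.
Qed.

Let T_taylor t y : 0 <= t -> D2 y ->
  N (T t y - y - ofR t *: L y) <= t ^+ 2 * expR (r * t) * N (L (L y)).
Proof.
move=> t0 D2y; have [n0 h] := Tn_small t0.
apply: nlim_le (nlimB hq (nlimB hq (T_lim y t0) (nlim_cst hq y)) (nlim_cst hq _)) _ => //.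
exists n0 => n /h hn.
have := iter_J_taylor (2 ^ n) hn D2y.
by rewrite Tn_scale -[r * _ * _]mulrA [_ / _ * _]mulrC Tn_scale.
Qed.

Let T0 y : T 0 y = y.
Proof.
apply: (nlim_unique hq (T_lim _ (lexx 0))) => e e0; exists 0%N => n _.
have -> : Tn 0 y n = y by rewrite /Tn mul0r; elim: (2 ^ n)%N => //= k ->; rewrite J0.
by rewrite subrr qnorm0 // ltW.
Qed.

Let T_add2 s t y : 0 <= s -> 0 <= t -> D2 y -> T (s + t) y = T s (T t y).
Proof.
move=> s0 t0 D2y; have st0 : 0 <= s + t by rewrite addr_ge0.
apply: (nlim_unique hq (T_lim _ st0)).
(* [Tn s (Tn t y)] is the common comparison sequence *)
apply: (@nlim_sub _ _ _ _ hq (fun n => Tn s (Tn t y n) n)).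
  apply: (@nlim_sub _ _ _ _ hq (Tn s (T t y))); first exact: T_lim.
  have [n1 h1'] := Tn_small s0.
  move=> e e0; have e1 : 0 < e / expR (r * s) by rewrite divr_gt0 ?expR_gt0.
  have [n2 h2] := T_lim y t0 e1.
  exists (maxn n1 n2) => n; rewrite geq_max => /andP[/h1' c1 /h2 c2].
  rewrite subr0 /Tn -iter_J_sub //; apply: le_trans (iter_J_le _ _ c1) _.
  rewrite -[r * _ * _]mulrA [_ / _ * _]mulrC Tn_scale (qnorm_sub hq).
  by rewrite mulrC -ler_pdivlMr ?expR_gt0.
have [n0 h] := Tn_small st0.
(* Merging [2 ^ n] pairs of steps [s / 2 ^ n] and [t / 2 ^ n] produces an error of order
   [s * t / 2 ^ n]. *)
pose C := s * t * expR (r * (3 * (s + t))) * N (L (L y)).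
have C0 : 0 <= C by rewrite !mulr_ge0 ?expR_ge0 ?qnorm_ge0.
move=> e e0; have e1 : 0 < e / (C + 1) by rewrite divr_gt0 //; lra.
have : (1 / 2 : R) ^+ n @[n --> \oo] --> (0 : R) by apply: cvg_expr; rewrite ger0_norm; lra.
move=> /cvgrPdist_le/(_ _ e1)[n1 _ hn1].
exists (maxn n0 n1) => n; rewrite geq_max => /andP[/h /andP[a0 a1] /hn1 /=].
rewrite sub0r normrN ger0_norm ?exprn_ge0 // => a2.
have p0 : 0 < (2 : R) ^+ n by rewrite exprn_gt0.
rewrite subr0 /Tn mulrDl in a1 *.
have b0 : 0 <= s / 2 ^+ n by rewrite divr_ge0 // ltW.
have c0 : 0 <= t / 2 ^+ n by rewrite divr_ge0 // ltW.
apply: le_trans (iter_J_split (2 ^ n) b0 c0 a1 D2y) _.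
apply: (@le_trans _ _ (C * (1 / 2) ^+ n)); last first.
  apply: (@le_trans _ _ ((C + 1) * (1 / 2) ^+ n)); first by rewrite ler_wpM2r ?exprn_ge0 //; lra.
  by rewrite mulrC -ler_pdivlMr //; lra.
rewrite /C [_ * (1 / 2) ^+ n]mulrAC ler_wpM2r ?qnorm_ge0 // [_ * (1 / 2) ^+ n]mulrAC.
have -> : (2 ^ n)%:R * (s / 2 ^+ n * (t / 2 ^+ n)) = s * t * (1 / 2) ^+ n.
  by rewrite natrX expr_div_n expr1n; field; rewrite expf_neq0.
rewrite ler_wpM2l ?mulr_ge0 ?exprn_ge0 // ler_expR -[r * _ * _]mulrA.
rewrite ler_wpM2l ?mulr_ge0 // -mulrDl.
set u := s + t in st0 *.
have ut : u / 2 ^+ n <= u by rewrite ler_pdivrMr // ler_peMr // exprn_ege1 //; lra.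
have : u / 2 ^+ n * (2 ^ n)%:R = u by rewrite mulrC Tn_scale.
rewrite mulrDr; lra.
Qed.

Let T_add s t y : 0 <= s -> 0 <= t -> T (s + t) y = T s (T t y).
Proof.
move=> s0 t0; have st0 : 0 <= s + t by rewrite addr_ge0.
apply/eqP; rewrite -subr_eq0; apply/eqP/(qnorm0_eq0 hq)/le_anti.
rewrite qnorm_ge0 andbT; apply/ler_addgt0Pr => e e0; rewrite add0r.
pose C := expR (r * (s + t)) + expR (r * s) * expR (r * t).
have C0 : 0 < C by rewrite addr_gt0 ?mulr_gt0 ?expR_gt0.
have e1 : 0 < e / C by rewrite divr_gt0.
have [z D2z yz] := D2_dense y e1.
have -> : T (s + t) y - T s (T t y) = T (s + t) (y - z) - T s (T t (y - z)).
  by rewrite !T_sub // subrACA (T_add2 s0 t0 D2z) subrr subr0.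
have -> : e = C * (e / C) by rewrite mulrC divfK // gt_eqF.
apply: le_trans (qnormB hq _ _ 0) _; rewrite subr0 sub0r (qnormN hq).
apply: (@le_trans _ _ (C * N (y - z))); last by rewrite ler_wpM2l // ltW.
rewrite /C mulrDl; apply: lerD; first exact: T_le.
rewrite -mulrA.
apply: le_trans (T_le _ s0) _; rewrite ler_wpM2l ?expR_ge0 // T_le //.
Qed.

Let T_cont0 y e : 0 < e -> exists2 d, 0 < d & forall t, 0 <= t <= d -> N (T t y - y) <= e.
Proof.
move=> e0; pose C := expR (r * 1) + 1.
have C0 : 0 < C by rewrite addr_gt0 ?expR_gt0.
have e1 : 0 < e / 2 / C by rewrite !divr_gt0.
have [z D2z yz] := D2_dense y e1.
pose M := expR (r * 1) * N (L z) + 1.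
have M0 : 0 < M by rewrite ltr_wpDl // mulr_ge0 ?expR_ge0 ?qnorm_ge0.
exists (Num.min 1 (e / 2 / M)); first by rewrite lt_min ltr01 !divr_gt0.
move=> t /andP[t0]; rewrite le_min => /andP[t1 tM].
have -> : T t y - y = (T t (y - z) - (y - z)) + (T t z - z).
  by rewrite T_sub // subrACA subrK.
have rt : expR (r * t) <= expR (r * 1) by rewrite ler_expR ler_wpM2l // mulr_ge0.
apply: le_trans (qnormD hq _ _) _.
have a1 : N (T t (y - z) - (y - z)) <= e / 2.
  apply: le_trans (qnormB hq _ _ 0) _; rewrite subr0 sub0r (qnormN hq).
  apply: (@le_trans _ _ (C * N (y - z))); last by rewrite mulrC -ler_pdivlMr.
  rewrite /C mulrDl mul1r lerD2r; apply: le_trans (T_le _ t0) _.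
  by rewrite ler_wpM2r ?qnorm_ge0.
have a2 : N (T t z - z) <= e / 2.
  have [Dz _] := D2z; apply: le_trans (T_step t0 Dz) _.
  apply: (@le_trans _ _ (t * M)); last by rewrite -ler_pdivlMr.
  rewrite -mulrA ler_wpM2l // /M ler_wpDr // ler_wpM2r ?qnorm_ge0 //.
lra.
Qed.

Let T_semigroup : c0_semigroup N T.
Proof.
split => [t t0|y|s t s0 t0 y|y s s0].
- split; first by move=> k y z; exact: T_linear.
  by exists (expR (r * t)) => y; exact: T_le.
- exact: T0.
- exact: T_add.
apply/cvgrPdist_le => e e0.
pose C := expR (r * (s + 1)); have C0 : 0 < C by exact: expR_gt0.
have e1 : 0 < e / C by rewrite divr_gt0.
have [d d0 hd] := T_cont0 y e1.
have key a b : 0 <= a <= b -> a <= s + 1 -> b - a <= d -> N (T b y - T a y) <= e.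
  move=> /andP[a0 ab] a1 bd; have ba : 0 <= b - a by lra.
  have -> : b = a + (b - a) by lra.
  rewrite T_add // -T_sub //; apply: le_trans (T_le _ a0) _.
  apply: (@le_trans _ _ (C * (e / C))); last by rewrite mulrC divfK // gt_eqF.
  rewrite ler_pM ?expR_ge0 ?qnorm_ge0 //; last by apply: hd; rewrite ba.
  by rewrite ler_expR ler_wpM2l // mulr_ge0.
pose d1 := Num.min 1 d.
have d10 : 0 < d1 by rewrite lt_min ltr01.
rewrite near_withinE; apply/nbhs_ballP; exists d1 => //= t; rewrite /ball /=.
move=> + t0; rewrite lt_min => /andP[]; rewrite !ltr_norml => /andP[u1 u2] /andP[u3 u4].
rewrite sub0r normrN ger0_norm ?qnorm_ge0 //.
have [st|ts] := leP s t.
  by apply: key; [rewrite s0|lra|lra].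
by rewrite (qnorm_sub hq); apply: key; [rewrite t0 ltW|lra|lra].
Qed.

(** The expansion [T_taylor] requires a point of [D2]. So [y] is compared with [x = J h y], for
    which [L x = J h (L y)] is close to [L y]: at [x] the expansion applies, and at [y - x] the
    first order bound [T_step] is small because [L (y - x)] is. *)
Let T_deriv y : D y -> forall e : R, 0 < e -> exists2 d, 0 < d &
  forall t, 0 < t < d -> N (ofR t^-1 *: (T t y - y) - L y) <= e.
Proof.
move=> Dy e e0; pose C := expR (r * 1) + 1.
have C0 : 0 < C by rewrite addr_gt0 ?expR_gt0.
have e1 : 0 < e / 2 / C by rewrite !divr_gt0.
have [h hh hz] := J_cont (L y) e1.
have hh' : 0 <= h <= h1 by case/andP: hh => /ltW->.
have [Dj ej] := JD hh' Dy; have [DLy _] := JP (L y) hh.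
have D2j : D2 (J h y) by rewrite ej.
set x := J h y in Dj ej D2j.
pose M := expR (r * 1) * N (L (L x)) + 1.
have M0 : 0 < M by rewrite ltr_wpDl // mulr_ge0 ?expR_ge0 ?qnorm_ge0.
exists (Num.min 1 (e / 2 / M)); first by rewrite lt_min ltr01 !divr_gt0.
move=> t /andP[t0]; rewrite lt_min => /andP[t1 tM].
have rt : expR (r * t) <= expR (r * 1).
  by rewrite ler_expR ler_wpM2l ?mulr_ge0 // ltW.
have -> : ofR t^-1 *: (T t y - y) - L y = ofR t^-1 *: (T t y - y - ofR t *: L y).
  by rewrite [RHS]scalerBr scalerA -rmorphM mulVf ?gt_eqF // rmorph1 scale1r.
rewrite (qnorm_ofRZ hq) ger0_norm ?invr_ge0 ?(ltW t0) // mulrC ler_pdivrMr //.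
have Dyx := DB Dy Dj.
have -> : T t y - y - ofR t *: L y = (T t x - x - ofR t *: L x) +
   ((T t (y - x) - (y - x)) - ofR t *: L (y - x)).
  rewrite T_sub ?ltW // subrACA LB // scalerBr.
  by rewrite [RHS]addrC [X in _ = X + _]subrACA subrK.
have a1 := T_taylor (ltW t0) D2j.
have a2 := T_step (ltW t0) Dyx.
have a3 : N (L (y - x)) <= e / 2 / C by rewrite LB // ej (qnorm_sub hq).
apply: le_trans (qnormD hq _ _) _.
have b1 : N (T t x - x - ofR t *: L x) <= t * (e / 2).
  apply: le_trans a1 _; rewrite expr2 -[_ * expR _ * _]mulrA -[t * t * _]mulrA ler_wpM2l ?(ltW t0) //.
  apply: (@le_trans _ _ (t * M)); last by rewrite -ler_pdivlMr // ltW.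
  by rewrite ler_wpM2l ?(ltW t0) // /M ler_wpDr // ler_wpM2r ?qnorm_ge0.
have b2 : N (T t (y - x) - (y - x) - ofR t *: L (y - x)) <= t * (e / 2).
  apply: le_trans (qnormB hq _ _ 0) _; rewrite subr0 sub0r (qnormN hq).
  rewrite (qnorm_ofRZ hq) (gtr0_norm t0).
  apply: (@le_trans _ _ (t * (C * N (L (y - x))))).
    rewrite /C mulrDl mul1r mulrDr lerD2r; apply: le_trans a2 _.
    by rewrite -mulrA ler_wpM2l ?(ltW t0) // ler_wpM2r ?qnorm_ge0.
  by rewrite ler_wpM2l ?(ltW t0) // mulrC -ler_pdivlMr.
lra.
Qed.

Let T_generator : generator N T A.
Proof.
move=> y z; split => [[Dy <-]|].
  apply/cvg_right0P => e e0; have [d d0 hd] := T_deriv Dy e0.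
  by exists d => // t /hd; rewrite ger0_norm ?qnorm_ge0.
move=> /cvg_right0P yz.
(* It remains to exclude that the generator properly extends [A]. An Euler equation with data [y]
   and [z] has a solution [w] in [D], and [v = y - w] is [h1 / 4] times its own derivative [g] under
   the semigroup. The growth bound gives [q g v <= 4 * m * q v v], so for this step length [q v v]
   is at most half of itself. *)
have h0 : 0 < h1 / 4 by rewrite divr_gt0.
have hh : 0 < h1 / 4 <= h1 by rewrite h0 /= ler_pdivrMr // ler_peMr ?ltW //; lra.
have [Dw ew] := JP (y - ofR (h1 / 4) *: z) hh.
set w := J _ _ in Dw ew.
pose v := y - w; pose g := z - L w.
have vg : v = ofR (h1 / 4) *: g.
  apply/eqP; rewrite -subr_eq0 /v /g scalerBr subrACA ew.
  by rewrite subrr.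
have gv e : 0 < e -> q g v <= 4 * m * q v v + e * N v.
  move=> e0; have e2 : 0 < e / 2 by lra.
  have [d1 d10 hd1] := yz _ e2; have [d2 d20 hd2] := T_deriv Dw e2.
  (* The last entry of the minimum ensures [r * t <= 1 / 2], where [expR (r * t)] is at most
     [1 + 4 * m * t]; halving makes the inequalities strict. *)
  pose t := Num.min (Num.min d1 d2) (1 / (2 * (r + 1))) / 2.
  have rp : 0 < r + 1 by have := m_ge0; lra.
  have ti : 0 < 1 / (2 * (r + 1)) by rewrite divr_gt0 // mulr_gt0.
  have mp : 0 < Num.min (Num.min d1 d2) (1 / (2 * (r + 1))) by rewrite !lt_min d10 d20.
  have t0 : 0 < t by rewrite divr_gt0.
  have tm : t < Num.min (Num.min d1 d2) (1 / (2 * (r + 1))) by rewrite /t; lra.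
  move: tm; rewrite !lt_min => /andP[/andP[td1 td2] td3].
  have rt : r * t <= 1 / 2.
    have : t * (2 * (r + 1)) < 1 by rewrite -ltr_pdivlMr // mulr_gt0.
    by nra.
  have n1 := hd1 t; rewrite t0 td1 ger0_norm ?qnorm_ge0 // in n1.
  have n2 := hd2 t; rewrite t0 td2 in n2.
  have n3 : N (g - ofR t^-1 *: (T t v - v)) <= e.
    rewrite /v T_sub ?(ltW t0) // subrACA scalerBr /g subrACA.
    apply: le_trans (qnormB hq _ _ 0) _; rewrite subr0 sub0r (qnormN hq).
    rewrite (qnorm_sub hq z) (qnorm_sub hq (L w)); have := n1 isT; have := n2 isT; lra.
  have n4 : q (ofR t^-1 *: (T t v - v)) v <= 4 * m * q v v.
    rewrite (ripZl hq) (ripBl hq) mulrC ler_pdivrMr //.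
    have c1 := rip_le hq (T t v) v; have c2 := T_le v (ltW t0).
    have v0 := qnorm_ge0 q v.
    have c3 : expR (r * t) <= 1 + 4 * m * t.
      have rt0 : 0 <= r * t by rewrite !mulr_ge0 // ltW.
      have -> : 4 * m * t = 2 * (r * t) by ring.
      exact: expR_le_1D2x.
    have c4 := ler_wpM2r v0 c2.
    have c5 := ler_wpM2r (rip_ge0 hq v) c3.
    rewrite -[expR (r * t) * _ * _]mulrA -expr2 (sqr_qnorm hq) in c4; lra.
  have n5 := rip_le hq (g - ofR t^-1 *: (T t v - v)) v.
  have n6 := ler_wpM2r (qnorm_ge0 q v) n3.
  rewrite (ripBl hq) in n5; lra.
have gv0 : q g v <= 4 * m * q v v.
  apply/ler_addgt0Pr => e e0.
  have Nv := qnorm_ge0 q v.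
  have e1 : 0 < e / (N v + 1) by rewrite divr_gt0 //; lra.
  apply: le_trans (gv _ e1) _; rewrite lerD2l.
  apply: (@le_trans _ _ (e / (N v + 1) * (N v + 1))).
    by rewrite ler_wpM2l ?(ltW e1) //; lra.
  by rewrite divfK // gt_eqF //; lra.
have v0 : v = 0.
  apply: (qnorm0_eq0 hq); apply/eqP; rewrite -sqrf_eq0 (sqr_qnorm hq); apply/eqP/le_anti.
  rewrite (rip_ge0 hq) andbT.
  have := ler_wpM2l (ltW h0) gv0; rewrite -[h1 / 4 * q g v](ripZl hq) -vg.
  have := rip_ge0 hq v; set a := q v v => a0.
  have : h1 / 4 * (4 * m * a) = (h1 * m) * a by field.
  have := ler_wpM2r a0 h1m; lra.
have yw : y = w by apply/eqP; rewrite -subr_eq0 -/v v0.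
split; first by rewrite yw.
have h0' : ofR (h1 / 4) != 0 :> K by rewrite fmorph_eq0 gt_eqF.
have : ofR (h1 / 4) *: g = 0 by rewrite -vg.
move/eqP; rewrite scaler_eq0 (negbTE h0') /= /g subr_eq0 => /eqP->.
by rewrite yw.
Qed.

Lemma lumer_phillips : generates_generalized_contraction_semigroup N A.
Proof.
exists T; split; [exact: T_semigroup|exact: T_generator|].
exists r => t t0; apply: ge_sup.
  by exists (N (T t 0)), 0 => //=; rewrite qnorm0.
move=> _ [y /= y1 <-]; apply: le_trans (T_le y t0) _.
by rewrite ler_piMr ?expR_ge0.
Qed.

End Generation.

(** * Lebesgue and Bochner integrals *)

Section RealIntegrals.
Context {R : realType}.
Notation mu := (@lebesgue_measure R).
Notation I := (`[-1, 0]%classic : set R).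
Implicit Types (f g : R -> R) (D : set R).

Lemma aeS (P Q : R -> Prop) : (forall t, P t -> Q t) ->
  {ae mu, forall t, P t} -> {ae mu, forall t, Q t}.
Proof. by move=> PQ; apply: (@filterS _ _ (ae_filter_ringOfSetsType mu)). Qed.

Lemma aeS2 (P1 P2 Q : R -> Prop) : (forall t, P1 t -> P2 t -> Q t) ->
  {ae mu, forall t, P1 t} -> {ae mu, forall t, P2 t} -> {ae mu, forall t, Q t}.
Proof. by move=> PQ; apply: (@filterS2 _ _ (ae_filter_ringOfSetsType mu)). Qed.

Definition integrable_on D f := mu.-integrable D (EFin \o f).

Lemma integrable_on_measurable D f : integrable_on D f -> measurable_fun D f.
Proof. by move=> /integrableP[/measurable_EFinP]. Qed.

Lemma integrable_on_le D g f : measurable D -> measurable_fun D f ->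
  (forall x, D x -> `|f x| <= g x) -> integrable_on D g -> integrable_on D f.
Proof.
move=> mD mf fg; apply: le_integrable => //; first exact/measurable_EFinP.
by move=> x Dx /=; rewrite lee_fin (le_trans (fg _ Dx)) // ler_norm.
Qed.

Lemma integrable_onD D f g : measurable D ->
  integrable_on D f -> integrable_on D g -> integrable_on D (fun x => f x + g x).
Proof. by move=> mD intf intg; refine (@integrableD _ _ _ mu D mD _ _ intf intg). Qed.

Lemma integrable_onZ D a f : measurable D ->
  integrable_on D f -> integrable_on D (fun x => a * f x).
Proof. by move=> mD intf; refine (@integrableZl _ _ _ mu D mD a _ intf). Qed.

Lemma integrable_onB D f g : measurable D ->
  integrable_on D f -> integrable_on D g -> integrable_on D (fun x => f x - g x).
Proof. by move=> mD intf intg; refine (@integrableB _ _ _ mu D mD _ _ intf intg). Qed.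

Lemma integrable_on_norm D f : integrable_on D f -> integrable_on D (fun x => `|f x|).
Proof. exact: integrable_norm. Qed.

Lemma integrable_on_sub D E f : measurable D -> measurable E -> E `<=` D ->
  integrable_on D f -> integrable_on E f.
Proof. by move=> mD mE ED; exact: integrableS. Qed.

Lemma mu_itv_lty (a b : R) : (mu `[a, b]%classic < +oo)%E.
Proof. by rewrite lebesgue_measure_itv /=; case: ifP => _; rewrite ?ltry // -EFinB ltry. Qed.

Lemma integrable_on_bounded (a b C : R) f : measurable_fun `[a, b] f ->
  (forall x, a <= x <= b -> `|f x| <= C) -> integrable_on `[a, b] f.
Proof.
move=> mf fC; apply: measurable_bounded_integrable => //; first exact: mu_itv_lty.
exists C; split; first by rewrite num_real.
move=> M CM x /=; rewrite in_itv /= => /fC /le_trans; apply; exact: ltW.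
Qed.

Lemma integrable_on_cst (a b c : R) : integrable_on `[a, b] (fun=> c).
Proof. exact: (@integrable_on_bounded _ _ `|c|). Qed.

Lemma eq_Rint D f g : (forall x, D x -> f x = g x) ->
  \int[mu]_(x in D) f x = \int[mu]_(x in D) g x.
Proof. by move=> fg; apply: eq_Rintegral => x /set_mem; exact: fg. Qed.

Lemma RintD D f g : measurable D -> integrable_on D f -> integrable_on D g ->
  \int[mu]_(x in D) (f x + g x) = \int[mu]_(x in D) f x + \int[mu]_(x in D) g x.
Proof. by move=> mD intf intg; refine (@RintegralD _ _ R mu D f g mD intf intg). Qed.

Lemma RintB D f g : measurable D -> integrable_on D f -> integrable_on D g ->
  \int[mu]_(x in D) (f x - g x) = \int[mu]_(x in D) f x - \int[mu]_(x in D) g x.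
Proof. by move=> mD intf intg; refine (@RintegralB _ _ R mu D f g mD intf intg). Qed.

Lemma RintZ D a f : measurable D -> integrable_on D f ->
  \int[mu]_(x in D) (a * f x) = a * \int[mu]_(x in D) f x.
Proof. by move=> mD intf; refine (@RintegralZl _ _ R mu D f a mD intf). Qed.

Lemma le_Rint D f g : measurable D -> integrable_on D f -> integrable_on D g ->
  (forall x, D x -> f x <= g x) -> \int[mu]_(x in D) f x <= \int[mu]_(x in D) g x.
Proof. by move=> mD intf intg; refine (@le_Rintegral _ _ R mu D f g mD intf intg). Qed.

Lemma le_norm_Rint D f : measurable D -> integrable_on D f ->
  `|\int[mu]_(x in D) f x| <= \int[mu]_(x in D) `|f x|.
Proof. by move=> mD intf; refine (@le_normr_Rintegral _ _ R mu D f mD intf). Qed.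

Lemma integral_Rint D f : measurable D -> integrable_on D f ->
  (\int[mu]_(x in D) (f x)%:E = (\int[mu]_(x in D) f x)%:E)%E.
Proof.
move=> mD intf; rewrite /Rintegral fineK //.
refine (@integrable_fin_num _ _ R mu D mD _ intf).
Qed.

Lemma RintegralN D f : measurable D -> integrable_on D f ->
  \int[mu]_(x in D) - f x = - \int[mu]_(x in D) f x.
Proof.
move=> mD intf; rewrite -mulN1r -RintegralZl //.
by apply: eq_Rintegral => x _; rewrite mulN1r.
Qed.

Lemma Rintegral_cst_itv (a b c : R) : a <= b ->
  \int[mu]_(x in `[a, b]) c = c * (b - a).
Proof.
move=> ab; rewrite Rintegral_cst //; congr (_ * _).
transitivity (fine (mu (`[a, b]%classic : set R))) => //.
rewrite lebesgue_measure_itv /= lte_fin.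
by move: ab; rewrite le_eqVlt => /predU1P[->|->//]; rewrite ltxx subrr.
Qed.

Lemma Rintegral_split (a b c : R) f : integrable_on `[a, c] f -> a <= b <= c ->
  \int[mu]_(x in `[a, c]) f x = \int[mu]_(x in `[a, b]) f x + \int[mu]_(x in `[b, c]) f x.
Proof.
move=> intf /andP[ab bc].
have := @Rintegral_itvB _ f (BLeft a) (BRight c) b intf.
rewrite !bnd_simp => /(_ ab bc) /eqP; rewrite subr_eq => /eqP ->.
rewrite addrC; congr (_ + _); apply: Rintegral_itv_obnd_cbnd.
apply: integrable_on_sub intf => //.
by move=> x /=; rewrite !in_itv /= => /andP[bx ->]; rewrite (le_trans ab) ?ltW.
Qed.

Lemma Rintegral_sum (T : Type) (s : seq T) (h : T -> R -> R) D : measurable D ->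
  (forall i, integrable_on D (h i)) ->
  integrable_on D (fun x => \sum_(i <- s) h i x) /\
  \int[mu]_(x in D) \sum_(i <- s) h i x = \sum_(i <- s) \int[mu]_(x in D) h i x.
Proof.
move=> mD hi; elim: s => [|i s [IH1 IH2]].
  have E : (fun x : R => \sum_(i <- [::]) h i x) = (fun=> 0).
    by apply/funext => x; rewrite big_nil.
  rewrite E big_nil; split; first exact: integrable0.
  by rewrite /Rintegral integral0_eq.
have E : (fun x : R => \sum_(i <- i :: s) h i x) = (fun x => h i x + \sum_(i <- s) h i x).
  by apply/funext => x; rewrite big_cons.
rewrite E big_cons -IH2 -RintegralD //; last exact: hi.
by split => //; apply: integrable_onD => //; exact: hi.
Qed.

Lemma ae_eq_Rintegral f g : integrable_on I f -> measurable_fun I g ->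
  {ae mu, forall t, I t -> f t = g t} ->
  integrable_on I g /\ \int[mu]_(x in I) f x = \int[mu]_(x in I) g x.
Proof.
move=> intf mg fg.
have mf := integrable_on_measurable intf.
have E : (\int[mu]_(x in I) `|(f x)%:E| = \int[mu]_(x in I) `|(g x)%:E|)%E.
  apply: ae_eq_integral => //.
  - exact/measurableT_comp/measurable_EFinP.
  - exact/measurableT_comp/measurable_EFinP.
  - by apply: aeS fg => t /= h It; rewrite h.
split.
  apply/integrableP; split; first exact/measurable_EFinP.
  by rewrite -E; case/integrableP: intf.
rewrite /Rintegral; congr fine; apply: ae_eq_integral => //.
- exact/measurable_EFinP.
- exact/measurable_EFinP.
- by apply: aeS fg => t /= h It; rewrite h.
Qed.

Lemma ge0_Rintegral_eq0 f : (forall t, I t -> 0 <= f t) -> integrable_on I f ->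
  \int[mu]_(x in I) f x = 0 -> {ae mu, forall t, I t -> f t = 0}.
Proof.
move=> f0 intf If0.
have mf := integrable_on_measurable intf.
have : (\int[mu]_(x in I) `|(f x)%:E| = 0)%E.
  have -> : (\int[mu]_(x in I) `|(f x)%:E| = \int[mu]_(x in I) (f x)%:E)%E.
    by apply: eq_integral => x /set_mem Ix; rewrite gee0_abs // lee_fin f0.
  have fin : (\int[mu]_(x in I) (f x)%:E)%E \is a fin_num by exact: integrable_fin_num.
  by rewrite -(fineK fin); congr EFin.
have mEf : measurable_fun I (EFin \o f) by exact/measurable_EFinP.
move/(ae_eq_integral_abs mu (measurable_itv _) mEf).
by apply: aeS => t h It; have [] := h It.
Qed.

(* By Lebesgue's differentiation theorem. *)
Lemma Rintegral_itv_eq0 f : integrable_on I f ->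
  (forall s t, -1 <= s -> s <= t -> t <= 0 -> \int[mu]_(x in `[s, t]) f x = 0) ->
  {ae mu, forall t, I t -> f t = 0}.
Proof.
move=> intf f0; pose g := f \_ I.
have intg D : measurable D -> integrable_on D g.
  move=> mD; apply: (@integrable_on_sub setT) => //.
  have := @integrable_mkcond _ _ _ mu I (EFin \o f) (measurable_itv _).
  rewrite restrict_EFin => [[h _]]; exact: h.
have locg : locally_integrable [set: R] g by exact: integrable_locally_restrict.
have F0 x : \int[mu]_(t in `]-oo, x]) g t = 0.
  rewrite /g -Rintegral_mkcondr.
  have [x1|x1] := ltP x (-1).
    have -> : `]-oo, x] `&` I = set0.
      by apply/seteqP; split => t //=; rewrite !in_itv /= => -[tx /andP[t1 _]]; lra.
    exact: Rintegral_set0.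
  have [x0|x0] := leP x 0.
    have -> : `]-oo, x] `&` I = `[-1, x]%classic.
      apply/seteqP; split => t /=; rewrite !in_itv /=; first by move=> [-> /andP[->]].
      by move=> /andP[-> tx]; split => //=; exact: le_trans tx x0.
    exact: f0.
  have -> : `]-oo, x] `&` I = `[-1, 0]%classic.
    apply/seteqP; split => t /=; rewrite !in_itv /=; first by move=> [_ /andP[-> ->]].
    by move=> /andP[-> tx]; split => //=; lra.
  by apply: f0.
have := @FTC1Ny _ g (fun y => intg _ (measurable_itv _)) locg.
apply: aeS => t /= + It => -[_].
have -> : (fun x : R => \int[mu]_(t in `]-oo, x]) g t) = cst 0 by exact/funext.
by rewrite derive1_cst /g patchE mem_set.
Qed.

End RealIntegrals.

(** * Finitely valued functions and sampling along level sets *)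

Section SimpleFunctions.
Import finmap.finmap.
Context {R : realType}.
Notation mu := (@lebesgue_measure R).
Notation I := (`[-1, 0]%classic : set R).

(** [simple] for values in an arbitrary type, and convertible to it on normed modules; booleans,
    indices and sample points occur as intermediate values. *)
Definition fsimple (T : Type) (f : R -> T) :=
  finite_set (range f) /\ forall v, measurable (f @^-1` [set v]).

Lemma fsimple_comp2 (T1 T2 T3 : Type) (h : T1 -> T2 -> T3) (f : R -> T1) (g : R -> T2) :
  fsimple f -> fsimple g -> fsimple (fun t => h (f t) (g t)).
Proof.
move=> [ff mf] [fg mg]; split.
  apply: (sub_finite_set _ (finite_image2 h ff fg)) => _ [t _ <-].
  by exists (f t) => //; exists (g t).
move=> v.
have -> : (fun t => h (f t) (g t)) @^-1` [set v] =
    \bigcup_(a in range f) \bigcup_(b in range g `&` [set b | h a b = v])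
      (f @^-1` [set a] `&` g @^-1` [set b]).
  apply/seteqP; split=> t /=.
    by move=> <-; exists (f t) => //; exists (g t).
  by move=> [_ [r _ <-]] [_ [[r' _ <-] /= <-]] [-> ->].
apply: fin_bigcup_measurable => // a _; apply: fin_bigcup_measurable.
  exact: (sub_finite_set _ fg).
by move=> b _; apply: measurableI.
Qed.

Lemma fsimple_comp (T1 T2 : Type) (h : T1 -> T2) (f : R -> T1) :
  fsimple f -> fsimple (fun t => h (f t)).
Proof. by move=> sf; exact: (fsimple_comp2 (fun x _ => h x) sf sf). Qed.

Lemma fsimple_restrict (T : Type) (f : R -> T) (A : set R) (c : T) :
  measurable A -> fsimple f -> fsimple (fun t => if `[< A t >] then f t else c).
Proof.
move=> mA sf.
have sA : fsimple (fun t => `[< A t >]).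
  split.
    exact: finite_finset.
  move=> b; have [->|->] : b = true \/ b = false by case: b; [left|right].
    have -> : (fun t => `[< A t >]) @^-1` [set true] = A by apply/seteqP; split=> t /= /asboolP.
    exact: mA.
  have -> : (fun t => `[< A t >]) @^-1` [set false] = ~` A.
    by apply/seteqP; split=> t /= => [/negbT/asboolPn//|/asboolPn/negbTE].
  exact: measurableC.
exact: (fsimple_comp2 (fun b x => if b then x else c) sA sf).
Qed.

Lemma fsimple_measurable (T : Type) (f : R -> T) (h : T -> R) D :
  fsimple f -> measurable_fun D (fun t => h (f t)).
Proof.
move=> [ff mf] mD Z _; apply: measurableI => //.
have -> : (fun t => h (f t)) @^-1` Z =
    \bigcup_(a in range f `&` h @^-1` Z) (f @^-1` [set a]).
  apply/seteqP; split=> t /=; first by move=> Zt; exists (f t).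
  by move=> [_ [[r _ <-] /= hZ] ->].
by apply: fin_bigcup_measurable => //; exact: (sub_finite_set _ ff).
Qed.

Lemma fsimple_Rintegral (T : choiceType) (f : R -> T) (h : T -> R) : fsimple f ->
  integrable_on I (fun t => h (f t)) /\
  \int[mu]_(t in I) h (f t) =
    \sum_(v <- fset_set (range f)) fine (mu (f @^-1` [set v] `&` I)) * h v.
Proof.
move=> sf; have [ff mf] := sf; set s := fset_set (range f).
have E : (fun t => h (f t)) = (fun t => \sum_(v <- s) h v * \1_(f @^-1` [set v]) t).
  apply/funext => t; rewrite (bigD1_seq (f t)) ?fset_uniq //=; last first.
    by rewrite in_fset_set // mem_set //; exists t.
  rewrite indicE mem_set // mulr1 big1 ?addr0 // => v /eqP vt.
  by rewrite indicE memNset ?mulr0 // => /= tv; apply: vt.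
have int1 v : integrable_on I (\1_(f @^-1` [set v]) : R -> R).
  apply: (@integrable_on_bounded _ _ _ 1) => [|x _].
    exact: measurable_indic.
  by rewrite indicE; case: (_ \in _); rewrite ?normr1 ?normr0.
have [i1 i2] := @Rintegral_sum R T s (fun v t => h v * \1_(f @^-1` [set v]) t) I
  (measurable_itv _) (fun v => integrable_onZ (h v) (measurable_itv _) (int1 v)).
rewrite E; split => //; rewrite i2; apply: eq_bigr => v _.
rewrite RintegralZl //; last exact: int1.
by rewrite mulrC /Rintegral integral_indic; [exact: erefl|exact: measurable_itv|exact: mf].
Qed.

Lemma trunc_close (x y : R) : 0 <= x -> 0 <= y -> Num.truncn x = Num.truncn y ->
  `|x - y| <= 1.
Proof.
move=> x0 y0 xy; have := truncn_itv x0; have := truncn_itv y0.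
rewrite xy -natr1 => /andP[u1 u2] /andP[u3 u4].
by rewrite ler_norml; apply/andP; split; lra.
Qed.

(** [I] is cut along the level sets of [W] at spacing [1 / n.+1], and [c n] sends each slice to one
    chosen point of it. Composition with [c n] turns a function controlled by [W] into a simple one
    close to it. *)
Lemma fsimple_grid (W : R -> R) (M : R) : measurable_fun I W ->
  (forall t, I t -> 0 <= W t <= M) ->
  exists c : nat -> R -> R, forall n, [/\ fsimple (c n), forall t, I (c n t) &
    forall t, I t -> `|W (c n t) - W t| <= n.+1%:R^-1].
Proof.
move=> mW WM.
(* Index [0] is reserved for the complement of [I], hence the successor; the other fibres are then
   preimages under [W] inside [I]. For an index without a point in [I], [sel] defaults to [0], which
   is a point of [I]. *)
pose k (n : nat) t := if `[< I t >] then (Num.truncn (n.+1%:R * W t)).+1 else 0%N.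
pose sel n j := xget 0 [set r | I r /\ k n r = j].
have I0 : I 0 by rewrite /= in_itv /= lexx andbT lerN10.
have kI n t : I t -> k n t = (Num.truncn (n.+1%:R * W t)).+1.
  by move=> It; rewrite /k asboolT.
have kN n t : ~ I t -> k n t = 0%N by move=> It; rewrite /k asboolF.
exists (fun n t => sel n (k n t)) => n.
have n0 : 0 < n.+1%:R :> R by [].
have selI j : I (sel n j).
  rewrite /sel; case: xgetP => [r -> []//|]; by [].
have selk t : I t -> k n (sel n (k n t)) = k n t.
  move=> It; have [] // : I (sel n (k n t)) /\ k n (sel n (k n t)) = k n t.
  by apply: (@xgetPex _ 0 [set r | I r /\ k n r = k n t]); exists t.
split=> [|t|t It]; last 1 first.
- have := selk _ It; rewrite !kI // => -[] tr.
  have /andP[a0 _] := WM _ (selI (k n t)); have /andP[b0 _] := WM _ It.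
  have a1 : 0 <= n.+1%:R * W (sel n (k n t)) by rewrite mulr_ge0.
  have b1 : 0 <= n.+1%:R * W t by rewrite mulr_ge0.
  have := trunc_close a1 b1; rewrite [in X in X -> _]kI // => /(_ tr).
  rewrite -mulrBr normrM gtr0_norm // -ler_pdivlMl // mulr1.
  by [].
- apply: (@fsimple_comp _ _ (sel n)); split.
    pose N := (Num.truncn (n.+1%:R * M)).+2.
    apply: (sub_finite_set _ (finite_II N)) => _ [t _ <-] /=.
    have [It|It] := pselect (I t); last by rewrite kN.
    rewrite kI // /N !ltnS; apply: le_truncn; rewrite ler_pM2l //.
    by have /andP[] := WM _ It.
  case=> [|j].
    have -> : k n @^-1` [set 0%N] = ~` I.
      apply/seteqP; split => t /=; last exact: kN.
      by move=> kt It; move: kt; rewrite kI.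
    by apply: measurableC; exact: measurable_itv.
  have -> : k n @^-1` [set j.+1] = I `&` W @^-1` `[j%:R / n.+1%:R, j.+1%:R / n.+1%:R[.
    apply/seteqP; split => t /=.
      have [It|It] := pselect (I t); last by rewrite kN.
      rewrite kI // => -[]; have /andP[b0 _] := WM _ It.
      have b1 : 0 <= n.+1%:R * W t by rewrite mulr_ge0.
      move/eqP; rewrite truncn_eq // in_itv /= => /andP[c1 c2]; split => //.
      by rewrite in_itv /= ler_pdivrMr // ltr_pdivlMr // mulrC c1.
    move=> [It]; rewrite in_itv /= ler_pdivrMr // ltr_pdivlMr // mulrC => /andP[c1 c2].
    by rewrite kI //; congr S; apply: truncn_def; rewrite c1.
  by apply: mW => //; exact: measurable_itv.
- exact: selI.
Qed.

Lemma Rintegral_dominated (g : nat -> R -> R) (l h : R -> R) :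
  (forall n, measurable_fun I (g n)) -> measurable_fun I l ->
  (forall t, I t -> g n t @[n --> \oo] --> l t) ->
  (forall n t, I t -> `|g n t| <= h t) -> integrable_on I h ->
  \int[mu]_(t in I) g n t @[n --> \oo] --> \int[mu]_(t in I) l t.
Proof.
move=> mg ml gl gh ih.
have [] := @dominated_convergence _ _ R mu I (measurable_itv _)
  (fun n => EFin \o g n) (EFin \o l) (EFin \o h).
- by move=> n; apply/measurable_EFinP; exact: mg.
- exact/measurable_EFinP.
- by apply: aeW => t It /=; apply: cvg_EFin; [exact: nearW|exact: gl].
- exact: ih.
- by apply: aeW => t n It /=; rewrite lee_fin gh.
move=> il _ cv.
have ig n : integrable_on I (g n).
  by apply: (integrable_on_le (g := h)) => // t It; exact: gh.
have E n : \int[mu]_(t in I) g n t = fine (\int[mu]_(t in I) (g n t)%:E)%E by [].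
rewrite /Rintegral; apply: fine_cvg.
rewrite fineK //; exact: integrable_fin_num.
Qed.

End SimpleFunctions.

(** * Strong measurability in normed modules *)

Section StrongMeasurability.
Context {R : realType}.
Notation mu := (@lebesgue_measure R).
Notation I := (`[-1, 0]%classic : set R).

Lemma invS_small (d : R) : 0 < d -> exists n0 : nat, forall n, (n0 <= n)%N ->
  n.+1%:R^-1 <= d.
Proof.
move=> d0; exists (Num.truncn d^-1) => n nn.
have di : 0 < d^-1 by rewrite invr_gt0.
rewrite -[leRHS]invrK lef_pV2 ?posrE //.
have /andP[_ h] := truncn_itv (ltW di).
by apply: le_trans (ltW h) _; rewrite ler_nat.
Qed.

Lemma nlim_nrmP (K : scalars R) (V : normedModType K) (u : nat -> V) x :
  nlim nrm u x <-> u @ \oo --> x.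
Proof.
have nrm_sub y z : nrm (y - z) = nrm (z - y) :> R by rewrite -nrmN opprB.
split=> [ux|/cvgrPdist_le ux e e0].
  apply/cvgrPdist_le => e e0.
  have eE : e = ofR (re `|e|) by rewrite re_normK ger0_norm // ltW.
  have re0 : 0 < re `|e|.
    rewrite lt_neqAle re_norm_ge0 andbT eq_sym.
    by apply/eqP => h; move: e0; rewrite eE h rmorph0 ltxx.
  have [n0 hn0] := ux _ re0; exists n0 => // n /hn0 /=.
  by move=> h; rewrite eE -ofR_nrm ler_ofR nrm_sub.
have e0' : 0 < ofR e :> K.
  by rewrite lt_neqAle eq_sym fmorph_eq0 gt_eqF //= ofR_ge0 ltW.
have [n0 _ hn0] := ux _ e0'; exists n0 => n /hn0 /=.
by rewrite -ofR_nrm ler_ofR nrm_sub.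
Qed.

Lemma strongly_measurableP (K : scalars R) (V : normedModType K) (f : R -> V) :
  strongly_measurable f <-> exists2 u : nat -> R -> V, (forall n, fsimple (u n)) &
    forall t, I t -> nlim nrm (u ^~ t) (f t).
Proof.
by split=> -[u su uf]; exists u => // t It; apply/nlim_nrmP; exact: uf.
Qed.

Lemma fsimple_strongly_measurable (K : scalars R) (V : normedModType K) (f : R -> V) :
  fsimple f -> strongly_measurable f.
Proof.
move=> sf; apply/strongly_measurableP; exists (fun=> f) => // t It e e0.
by exists 0%N => n _; rewrite subrr nrm0 ltW.
Qed.

Lemma strongly_measurable_comp2 (K1 K2 K3 : scalars R) (V1 : normedModType K1)
    (V2 : normedModType K2) (V3 : normedModType K3) (h : V1 -> V2 -> V3) f g :
  (forall u w x y, nlim nrm u x -> nlim nrm w y ->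
     nlim nrm (fun n => h (u n) (w n)) (h x y)) ->
  strongly_measurable f -> strongly_measurable g ->
  strongly_measurable (fun t => h (f t) (g t)).
Proof.
move=> hc /strongly_measurableP[u su uf] /strongly_measurableP[w sw wg].
apply/strongly_measurableP; exists (fun n t => h (u n t) (w n t)).
  by move=> n; exact: fsimple_comp2.
by move=> t It; apply: hc; [exact: uf|exact: wg].
Qed.

Lemma strongly_measurable_comp (K1 K2 : scalars R) (V1 : normedModType K1)
    (V2 : normedModType K2) (h : V1 -> V2) f :
  (forall u x, nlim nrm u x -> nlim nrm (fun n => h (u n)) (h x)) ->
  strongly_measurable f -> strongly_measurable (fun t => h (f t)).
Proof.
move=> hc sf.
have hc2 (u w : nat -> V1) x y : nlim nrm u x -> nlim nrm w y ->
  nlim nrm (fun n => h (u n)) (h x) by move=> ux _; exact: hc.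
exact: (@strongly_measurable_comp2 _ _ _ _ _ _ (fun x _ => h x) f f hc2 sf sf).
Qed.

Section OneSpace.
Context {K : scalars R} {V : normedModType K}.
Implicit Types (f g : R -> V).

Lemma nrm_sub (x y : V) : nrm (x - y) = nrm (y - x).
Proof. by rewrite -nrmN opprB. Qed.

Lemma nrmB_le (x y z : V) : nrm (x - y) <= nrm (x - z) + nrm (z - y).
Proof. by rewrite -{1}(subrK z x) -addrA; exact: nrmD. Qed.

Lemma nrm_ofRZ (a : R) (x : V) : nrm (ofR a *: x) = `|a| * nrm x.
Proof. by rewrite nrmZ re_norm_ofR. Qed.

Lemma nrm_eq0 (x : V) : nrm x = 0 -> x = 0.
Proof. by move=> h; apply/eqP; rewrite -normr_eq0 -ofR_nrm h rmorph0. Qed.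

Lemma nrm_lip (x y : V) : `|nrm x - nrm y| <= nrm (x - y).
Proof.
have h1 := nrmD (x - y) y; have h2 := nrmD (y - x) x.
rewrite subrK in h1; rewrite subrK nrm_sub in h2.
by rewrite ler_norml; apply/andP; split; lra.
Qed.

Lemma strongly_measurableD f g : strongly_measurable f -> strongly_measurable g ->
  strongly_measurable (fun t => f t + g t).
Proof.
apply: strongly_measurable_comp2 => u w x y ux wy; apply/nlim_nrmP.
by apply: cvgD; exact/nlim_nrmP.
Qed.

Lemma strongly_measurable_scale (k : K) f : strongly_measurable f ->
  strongly_measurable (fun t => k *: f t).
Proof.
apply: strongly_measurable_comp => u x ux; apply/nlim_nrmP.
by apply: cvgZl_tmp; exact/nlim_nrmP.
Qed.

Lemma strongly_measurableB f g : strongly_measurable f -> strongly_measurable g ->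
  strongly_measurable (fun t => f t - g t).
Proof.
move=> sf sg; have := strongly_measurableD sf (strongly_measurable_scale (-1) sg).
by congr strongly_measurable; apply/funext => t; rewrite scaleN1r.
Qed.

(* [F t] is approximated by [F (c_n t)], with [c_n] simple and [W (c_n t)] within
   [1 / n.+1] of [W t]; this covers operators of bounded variation, for which [W]
   is the variation function. *)
Lemma strongly_measurable_grid (W : R -> R) M (F : R -> V -> V) f :
  measurable_fun I W -> (forall t, I t -> 0 <= W t <= M) ->
  (forall t, I t -> forall x y : V, F t (x - y) = F t x - F t y) ->
  (exists C, forall t, I t -> forall x, nrm (F t x) <= C * nrm x) ->
  (forall t x, I t -> forall e : R, 0 < e -> exists2 d : R, 0 < d &
     forall s, I s -> `|W s - W t| <= d -> nrm (F s x - F t x) <= e) ->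
  strongly_measurable f -> strongly_measurable (fun t => F t (f t)).
Proof.
move=> mW WM FB [C FC] Fc /strongly_measurableP[u su uf].
have [c hc] := fsimple_grid mW WM.
apply/strongly_measurableP; exists (fun n t => F (c n t) (u n t)).
  by move=> n; have [sc _ _] := hc n; exact: (fsimple_comp2 F sc (su n)).
move=> t It e e0; have e2 : 0 < e / 2 by lra.
have [d d0 hd] := Fc _ (f t) It _ e2.
have C1 : 0 < `|C| + 1 by have := normr_ge0 C; lra.
have e3 : 0 < e / 2 / (`|C| + 1) by rewrite !divr_gt0.
have [n1 h1] := uf t It _ e3.
have [n2 h2] := invS_small d0.
exists (maxn n1 n2) => n; rewrite geq_max => /andP[/h1 a1 /h2 a2].
have [_ cI cW] := hc n.
apply: le_trans (nrmB_le _ _ (F (c n t) (f t))) _.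
have b1 : nrm (F (c n t) (f t) - F t (f t)) <= e / 2.
  by apply: hd => //; apply: le_trans (cW _ It) a2.
have b2 : nrm (F (c n t) (u n t) - F (c n t) (f t)) <= e / 2.
  rewrite -FB //; apply: le_trans (FC _ (cI t) _) _.
  apply: (@le_trans _ _ ((`|C| + 1) * (e / 2 / (`|C| + 1)))); last first.
    by rewrite mulrC divfK // gt_eqF.
  apply: (@le_trans _ _ ((`|C| + 1) * nrm (u n t - f t))).
    by rewrite ler_wpM2r ?nrm_ge0 //; have := ler_norm C; lra.
  by rewrite ler_wpM2l // ltW.
lra.
Qed.

Lemma strongly_measurableZ (phi : R -> R) C f : measurable_fun I phi ->
  (forall t, I t -> `|phi t| <= C) -> strongly_measurable f ->
  strongly_measurable (fun t => ofR (phi t) *: f t).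
Proof.
move=> mphi phiC.
(* Adding [C] makes the sampled function nonnegative, as the grid requires, and leaves its
   differences unchanged. *)
apply: (@strongly_measurable_grid (fun t => phi t + C) (C + C) (fun t x => ofR (phi t) *: x)).
- by apply: measurable_funD => //; exact: measurable_cst.
- by move=> t /phiC; rewrite ler_norml => /andP[a b]; apply/andP; split; lra.
- by move=> t _ x y; rewrite scalerBr.
- by exists C => t /phiC h x; rewrite nrm_ofRZ ler_wpM2r ?nrm_ge0.
move=> t x It e e0.
have C1 : 0 < nrm x + 1 by have := nrm_ge0 x; lra.
exists (e / (nrm x + 1)); first by rewrite divr_gt0.
move=> s Is; rewrite opprD addrACA subrr addr0 => h.
rewrite -scalerBl -rmorphB nrm_ofRZ.
apply: (@le_trans _ _ (e / (nrm x + 1) * (nrm x + 1))); last by rewrite divfK // gt_eqF.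
by apply: ler_pM; rewrite ?nrm_ge0 //; lra.
Qed.

Lemma strongly_measurable_modulus f (W : R -> R) M : measurable_fun I W ->
  (forall t, I t -> 0 <= W t <= M) ->
  (forall t, I t -> forall e : R, 0 < e -> exists2 d : R, 0 < d &
     forall s, I s -> `|W s - W t| <= d -> nrm (f s - f t) <= e) ->
  strongly_measurable f.
Proof.
move=> mW WM fc.
have [c hc] := fsimple_grid mW WM.
apply/strongly_measurableP; exists (fun n t => f (c n t)).
  by move=> n; have [sc _ _] := hc n; exact: fsimple_comp.
move=> t It e /(fc _ It)[d d0 hd].
have [n0 h0] := invS_small d0.
exists n0 => n /h0 nn; have [_ cI cW] := hc n.
by apply: hd => //; apply: le_trans (cW _ It) _.
Qed.

Lemma strongly_measurable_real (l : V -> R) C f : strongly_measurable f ->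
  (forall x y, `|l x - l y| <= C * nrm (x - y)) -> measurable_fun I (fun t => l (f t)).
Proof.
move=> /strongly_measurableP[u su uf] lC.
apply: (@measurable_fun_cvg _ _ _ _ (fun n t => l (u n t))).
  by move=> n; exact: fsimple_measurable (su n).
move=> t It; apply/cvgrPdist_le => e e0.
have C1 : 0 < `|C| + 1 by have := normr_ge0 C; lra.
have [n0 h] := uf t It _ (divr_gt0 e0 C1).
exists n0 => // n /h {}h /=; rewrite distrC; apply: le_trans (lC _ _) _.
apply: (@le_trans _ _ ((`|C| + 1) * (e / (`|C| + 1)))); last by rewrite mulrC divfK // gt_eqF.
apply: (@le_trans _ _ ((`|C| + 1) * nrm (u n t - f t))).
  by rewrite ler_wpM2r ?nrm_ge0 //; have := ler_norm C; lra.
by rewrite ler_wpM2l // ltW.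
Qed.

Lemma strongly_measurable_nrm' f : strongly_measurable f ->
  measurable_fun I (fun t => nrm (f t)).
Proof.
by move=> sf; apply: (strongly_measurable_real (C := 1) sf) => x y; rewrite mul1r nrm_lip.
Qed.

(* Truncating where the approximation overshoots makes it dominated. *)
Lemma dominated_simple_approx f : strongly_measurable f ->
  exists w : nat -> R -> V, [/\ forall n, fsimple (w n),
    forall n t, nrm (w n t) <= 2 * nrm (f t) &
    forall t, I t -> nlim nrm (w ^~ t) (f t)].
Proof.
move=> sf; have /strongly_measurableP[u su uf] := sf.
pose A n := I `&` [set t | nrm (u n t) - 2 * nrm (f t) <= 0].
have mA n : measurable (A n).
  have mg : measurable_fun I (fun t => nrm (u n t) - 2 * nrm (f t)).
    apply: measurable_funB; first exact: fsimple_measurable (su n).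
    by apply: measurable_funM => //; exact: strongly_measurable_nrm'.
  have := mg (measurable_itv _) `]-oo, 0]%classic (measurable_itv _).
  by congr measurable; apply/seteqP; split => t /=; rewrite in_itv.
exists (fun n t => if `[< A n t >] then u n t else 0); split => [n|n t|t It e e0].
- exact: fsimple_restrict.
- case: asboolP => [[_ /=]|_]; first lra.
  by rewrite nrm0 mulr_ge0 ?nrm_ge0.
have [f0|/eqP f0] := eqVneq (nrm (f t)) 0.
  exists 0%N => n _; rewrite (nrm_eq0 f0) subr0.
  case: asboolP => [[_ /=]|_]; rewrite ?nrm0 ?f0; last exact: ltW.
  by lra.
have fp : 0 < nrm (f t) by rewrite lt_neqAle nrm_ge0 andbT eq_sym; exact/eqP.
have [n1 h1] := uf t It _ e0; have [n2 h2] := uf t It _ fp.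
exists (maxn n1 n2) => n; rewrite geq_max => /andP[a1 a2].
rewrite asboolT; first exact: h1.
split => //=; have := h2 n a2; have := nrm_lip (u n t) (f t).
by rewrite ler_norml => /andP[]; lra.
Qed.

End OneSpace.
End StrongMeasurability.

(** * The Bochner integral in Hilbert spaces *)

Section BochnerIntegral.
Context {R : realType}.
Notation mu := (@lebesgue_measure R).
Notation I := (`[-1, 0]%classic : set R).

(** The form is a parameter, so that the real line, the scalar field and [X] are all instances and
    share one theory of integrals and primitives. *)
Record hilbert (K : scalars R) (V : normedModType K) (q : V -> V -> R) : Prop := Hilbert {
  hilbert_ip : real_ip q ;
  hilbert_nrm : forall x, nrm x ^+ 2 = q x x ;
  hilbert_complete : ncomplete (nrm : V -> R) }.

(** Real linearity is the right notion here: the functionals [q^~ y] have it over either scalar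
    field, and they separate points. *)
Record bounded_functional (K : scalars R) (V : normedModType K) (C : R) (l : V -> R) : Prop :=
  BoundedFunctional {
  bfunD : forall x y, l (x + y) = l x + l y ;
  bfunZ : forall a x, l (ofR a *: x) = a * l x ;
  bfun_le : forall x, `|l x| <= C * nrm x }.

Section Space.
Context {K : scalars R} {V : normedModType K} {q : V -> V -> R} (hV : hilbert q).
Implicit Types (f g : R -> V) (l : V -> R).

Let hq := hilbert_ip hV.

Lemma qnorm_nrm (x : V) : qnorm q x = nrm x.
Proof. by rewrite /qnorm -(hilbert_nrm hV) sqrtr_sqr ger0_norm // nrm_ge0. Qed.

Lemma hilbert_cs (x y : V) : `|q x y| <= nrm x * nrm y.
Proof. by rewrite -!qnorm_nrm; exact: rip_cs. Qed.

Lemma bounded_functional_ip (y : V) : bounded_functional (nrm y) (q^~ y).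
Proof.
split=> [x z|a x|x]; [exact: ripDl|exact: ripZl|].
by rewrite mulrC; exact: hilbert_cs.
Qed.

Definition bochner_integrable f :=
  strongly_measurable f /\ integrable_on I (fun t => nrm (f t)).

Lemma bfun0 C l : bounded_functional C l -> l 0 = 0.
Proof. by move=> hl; have := bfunZ hl 0 0; rewrite scaler0 mul0r. Qed.

Lemma bfunB C l : bounded_functional C l -> forall x y, l (x - y) = l x - l y.
Proof.
move=> hl x y; rewrite (bfunD hl) -scaleN1r -(rmorphN1 (@ofR R K)) (bfunZ hl).
by rewrite mulN1r.
Qed.

Lemma bfun_lip C l : bounded_functional C l ->
  forall x y, `|l x - l y| <= C * nrm (x - y).
Proof. by move=> hl x y; rewrite -(bfunB hl); exact: (bfun_le hl). Qed.

Lemma fsimple_bochner_integrable f : fsimple f -> bochner_integrable f.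
Proof.
move=> sf; split; first exact: fsimple_strongly_measurable.
by have [] := fsimple_Rintegral nrm sf.
Qed.

Lemma bfun_simple_integral C l f : bounded_functional C l -> fsimple f ->
  l (simple_integral f) = \int[mu]_(t in I) l (f t).
Proof.
move=> hl sf; have [_ ->] := fsimple_Rintegral l sf; have [ff _] := sf.
rewrite /simple_integral fsbig_finite //=.
elim/big_ind2: _ => //; first exact: bfun0 hl.
  by move=> x a y b <- <-; exact: (bfunD hl).
by move=> v _; rewrite (bfunZ hl).
Qed.

(** The difference [d] of the integrals is paired with itself: [nrm d ^+ 2] is the integral of
    [q (f t - g t) d], and after Cauchy-Schwarz one factor [nrm d] cancels. *)
Lemma simple_integral_sub f g : fsimple f -> fsimple g ->
  nrm (simple_integral f - simple_integral g) <= \int[mu]_(t in I) nrm (f t - g t).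
Proof.
move=> sf sg; set d := simple_integral f - simple_integral g.
have hl := bounded_functional_ip d.
have [i1 _] := fsimple_Rintegral (q^~ d) sf; have [i2 _] := fsimple_Rintegral (q^~ d) sg.
have [i3 _] := fsimple_Rintegral nrm (fsimple_comp2 (fun x y : V => x - y) sf sg).
have mI : measurable I by exact: measurable_itv.
have E : nrm d * nrm d <= (\int[mu]_(t in I) nrm (f t - g t)) * nrm d.
  rewrite -expr2 (hilbert_nrm hV) {1}/d (ripBl hq).
  rewrite (bfun_simple_integral hl sf) (bfun_simple_integral hl sg) -RintB //.
  rewrite mulrC -RintZ //; apply: le_Rint => //.
  - exact: integrable_onB.
  - exact: integrable_onZ.
  move=> t _; rewrite -(ripBl hq) mulrC.
  by apply: le_trans (ler_norm _) _; exact: hilbert_cs.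
have [d0|] := ltP 0 (nrm d); first by rewrite -(ler_pM2r d0).
move/le_trans; apply; apply: Rintegral_ge0 => t _; exact: nrm_ge0.
Qed.

Lemma bfun_integrable C l f : bounded_functional C l -> bochner_integrable f ->
  integrable_on I (fun t => l (f t)).
Proof.
move=> hl [sf nf].
apply: (integrable_on_le (g := fun t => C * nrm (f t))) => //.
- exact: strongly_measurable_real sf (bfun_lip hl).
- by move=> t _; exact: (bfun_le hl).
- exact: integrable_onZ.
Qed.

Lemma bochner_integrable_le f (h : R -> R) : strongly_measurable f ->
  (forall t, I t -> nrm (f t) <= h t) -> integrable_on I h -> bochner_integrable f.
Proof.
move=> sf fh ih; split => //; apply: (integrable_on_le (g := h)) => //.
  exact: strongly_measurable_nrm'.
by move=> t It; rewrite ger0_norm ?nrm_ge0 // fh.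
Qed.

Lemma bochner_integrableD f g : bochner_integrable f -> bochner_integrable g ->
  bochner_integrable (fun t => f t + g t).
Proof.
move=> [sf nf] [sg ng].
apply: (bochner_integrable_le (h := fun t => nrm (f t) + nrm (g t))).
- exact: strongly_measurableD.
- by move=> t _; exact: nrmD.
- exact: integrable_onD.
Qed.

Lemma bochner_integrable_scale (k : K) f : bochner_integrable f ->
  bochner_integrable (fun t => k *: f t).
Proof.
move=> [sf nf]; apply: (bochner_integrable_le (h := fun t => re `|k| * nrm (f t))).
- exact: strongly_measurable_scale.
- by move=> t _; rewrite nrmZ.
- exact: integrable_onZ.
Qed.

Lemma bochner_integrableB f g : bochner_integrable f -> bochner_integrable g ->
  bochner_integrable (fun t => f t - g t).
Proof.
move=> bf bg; have := bochner_integrableD bf (bochner_integrable_scale (-1) bg).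
by congr bochner_integrable; apply/funext => t; rewrite scaleN1r.
Qed.

Lemma bochner_integrableZ (phi : R -> R) C f : measurable_fun I phi ->
  (forall t, I t -> `|phi t| <= C) -> bochner_integrable f ->
  bochner_integrable (fun t => ofR (phi t) *: f t).
Proof.
move=> mphi phiC [sf nf].
apply: (bochner_integrable_le (h := fun t => C * nrm (f t))).
- exact: strongly_measurableZ phiC sf.
- by move=> t It; rewrite nrm_ofRZ ler_wpM2r ?nrm_ge0 // phiC.
- exact: integrable_onZ.
Qed.

Lemma bochner_simple_approx f : bochner_integrable f ->
  exists w : nat -> R -> V, (forall n, fsimple (w n)) /\
    \int[mu]_(t in I) nrm (f t - w n t) @[n --> \oo] --> (0 : R).
Proof.
move=> [sf nf]; have [w [sw wf wc]] := dominated_simple_approx sf.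
exists w; split => //.
have z : \int[mu]_(t in I) (0 : R) = 0 by rewrite Rintegral_cst_itv ?lerN10 // mul0r.
rewrite -[X in _ --> X]z.
apply: (Rintegral_dominated (h := fun t => 3 * nrm (f t))).
- move=> n; apply: strongly_measurable_nrm'; apply: strongly_measurableB => //.
  exact: fsimple_strongly_measurable.
- exact: measurable_cst.
- move=> t It; apply/cvgrPdist_le => e e0; have [n0 h] := wc t It _ e0.
  by exists n0 => // n /h /=; rewrite sub0r normrN ger0_norm ?nrm_ge0 // nrm_sub.
- move=> n t It; rewrite ger0_norm ?nrm_ge0 //.
  have := nrmD (f t) (- w n t); rewrite nrmN; have := wf n t; lra.
- exact: integrable_onZ.
Qed.

Let mI : measurable I. Proof. exact: measurable_itv. Qed.

Lemma bochner_exists f : bochner_integrable f -> exists v, is_bochner f v.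
Proof.
move=> bf; have [sf nf] := bf; have [w [sw wc]] := bochner_simple_approx bf.
have iw n : integrable_on I (fun t => nrm (f t - w n t)).
  by have [] := bochner_integrableB bf (fsimple_bochner_integrable (sw n)).
have cw : ncauchy nrm (fun n => simple_integral (w n)).
  move=> e e0; have e2 : 0 < e / 2 by lra.
  move/cvgrPdist_le : wc => /(_ _ e2)[n0 _ hn0]; exists n0 => m n mn nn.
  apply: le_trans (simple_integral_sub (sw m) (sw n)) _.
  have [ii _] := fsimple_Rintegral nrm (fsimple_comp2 (fun x y : V => x - y) (sw m) (sw n)).
  apply: (@le_trans _ _ (\int[mu]_(t in I) (nrm (f t - w m t) + nrm (f t - w n t)))).
    apply: le_Rint => //; first exact: integrable_onD.
    by move=> t _; rewrite (nrm_sub (f t) (w m t)); exact: nrmB_le.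
  rewrite RintD //; have := hn0 m mn; have := hn0 n nn.
  by rewrite /= !sub0r !normrN !ger0_norm ?Rintegral_ge0 // => *; rewrite ?nrm_ge0 //; lra.
have [v hv] := hilbert_complete hV cw.
exists v; split => //; exists w; split => //; last exact/nlim_nrmP.
have -> : (fun n => \int[mu]_(t in I) (nrm (f t - w n t))%:E)%E =
    (fun n => (\int[mu]_(t in I) nrm (f t - w n t))%:E).
  by apply/funext => n; rewrite integral_Rint.
by apply: cvg_EFin => //; exact: nearW.
Qed.

Lemma is_bochner_functional C l f v : bounded_functional C l -> bochner_integrable f ->
  is_bochner f v -> l v = \int[mu]_(t in I) l (f t).
Proof.
move=> hl bf [_ [w [sw wc wv]]].
have bw n := fsimple_bochner_integrable (sw n : fsimple (w n)).
have bfw n := bochner_integrableB bf (bw n).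
(* A negative [C] can only bound a functional if every vector has norm zero. *)
have C0 : 0 <= C \/ forall x : V, nrm x = 0.
  have [|C0] := leP 0 C; first by left.
  right => x; apply/le_anti; rewrite nrm_ge0 andbT leNgt; apply/negP => x0.
  have := bfun_le hl x; rewrite leNgt => /negP; apply.
  by apply: lt_le_trans (normr_ge0 _); rewrite nmulr_rlt0.
case: C0 => [C0|V0]; last first.
  have l0 x : l x = 0 by rewrite (nrm_eq0 (V0 x)) (bfun0 hl).
  rewrite l0 (_ : (fun t => l (f t)) = fun=> 0); last by apply/funext => t; rewrite l0.
  by rewrite Rintegral_cst_itv ?lerN10 // mul0r.
apply/eqP; rewrite -subr_eq0 -normr_eq0; apply/eqP/le_anti.
rewrite normr_ge0 andbT; apply/ler_addgt0Pr => e e0; rewrite add0r.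
have e1 : 0 < e / 2 / (C + 1) by rewrite !divr_gt0 //; lra.
have [n1 h1] := (nlim_nrmP _ _).2 wv _ e1.
have : \forall n \near \oo, (\int[mu]_(t in I) (nrm (f t - w n t))%:E <= (e / 2 / (C + 1))%:E)%E.
  have wc' : (\int[mu]_(t in I) (nrm (f t - w n t))%:E)%E @[n --> \oo] --> (0 : R)%:E by [].
  move/fine_cvgP : wc' => [fin /cvgrPdist_le/(_ _ e1) wc'].
  near=> n; have fn : (\int[mu]_(t in I) (nrm (f t - w n t))%:E)%E \is a fin_num by near: n.
  rewrite -(fineK fn) lee_fin; apply: le_trans (ler_norm _) _.
  by rewrite -normrN -sub0r; near: n.
move=> [n2 _ h2]; pose n := maxn n1 n2.
have a1 := h1 n (leq_maxl _ _); have a2 := h2 n (leq_maxr _ _).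
have a3 : \int[mu]_(t in I) nrm (f t - w n t) <= e / 2 / (C + 1).
  by rewrite -lee_fin -integral_Rint //; exact: (bfw n).2.
have E : l v - \int[mu]_(t in I) l (f t) =
    (l v - l (simple_integral (w n))) - \int[mu]_(t in I) (l (f t - w n t)).
  rewrite (bfun_simple_integral hl (sw n)).
  rewrite (eq_Rint (f := fun t => l (f t - w n t)) (g := fun t => l (f t) - l (w n t))); last by move=> t _; rewrite (bfunB hl).
  rewrite RintB //; [lra|exact: bfun_integrable hl bf|exact: bfun_integrable hl (bw n)].
rewrite E; apply: le_trans (ler_normB _ _) _.
have b1 : `|l v - l (simple_integral (w n))| <= e / 2.
  apply: le_trans (bfun_lip hl _ _) _; rewrite nrm_sub.
  apply: (@le_trans _ _ ((C + 1) * (e / 2 / (C + 1)))); last first.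
    by rewrite mulrC divfK // gt_eqF //; lra.
  by apply: ler_pM; rewrite ?nrm_ge0 //; lra.
have b2 : `|\int[mu]_(t in I) (l (f t - w n t))| <= e / 2.
  have ii := bfun_integrable hl (bfw n).
  apply: le_trans (le_norm_Rint mI ii) _.
  apply: (@le_trans _ _ (\int[mu]_(t in I) (C * nrm (f t - w n t)))).
    apply: le_Rint => //; [exact: integrable_on_norm|exact: integrable_onZ (bfw n).2|].
    by move=> t _; exact: (bfun_le hl).
  rewrite RintZ //; last exact: (bfw n).2.
  apply: (@le_trans _ _ ((C + 1) * (e / 2 / (C + 1)))); last first.
    by rewrite mulrC divfK // gt_eqF //; lra.
  by apply: ler_pM => //; rewrite ?Rintegral_ge0 // => *; rewrite ?nrm_ge0 //; lra.
lra.
Unshelve. all: by end_near. Qed.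

Lemma bochner_functional C l f : bounded_functional C l -> bochner_integrable f ->
  l (bochner f) = \int[mu]_(t in I) l (f t).
Proof.
move=> hl bf; apply: (is_bochner_functional hl bf).
have [v hv] := bochner_exists bf.
by apply: (@xgetPex _ 0 [set v | is_bochner f v]); exists v.
Qed.

Lemma bochner_ip f w : bochner_integrable f ->
  q (bochner f) w = \int[mu]_(t in I) q (f t) w.
Proof. exact: bochner_functional (bounded_functional_ip w). Qed.

Lemma ip_ext (x y : V) : (forall w, q x w = q y w) -> x = y.
Proof.
move=> h; apply/eqP; rewrite -subr_eq0; apply/eqP/(qnorm0_eq0 hq).
by rewrite /qnorm (ripBl hq) h subrr sqrtr0.
Qed.

(** An integral in a Hilbert space is determined by its pairings. Linearity, integration by parts
    and invariance under almost everywhere equality thus become statements on real integrals. *)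
Lemma bochner_eqP f v : bochner_integrable f ->
  (forall w, q v w = \int[mu]_(t in I) q (f t) w) -> bochner f = v.
Proof. by move=> bf h; apply: ip_ext => w; rewrite h bochner_ip. Qed.

Lemma nrm_bochner f : bochner_integrable f ->
  nrm (bochner f) <= \int[mu]_(t in I) nrm (f t).
Proof.
move=> bf; set v := bochner f.
have E : nrm v * nrm v <= (\int[mu]_(t in I) nrm (f t)) * nrm v.
  rewrite -expr2 (hilbert_nrm hV) {1}/v bochner_ip // mulrC -RintZ //; last exact: bf.2.
  apply: le_Rint => //.
  - exact: bfun_integrable (bounded_functional_ip v) bf.
  - by apply: integrable_onZ => //; exact: bf.2.
  move=> t _; rewrite mulrC; apply: le_trans (ler_norm _) _; exact: hilbert_cs.
have [d0|] := ltP 0 (nrm v); first by rewrite -(ler_pM2r d0).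
move/le_trans; apply; apply: Rintegral_ge0 => t _; exact: nrm_ge0.
Qed.

End Space.
End BochnerIntegral.

(** * Primitives of square integrable functions *)

Section Primitives.
Context {R : realType}.
Notation mu := (@lebesgue_measure R).
Notation I := (`[-1, 0]%classic : set R).

(** Pieces of length [d] are peeled off at the right end, and both sides add up over them. With a
    small multiple of an integral as [m], a local approximation becomes an estimate on every
    interval. *)
Lemma interval_additive_le (D m : R -> R -> R) (d : R) : 0 < d ->
  (forall a b c, -1 <= a -> a <= b -> b <= c -> c <= 0 -> D a c = D a b + D b c) ->
  (forall a b c, -1 <= a -> a <= b -> b <= c -> c <= 0 -> m a c = m a b + m b c) ->
  (forall a b, -1 <= a -> a <= b -> b <= 0 -> b - a <= d -> `|D a b| <= m a b) ->
  forall a b, -1 <= a -> a <= b -> b <= 0 -> `|D a b| <= m a b.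
Proof.
move=> d0 Dadd madd loc.
suff H (n : nat) : forall a b, -1 <= a -> a <= b -> b <= 0 -> b - a <= n%:R * d ->
    `|D a b| <= m a b.
  move=> a b a1 ab b0; apply: (H (Num.truncn ((b - a) / d)).+1) => //.
  rewrite -ler_pdivrMr //; apply: ltW.
  have : 0 <= (b - a) / d by rewrite divr_ge0 ?(ltW d0) // subr_ge0.
  by move=> /truncn_itv/andP[].
elim: n => [|n IH] a b a1 ab b0 nd.
  by apply: loc => //; rewrite mul0r in nd; lra.
have [small|big] := leP (b - a) d; first exact: loc.
rewrite -natr1 in nd.
have c1 : a <= b - d by lra.
have c2 : b - d <= b by lra.
have n1 : -1 <= b - d by lra.
have n2 : b - d <= 0 by lra.
rewrite (Dadd a (b - d) b) // (madd a (b - d) b) //.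
apply: le_trans (ler_normD _ _) _; apply: lerD.
  by apply: IH => //; lra.
by apply: loc => //; lra.
Qed.

Lemma sub_itvI (s t : R) : -1 <= s -> t <= 0 -> `[s, t]%classic `<=` I.
Proof.
move=> s1 t0 r /=; rewrite !in_itv /= => /andP[sr rt].
by rewrite (le_trans s1 sr) (le_trans rt t0).
Qed.

Lemma integrable_on_itv (s t : R) (h : R -> R) : -1 <= s -> t <= 0 ->
  integrable_on I h -> integrable_on `[s, t] h.
Proof.
move=> s1 t0; apply: integrable_on_sub; try exact: measurable_itv.
exact: sub_itvI.
Qed.

Lemma Rint_indic (s t : R) (h : R -> R) : -1 <= s -> t <= 0 ->
  \int[mu]_(r in I) (\1_(`[s, t]%classic) r * h r) = \int[mu]_(r in `[s, t]) h r.
Proof.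
move=> s1 t0.
have E : I `&` `[s, t]%classic = `[s, t]%classic.
  by apply/seteqP; split => [r [] //|r rst]; split => //; exact: sub_itvI rst.
rewrite -[in RHS]E Rintegral_mkcondr; apply: eq_Rint => r _.
by rewrite patchE indicE; case: (r \in _); rewrite ?mul1r ?mul0r.
Qed.

(* By [h <= h^2 / (2 k) + k / 2]. *)
Lemma Rint_small (h : R -> R) : (forall t, I t -> 0 <= h t) -> integrable_on I h ->
  integrable_on I (fun t => h t ^+ 2) ->
  forall e : R, 0 < e -> exists2 d : R, 0 < d &
    forall s t, -1 <= s -> s <= t -> t <= 0 -> t - s <= d ->
      \int[mu]_(r in `[s, t]) h r <= e.
Proof.
move=> h0 ih ih2 e e0; pose G := \int[mu]_(r in I) h r ^+ 2.
have G0 : 0 <= G by apply: Rintegral_ge0 => r _; exact: sqr_ge0.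
(* With this [k] the square term contributes at most [G / (2 * k) <= e / 2], and the constant
   [k / 2] contributes at most [e / 2] on an interval of length [e / k]. *)
pose k := G / e + 1; have k0 : 0 < k by rewrite /k ltr_wpDl // divr_ge0 // ltW.
exists (e / k); first by rewrite divr_gt0.
move=> s t s1 st t0 tsd.
have mst : measurable `[s, t]%classic by exact: measurable_itv.
have i2 := integrable_on_itv s1 t0 ih2.
have ic : integrable_on `[s, t] (fun=> k / 2) by exact: integrable_on_cst.
apply: (@le_trans _ _ (\int[mu]_(r in `[s, t]) (1 / (2 * k) * h r ^+ 2 + k / 2))).
  apply: le_Rint => //; first exact: integrable_on_itv.
    by apply: integrable_onD => //; exact: integrable_onZ.
  move=> r _; rewrite -subr_ge0.
  have -> : 1 / (2 * k) * h r ^+ 2 + k / 2 - h r = (h r - k) ^+ 2 / (2 * k).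
    by field; rewrite gt_eqF.
  by rewrite divr_ge0 ?sqr_ge0 // mulr_ge0 // ltW.
rewrite RintD //; last exact: integrable_onZ.
rewrite (RintZ _ mst i2).
rewrite Rintegral_cst_itv //.
have a1 : \int[mu]_(r in `[s, t]) h r ^+ 2 <= G.
  rewrite -(Rint_indic _ s1 t0); apply: le_Rint => //.
  - apply: (integrable_on_le (g := fun r => h r ^+ 2)) => //.
      apply: measurable_funM; first exact: measurable_indic.
      exact: integrable_on_measurable ih2.
    move=> r _; rewrite indicE; case: (r \in _); rewrite ?mul1r ?mul0r ?normr0 ?sqr_ge0 //.
    by rewrite ger0_norm ?sqr_ge0.
  - by move=> r _; rewrite indicE; case: (r \in _); rewrite ?mul1r ?mul0r ?sqr_ge0.
have a2 : 1 / (2 * k) * G <= e / 2.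
  rewrite mul1r mulrC ler_pdivrMr ?mulr_gt0 //.
  have : G = (k - 1) * e by rewrite /k addrK divfK // gt_eqF.
  by move=> ->; rewrite -subr_ge0 (_ : _ - _ = e) ?ltW //; field.
have a3 : 1 / (2 * k) * \int[mu]_(r in `[s, t]) h r ^+ 2 <= 1 / (2 * k) * G.
  by rewrite ler_wpM2l // divr_ge0 // mulr_ge0 // ltW.
have a4 : k / 2 * (t - s) <= e / 2.
  apply: (@le_trans _ _ (k / 2 * (e / k))); first by rewrite ler_wpM2l // divr_ge0 // ltW.
  by rewrite le_eqVlt; apply/orP; left; apply/eqP; field; rewrite gt_eqF.
lra.
Qed.

Section Space.
Context {K : scalars R} {V : normedModType K} {q : V -> V -> R} (hV : hilbert q).
Implicit Types (f g h F H : R -> V).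

Let hq := hilbert_ip hV.
Let mI : measurable I. Proof. exact: measurable_itv. Qed.

Definition sq_integrable g :=
  strongly_measurable g /\ integrable_on I (fun t => nrm (g t) ^+ 2).

Lemma sq_integrable_bochner g : sq_integrable g -> bochner_integrable g.
Proof.
move=> [sg ig]; apply: (bochner_integrable_le (h := fun t => 1 + nrm (g t) ^+ 2)) => //.
  by move=> t _; have := sqr_ge0 (nrm (g t) - 1); have := nrm_ge0 (g t); rewrite sqrrB; lra.
by apply: integrable_onD => //; exact: integrable_on_cst.
Qed.

(* Testing against [V] avoids vector-valued integrals over subintervals. *)
Definition primitive F g := forall w s t, -1 <= s -> s <= t -> t <= 0 ->
  q (F t - F s) w = \int[mu]_(r in `[s, t]) q (g r) w.

Lemma measurable_ip f g : strongly_measurable f -> strongly_measurable g ->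
  measurable_fun I (fun t => q (f t) (g t)).
Proof.
move=> sf sg.
have -> : (fun t => q (f t) (g t)) =
    (fun t => 4^-1 * (nrm (f t + g t) ^+ 2 - nrm (f t - g t) ^+ 2)).
  apply/funext => t; rewrite !(hilbert_nrm hV) !(ripDl hq) !(ripDr hq) !(ripNl hq) !(ripNr hq).
  by rewrite (rip_sym hq (g t) (f t)); field.
apply: measurable_funM; first exact: measurable_cst.
apply: measurable_funB; apply: measurable_funX; apply: strongly_measurable_nrm'.
  exact: strongly_measurableD.
exact: strongly_measurableB.
Qed.

Lemma integrable_ip f g C : bochner_integrable f -> strongly_measurable g ->
  (forall t, I t -> nrm (g t) <= C) -> integrable_on I (fun t => q (f t) (g t)).
Proof.
move=> [sf nf] sg gC; apply: (integrable_on_le (g := fun t => C * nrm (f t))) => //.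
- exact: measurable_ip.
- move=> t It; apply: le_trans (hilbert_cs hV _ _) _; rewrite mulrC.
  by rewrite ler_wpM2r ?nrm_ge0 // gC.
- exact: integrable_onZ.
Qed.

Lemma bochner_integrable_indic s t g : bochner_integrable g ->
  bochner_integrable (fun r => ofR (\1_(`[s, t]%classic) r) *: g r).
Proof.
apply: (bochner_integrableZ (C := 1)); first exact: measurable_indic.
by move=> r _; rewrite indicE; case: (r \in _); rewrite ?normr1 ?normr0.
Qed.

Lemma primitiveE F g : bochner_integrable g -> primitive F g -> forall s t,
  -1 <= s -> s <= t -> t <= 0 ->
  F t - F s = bochner (fun r => ofR (\1_(`[s, t]%classic) r) *: g r).
Proof.
move=> bg Fg s t s1 st t0; apply/esym; apply: (bochner_eqP hV).
  exact: bochner_integrable_indic.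
move=> w; rewrite Fg // -[LHS]Rint_indic //; apply: eq_Rint => r _.
by rewrite (ripZl hq).
Qed.

Lemma primitive_functional C l F g : bounded_functional C l -> bochner_integrable g ->
  primitive F g -> forall s t, -1 <= s -> s <= t -> t <= 0 ->
  l (F t) - l (F s) = \int[mu]_(r in `[s, t]) l (g r).
Proof.
move=> hl bg Fg s t s1 st t0; rewrite -(bfunB hl) (primitiveE bg Fg) //.
rewrite (bochner_functional hV hl); last exact: bochner_integrable_indic.
rewrite -[RHS]Rint_indic //.
by apply: eq_Rint => r _; rewrite (bfunZ hl).
Qed.

Lemma primitive_exists g : bochner_integrable g -> exists F, primitive F g.
Proof.
move=> bg; exists (fun t => bochner (fun r => ofR (\1_(`[-1, t]%classic) r) *: g r)).
move=> w s t s1 st t0.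
have s0 : s <= 0 by lra.
rewrite (ripBl hq) !(bochner_ip hV) //; try exact: bochner_integrable_indic.
have E u : -1 <= u -> u <= 0 -> \int[mu]_(r in I) q (ofR (\1_(`[-1, u]%classic) r) *: g r) w =
    \int[mu]_(r in `[-1, u]) q (g r) w.
  move=> u1 u0; rewrite -[RHS]Rint_indic //; apply: eq_Rint => r _; exact: ripZl.
rewrite !E //; last lra.
have ii := bfun_integrable (bounded_functional_ip hV w) bg.
rewrite (@Rintegral_split _ (-1) s t) ?s1 //; first by rewrite addrC addKr.
exact: integrable_on_itv.
Qed.

Lemma nrm_primitive F g : bochner_integrable g -> primitive F g -> forall s t,
  -1 <= s -> s <= t -> t <= 0 -> nrm (F t - F s) <= \int[mu]_(r in `[s, t]) nrm (g r).
Proof.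
move=> bg Fg s t s1 st t0; rewrite (primitiveE bg Fg) //.
apply: le_trans (nrm_bochner hV (bochner_integrable_indic s t bg)) _.
rewrite -[leRHS]Rint_indic //; apply: eq_ler; apply: eq_Rint => r _.
by rewrite nrm_ofRZ ger0_norm.
Qed.

Lemma primitive_modulus F g : sq_integrable g -> primitive F g ->
  forall e : R, 0 < e -> exists2 d : R, 0 < d &
    forall s t, I s -> I t -> `|s - t| <= d -> nrm (F s - F t) <= e.
Proof.
move=> sg Fg e e0; have bg := sq_integrable_bochner sg.
have [d d0 hd] := Rint_small (fun t _ => nrm_ge0 (g t)) bg.2 sg.2 e0.
exists d => // s t; rewrite /= !in_itv /= => /andP[s1 s0] /andP[t1 t0] std.
wlog st : s t s1 s0 t1 t0 std / t <= s.
  move=> H; have [ts|/ltW st] := leP t s; first exact: H.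
  by rewrite nrm_sub; apply: H => //; rewrite distrC.
apply: le_trans (nrm_primitive bg Fg t1 st s0) _; apply: hd => //.
by apply: le_trans std; exact: ler_norm.
Qed.

Lemma primitive_bounded F g : bochner_integrable g -> primitive F g ->
  exists C, forall t, I t -> nrm (F t) <= C.
Proof.
move=> bg Fg; exists (nrm (F (-1)) + \int[mu]_(r in I) nrm (g r)) => t.
rewrite /= in_itv /= => /andP[t1 t0].
have := nrmD (F (-1)) (F t - F (-1)); rewrite addrC subrK.
have h1 : -1 <= -1 :> R by [].
have := nrm_primitive bg Fg h1 t1 t0.
have : \int[mu]_(r in `[-1, t]) nrm (g r) <= \int[mu]_(r in I) nrm (g r).
  have t10 : -1 <= t <= 0 by rewrite t1.
  rewrite [leRHS](Rintegral_split bg.2 t10) lerDl.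
  by apply: Rintegral_ge0 => r _; exact: nrm_ge0.
lra.
Qed.

Lemma primitive_strongly_measurable F g : sq_integrable g -> primitive F g ->
  strongly_measurable F.
Proof.
move=> sg Fg; apply: (strongly_measurable_modulus (W := fun t => t + 1) (M := 1)).
- by apply: measurable_funD => //; exact: measurable_cst.
- by move=> t; rewrite /= in_itv /= => /andP[a b]; apply/andP; split; lra.
move=> t It e /(primitive_modulus sg Fg)[d d0 hd]; exists d => // s Is.
by rewrite opprD addrACA subrr addr0; exact: hd.
Qed.

Lemma primitive_sq_integrable F g : sq_integrable g -> primitive F g -> sq_integrable F.
Proof.
move=> sg Fg; have sF := primitive_strongly_measurable sg Fg; split => //.
have [C FC] := primitive_bounded (sq_integrable_bochner sg) Fg.
apply: (@integrable_on_bounded _ _ _ (C ^+ 2)).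
  by apply: measurable_funX; exact: strongly_measurable_nrm'.
move=> t It; rewrite ger0_norm ?sqr_ge0 //.
have It' : I t by rewrite /= in_itv.
by rewrite lerXn2r ?nnegrE ?nrm_ge0 ?FC // (le_trans (nrm_ge0 _) (FC _ It')).
Qed.

Lemma primitiveD F H g h : bochner_integrable g -> bochner_integrable h ->
  primitive F g -> primitive H h ->
  primitive (fun t => F t + H t) (fun t => g t + h t).
Proof.
move=> bg bh Fg Hh w s t s1 st t0.
rewrite opprD addrACA (ripDl hq) Fg // Hh // -RintD //.
- by apply: eq_Rint => r _; rewrite (ripDl hq).
- exact: (integrable_on_itv s1 t0 (bfun_integrable (bounded_functional_ip hV w) bg)).
- exact: (integrable_on_itv s1 t0 (bfun_integrable (bounded_functional_ip hV w) bh)).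
Qed.

(** On a short interval the factors are frozen at end points, [H] at the right one and [F] at the
    left one. The error is at most a small multiple of the integral of [nrm (g r) + nrm (h r)],
    which is additive, so [interval_additive_le] removes the restriction on the length. *)
Lemma primitive_rule F H g h : sq_integrable g -> sq_integrable h ->
  primitive F g -> primitive H h ->
  integrable_on I (fun r => q (g r) (H r) + q (F r) (h r)) /\
  forall s t, -1 <= s -> s <= t -> t <= 0 -> q (F t) (H t) - q (F s) (H s) =
    \int[mu]_(r in `[s, t]) (q (g r) (H r) + q (F r) (h r)).
Proof.
move=> sg sh Fg Hh; have bg := sq_integrable_bochner sg; have bh := sq_integrable_bochner sh.
have sF := primitive_strongly_measurable sg Fg.
have sH := primitive_strongly_measurable sh Hh.
have [CF bF] := primitive_bounded bg Fg; have [CH bH] := primitive_bounded bh Hh.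
have i1 : integrable_on I (fun r => q (g r) (H r)) by exact: integrable_ip bH.
have i2 : integrable_on I (fun r => q (F r) (h r)).
  have : integrable_on I (fun r => q (h r) (F r)) by exact: integrable_ip bF.
  by congr integrable_on; apply/funext => r; exact: rip_sym.
have i12 := integrable_onD mI i1 i2; split => //.
set k := fun r : R => _ in i12 *.
pose D a b := q (F b) (H b) - q (F a) (H a) - \int[mu]_(r in `[a, b]) k r.
have nI := integrable_onD mI bg.2 bh.2.
pose M a b := \int[mu]_(r in `[a, b]) (nrm (g r) + nrm (h r)).
have Dadd a b c : -1 <= a -> a <= b -> b <= c -> c <= 0 -> D a c = D a b + D b c.
  move=> a1 ab bc c0; rewrite /D (@Rintegral_split _ a b c) ?ab //; first ring.
  exact: integrable_on_itv.
have Madd a b c : -1 <= a -> a <= b -> b <= c -> c <= 0 -> M a c = M a b + M b c.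
  move=> a1 ab bc c0; rewrite /M (@Rintegral_split _ a b c) ?ab //.
  exact: integrable_on_itv.
move=> s t s1 st t0; apply/eqP; rewrite -subr_eq0 -normr_eq0 -/(D s t).
apply/eqP/le_anti; rewrite normr_ge0 andbT.
apply/ler_addgt0Pr => e e0; rewrite add0r.
have M0 : 0 <= M s t by apply: Rintegral_ge0 => r _; rewrite addr_ge0 ?nrm_ge0.
have e1 : 0 < e / (M s t + 1) by rewrite divr_gt0 //; lra.
set e' := e / _ in e1.
have [d1 d10 hd1] := primitive_modulus sg Fg e1.
have [d2 d20 hd2] := primitive_modulus sh Hh e1.
have d0 : 0 < Num.min d1 d2 by rewrite lt_min d10.
apply: (@le_trans _ _ (e' * M s t)); last first.
  apply: (@le_trans _ _ (e' * (M s t + 1))); first by rewrite ler_wpM2l ?(ltW e1) //; lra.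
  by rewrite /e' divfK // gt_eqF //; lra.
apply: (@interval_additive_le D (fun a b => e' * M a b) _ d0) => //.
  by move=> a b c *; rewrite (Madd a b c) // mulrDr.
move=> a b a1 ab b0 bad.
have mab : measurable `[a, b]%classic by exact: measurable_itv.
have j1 := integrable_on_itv a1 b0 (bfun_integrable (bounded_functional_ip hV (H b)) bg).
have j2 := integrable_on_itv a1 b0 (bfun_integrable (bounded_functional_ip hV (F a)) bh).
have jk := integrable_on_itv a1 b0 i12.
(* From [q (F b) (H b) - q (F a) (H a) = q (F b - F a) (H b) + q (F a) (H b - H a)]; this is why the
   two factors are frozen at different ends. *)
have -> : D a b = \int[mu]_(r in `[a, b]) (q (g r) (H b) + q (h r) (F a) - k r).
  rewrite RintB //; last exact: integrable_onD.
  rewrite RintD // -Fg // -Hh // /D (ripBl hq) (ripBl hq).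
  by rewrite (rip_sym hq (H b) (F a)) (rip_sym hq (H a) (F a)); ring.
have jd := integrable_onB mab (integrable_onD mab j1 j2) jk.
apply: le_trans (le_norm_Rint mab jd) _.
rewrite /M -RintZ //; last exact: integrable_on_itv.
apply: le_Rint => //.
- exact: integrable_on_norm.
- by apply: integrable_onZ => //; exact: integrable_on_itv.
move=> r rab; have Ir := sub_itvI a1 b0 rab.
have Ia : I a by apply: (sub_itvI a1 b0); rewrite /= in_itv /= lexx.
have Ib : I b by apply: (sub_itvI a1 b0); rewrite /= in_itv /= lexx andbT.
move: rab; rewrite /= in_itv /= => /andP[ar rb].
have -> : q (g r) (H b) + q (h r) (F a) - k r = q (g r) (H b - H r) + q (h r) (F a - F r).
  by rewrite /k !(ripBr hq) (rip_sym hq (F r)); ring.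
apply: le_trans (ler_normD _ _) _; rewrite mulrDr.
move: bad; rewrite le_min => /andP[ba1 ba2].
apply: lerD.
  apply: le_trans (hilbert_cs hV _ _) _; rewrite mulrC ler_wpM2r ?nrm_ge0 //.
  by apply: hd2 => //; rewrite ger0_norm; lra.
apply: le_trans (hilbert_cs hV _ _) _; rewrite mulrC ler_wpM2r ?nrm_ge0 //.
by apply: hd1 => //; rewrite distrC ger0_norm; lra.
Qed.

Lemma primitive_map (L : V -> V) C F g : (forall x y, L (x + y) = L x + L y) ->
  (forall a x, L (ofR a *: x) = ofR a *: L x) -> (forall x, nrm (L x) <= C * nrm x) ->
  0 <= C -> bochner_integrable g -> primitive F g ->
  primitive (fun t => L (F t)) (fun t => L (g t)).
Proof.
move=> LD LZ LC C0 bg Fg w s t s1 st t0.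
have hl : bounded_functional (C * nrm w) (fun x => q (L x) w).
  split=> [x y|a x|x]; [by rewrite LD (ripDl hq)|by rewrite LZ (ripZl hq)|].
  apply: le_trans (hilbert_cs hV _ _) _; rewrite mulrAC ler_wpM2r ?nrm_ge0 //.
rewrite (ripBl hq); exact: (primitive_functional hl bg Fg).
Qed.

End Space.

(** Makes real functions instances of [primitive], so that the product rule also covers a scalar
    factor times a paired vector function. *)
Lemma hilbert_real : @hilbert R (real_scalars R) (R^o) (fun a b : R => a * b).
Proof.
split.
- split=> [x y|x y z|a x y|k x|x x0].
  + exact: mulrC.
  + exact: mulrDl.
  + by rewrite -mulrA.
  + by rewrite /= -expr2 exprMn expr2 real_normK ?num_real.
  + by rewrite -expr2 lt_neqAle sqr_ge0 eq_sym sqrf_eq0 x0.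
- by move=> x; rewrite /nrm /= real_normK ?num_real // expr2.
move=> u cu; exact: (@scalars_complete R (real_scalars R) u cu).
Qed.

End Primitives.

(** * Test functions and the du Bois-Reymond lemma *)

Section SmoothSteps.
Context {R : realType}.
Notation mu := (@lebesgue_measure R).
Implicit Types (f g F : R -> R) (x : R).

(** The functions $x^{-k}e^{-1/x}$, extended by zero to the left. All powers are kept because
    differentiation raises [k]; the linear span of the family is closed under it. *)
Definition flat (k : nat) x : R := if 0 < x then x^-1 ^+ k * expR (- x^-1) else 0.

(** One term of the exponential series at [x^-1], of degree [k + 2]: the two spare powers leave
    [x ^+ 2], and so the difference quotient at [0] tends to zero. *)
Lemma flat_le (k : nat) x : 0 < x -> flat k x <= k.+2`!%:R * x ^+ 2.
Proof.
move=> x0; rewrite /flat x0.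
have y0 : 0 < x^-1 by rewrite invr_gt0.
have h := expR_ge1Dxn k.+1 (ltW y0).
have h' : x^-1 ^+ k.+2 <= k.+2`!%:R * expR x^-1.
  rewrite mulrC -ler_pdivrMr ?ltr0n ?fact_gt0 //; lra.
have e0 := expR_gt0 (- x^-1).
have : x^-1 ^+ k.+2 * expR (- x^-1) <= k.+2`!%:R.
  have -> : k.+2`!%:R = k.+2`!%:R * expR x^-1 * expR (- x^-1) :> R.
    by rewrite -mulrA -expRD subrr expR0 mulr1.
  by rewrite ler_wpM2r // ltW.
rewrite -[X in _ -> _ <= X]mulrC -ler_pdivrMl ?exprn_gt0 //.
rewrite !exprS => h2; apply: le_trans h2; apply: eq_ler.
by rewrite expr0 mulr1 invfM !mulrA.
Qed.

Lemma is_derive_flat k x : is_derive x 1 (flat k) (- k%:R * flat k.+1 x + flat k.+2 x).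
Proof.
have [x0|x0|<-] := ltgtP 0 x.
- have xn0 : x != 0 by rewrite gt_eqF.
  pose g := (fun y : R => y^-1) ^+ k * (expR \o (fun y : R => - y^-1)).
  have dV : is_derive x 1 (fun y : R => y^-1) (- x ^- 2 *: 1).
    exact: (@is_deriveV R id x 1 1 xn0 (is_derive_id _ _)).
  have dN : is_derive x 1 (fun y : R => - y^-1) (- (- x ^- 2 *: 1)) by exact: is_deriveN.
  have dE := @is_derive1_comp _ expR (fun y : R => - y^-1) x _ _ (is_derive_expR _) dN.
  have dX := is_deriveX k dV.
  have dM := is_deriveM dX dE.
  have -> : - k%:R * flat k.+1 x + flat k.+2 x =
    ((fun y : R => y^-1) ^+ k) x *: (expR (- x^-1) * - (- x ^- 2 *: 1)) +
    (expR \o (fun y : R => - y^-1)) x *: ((k%:R * (x^-1) ^+ k.-1) *: (- x ^- 2 *: 1)).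
    rewrite /flat x0 exprfctE /= /GRing.scale /= !mulr1 -!exprVn.
    case: k {g dX dM} => [|k]; first by rewrite !expr0; ring.
    by rewrite /= !exprS expr0; ring.
  apply: near_eq_is_derive dM.
  near=> y; rewrite /flat ifT; first by rewrite /= fctE exprfctE.
  by near: y; exact: lt_nbhsr.
- have -> : - k%:R * flat k.+1 x + flat k.+2 x = 0.
    by rewrite /flat ltNge (ltW x0) /= mulr0 addr0.
  apply: near_eq_is_derive (@is_derive_cst _ _ _ 0 x 1).
  near=> y; rewrite /flat ltNge ifF //; apply/negbF; rewrite ltW //.
  by near: y; exact: lt_nbhsl.
have -> : - k%:R * flat k.+1 0 + flat k.+2 0 = 0 by rewrite /flat ltxx mulr0 addr0.
have c : h^-1 *: ((flat k \o shift 0) (h *: 1) - flat k 0) @[h --> (0 : R)^'] --> (0 : R).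
  apply/cvgrPdist_le => e e0.
  have c0 : 0 < k.+2`!%:R :> R by rewrite ltr0n fact_gt0.
  have d0 : 0 < e / k.+2`!%:R by rewrite divr_gt0.
  apply/nbhs_ballP; exists (e / k.+2`!%:R) => //= h.
  rewrite /ball /= !sub0r !normrN => hd h0.
  rewrite /= /shift /= addr0 /GRing.scale /= mulr1 {2}/flat ltxx subr0.
  rewrite /flat; case: ifP => hp; last by rewrite mulr0 normr0 ltW.
  have fl := flat_le k hp; rewrite /flat hp in fl.
  have fp : 0 <= h^-1 ^+ k * expR (- h^-1).
    by rewrite mulr_ge0 ?expR_ge0 // exprn_ge0 // invr_ge0 ltW.
  rewrite ger0_norm; last by rewrite mulr_ge0 // invr_ge0 ltW.
  rewrite mulrC ler_pdivrMr //; apply: le_trans fl _.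
  rewrite expr2 mulrA ler_wpM2r ?(ltW hp) // mulrC -ler_pdivlMr //.
  by rewrite ltW // -(gtr0_norm hp).
by apply: DeriveDef; [apply/cvg_ex; exists 0|exact: cvg_lim].
Unshelve. all: by end_near. Qed.

(** A syntactic class closed under differentiation, so that one induction yields derivatives of all
    orders. [smooth_primitive] admits functions known only as integrals. *)
Inductive smooth_gen : (R -> R) -> Prop :=
| smooth_flat k : smooth_gen (flat k)
| smooth_cst c : smooth_gen (fun=> c)
| smooth_add f g : smooth_gen f -> smooth_gen g -> smooth_gen (fun x => f x + g x)
| smooth_mul f g : smooth_gen f -> smooth_gen g -> smooth_gen (fun x => f x * g x)
| smooth_affine f a b : smooth_gen f -> smooth_gen (fun x => f (a * x + b))
| smooth_primitive F f : (forall x, is_derive x 1 F (f x)) -> smooth_gen f -> smooth_gen F.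

Lemma smooth_gen_derive f : smooth_gen f ->
  exists2 f', smooth_gen f' & forall x, is_derive x 1 f (f' x).
Proof.
elim=> {f}[k|c|f g sf [f' sf' df] sg [g' sg' dg]|f g sf [f' sf' df] sg [g' sg' dg]
  |f a b sf [f' sf' df]|F f dF sf _].
- exists (fun x => - k%:R * flat k.+1 x + flat k.+2 x); last exact: is_derive_flat.
  apply: smooth_add (smooth_flat _).
  exact: smooth_mul (smooth_cst _) (smooth_flat _).
- by exists (fun=> 0); [exact: smooth_cst|move=> x; exact: is_derive_cst].
- exists (fun x => f' x + g' x); first exact: smooth_add.
  by move=> x; exact: is_deriveD.
- exists (fun x => f x * g' x + g x * f' x).
    by apply: smooth_add; exact: smooth_mul.
  by move=> x; exact: is_deriveM.
- exists (fun x => f' (a * x + b) * a).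
    exact: smooth_mul (smooth_affine _ _ sf') (smooth_cst a).
  move=> x; have dl : is_derive x 1 (fun y => a * y + b) a.
    have := is_deriveD (is_deriveZ a (is_derive_id x 1)) (is_derive_cst b x 1).
    by rewrite addr0 /GRing.scale /= mulr1.
  exact: (is_derive1_comp (df _) dl).
- by exists f.
Qed.

Lemma smooth_gen_derivable f : smooth_gen f ->
  forall n x, derivable (f^`(n)%classic) x 1.
Proof.
move=> sf n; elim: n f sf => [|n IH] f /smooth_gen_derive[f' sf' df] x; first by [].
rewrite derive1Sn; have -> : f^`()%classic = f'.
  by apply/funext => y; rewrite derive1E; exact: derive_val.
exact: IH.
Qed.

Lemma is_derive_continuous f (f' : R) x : is_derive x 1 f f' -> {for x, continuous f}.
Proof. by move=> [d _]; exact/differentiable_continuous/derivable1_diffP. Qed.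

Lemma smooth_gen_continuous f : smooth_gen f -> continuous f.
Proof. by move=> /smooth_gen_derive[f' _ df] x; exact: is_derive_continuous (df x). Qed.

Lemma continuous_integrable_on f (a b : R) : continuous f -> integrable_on `[a, b] f.
Proof.
move=> cf; apply: continuous_compact_integrable; first exact: segment_compact.
exact: continuous_subspaceT.
Qed.

(** The integral starts at [-1], inside the region where [f] vanishes, so that the fundamental
    theorem of calculus applies at every point beyond [-1], in particular at [0]; elsewhere the
    function is locally zero. *)
Lemma primitive_from_left f : continuous f -> (forall x, x <= 0 -> f x = 0) ->
  exists F, [/\ forall x, is_derive x 1 F (f x), forall x, x <= 0 -> F x = 0 &
    forall x, F x = \int[mu]_(t in `[0, x]) f t].
Proof.
move=> cf f0; pose F x := \int[mu]_(t in `[-1, x]) f t.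
have Fint x : F x = \int[mu]_(t in `[0, x]) f t.
  have [x1|x1] := ltP x 0.
    have -> : `[0, x]%classic = set0.
      by apply/seteqP; split => t //=; rewrite in_itv /= => /andP[t0 tx]; lra.
    rewrite Rintegral_set0 /F.
    have -> : \int[mu]_(t in `[-1, x]) f t = \int[mu]_(t in `[-1, x]) (0 * f t).
      by apply: eq_Rint => t /=; rewrite in_itv /= => /andP[_ tx]; rewrite mul0r f0 //; lra.
    by rewrite RintZ ?mul0r //; exact: continuous_integrable_on.
  rewrite /F (@Rintegral_split _ (-1) 0 x) ?lerN10 //; last exact: continuous_integrable_on.
  have -> : \int[mu]_(t in `[-1, 0]) f t = \int[mu]_(t in `[-1, 0]) (0 * f t).
    by apply: eq_Rint => t /=; rewrite in_itv /= => /andP[_ tx]; rewrite mul0r f0.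
  by rewrite RintZ ?mul0r ?add0r //; exact: continuous_integrable_on.
have F0 x : x <= 0 -> F x = 0.
  move=> x0; rewrite Fint.
  move: x0; rewrite le_eqVlt => /predU1P[->|x0]; first by rewrite set_itv1 Rintegral_set1.
  have -> : `[0, x]%classic = set0.
    by apply/seteqP; split => t //=; rewrite in_itv /= => /andP[t0 tx]; lra.
  exact: Rintegral_set0.
exists F; split => // x.
have [x1|x1] := ltP (-1) x.
  have xx : x < x + 1 by lra.
  have [d e] := continuous_FTC1_closed xx (continuous_integrable_on (-1) (x + 1) cf) x1 (cf x).
  have e' : 'D_1 F x = f x by rewrite -[RHS]e derive1E.
  exact: DeriveDef d e'.
have -> : f x = 0 by apply: f0; lra.
apply: near_eq_is_derive (@is_derive_cst _ _ _ 0 x 1).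
near=> y; rewrite F0 //; apply: ltW.
by near: y; apply: lt_nbhsl; lra.
Unshelve. all: by end_near. Qed.

(** [rho] is a bump supported in [[0, 1]], and [st] its normalized primitive. Beyond [1] the
    primitive [S] of [st] has slope one, and [kappa] is the lag accumulated before; it drops out of
    differences of [S]. *)
Lemma smooth_step_exists : exists st S : R -> R, exists kappa : R,
  [/\ smooth_gen st, smooth_gen S, forall x, is_derive x 1 S (st x),
    forall x, 0 <= st x <= 1 &
    [/\ forall x, x <= 0 -> st x = 0, forall x, 1 <= x -> st x = 1,
      forall x, x <= 0 -> S x = 0 & forall x, 1 <= x -> S x = x - kappa]].
Proof.
pose rho x := flat 0 x * flat 0 (- 1 * x + 1).
have srho : smooth_gen rho.
  exact: smooth_mul (smooth_flat 0) (smooth_affine _ _ (smooth_flat 0)).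
have flat0 k x : 0 <= flat k x.
  rewrite /flat; case: ifP => // x0.
  by rewrite mulr_ge0 ?expR_ge0 // exprn_ge0 // invr_ge0 ltW.
have rho0 x : 0 <= rho x by rewrite mulr_ge0.
have rhol x : x <= 0 -> rho x = 0 by rewrite /rho {1}/flat ltNge => -> /=; rewrite mul0r.
have rhor x : 1 <= x -> rho x = 0.
  move=> x1; rewrite /rho [flat 0 (_ + _)]/flat ifF ?mulr0 //.
  by apply/negbTE; rewrite -leNgt; lra.
have crho := smooth_gen_continuous srho.
have [s [ds s0 sint]] := primitive_from_left crho rhol.
have ss : smooth_gen s by exact: smooth_primitive ds srho.
have irho a b : integrable_on `[a, b] rho by exact: continuous_integrable_on.
have smono a b : 0 <= a -> a <= b -> s a <= s b.
  move=> a0 ab; rewrite !sint (@Rintegral_split _ 0 a b) ?a0 // lerDl.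
  by apply: Rintegral_ge0 => t _; exact: rho0.
have s1 x : 1 <= x -> s x = s 1.
  move=> x1; rewrite !sint (@Rintegral_split _ 0 1 x) ?ler01 //.
  have -> : \int[mu]_(t in `[1, x]) rho t = \int[mu]_(t in `[1, x]) (0 * rho t).
    by apply: eq_Rint => t /=; rewrite in_itv /= => /andP[tx _]; rewrite mul0r rhor.
  by rewrite RintZ // mul0r addr0.
have sge0 x : 0 <= s x.
  have [/s0->//|x0] := leP x 0.
  by rewrite -(s0 0) // smono // ltW.
(* If the mass of [rho] were zero, its monotone primitive [s] would vanish on []0, 1[], and with it
   the derivative at [1 / 2], where [rho] is positive. *)
have C0 : 0 < s 1.
  rewrite lt_neqAle sge0 andbT; apply/eqP => h.
  have z y : 0 < y < 1 -> s y = 0.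
    by move=> /andP[y0 y1]; apply/le_anti; rewrite sge0 h smono ?ltW.
  have d0 : is_derive (1 / 2 : R) 1 s 0.
    apply: (@near_eq_is_derive _ _ _ (cst 0) s (1 / 2) 1 0).
    near=> y; rewrite z //; apply/andP; split.
      by near: y; apply: lt_nbhsr; lra.
    by near: y; apply: lt_nbhsl; lra.
  have : rho (1 / 2) = 0.
    by rewrite -(@derive_val _ _ _ _ _ _ _ (ds _)) (@derive_val _ _ _ _ _ _ _ d0).
  apply/eqP; rewrite gt_eqF // mulr_gt0 // /flat ifT ?expr0 ?mul1r ?expR_gt0 //; lra.
pose st x := (s 1)^-1 * s x.
have sst : smooth_gen st by exact: smooth_mul (smooth_cst _) ss.
have stl x : x <= 0 -> st x = 0 by move=> /s0; rewrite /st => ->; rewrite mulr0.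
have str x : 1 <= x -> st x = 1 by move=> /s1; rewrite /st => ->; rewrite mulVf // gt_eqF.
have cst := smooth_gen_continuous sst.
have ist a b : integrable_on `[a, b] st by exact: continuous_integrable_on.
have [S [dS S0 Sint]] := primitive_from_left cst stl.
exists st, S, (1 - S 1); split => //.
- exact: smooth_primitive dS sst.
- move=> x; rewrite mulr_ge0 ?invr_ge0 // ?(ltW C0) //=.
  rewrite /st mulrC ler_pdivrMr // mul1r.
  have [x0|x0] := leP x 0; first by rewrite s0 // ltW.
  have [x1|x1] := leP x 1; first by rewrite smono // ltW.
  by rewrite s1 // ltW.
- split => // x x1; rewrite !Sint (@Rintegral_split _ 0 1 x) ?ler01 //.
  have -> : \int[mu]_(t in `[1, x]) st t = \int[mu]_(t in `[1, x]) 1.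
    by apply: eq_Rint => t /=; rewrite in_itv /= => /andP[tx _]; rewrite str.
  by rewrite Rintegral_cst_itv //; ring.
Unshelve. all: by end_near. Qed.

End SmoothSteps.

Section DuBoisReymond.
Context {R : realType}.
Notation mu := (@lebesgue_measure R).
Notation I := (`[-1, 0]%classic : set R).

Lemma eventually_natM (x c : R) : 0 < x -> exists n0 : nat, forall n, (n0 <= n)%N ->
  c <= n.+1%:R * x.
Proof.
move=> x0; have c1 : 0 < `|c| + 1 by have := normr_ge0 c; lra.
have d0 : 0 < x / (`|c| + 1) by rewrite divr_gt0.
have [n0 h] := invS_small d0; exists n0 => n /h.
rewrite ler_pdivlMr // ler_pdivrMl // => hh; apply: le_trans hh.
by have := ler_norm c; lra.
Qed.

(* Smooth approximations [bump n c d] of the indicator of ]c,d[, supported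
   inside, together with their primitives. *)
Lemma bump_family : exists bump prim : nat -> R -> R -> R -> R,
  [/\ forall n c d, smooth_gen (bump n c d) /\ smooth_gen (prim n c d),
    forall n c d (x : R), is_derive x 1 (prim n c d) (bump n c d x),
    forall n c d (x : R), `|bump n c d x| <= 1,
    forall n c d (x : R), 4 <= n.+1%:R * (d - c) ->
      (n.+1%:R * (x - c) <= 1 -> prim n c d x = 0) /\
      (-1 <= n.+1%:R * (x - d) -> prim n c d x = d - c - 3 * n.+1%:R^-1) &
    forall c d (t : R), c < d -> exists n0 : nat, forall n, (n0 <= n)%N ->
      bump n c d t = \1_(`]c, d[%classic) t].
Proof.
have [st [S [kap [sst sS dS st01 [stl str Sl Sr]]]]] := @smooth_step_exists R.
(* With [N = n.+1], the rise takes place between [c + 1 / N] and [c + 2 / N], the fall between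
   [d - 2 / N] and [d - 1 / N]. The gap between the shifts [-1] and [2] is the loss [3 / N] of total
   mass; [kap] cancels. *)
pose bump (n : nat) (c d x : R) := st (n.+1%:R * x + (- (n.+1%:R * c) - 1)) +
  -1 * st (n.+1%:R * x + (- (n.+1%:R * d) + 2)).
pose prim (n : nat) (c d x : R) := n.+1%:R^-1 * (S (n.+1%:R * x + (- (n.+1%:R * c) - 1)) +
  -1 * S (n.+1%:R * x + (- (n.+1%:R * d) + 2))).
have Npos n : 0 < n.+1%:R :> R by [].
exists bump, prim; split.
- move=> n c d; split.
    apply: smooth_add; first exact: smooth_affine.
    by apply: smooth_mul; [exact: smooth_cst|exact: smooth_affine].
  apply: smooth_mul; first exact: smooth_cst.
  apply: smooth_add; first exact: smooth_affine.
  by apply: smooth_mul; [exact: smooth_cst|exact: smooth_affine].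
- move=> n c d x.
  have dl e : is_derive x 1 (fun y => n.+1%:R * y + e) n.+1%:R.
    have := is_deriveD (is_deriveZ (n.+1%:R : R) (is_derive_id x 1)) (@is_derive_cst _ _ _ e x 1).
    by rewrite addr0 /GRing.scale /= mulr1.
  have d1 := @is_derive1_comp _ S _ x _ _ (dS _) (dl (- (n.+1%:R * c) - 1)).
  have d2 := @is_derive1_comp _ S _ x _ _ (dS _) (dl (- (n.+1%:R * d) + 2)).
  have d3 := is_deriveZ (n.+1%:R^-1 : R) (is_deriveD d1 (is_deriveZ (-1 : R) d2)).
  have E : bump n c d x = n.+1%:R^-1 *: (st (n.+1%:R * x + (- (n.+1%:R * c) - 1)) * n.+1%:R +
     -1 *: (st (n.+1%:R * x + (- (n.+1%:R * d) + 2)) * n.+1%:R)).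
    rewrite /bump /GRing.scale /=; field; by rewrite gt_eqF // Npos.
  by rewrite E; exact: d3.
- move=> n c d x; rewrite /bump mulN1r.
  have /andP[a1 a2] := st01 (n.+1%:R * x + (- (n.+1%:R * c) - 1)).
  have /andP[b1 b2] := st01 (n.+1%:R * x + (- (n.+1%:R * d) + 2)).
  by rewrite ler_norml; apply/andP; split; lra.
- move=> n c d x N4; split => xc; rewrite /prim.
    by rewrite !Sl ?mulr0 ?addr0 ?mulr0 //; lra.
  rewrite !Sr; [|lra|lra].
  by field; rewrite gt_eqF // Npos.
move=> c d t cd.
have [tc|ct] := leP t c.
  have dc : 0 < d - c by lra.
  have [n1 h1] := eventually_natM 2 dc; exists n1 => n /h1 hn.
  rewrite indicE memNset /=; last by rewrite in_itv /=; lra.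
  have nt : n.+1%:R * t <= n.+1%:R * c by rewrite ler_wpM2l.
  by rewrite /bump !stl ?mulr0 ?addr0 //; lra.
have [dt|td] := leP d t.
  have dc : 0 < d - c by lra.
  have [n1 h1] := eventually_natM 2 dc; exists n1 => n /h1 hn.
  rewrite indicE memNset /=; last by rewrite in_itv /=; lra.
  have nt : n.+1%:R * d <= n.+1%:R * t by rewrite ler_wpM2l.
  by rewrite /bump !str; lra.
have tc : 0 < t - c by lra.
have dt : 0 < d - t by lra.
have [n1 h1] := eventually_natM 2 tc; have [n2 h2] := eventually_natM 2 dt.
exists (maxn n1 n2) => n; rewrite geq_max => /andP[/h1 a /h2 b].
rewrite indicE mem_set /=; last by rewrite in_itv /= ct td.
rewrite /bump str; last lra.
by rewrite stl; lra.
Qed.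

Lemma measurable_continuous (f : R -> R) D : continuous f -> measurable_fun D f.
Proof.
by move=> cf; apply: (@measurable_funS _ _ _ _ setT) => //; exact: continuous_measurable_fun.
Qed.

(** The primitive of an approximate indicator of []a, b[] is constant but not zero to the right of
    [b]. Subtracting the one for []-1, 0[], with the total masses [len] as cross weights, restores
    compact support; the identity is the limit in [n]. *)
Lemma du_bois_reymond_itv (h : R -> R) : integrable_on I h ->
  (forall phi, test_function phi -> \int[mu]_(t in I) (phi^`()%classic t * h t) = 0) ->
  forall a b, -1 <= a -> a < b -> b <= 0 ->
    \int[mu]_(t in `[a, b]) h t = (b - a) * \int[mu]_(t in I) h t.
Proof.
move=> ih h0 a b a1 ab b0.
have mI : measurable I by exact: measurable_itv.
have mh := integrable_on_measurable ih.
have [bump [prim [smb dprim b1 pE bE]]] := bump_family.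
pose len (n : nat) (c d : R) := d - c - 3 * n.+1%:R^-1.
pose phi n x := len n (-1) 0 * prim n a b x + (- len n a b) * prim n (-1) 0 x.
pose phi' n x := len n (-1) 0 * bump n a b x + (- len n a b) * bump n (-1) 0 x.
have dphi n (x : R) : is_derive x 1 (phi n) (phi' n x).
  exact: is_deriveD (is_deriveZ (len n (-1) 0) (dprim n a b x))
     (is_deriveZ (- len n a b) (dprim n (-1) 0 x)).
have Npos (n : nat) : 0 < n.+1%:R :> R by [].
have ab0 : 0 < b - a by rewrite subr_gt0.
have [n0 hn0] := eventually_natM 4 ab0.
have N4' n : (n0 <= n)%N -> 4 <= n.+1%:R * (0 - -1 : R).
  by move=> /hn0 N4; apply: le_trans N4 _; rewrite ler_wpM2l //; lra.
have tphi n : (n0 <= n)%N -> test_function (phi n).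
  move=> nn; have N4 := hn0 n nn; have N4'' := N4' n nn.
  split.
    apply: smooth_gen_derivable; apply: smooth_add.
      by apply: smooth_mul; [exact: smooth_cst|have [] := smb n a b].
    by apply: smooth_mul; [exact: smooth_cst|have [] := smb n (-1) 0].
  have Ni : 0 < n.+1%:R^-1 :> R by rewrite invr_gt0.
  exists (-1 + n.+1%:R^-1), (- n.+1%:R^-1); split; [by rewrite ltrDl|by rewrite oppr_lt0|].
  move=> x; apply: contraNT; rewrite negb_and -!ltNge => /orP[xl|xr]; apply/eqP.
    have nx : n.+1%:R * (x - -1) <= 1.
      rewrite -ler_pdivlMl // mulr1; move: (n.+1%:R^-1) xl => r xl; lra.
    have nx' : n.+1%:R * (x - a) <= 1.
      by apply: le_trans nx; rewrite ler_wpM2l //; lra.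
    by rewrite /phi (pE _ _ _ _ N4).1 // (pE _ _ _ _ N4'').1 // !mulr0 addr0.
  have nx : -1 <= n.+1%:R * (x - 0).
    rewrite -ler_pdivrMl // mulrN1; move: (n.+1%:R^-1) xr => r xr; lra.
  have nx' : -1 <= n.+1%:R * (x - b).
    by apply: le_trans nx _; rewrite ler_wpM2l //; lra.
  rewrite /phi (pE _ _ _ _ N4).2 // (pE _ _ _ _ N4'').2 // /len; ring.
pose chi (c d t : R) : R := \1_(`]c, d[%classic) t.
pose l t := ((0 - -1) * chi a b t - (b - a) * chi (-1) 0 t) * h t.
have bump_cvg (c d t : R) : c < d -> bump n c d t @[n --> \oo] --> chi c d t.
  move=> cd; have [n1 hn1] := bE c d t cd.
  apply/cvgrPdist_le => e e0; exists n1 => // n /hn1 /= ->.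
  by rewrite subrr normr0 ltW.
have len_cvg (c d : R) : len n c d @[n --> \oo] --> d - c.
  apply/cvgrPdist_le => e e0; have e3 : 0 < e / 3 by lra.
  have [n1 hn1] := invS_small e3; exists n1 => // n /hn1 /= hn.
  have Ni : 0 < n.+1%:R^-1 :> R by rewrite invr_gt0.
  rewrite /len; move: (n.+1%:R^-1) Ni hn => r Ni hn.
  by rewrite (_ : d - c - (d - c - 3 * r) = 3 * r); [rewrite ger0_norm; lra|ring].
have chi01 c d t : `|chi c d t| <= 1.
  by rewrite /chi indicE; case: (_ \in _); rewrite ?normr1 ?normr0.
have len2 n (c d : R) : -1 <= c -> c <= d -> d <= 0 -> `|len n c d| <= 4.
  move=> c1 cd d0; have Ni : 0 < n.+1%:R^-1 :> R by rewrite invr_gt0.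
  have : n.+1%:R^-1 <= 1 :> R by rewrite invf_le1 // ler1n.
  rewrite /len; move: (n.+1%:R^-1) Ni => r Ni r1.
  by rewrite ler_norml; apply/andP; split; lra.
have mphi' n : measurable_fun I (phi' n).
  apply: measurable_continuous; apply: smooth_gen_continuous; apply: smooth_add.
    by apply: smooth_mul; [exact: smooth_cst|have [] := smb n a b].
  by apply: smooth_mul; [exact: smooth_cst|have [] := smb n (-1) 0].
have mchi c d : measurable_fun I (chi c d) by exact: measurable_indic.
have cv : \int[mu]_(t in I) (phi' n t * h t) @[n --> \oo] --> \int[mu]_(t in I) l t.
  apply: (Rintegral_dominated (h := fun t => 8 * `|h t|)).
  - by move=> n; exact: measurable_funM.
  - apply: measurable_funM => //; apply: measurable_funB;
      by apply: measurable_funM; [exact: measurable_cst|exact: mchi].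
  - move=> t _; apply: cvgM; last exact: cvg_cst.
    apply: cvgD; first by apply: cvgM; [exact: len_cvg|exact: bump_cvg].
    rewrite -mulNr; apply: cvgM; last by apply: bump_cvg; rewrite ltrN10.
    by apply: cvgN; exact: len_cvg.
  - move=> n t _; rewrite normrM ler_wpM2r //.
    apply: le_trans (ler_normD _ _) _; rewrite !normrM normrN.
    have l1 : `|len n (-1) 0| <= 4 by apply: len2; rewrite ?lerN10.
    have l2 : `|len n a b| <= 4 by apply: len2 => //; exact: ltW.
    have h1 : `|len n (-1) 0| * `|bump n a b t| <= 4 * 1 by exact: ler_pM.
    have h2 : `|len n a b| * `|bump n (-1) 0 t| <= 4 * 1 by exact: ler_pM.
    lra.
  - by apply: integrable_onZ => //; exact: integrable_on_norm.
have l0 : \int[mu]_(t in I) l t = 0.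
  apply: (cvg_unique _ cv); first exact: Rhausdorff.
  apply/cvgrPdist_le => e e0; exists n0 => // n /= nn.
  have E : (phi n)^`()%classic = phi' n.
    by apply/funext => x; rewrite derive1E; have [] := dphi n x.
  by have := h0 _ (tphi n nn); rewrite E => ->; rewrite subrr normr0 ltW.
have ichi c d : integrable_on I (fun t => chi c d t * h t).
  apply: (integrable_on_le (g := fun t => `|h t|)) => //.
  - exact: measurable_funM.
  - by move=> t _; rewrite normrM ler_piMl.
  - exact: integrable_on_norm.
have chiE (c d : R) : -1 <= c -> c < d -> d <= 0 ->
    \int[mu]_(t in I) (chi c d t * h t) = \int[mu]_(t in `[c, d]) h t.
  move=> c1 cd d0.
  have E : I `&` `]c, d[%classic = `]c, d[%classic.
    apply/seteqP; split => [r [] //|r]; rewrite /= !in_itv /= => /andP[cr rd].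
    by rewrite cr rd; split => //; apply/andP; split; lra.
  have i1 := integrable_on_itv c1 d0 ih.
  rewrite -[RHS]Rintegral_itv_obnd_cbnd; last first.
    by apply: integrable_on_sub i1 => // r /=; rewrite !in_itv /= => /andP[/ltW -> ->].
  rewrite -[RHS]Rintegral_itv_bndo_bndc; last first.
    by apply: integrable_on_sub i1 => // r /=; rewrite !in_itv /= => /andP[/ltW -> /ltW ->].
  rewrite -[in RHS]E Rintegral_mkcondr; apply: eq_Rint => r _.
  by rewrite patchE /chi indicE; case: (r \in _); rewrite ?mul1r ?mul0r.
move: l0; rewrite /l.
rewrite (eq_Rint (f := fun t => ((0 - -1) * chi a b t - (b - a) * chi (-1) 0 t) * h t)
  (g := fun t => (0 - -1) * (chi a b t * h t) - (b - a) * (chi (-1) 0 t * h t))); last first.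
  by move=> t _; ring.
rewrite RintB //; [|exact: integrable_onZ|exact: integrable_onZ].
rewrite !RintZ // !chiE ?ltrN10 //.
by move/eqP; rewrite subr_eq0 => /eqP <-; ring.
Qed.

(** [I] has length one, so the mean value of [h] is its integral; after subtracting it, the integral
    over every subinterval is zero. *)
Lemma du_bois_reymond (h : R -> R) : integrable_on I h ->
  (forall phi, test_function phi -> \int[mu]_(t in I) (phi^`()%classic t * h t) = 0) ->
  {ae mu, forall t, I t -> h t = \int[mu]_(t in I) h t}.
Proof.
move=> ih h0; set c := \int[mu]_(t in I) h t.
have ic a b : integrable_on `[a, b] (fun=> c) by exact: integrable_on_cst.
have : {ae mu, forall t, I t -> h t - c = 0}.
  apply: Rintegral_itv_eq0; first by apply: integrable_onB.
  move=> s t s1 st t0; have is' := integrable_on_itv s1 t0 ih.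
  rewrite RintB // Rintegral_cst_itv //.
  move: st; rewrite le_eqVlt => /predU1P[->|st].
    by rewrite set_itv1 Rintegral_set1 subrr mulr0 subrr.
  by rewrite (du_bois_reymond_itv ih h0) // mulrC subrr.
by apply: aeS => t h1 It; apply/eqP; rewrite -subr_eq0 h1.
Qed.

End DuBoisReymond.

Section TestFunctions.
Context {R : realType}.
Notation mu := (@lebesgue_measure R).
Notation I := (`[-1, 0]%classic : set R).

Lemma test_function_derive (phi : R -> R) : test_function phi ->
  [/\ forall x : R, is_derive x 1 phi (phi^`()%classic x), continuous phi,
    continuous (phi^`()%classic) & phi (-1) = 0 /\ phi 0 = 0].
Proof.
move=> [dphi [a [b [a1 b0 supp]]]].
have d0 (x : R) : is_derive x 1 phi (phi^`()%classic x).
  by rewrite derive1E; apply/derivableP; exact: dphi 0%N x.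
have d1 (x : R) : is_derive x 1 (phi^`()%classic) ((phi^`()%classic)^`()%classic x).
  by rewrite [X in is_derive _ _ _ X]derive1E; apply/derivableP; exact: dphi 1%N x.
split => //.
- by move=> x; exact: is_derive_continuous (d0 x).
- by move=> x; exact: is_derive_continuous (d1 x).
split; apply/eqP; apply: contraT => /supp /andP[h1 h2].
  by move: a1; rewrite ltNge h1.
by move: b0; rewrite ltNge h2.
Qed.

Lemma continuous_bounded_itv (f : R -> R) : continuous f ->
  exists C, forall t, I t -> `|f t| <= C.
Proof.
move=> cf.
have cn : {within I, continuous (fun x => `|f x|)}.
  by apply: continuous_subspaceT => x; apply: continuous_comp; [exact: cf|exact: norm_continuous].
have [c _ hc] := @EVT_max R _ (-1) 0 (@lerN10 R) cn.
exists (`|f c|) => t It; apply: hc; move: It; by rewrite /= in_itv.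
Qed.

Lemma Rintegral_itv1 (s : R) (f : R -> R) : integrable_on `[s, s] f ->
  \int[mu]_(r in `[s, s]) f r = 0.
Proof.
move=> fi; have sss : s <= s <= s by rewrite lexx.
by have /eqP := Rintegral_split fi sss; rewrite -subr_eq subrr eq_sym => /eqP.
Qed.

Lemma Rintegral_derive (f f' : R -> R) (s t : R) : s <= t ->
  (forall x : R, is_derive x 1 f (f' x)) -> continuous f' ->
  \int[mu]_(r in `[s, t]) f' r = f t - f s.
Proof.
move=> st df cf'.
have fi : integrable_on `[s, t] f' by exact: continuous_integrable_on.
move: st; rewrite le_eqVlt => /orP[/eqP E|st].
  by subst t; rewrite Rintegral_itv1 // subrr.
have cf : continuous f by move=> x; exact: is_derive_continuous (df x).
apply: EFin_inj; rewrite -integral_Rint // EFinB.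
apply: continuous_FTC2 => //.
- exact: continuous_subspaceT.
- split.
  + by move=> x _; have [] := df x.
  + by apply: cvg_at_right_filter; exact: cf.
  + by apply: cvg_at_left_filter; exact: cf.
- by move=> x _; rewrite derive1E; have [_ ] := df x.
Qed.

Lemma primitive_derive (f f' : R -> R) :
  (forall x : R, is_derive x 1 f (f' x)) -> continuous f' ->
  @primitive R (real_scalars R) R^o (fun a b : R => a * b) f f'.
Proof.
move=> df cf' w s t s1 st t0.
have fi : integrable_on `[s, t] f' by exact: continuous_integrable_on.
rewrite (eq_Rint (g := fun r => w * f' r)); last by move=> r _; rewrite mulrC.
by rewrite RintZ // (Rintegral_derive st df cf') mulrC.
Qed.

Lemma real_strongly_measurable_continuous (f : R -> R) : continuous f ->
  @strongly_measurable R (real_scalars R) R^o f.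
Proof.
move=> cf.
apply: (@strongly_measurable_modulus R (real_scalars R) R^o f (fun t => t + 1) 1).
- by apply: measurable_funD => //; exact: measurable_id.
- by move=> t; rewrite /= in_itv /= => /andP[t1 t0]; apply/andP; split; lra.
- move=> t It e e0; have := cf t; move/cvgrPdist_le => /(_ e e0) /nbhs_ballP[d /= d0 h].
  exists (d / 2); first by rewrite divr_gt0.
  move=> s _; rewrite opprD addrACA subrr addr0 => sd.
  have : `|f t - f s| <= e.
    by apply: h; rewrite /ball /= distrC; apply: le_lt_trans sd _; rewrite ltr_pdivrMr // ltr_pMr // ltr1n.
  by rewrite distrC.
Qed.

Lemma sq_integrable_continuous (f : R -> R) : continuous f ->
  @sq_integrable R (real_scalars R) R^o f.
Proof.
move=> cf; split; first exact: real_strongly_measurable_continuous.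
have [C hC] := continuous_bounded_itv cf.
apply: (@integrable_on_bounded R (-1) 0 (C ^+ 2)).
  apply: measurable_funX; apply: (@strongly_measurable_nrm' R (real_scalars R) R^o f).
  exact: real_strongly_measurable_continuous.
move=> x xI; have h : `|f x| <= C by apply: hC; rewrite /= in_itv.
rewrite ger0_norm ?sqr_ge0 // ; apply: lerXn2r => //; rewrite ?nnegrE ?nrm_ge0 //.
by apply: le_trans h.
Qed.

Lemma real_integrable_nrm (f : R -> R) : @sq_integrable R (real_scalars R) R^o f ->
  integrable_on I f.
Proof.
move=> [mf fi]; have [mb ib] := sq_integrable_bochner (conj mf fi).
apply: (integrable_on_le (g := @nrm R (real_scalars R) R^o \o f)) => //.
exact: (@strongly_measurable_real R (real_scalars R) R^o (fun x => x) 1 f mf (fun x y => eq_ler (esym (mul1r _)))).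
Qed.

End TestFunctions.

Section AlmostEverywhere.
Context {R : realType}.
Notation mu := (@lebesgue_measure R).
Notation I := (`[-1, 0]%classic : set R).

Lemma ae_exists_itv (P : R -> Prop) (a b : R) : a < b ->
  {ae mu, forall t, P t} -> exists2 t, a <= t <= b & P t.
Proof.
move=> ab [A [mA A0 PA]]; apply: contrapT => nP.
have sub : `[a, b]%classic `<=` A.
  move=> t /=; rewrite in_itv /= => tab; apply: PA => /= Pt; apply: nP; by exists t.
have mab : measurable (`[a, b]%classic : set R) by exact: measurable_itv.
have : (mu `[a, b]%classic <= 0)%E.
  by rewrite -A0; apply: le_measure => //; exact: mem_set.
by rewrite lebesgue_measure_itv /= lte_fin ab -EFinB lee_fin subr_le0 leNgt ab.
Qed.

Lemma ae_all_seq (T : Type) (s : seq T) (P : T -> R -> Prop) :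
  (forall x, {ae mu, forall t, P x t}) ->
  {ae mu, forall t, forall i, (i < size s)%N -> forall x0, P (nth x0 s i) t}.
Proof.
move=> h; elim: s => [|x s ih]; first by apply: aeW => t [|].
apply: aeS2 (h x) ih => t h1 h2 [|i] //= it x0; exact: h2.
Qed.

Definition continuous_in_I {K : scalars R} {V : normedModType K} (h : R -> V) :=
  forall t, I t -> forall e : R, 0 < e -> exists2 d : R, 0 < d &
    forall s, I s -> `|s - t| <= d -> nrm (h s - h t) <= e.

Section Space.
Context {K : scalars R} {V : normedModType K} {q : V -> V -> R} (hV : hilbert q).
Implicit Types (f g h F H k : R -> V).

Lemma continuous_in_IP h : continuous_in_I h <-> {within I, continuous h}.
Proof.
rewrite subspace_continuousP; split=> [ch t It|ch t It e e0].
  apply/cvgrPdist_le => e e0.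
  have eE : e = ofR (re `|e|) by rewrite re_normK ger0_norm // ltW.
  have re0 : 0 < re `|e|.
    rewrite lt_neqAle re_norm_ge0 andbT eq_sym.
    by apply/eqP => r0; move: e0; rewrite eE r0 rmorph0 ltxx.
  have [d d0 hd] := ch t It _ re0.
  apply/nbhs_ballP; exists d => //= s st Is.
  by rewrite eE -ofR_nrm ler_ofR nrm_sub; apply: hd => //; rewrite distrC ltW.
have e0' : 0 < ofR e :> K.
  by rewrite lt_neqAle eq_sym fmorph_eq0 gt_eqF //= ofR_ge0 ltW.
have /cvgrPdist_le/(_ _ e0')/nbhs_ballP[d /= d0 hd] := ch t It.
exists (d / 2); first by rewrite divr_gt0.
move=> s Is sd; rewrite nrm_sub -(@ler_ofR R K) ofR_nrm; apply: hd => //.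
rewrite /ball /= distrC; apply: le_lt_trans sd _.
by rewrite ltr_pdivrMr // ltr_pMr // ltr1n.
Qed.

Lemma ae_eq_continuous F H : continuous_in_I F -> continuous_in_I H ->
  {ae mu, forall t, I t -> F t = H t} -> forall t, I t -> F t = H t.
Proof.
move=> cF cH FH t It; apply/eqP; rewrite -subr_eq0; apply/eqP; apply: nrm_eq0.
apply/eqP; rewrite eq_le nrm_ge0 andbT; apply/ler_addgt0Pl => e e0; rewrite addr0.
have e2 : 0 < e / 2 by rewrite divr_gt0.
have [d1 d10 h1] := cF t It _ e2; have [d2 d20 h2] := cH t It _ e2.
pose d := Num.min (Num.min d1 d2) (1 / 2).
have dd1 : d <= d1 by rewrite /d !ge_min lexx.
have dd2 : d <= d2 by rewrite /d !ge_min lexx orbT.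
have d12 : d <= 1 / 2 by rewrite /d ge_min lexx orbT.
have d0 : 0 < d by rewrite /d !lt_min d10 d20 /=.
move: It; rewrite /= in_itv /= => /andP[t1 t0].
(* A one-sided neighbourhood of [t] inside [I], of length [d <= 1 / 2]: to the right if [t] lies in
   the left half of [I], to the left otherwise. *)
have [a [b [ab aI bI abt]]] : exists a b, [/\ a < b, -1 <= a, b <= 0 &
    forall s, a <= s <= b -> `|s - t| <= d].
  have [th|th] := leP t (- (1 / 2)).
    exists t, (t + d); split; [lra|lra|lra|].
    by move=> s /andP[s1 s2]; rewrite ger0_norm; lra.
  exists (t - d), t; split; [lra|lra|lra|].
  by move=> s /andP[s1 s2]; rewrite ler0_norm; lra.
have [s sab Ps] := ae_exists_itv ab FH.
have Is : I s by move: sab; rewrite /= in_itv /= => /andP[s1 s2]; apply/andP; split; lra.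
have sd := abt s sab.
have n1 := h1 s Is (le_trans sd dd1); have n2 := h2 s Is (le_trans sd dd2).
apply: le_trans (nrmB_le _ _ (F s)) _; rewrite nrm_sub {2}Ps //; lra.
Qed.

(** The null set depends on [w], but the simple functions that converge to [k] take only countably
    many values. Off a single null set [k t] is orthogonal to every [u n t], so
    [nrm (k t) ^+ 2 = q (k t) (k t - u n t)] and [nrm (k t) <= nrm (k t - u n t)]. *)
Lemma ae_ip0 k : strongly_measurable k ->
  (forall w, {ae mu, forall t, I t -> q (k t) w = 0}) ->
  {ae mu, forall t, I t -> k t = 0}.
Proof.
move=> /strongly_measurableP[u su uk] h.
have A : {ae mu, forall t, forall n, I t -> q (k t) (u n t) = 0}.
  apply: ae_foralln => n; have [/finite_seqP[s Es] _] := su n.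
  apply: aeS (ae_all_seq s h) => t ht It.
  have us : u n t \in s.
    have : [set` s] (u n t) by rewrite -Es; exists t.
    by [].
  by have := ht (index (u n t) s); rewrite index_mem => /(_ us 0 It); rewrite nth_index.
apply: aeS A => t ht It; apply: nrm_eq0; apply/eqP; rewrite eq_le nrm_ge0 andbT.
apply/ler_addgt0Pl => e e0; rewrite addr0.
have [n0 hn] := uk t It e e0; have := hn n0 (leqnn _); rewrite nrm_sub => kn.
have [/nrm_eq0 ->|k0] := eqVneq (nrm (k t)) 0; first by rewrite nrm0 ltW.
have kp : 0 < nrm (k t) by rewrite lt_neqAle eq_sym k0 nrm_ge0.
have E : nrm (k t) ^+ 2 = q (k t) (k t - u n0 t).
  by rewrite (ripBr (hilbert_ip hV)) ht // subr0 (hilbert_nrm hV).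
have := le_trans (ler_norm _) (hilbert_cs hV (k t) (k t - u n0 t)).
by rewrite -E expr2 ler_pM2l // => /le_trans; apply.
Qed.

Lemma du_bois_reymond_vector k : bochner_integrable k ->
  (forall phi, test_function phi ->
     bochner (fun t => ofR (phi^`()%classic t) *: k t) = 0) ->
  {ae mu, forall t, I t -> k t = bochner k}.
Proof.
move=> ik h0; have [mk _] := ik.
suff : {ae mu, forall t, I t -> k t - bochner k = 0}.
  by apply: aeS => t + It => /(_ It) /eqP; rewrite subr_eq0 => /eqP.
apply: ae_ip0.
  by apply: strongly_measurableB => //; exact: fsimple_strongly_measurable (simple_cst _).
move=> w.
have bw := bounded_functional_ip hV w.
have iw := bfun_integrable bw ik.
have := du_bois_reymond iw.
have E : \int[mu]_(t in I) q (k t) w = q (bochner k) w by rewrite (bochner_ip hV).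
rewrite E => dB.
have : {ae mu, forall t, I t -> q (k t) w = q (bochner k) w}.
  apply: dB => phi tphi.
  have [_ _ cphi' _] := test_function_derive tphi.
  have [C hC] := continuous_bounded_itv cphi'.
  have ib : bochner_integrable (fun t => ofR (phi^`()%classic t) *: k t).
    by apply: bochner_integrableZ hC ik; exact: measurable_continuous.
  have := bochner_ip hV w ib; rewrite (h0 _ tphi) (rip0l (hilbert_ip hV)) => E0.
  apply: etrans (esym E0).
  by apply: eq_Rint => t _; rewrite (ripZl (hilbert_ip hV)).
by apply: aeS => t + It => /(_ It) e; rewrite (ripBl (hilbert_ip hV)) e subrr.
Qed.

Lemma sq_integrable_ip_real f w : sq_integrable f ->
  @sq_integrable R (real_scalars R) R^o (fun t => q (f t) w).
Proof.
move=> [mf fi]; have bw := bounded_functional_ip hV w.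
have mm : @strongly_measurable R (real_scalars R) R^o (fun t => q (f t) w).
  refine (@strongly_measurable_comp R K (real_scalars R) V R^o (fun x => q x w) f _ mf) => u x ux.
  move=> e e0; have w1 : 0 < nrm w + 1 by rewrite ltr_wpDl // nrm_ge0.
  have [n0 hn] := ux _ (divr_gt0 e0 w1); exists n0 => n nn.
  apply: le_trans (bfun_lip bw _ _) _.
  have := hn n nn; rewrite ler_pdivlMr //; have := nrm_ge0 (u n - x); nra.
split => //; apply: (integrable_on_le (g := fun t => nrm w ^+ 2 * nrm (f t) ^+ 2)) => //.
- apply: measurable_funX.
  exact: (@strongly_measurable_nrm' R (real_scalars R) R^o _ mm).
- move=> x _; rewrite ger0_norm ?sqr_ge0 // -exprMn; apply: lerXn2r.
  + by rewrite nnegrE nrm_ge0.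
  + by rewrite nnegrE mulr_ge0 // nrm_ge0.
  + by have := bfun_le bw (f x).
- exact: integrable_onZ.
Qed.

Lemma primitive_ip_real F g w : bochner_integrable g -> primitive (q := q) F g ->
  @primitive R (real_scalars R) R^o (fun a b : R => a * b) (fun t => q (F t) w)
    (fun t => q (g t) w).
Proof.
move=> ig pF; have hq := hilbert_ip hV.
move=> c s t s1 st t0; rewrite -(ripBl hq) pF //.
rewrite mulrC -RintZ //; last first.
  by apply: integrable_on_itv => //; exact: bfun_integrable (bounded_functional_ip hV w) ig.
by apply: eq_Rint => r _; rewrite mulrC.
Qed.

(** The product rule for [phi] against each function [q (F t) w]; the boundary terms vanish with
    [phi] at both ends. *)
Lemma bochner_test F g (phi : R -> R) : sq_integrable g -> primitive (q := q) F g ->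
  test_function phi ->
  bochner (fun t => ofR (phi^`()%classic t) *: F t) =
  - bochner (fun t => ofR (phi t) *: g t).
Proof.
move=> sg pF tphi; have sF := primitive_sq_integrable hV sg pF.
have hq := hilbert_ip hV.
have [dphi cphi cphi' [p1 p0]] := test_function_derive tphi.
have [C hC] := continuous_bounded_itv cphi'.
have [C' hC'] := continuous_bounded_itv cphi.
have iF := sq_integrable_bochner sF; have ig := sq_integrable_bochner sg.
have i1 : bochner_integrable (fun t => ofR (phi^`()%classic t) *: F t).
  by apply: bochner_integrableZ hC _ => //; exact: measurable_continuous.
have i2 : bochner_integrable (fun t => ofR (phi t) *: g t).
  by apply: bochner_integrableZ hC' _ => //; exact: measurable_continuous.
apply: (ip_ext hV) => w; rewrite (ripNl hq) !(bochner_ip hV) //.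
have [iR /(_ (-1) 0 (lexx _) (@lerN10 R) (lexx _))] :=
  primitive_rule (@hilbert_real R) (sq_integrable_continuous cphi')
   (sq_integrable_ip_real w sg) (primitive_derive dphi cphi') (primitive_ip_real w ig pF).
rewrite p1 p0 !mul0r subrr => /esym/eqP.
have e1 : integrable_on I (fun r => phi^`()%classic r * q (F r) w).
  apply: eq_integrable (bfun_integrable (bounded_functional_ip hV w) i1) => // t _.
  by rewrite /= (ripZl hq).
have e2 : integrable_on I (fun r => phi r * q (g r) w).
  apply: eq_integrable (bfun_integrable (bounded_functional_ip hV w) i2) => // t _.
  by rewrite /= (ripZl hq).
rewrite RintD // addr_eq0 => /eqP E.
rewrite (eq_Rint (g := fun t => phi^`()%classic t * q (F t) w)); last first.
  by move=> t _; rewrite (ripZl hq).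
rewrite E; congr (- _); apply: eq_Rint => t _; by rewrite (ripZl hq).
Qed.

End Space.
End AlmostEverywhere.

(** * Square integrable classes and Sobolev functions *)

Section SquareIntegrableClasses.
Context {R : realType} {K : scalars R} {V : normedModType K} {q : V -> V -> R}.
Hypothesis hV : hilbert q.
Notation mu := (@lebesgue_measure R).
Notation I := (`[-1, 0]%classic : set R).
Implicit Types (f g : L2 V).

Lemma square_integrableP (h : R -> V) : square_integrable h <-> sq_integrable h.
Proof.
split=> -[mh ih]; split=> //.
  apply/integrableP; split.
    by apply/measurable_EFinP/measurable_funX; exact: strongly_measurable_nrm'.
  rewrite [X in (X < _)%E](_ : _ = \int[mu]_(t in I) (nrm (h t) ^+ 2)%:E)%E //.
  by apply: eq_integral => t _; rewrite /= ger0_norm // sqr_ge0.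
move/integrableP: ih => [_].
rewrite [X in (X < _)%E](_ : _ = \int[mu]_(t in I) (nrm (h t) ^+ 2)%:E)%E //.
by apply: eq_integral => t _; rewrite /= ger0_norm // sqr_ge0.
Qed.

Lemma L2rep_sq_integrable f : sq_integrable (L2rep f).
Proof.
by apply/square_integrableP; have := valP (repr f) => /set_mem.
Qed.

Lemma L2rep_bochner f : bochner_integrable (L2rep f).
Proof. exact: sq_integrable_bochner (L2rep_sq_integrable f). Qed.

Local Open Scope quotient_scope.

Lemma L2rep_pi (h : L2fun V) : {ae mu, forall t, I t -> L2rep (\pi_(L2 V) h) t = h t}.
Proof.
have : repr (\pi_(L2 V) h) = h %[mod L2 V] by rewrite reprK.
move=> /eqmodP /set_mem; apply: aeS => t + It => /(_ It) /eqP.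
by rewrite L2funB subr_eq0 => /eqP.
Qed.

Lemma L2_exists (h : R -> V) : sq_integrable h ->
  exists f, {ae mu, forall t, I t -> L2rep f t = h t}.
Proof.
move=> /square_integrableP sh.
exists (\pi_(L2 V) (@MkL2fun R K V h (mem_set sh))); exact: L2rep_pi.
Qed.

Lemma L2_eq f g : {ae mu, forall t, I t -> L2rep f t = L2rep g t} -> f = g.
Proof.
move=> fg; rewrite -[f]reprK -[g]reprK; apply/eqmodP; apply: mem_set.
apply: aeS fg => t + It => /(_ It) h.
by apply/eqP; rewrite L2funB subr_eq0; apply/eqP.
Qed.

Lemma L2repB f g : {ae mu, forall t, I t -> L2rep (f - g) t = L2rep f t - L2rep g t}.
Proof.
have -> : f - g = \pi_(L2 V) (repr f - repr g).
  by rewrite raddfB; congr (_ - _); symmetry; exact: reprK.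
by apply: aeS (L2rep_pi (repr f - repr g)) => t + It => /(_ It) ->; rewrite L2funB.
Qed.

Lemma L2repZ a f : {ae mu, forall t, I t -> L2rep (a *: f) t = a *: L2rep f t}.
Proof.
have -> : a *: f = \pi_(L2 V) (a *: repr f) by [].
by apply: aeS (L2rep_pi (a *: repr f)) => t + It => /(_ It) ->; rewrite L2funZ.
Qed.

Lemma L2rep0 : {ae mu, forall t, I t -> L2rep (0 : L2 V) t = 0}.
Proof.
by rewrite -(subrr (0 : L2 V)); apply: aeS (L2repB 0 0) => t + It => /(_ It) ->; rewrite subrr.
Qed.

Lemma L2repD f g : {ae mu, forall t, I t -> L2rep (f + g) t = L2rep f t + L2rep g t}.
Proof.
have -> : f + g = f - (0 - g) by rewrite sub0r opprK.
apply: aeS2 (L2repB f (0 - g)) _; last first.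
  apply: aeS2 (L2repB 0 g) L2rep0 => t.
  by move=> h1 h2; exact: (conj h1 h2).
move=> t h1 [h2 h3] It; rewrite h1 // h2 // h3 //; by rewrite sub0r opprK.
Qed.

Lemma ae_eq_bochner (h k : R -> V) : bochner_integrable h -> bochner_integrable k ->
  {ae mu, forall t, I t -> h t = k t} -> bochner h = bochner k.
Proof.
move=> ih ik hk; apply: (ip_ext hV) => w; rewrite !(bochner_ip hV) //.
have bw := bounded_functional_ip hV w.
apply: (proj2 (ae_eq_Rintegral (bfun_integrable bw ih) _ _)).
  exact: integrable_on_measurable (bfun_integrable bw ik).
by apply: aeS hk => t + It => /(_ It) ->.
Qed.

Lemma primitive_continuous F (g : R -> V) : sq_integrable g -> primitive (q := q) F g ->
  continuous_in_I F.
Proof.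
move=> sg pF t It e e0; have [d d0 h] := primitive_modulus hV sg pF e0.
by exists d => // s Is; exact: h.
Qed.

Lemma primitive_weak_derivative F f g : primitive (q := q) F (L2rep g) ->
  {ae mu, forall t, I t -> L2rep f t = F t} -> weak_derivative f g.
Proof.
move=> pF fF phi tphi.
have sg := L2rep_sq_integrable g.
rewrite -(bochner_test hV sg pF tphi).
have [_ _ cphi' _] := test_function_derive tphi.
have [C hC] := continuous_bounded_itv cphi'.
apply: ae_eq_bochner.
- by apply: bochner_integrableZ hC (L2rep_bochner f); exact: measurable_continuous.
- apply: bochner_integrableZ hC _; first exact: measurable_continuous.
  exact: sq_integrable_bochner (primitive_sq_integrable hV sg pF).
- by apply: aeS fF => t + It => /(_ It) ->.
Qed.

(** For any primitive [F] of the integrand, [L2rep f - F] has weak derivative zero and is constant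
    by the du Bois-Reymond lemma; the constant is absorbed into the primitive. *)
Lemma weak_derivative_primitive f g : weak_derivative f g ->
  exists2 F, primitive (q := q) F (L2rep g) &
    {ae mu, forall t, I t -> L2rep f t = F t}.
Proof.
move=> fg; have sg := L2rep_sq_integrable g.
have [F pF] := primitive_exists hV (L2rep_bochner g).
have iF := sq_integrable_bochner (primitive_sq_integrable hV sg pF).
have ik : bochner_integrable (fun t => L2rep f t - F t).
  exact: bochner_integrableB (L2rep_bochner f) iF.
have /(du_bois_reymond_vector hV ik) kc : forall phi, test_function phi ->
    bochner (fun t => ofR (phi^`()%classic t) *: (L2rep f t - F t)) = 0.
  move=> phi tphi.
  have [_ _ cphi' _] := test_function_derive tphi.
  have [C hC] := continuous_bounded_itv cphi'.
  have mp : measurable_fun I (phi^`()%classic) by exact: measurable_continuous.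
  have i1 := bochner_integrableZ mp hC (L2rep_bochner f).
  have i2 := bochner_integrableZ mp hC iF.
  have i3 := bochner_integrableZ mp hC ik.
  have e1 := fg phi tphi; have e2 := bochner_test hV sg pF tphi.
  have hq := hilbert_ip hV.
  apply: (ip_ext hV) => w; rewrite (rip0l hq) (bochner_ip hV) //.
  have bw := bounded_functional_ip hV w.
  rewrite (eq_Rint (g := fun t => q (ofR (phi^`()%classic t) *: L2rep f t) w -
    q (ofR (phi^`()%classic t) *: F t) w)); last first.
    by move=> t _; rewrite -(ripBl hq) scalerBr.
  rewrite RintB //; [|exact: bfun_integrable bw i1|exact: bfun_integrable bw i2].
  by rewrite -!(bochner_ip hV) // e1 e2 subrr.
move: (bochner _) kc => c kc.
exists (fun t => F t + c).
  by move=> w s t s1 st t0; rewrite opprD addrACA subrr addr0; exact: pF.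
by apply: aeS kc => t + It => /(_ It) <-; rewrite addrC subrK.
Qed.

Lemma primitive_unique_derivative F H (g h : R -> V) : bochner_integrable g ->
  bochner_integrable h -> primitive (q := q) F g -> primitive (q := q) H h ->
  (forall t, I t -> F t = H t) -> {ae mu, forall t, I t -> g t = h t}.
Proof.
move=> ig ih pF pH FH; have hq := hilbert_ip hV.
suff : {ae mu, forall t, I t -> g t - h t = 0}.
  by apply: aeS => t + It => /(_ It) /eqP; rewrite subr_eq0 => /eqP.
have igh := bochner_integrableB ig ih.
apply: (ae_ip0 hV); first exact: igh.1.
move=> w; have bw := bounded_functional_ip hV w.
apply: Rintegral_itv_eq0; first exact: bfun_integrable bw igh.
move=> s t s1 st t0.
have ms : measurable (`[s, t]%classic : set R) by exact: measurable_itv.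
rewrite (eq_Rint (g := fun r => q (g r) w - q (h r) w)); last first.
  by move=> r _; rewrite (ripBl hq).
rewrite RintB //; last first.
- by apply: integrable_on_itv => //; exact: bfun_integrable bw ih.
- by apply: integrable_on_itv => //; exact: bfun_integrable bw ig.
rewrite -pF // -pH // !FH ?subrr //= in_itv /=; apply/andP; split=> //.
- exact: le_trans st t0.
- exact: le_trans s1 st.
Qed.

Lemma crep_primitive F f g : primitive (q := q) F (L2rep g) ->
  {ae mu, forall t, I t -> L2rep f t = F t} -> forall t, I t -> crep f t = F t.
Proof.
move=> pF fF; have cF := primitive_continuous (L2rep_sq_integrable g) pF.
have : [set h : R -> V | {within I, continuous h} /\
    {ae mu, forall t, I t -> L2rep f t = h t}] (crep f).
  by apply: xgetPex; exists F; split => //; apply/continuous_in_IP.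
move=> [/continuous_in_IP cc fc].
apply: ae_eq_continuous => //.
by apply: aeS2 fF fc => t + + It => /(_ It) <- /(_ It).
Qed.

Lemma wderivP f : W12 f -> weak_derivative f (wderiv f).
Proof. by move=> h; have := xgetPex 0 h. Qed.

Lemma primitive_ae_eq F (g h : R -> V) : bochner_integrable g -> bochner_integrable h ->
  {ae mu, forall t, I t -> g t = h t} -> primitive (q := q) F g -> primitive (q := q) F h.
Proof.
move=> ig ih gh pF w s t s1 st t0; rewrite pF // -[LHS]Rint_indic // -[RHS]Rint_indic //.
have bw := bounded_functional_ip hV w.
have ind1 (k : R -> R) : integrable_on I k ->
    integrable_on I (fun r => \1_(`[s, t]%classic) r * k r).
  move=> ik; apply: (integrable_on_le (g := fun t => `|k t|)) => //.
  - by apply: measurable_funM; [exact: measurable_indic|exact: integrable_on_measurable ik].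
  - by move=> r _; rewrite normrM ler_piMl // indicE; case: (_ \in _); rewrite ?normr1 ?normr0.
  - exact: integrable_on_norm.
apply: (proj2 (ae_eq_Rintegral (ind1 _ (bfun_integrable bw ig)) _ _)).
  exact: integrable_on_measurable (ind1 _ (bfun_integrable bw ih)).
by apply: aeS gh => r + Ir => /(_ Ir) ->.
Qed.

(** The gateway to Sobolev functions: the choices behind [crep] and [wderiv] become a primitive and
    its integrand, to which the product rule applies. *)
Lemma W12P f : W12 f -> primitive (q := q) (crep f) (L2rep (wderiv f)) /\
  {ae mu, forall t, I t -> L2rep f t = crep f t}.
Proof.
move=> /wderivP fw.
have {fw} [F pF fF] := weak_derivative_primitive fw.
have E := crep_primitive pF fF.
have inI s : -1 <= s -> s <= 0 -> I s by move=> h1 h2; rewrite /= in_itv /= h1 h2.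
split.
  move=> w s t s1 st t0; rewrite !E ?pF //; apply: inI => //.
    exact: le_trans st t0.
  exact: le_trans s1 st.
by apply: aeS fF => t + It => /(_ It) ->; rewrite E.
Qed.

Lemma W12_primitive F (g : R -> V) : sq_integrable g -> primitive (q := q) F g ->
  exists f, [/\ W12 f, {ae mu, forall t, I t -> L2rep f t = F t},
    {ae mu, forall t, I t -> L2rep (wderiv f) t = g t} &
    forall t, I t -> crep f t = F t].
Proof.
move=> sg pF; have sF := primitive_sq_integrable hV sg pF.
have [f fF] := L2_exists sF; have [g' gg] := L2_exists sg.
have ig := sq_integrable_bochner sg.
have pF' : primitive (q := q) F (L2rep g').
  apply: primitive_ae_eq pF => //; first exact: L2rep_bochner.
  by apply: aeS gg => t + It => /(_ It) ->.
have wd := primitive_weak_derivative pF' fF.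
have Wf : W12 f by exists g'.
have [pc fc] := W12P Wf.
exists f; split => //; last exact: crep_primitive pF' fF.
have := primitive_unique_derivative (L2rep_bochner _) ig pc pF.
apply; exact: crep_primitive pF' fF.
Qed.

Lemma wderiv_primitive F f g : primitive (q := q) F (L2rep g) ->
  {ae mu, forall t, I t -> L2rep f t = F t} -> wderiv f = g.
Proof.
move=> pF fF; have Wf : W12 f by exists g; exact: primitive_weak_derivative pF fF.
have [pc _] := W12P Wf; apply: L2_eq.
refine (primitive_unique_derivative (L2rep_bochner _) (L2rep_bochner _) pc pF _).
exact: crep_primitive pF fF.
Qed.

Lemma W12_lin a f g : W12 f -> W12 g -> [/\ W12 (a *: f + g),
  wderiv (a *: f + g) = a *: wderiv f + wderiv g &
  forall t, I t -> crep (a *: f + g) t = a *: crep f t + crep g t].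
Proof.
move=> /W12P[pf ff] /W12P[pg fg].
have ib := L2rep_bochner.
have paf : primitive (q := q) (fun t => a *: crep f t) (fun t => a *: L2rep (wderiv f) t).
  apply: (primitive_map hV (L := fun x => a *: x) (C := re `|a|) _ _ _ _ _ pf) => //.
  - by move=> x y; rewrite scalerDr.
  - by move=> b x; rewrite !scalerA mulrC.
  - by move=> x; rewrite nrmZ.
  - exact: re_norm_ge0.
have ia := bochner_integrable_scale a (ib (wderiv f)).
have pD := primitiveD hV ia (ib (wderiv g)) paf pg.
have {}pD : primitive (q := q) (fun t => a *: crep f t + crep g t)
    (L2rep (a *: wderiv f + wderiv g)).
  apply: primitive_ae_eq pD; [exact: bochner_integrableD|exact: ib|].
  apply: aeS2 (L2repD (a *: wderiv f) (wderiv g)) (L2repZ a (wderiv f)) => t h1 h2 It.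
  by rewrite h1 // h2.
have aeD : {ae mu, forall t, I t -> L2rep (a *: f + g) t = a *: crep f t + crep g t}.
  have fg2 := aeS2 (fun t h1 h2 => conj h1 h2) ff fg.
  have r2 := aeS2 (fun t h1 h2 => conj h1 h2) (L2repD (a *: f) g) (L2repZ a f).
  apply: aeS2 fg2 r2 => t [h1 h2] [h3 h4] It.
  by rewrite h3 // h4 // h1 // h2.
split.
- by exists (a *: wderiv f + wderiv g); exact: primitive_weak_derivative pD aeD.
- exact: wderiv_primitive pD aeD.
- exact: crep_primitive pD aeD.
Qed.

End SquareIntegrableClasses.

(** * Completeness of the space of square integrable classes *)

Section RieszFischer.
Context {R : realType}.
Notation mu := (@lebesgue_measure R).
Notation I := (`[-1, 0]%classic : set R).

(** [s] is the sum of the series, integrable by monotone convergence and set to zero on a null set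
    [A] that contains the points of divergence. [A] is measurable so that functions can be cut off
    on it. *)
Lemma summable_majorant (h : nat -> R -> R) (C : R) :
  (forall k t, I t -> 0 <= h k t) -> (forall k, integrable_on I (h k)) ->
  (forall n, \sum_(0 <= k < n) \int[mu]_(t in I) h k t <= C) ->
  exists A : set R, exists s : R -> R,
    [/\ measurable A, mu A = 0%E, integrable_on I s,
      forall t, I t -> 0 <= s t /\ (A t -> s t = 0) &
      forall t, I t -> ~ A t -> forall k, h k t <= s t].
Proof.
move=> h0 ih bC.
have mI : measurable I by exact: measurable_itv.
have h0E k t : I t -> (0 <= (h k t)%:E)%E by move=> It; rewrite lee_fin h0.
have mh k : measurable_fun I (fun t => (h k t)%:E).
  by apply/measurable_EFinP; exact: integrable_on_measurable (ih k).
pose S t := (\sum_(0 <= k <oo) (h k t)%:E)%E.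
have S0 t : I t -> (0 <= S t)%E by move=> It; apply: nneseries_ge0 => k _ _; exact: h0E.
have mS : measurable_fun I S.
  by apply: (@ge0_emeasurable_sum _ _ _ _ (fun k t => (h k t)%:E) xpredT) => // k t It _; exact: h0E.
have IS : (\int[mu]_(t in I) S t < +oo)%E.
  rewrite integral_nneseries //.
  apply: (@le_lt_trans _ _ C%:E); last exact: ltry.
  apply: lime_le.
    by apply: is_cvg_nneseries => k _ _; apply: integral_ge0 => t; exact: h0E.
  near=> n; rewrite (eq_bigr (fun k => (\int[mu]_(t in I) h k t)%:E)); last first.
    by move=> k _; rewrite integral_Rint.
  by rewrite [X in (X <= _)%E]sumEFin lee_fin.
have iS : mu.-integrable I S.
  apply/integrableP; split => //.
  rewrite [X in (X < _)%E](_ : _ = \int[mu]_(t in I) S t)%E //.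
  by apply: eq_integral => t /set_mem It; rewrite gee0_abs // S0.
have [A [mA A0 sA]] := @integrable_ae _ _ _ mu I mI S iS.
pose s t := (\1_(~` A) t : R) * fine (S t).
have sS t : I t -> ((s t)%:E <= S t)%E /\ 0 <= s t.
  move=> It; rewrite /s indicE; case: (boolP (t \in ~` A)) => [/set_mem At|_].
    have /fineK fS : S t \is a fin_num by apply: contrapT => nf; apply: At; apply: sA => /(_ It).
    by rewrite mul1r fS; split => //; apply: fine_ge0; exact: S0.
  by rewrite mul0r; split => //; exact: S0.
exists A, s; split => //.
- have ms : measurable_fun I s.
    apply: measurable_funM; first by apply: measurable_indic; exact: measurableC.
    exact: measurableT_comp mS.
  apply/integrableP; split; first exact/measurable_EFinP.
  apply: le_lt_trans IS; apply: ge0_le_integral => //.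
  + apply/measurable_EFinP; exact: measurableT_comp.
  + by move=> t It; have [h1 h2] := sS t It; rewrite /= ger0_norm.
- move=> t It; split; first by have [] := sS t It.
  by move=> At; rewrite /s indicE memNset ?mul0r //; exact.
- move=> t It At k.
  have /fineK fS : S t \is a fin_num by apply: contrapT => nf; apply: At; apply: sA => /(_ It).
  rewrite /s indicE mem_set //= mul1r -lee_fin fS.
  apply: le_trans (nneseries_lim_ge k.+1 _); last by move=> i _ _; exact: h0E.
  rewrite big_nat_recr //= leeDr // sume_ge0 // => i _; exact: h0E.
Unshelve. all: by end_near.
Qed.

Lemma sqr_le_2sqr (a b c : R) : 0 <= c -> c <= a + b -> c ^+ 2 <= 2 * a ^+ 2 + 2 * b ^+ 2.
Proof.
move=> c0 cab; have : c ^+ 2 <= (a + b) ^+ 2.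
  by apply: lerXn2r; rewrite ?nnegrE //; exact: le_trans cab.
by have := sqr_ge0 (a - b); rewrite sqrrB sqrrD; lra.
Qed.

Section Space.
Context {K : scalars R} {V : normedModType K} {q : V -> V -> R} (hV : hilbert q).
Implicit Types (f g h : R -> V).

Local Notation E h := (\int[mu]_(t in I) nrm (h t) ^+ 2).

Lemma sqr_nrmD_le (x y : V) : nrm (x + y) ^+ 2 <= 2 * nrm x ^+ 2 + 2 * nrm y ^+ 2.
Proof. by apply: sqr_le_2sqr (nrmD x y); exact: nrm_ge0. Qed.

Lemma sq_integrable_le f (k : R -> R) : strongly_measurable f ->
  (forall t, I t -> nrm (f t) ^+ 2 <= k t) -> integrable_on I k -> sq_integrable f.
Proof.
move=> mf fk ik; split=> //; apply: (integrable_on_le (g := k)) => //.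
  by apply: measurable_funX; exact: strongly_measurable_nrm'.
by move=> t It; rewrite ger0_norm ?sqr_ge0 // fk.
Qed.

Lemma sq_integrableD f g : sq_integrable f -> sq_integrable g ->
  sq_integrable (fun t => f t + g t) /\
  E (fun t => f t + g t) <= 2 * E f + 2 * E g.
Proof.
move=> [mf jf] [mg jg].
have mI : measurable I by exact: measurable_itv.
have ik : integrable_on I (fun t => 2 * nrm (f t) ^+ 2 + 2 * nrm (g t) ^+ 2).
  by apply: integrable_onD => //; exact: integrable_onZ.
have fk t : I t -> nrm (f t + g t) ^+ 2 <= 2 * nrm (f t) ^+ 2 + 2 * nrm (g t) ^+ 2.
  by move=> _; exact: sqr_nrmD_le.
have sD : sq_integrable (fun t => f t + g t).
  by apply: sq_integrable_le fk ik; exact: strongly_measurableD.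
split => //; apply: le_trans (le_Rint mI sD.2 ik fk) _.
by rewrite RintD // ?RintZ //; exact: integrable_onZ.
Qed.

Lemma sq_integrable_scale (a : K) f : sq_integrable f -> sq_integrable (fun t => a *: f t).
Proof.
move=> [mf jf]; apply: (sq_integrable_le (k := fun t => re `|a| ^+ 2 * nrm (f t) ^+ 2)).
- exact: strongly_measurable_scale.
- by move=> t _; rewrite nrmZ exprMn.
- by apply: integrable_onZ.
Qed.

Lemma sq_integrableB f g : sq_integrable f -> sq_integrable g ->
  sq_integrable (fun t => f t - g t) /\
  E (fun t => f t - g t) <= 2 * E f + 2 * E g.
Proof.
move=> sf sg; have [h1 h2] := sq_integrableD sf (sq_integrable_scale (-1) sg).
have fgE : (fun t => f t + -1 *: g t) = (fun t => f t - g t).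
  by apply/funext => t; rewrite scaleN1r.
have gE : E (fun t => -1 *: g t) = E g.
  by apply: eq_Rint => t _; rewrite scaleN1r nrmN.
have fE : E (fun t => f t + -1 *: g t) = E (fun t => f t - g t).
  by apply: eq_Rint => t _; rewrite scaleN1r.
by split; [rewrite -fgE|rewrite -fE -gE].
Qed.

Lemma sq_integral_sym f g : E (fun t => f t - g t) = E (fun t => g t - f t).
Proof. by apply: eq_Rint => t _; rewrite nrm_sub. Qed.

Lemma sq_integral_tri f g h : sq_integrable f -> sq_integrable g -> sq_integrable h ->
  E (fun t => f t - g t) <= 2 * E (fun t => f t - h t) + 2 * E (fun t => h t - g t).
Proof.
move=> sf sg sh; have [s1 _] := sq_integrableB sf sh; have [s2 _] := sq_integrableB sh sg.
have [_ h1] := sq_integrableD s1 s2.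
have fE : E (fun t => f t - h t + (h t - g t)) = E (fun t => f t - g t).
  by apply: eq_Rint => t _; rewrite addrA subrK.
by rewrite -fE.
Qed.

Lemma sq_simple_approx f (e : R) : sq_integrable f -> 0 < e ->
  exists w : R -> V, [/\ fsimple w, sq_integrable w & E (fun t => f t - w t) <= e].
Proof.
move=> [mf jf] e0; have [w [sw bw cw]] := dominated_simple_approx mf.
have mI : measurable I by exact: measurable_itv.
have smw n : sq_integrable (w n).
  apply: (sq_integrable_le (k := fun t => 4 * nrm (f t) ^+ 2)).
  - exact: fsimple_strongly_measurable.
  - move=> t _; have := bw n t; have := nrm_ge0 (w n t); have := nrm_ge0 (f t).
    by move: (nrm (w n t)) (nrm (f t)) => a b a0 b0 h; nra.
  - exact: integrable_onZ.
have := @Rintegral_dominated R (fun n t => nrm (f t - w n t) ^+ 2) (fun=> 0)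
  (fun t => 9 * nrm (f t) ^+ 2).
rewrite Rintegral_cst_itv ?lerN10 // mul0r => H.
have : \int[mu]_(t in I) nrm (f t - w n t) ^+ 2 @[n --> \oo] --> (0 : R).
  apply: H.
  - move=> n; apply: measurable_funX; apply: strongly_measurable_nrm'.
    by apply: strongly_measurableB => //; exact: fsimple_strongly_measurable.
  - exact: measurable_cst.
  - move=> t It; apply/cvgrPdist_le => d d0.
    have d1 : 0 < Num.min d 1 by rewrite lt_min d0 ltr01.
    have [n0 hn] := cw t It _ d1; exists n0 => // n /= nn.
    have := hn n nn; rewrite nrm_sub => hd; rewrite sub0r normrN ger0_norm ?sqr_ge0 //.
    move: hd; rewrite le_min => /andP[h1 h2]; have := nrm_ge0 (w n t - f t).
    by move: (nrm (w n t - f t)) h1 h2 => a h1 h2 a0; nra.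
  - move=> n t _; rewrite ger0_norm ?sqr_ge0 //.
    have h1 := nrmD (f t) (- w n t); rewrite nrmN in h1.
    have h2 := bw n t; have h0 := nrm_ge0 (f t).
    have -> : 9 * nrm (f t) ^+ 2 = (3 * nrm (f t)) ^+ 2 by rewrite exprMn; congr (_ * _); ring.
    by apply: lerXn2r; rewrite ?nnegrE ?nrm_ge0 ?mulr_ge0 //; lra.
  - exact: integrable_onZ.
move/cvgrPdist_le => /(_ e e0) [n _ /(_ n (leqnn _))].
rewrite sub0r normrN => h; exists (w n); split => //.
by apply: le_trans h; rewrite ler_norm.
Qed.

Lemma sqr_half_exp k : (2^-1 ^+ k) ^+ 2 = 4^-1 ^+ k :> R.
Proof. by rewrite -exprM mulnC exprM; congr (_ ^+ k); field. Qed.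

Lemma quarter_exp_le k : 4^-1 ^+ k <= k.+1%:R^-1 :> R.
Proof.
by rewrite exprVn lef_pV2 ?posrE ?exprn_gt0 // -natrX ler_nat ltn_expl.
Qed.

(** Increments of size [Num.sqrt (s t)] times [2^-1 ^+ k] add up from [k] on to at most twice the
    first; squaring gives the factor [4]. *)
Lemma strongly_measurable_limit (v : nat -> R -> V) (s : R -> R) :
  (forall k, fsimple (v k)) -> integrable_on I s -> (forall t, I t -> 0 <= s t) ->
  (forall t, I t -> forall k, nrm (v k.+1 t - v k t) ^+ 2 <= 4^-1 ^+ k * s t) ->
  exists w, strongly_measurable w /\
    forall k t, I t -> nrm (v k t - w t) ^+ 2 <= 4 * 4^-1 ^+ k * s t.
Proof.
move=> sv js s0 hs.
have qE : qnorm q = (nrm : V -> R) by apply/funext; exact: qnorm_nrm.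
have hq := hilbert_ip hV.
have step t k : I t -> nrm (v k.+1 t - v k t) <= Num.sqrt (s t) * 2^-1 ^+ k.
  move=> It; rewrite -ler_sqr ?nnegrE ?nrm_ge0 ?mulr_ge0 ?sqrtr_ge0 ?exprn_ge0 //.
  by rewrite exprMn sqr_sqrtr ?s0 // mulrC sqr_half_exp hs.
have cau t : I t -> ncauchy nrm (v ^~ t).
  move=> It; rewrite -qE; apply: (geometric_ncauchy hq (C := Num.sqrt (s t)) (c := 2^-1)).
  - exact: sqrtr_ge0.
  - by apply/andP; split; lra.
  - by exists 0%N => n _; rewrite qE; exact: step.
pose w t := xget 0 [set l | nlim nrm (v ^~ t) l].
have vw t : I t -> nlim nrm (v ^~ t) (w t).
  move=> It; have [l hl] := hilbert_complete hV (cau t It).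
  by have := @xgetPex V 0 [set l | nlim nrm (v ^~ t) l]; apply; exists l.
exists w; split; first by apply/strongly_measurableP; exists v.
move=> k t It.
have dist m : nrm (v k t - v (k + m)%N t) <= Num.sqrt (s t) * (2 * 2^-1 ^+ k - 2 * 2^-1 ^+ (k + m)).
  elim: m => [|m ih]; first by rewrite addn0 !subrr nrm0 mulr0.
  apply: le_trans (nrmB_le _ _ (v (k + m)%N t)) _.
  have := step t (k + m)%N It; rewrite nrm_sub addnS => st.
  apply: le_trans (lerD ih st) _; rewrite -mulrDr exprS ler_wpM2l ?sqrtr_ge0 //.
  by move: (2^-1 ^+ (k + m)) (2^-1 ^+ k) => a b; lra.
have lim : nrm (v k t - w t) <= Num.sqrt (s t) * (2 * 2^-1 ^+ k).
  rewrite -qE; apply: (nlim_le hq (u := fun n => v k t - v n t)).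
    by apply: nlimB => //; [exact: nlim_cst|rewrite qE; exact: vw].
  exists k => n kn; rewrite qE -(subnKC kn); apply: le_trans (dist _) _.
  by rewrite ler_wpM2l ?sqrtr_ge0 // lerBlDr lerDl mulr_ge0 // exprn_ge0.
have : nrm (v k t - w t) ^+ 2 <= (Num.sqrt (s t) * (2 * 2^-1 ^+ k)) ^+ 2.
  by rewrite ler_sqr ?nnegrE ?nrm_ge0 ?mulr_ge0 ?sqrtr_ge0 ?exprn_ge0.
rewrite !exprMn sqr_sqrtr ?s0 // mulrC sqr_half_exp.
by have -> : 2 ^+ 2 = 4 :> R by ring.
Qed.

(* The terms of a subsequence are replaced by close simple functions, so that the
   pointwise limit is strongly measurable. *)
Lemma L2_complete (f : nat -> L2 V) :
  (forall e : R, 0 < e -> exists n0, forall m n, (n0 <= m)%N -> (n0 <= n)%N ->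
     E (L2rep (f m - f n)) <= e) ->
  exists l, forall e : R, 0 < e -> exists n0, forall n, (n0 <= n)%N ->
     E (L2rep (f n - l)) <= e.
Proof.
move=> cau.
have mI : measurable I by exact: measurable_itv.
have sL := @L2rep_sq_integrable R K V.
have EB (g h : L2 V) : E (L2rep (g - h)) = E (fun t => L2rep g t - L2rep h t).
  apply: (proj2 (ae_eq_Rintegral (sL _).2 _ _)).
    exact: integrable_on_measurable (sq_integrableB (sL g) (sL h)).1.2.
  by apply: aeS (L2repB g h) => t + It => /(_ It) ->.
have E0 (h : R -> V) : 0 <= E h by apply: Rintegral_ge0 => t _; exact: sqr_ge0.
(* After the weight [4 ^+ k] that enters [h] below, the integrals still decay like [4^-1 ^+ k]; the
   majorant [s] of the weighted terms then gives pointwise decay at that same rate. *)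
pose c k : R := 16^-1 ^+ k.
have c0 k : 0 < c k by rewrite exprn_gt0.
have [nu hnu] : exists nu : nat -> nat, forall k m n, (nu k <= m)%N -> (nu k <= n)%N ->
    E (L2rep (f m - f n)) <= c k.
  exists (fun k => projT1 (cid (cau _ (c0 k)))) => k; exact: projT2 (cid (cau _ (c0 k))).
pose g k := L2rep (f (nu k)).
have gg k : E (fun t => g k.+1 t - g k t) <= 4 * c k.
  pose j := maxn (nu k) (nu k.+1).
  apply: le_trans (sq_integral_tri (sL _) (sL _) (sL (f j))) _; rewrite -!EB.
  have h1 := hnu k.+1 (nu k.+1) j (leqnn _) (leq_maxr _ _).
  have h2 := hnu k j (nu k) (leq_maxl _ _) (leqnn _).
  have : c k.+1 <= c k by rewrite /c exprS ler_piMl ?exprn_ge0 // invf_le1 ?ler1n.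
  by move=> h3; lra.
have [v hv] : exists v : nat -> R -> V, forall k,
    [/\ fsimple (v k), sq_integrable (v k) & E (fun t => g k t - v k t) <= c k].
  exists (fun k => projT1 (cid (sq_simple_approx (sL (f (nu k))) (c0 k)))) => k.
  exact: projT2 (cid (sq_simple_approx (sL (f (nu k))) (c0 k))).
have sv k : sq_integrable (v k) by have [] := hv k.
(* [22 = 2 + 2 * (2 * 4 + 2)], from two applications of [sq_integral_tri] with [gg] for the middle
   distance. *)
have vv k : E (fun t => v k.+1 t - v k t) <= 22 * c k.
  have h1 := sq_integral_tri (sv k.+1) (sv k) (sL (f (nu k.+1))).
  have h2 := sq_integral_tri (sL (f (nu k.+1))) (sv k) (sL (f (nu k))).
  have [_ _ h3] := hv k.+1; have [_ _ h4] := hv k; have h5 := gg k.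
  rewrite sq_integral_sym in h3.
  have : c k.+1 <= c k by rewrite /c exprS ler_piMl ?exprn_ge0 // invf_le1 ?ler1n.
  rewrite -/(g k.+1) -/(g k) in h1 h2 h3 h4 *; move=> h6.
  by lra.
pose h k t := 4 ^+ k * nrm (v k.+1 t - v k t) ^+ 2.
have sd k := (sq_integrableB (sv k.+1) (sv k)).1.
have [A [s [mA A0 js s0 hs]]] : exists A : set R, exists s : R -> R,
    [/\ measurable A, mu A = 0%E, integrable_on I s,
      forall t, I t -> 0 <= s t /\ (A t -> s t = 0) &
      forall t, I t -> ~ A t -> forall k, h k t <= s t].
  apply: (@summable_majorant h 44).
  - by move=> k t _; apply: mulr_ge0; [exact: exprn_ge0|exact: sqr_ge0].
  - by move=> k; apply: integrable_onZ => //; have [] := sd k.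
  (* The bound [44 * (1 - 4^-1 ^+ n)] is inductive: its increment [33 * 4^-1 ^+ n] exceeds the bound
     [22 * 4^-1 ^+ n] for the new term. *)
  move=> n; apply: (@le_trans _ _ (44 * (1 - 4^-1 ^+ n))); last first.
    by rewrite ler_piMr // lerBlDr lerDl exprn_ge0.
  elim: n => [|n ih]; first by rewrite big_nil subrr mulr0.
  rewrite big_nat_recr //= RintZ //; last by have [] := sd n.
  have := vv n; rewrite -(@ler_pM2l _ (4 ^+ n)) ?exprn_gt0 // => h1.
  apply: le_trans (lerD ih h1) _.
  have -> : 4 ^+ n * (22 * c n) = 22 * 4^-1 ^+ n.
    rewrite /c mulrCA -exprMn; congr (_ * _ ^+ _).
    by rewrite (_ : 16 = 4 * 4) ?invfM ?mulrA ?divff ?mul1r // -natrM.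
  have p0 : (0 : R) <= 4^-1 ^+ n by rewrite exprn_ge0.
  by rewrite exprS; move: (4^-1 ^+ n) p0 => r p0; lra.
pose u k t := if `[< (~` A) t >] then v k t else 0.
have su k : fsimple (u k).
  by have [sk _ _] := hv k; apply: fsimple_restrict => //; exact: measurableC.
have us t : I t -> forall k, nrm (u k.+1 t - u k t) ^+ 2 <= 4^-1 ^+ k * s t.
  move=> It k; rewrite /u; case: asboolP => At; last first.
    by rewrite subrr nrm0 expr0n /= (s0 t It).2 ?mulr0 //; exact: contrapT.
  have := hs t It At k; rewrite /h.
  by rewrite exprVn ler_pdivlMl // exprn_gt0.
have [w [mw hw]] := strongly_measurable_limit su js (fun t It => (s0 t It).1) us.
have uv k : {ae mu, forall t, I t -> u k t = v k t}.
  exists A; split => // t /= nt; apply: contrapT => At; apply: nt => _.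
  by rewrite /u asboolT.
have sw : sq_integrable w.
  apply: (sq_integrable_le (k := fun t => 2 * nrm (v 0%N t) ^+ 2 + 8 * s t)) => //.
    move=> t It; have -> : w t = u 0%N t + (w t - u 0%N t) by rewrite addrC subrK.
    apply: le_trans (sqr_nrmD_le _ _) _; apply: lerD.
      rewrite ler_pM2l // /u; case: asboolP => // _.
      by rewrite nrm0 expr0n /= sqr_ge0.
    by have := hw 0%N t It; rewrite nrm_sub expr0; lra.
  by apply: integrable_onD => //; apply: integrable_onZ => //; have [] := sv 0%N.
have [l hl] := L2_exists sw.
exists l => e e0.
pose S := \int[mu]_(t in I) s t.
have S0 : 0 <= S by apply: Rintegral_ge0 => t It; have [] := s0 t It.
have bk k : E (fun t => g k t - w t) <= 4^-1 ^+ k * (2 + 8 * S).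
  apply: le_trans (sq_integral_tri (sL _) sw (sv k)) _.
  have [_ _ h1] := hv k.
  have h2 : E (fun t => v k t - w t) <= 4 * 4^-1 ^+ k * S.
    have suw := sq_integrable_le (strongly_measurableB (fsimple_strongly_measurable (su k)) mw)
      (hw k) (integrable_onZ (4 * 4^-1 ^+ k) mI js).
    have <- : E (fun t => u k t - w t) = E (fun t => v k t - w t).
      apply: (proj2 (ae_eq_Rintegral suw.2 _ _)).
        exact: integrable_on_measurable (sq_integrableB (sv k) sw).1.2.
      by apply: aeS (uv k) => t + It => /(_ It) ->.
    rewrite -RintZ //; apply: (le_Rint mI suw.2 _ (hw k)).
    exact: integrable_onZ.
  have h3 : c k <= 4^-1 ^+ k.
    rewrite /c !exprVn lef_pV2 ?posrE ?exprn_gt0 //; apply: lerXn2r; rewrite ?nnegrE //; lra.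
  move: (4^-1 ^+ k) h2 h3 => r h2 h3; rewrite -/(g k) in h1 *; nra.
have D0 : 0 < 6 + 16 * S by lra.
have [k0 hk0] := invS_small (divr_gt0 e0 D0).
have hk := le_trans (quarter_exp_le k0) (hk0 k0 (leqnn _)).
rewrite ler_pdivlMr // in hk.
exists (nu k0) => n nn.
have -> : E (L2rep (f n - l)) = E (fun t => L2rep (f n) t - w t).
  rewrite EB; apply: (proj2 (ae_eq_Rintegral (sq_integrableB (sL _) (sL _)).1.2 _ _)).
    exact: integrable_on_measurable (sq_integrableB (sL (f n)) sw).1.2.
  by apply: aeS hl => t + It => /(_ It) ->.
apply: le_trans (sq_integral_tri (sL _) sw (sL (f (nu k0)))) _; rewrite -EB.
have h1 := hnu k0 n (nu k0) nn (leqnn _); have h2 := bk k0.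
have h3 : c k0 <= 4^-1 ^+ k0.
  rewrite /c !exprVn lef_pV2 ?posrE ?exprn_gt0 //; apply: lerXn2r; rewrite ?nnegrE //; lra.
rewrite -/(g k0); move: (4^-1 ^+ k0) hk h2 h3 => r hk h2 h3; nra.
Qed.


End Space.
End RieszFischer.

Section DotConstruction.
Context {R : realType} {K : scalars R} {Y : lmodType K}.

(** [op x x] is fixed by [sconj K], hence a real scalar, and so positivity of its real part is
    positivity in [K]. *)
Lemma dot_exists (op : Y -> Y -> K) :
  (forall x y z, op (x + y) z = op x z + op y z) ->
  (forall k x y, op (k *: x) y = k * op x y) ->
  (forall x y, op x y = sconj K (op y x)) ->
  (forall x, x != 0 -> 0 < re (op x x)) ->
  exists ip : {dot Y for sconj K}, forall x y, ip x y = op x y.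
Proof.
move=> opD opZ opS op0.
have opDr x y z : op x (y + z) = op x y + op x z.
  by rewrite opS opD rmorphD /= -!opS.
have opZr k x y : op x (k *: y) = sconj K k * op x y.
  by rewrite opS opZ rmorphM /= -opS.
have opNl x y : op (- x) y = - op x y by rewrite -scaleN1r opZ mulN1r.
have opNr x y : op x (- y) = - op x y by rewrite opS opNl rmorphN /= -opS.
have b1 u' : zmod_morphism (op ^~ u') by move=> x y; rewrite opD opNl.
have b2 u : zmod_morphism (op u) by move=> x y; rewrite opDr opNr.
have b3 u' : scalable_for *%R (op ^~ u') by move=> k x; rewrite opZ.
have b4 u : scalable_for (sconj K \; *%R) (op u) by move=> k x; rewrite opZr.
have h x y : op x y = (-1) ^+ false * sconj K (op y x) by rewrite expr0 mul1r.
have p u : u != 0 -> 0 < op u u.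
  move=> /op0 u0; have E : op u u = ofR (re (op u u)).
    have := add_sconj (op u u); rewrite -opS -mulr2n rmorphMn /=.
    by move/eqP; rewrite -subr_eq0 -mulrnBl mulrn_eq0 subr_eq0 => /eqP.
  by rewrite E lt_neqAle eq_sym fmorph_eq0 gt_eqF //= ofR_ge0 ltW.
pose m1 := isBilinear.Build K Y Y K *%R (sconj K \; *%R) op b1 b2 b3 b4.
pose m2 := isHermitianSesquilinear.Build K Y false (sconj K) op h.
pose m3 := isDotProduct.Build K Y op p.
pose d : {dot Y for sconj K} := HB.pack_for {dot Y for sconj K} op m1 m2 m3.
by exists d.
Qed.

End DotConstruction.

Section ScalarBochner.
Context {R : realType} {K : scalars R}.
Notation mu := (@lebesgue_measure R).
Notation I := (`[-1, 0]%classic : set R).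

Lemma re_norm_sconj (z : K) : re `|sconj K z| = re `|z|.
Proof.
apply/eqP; rewrite -(@eqrXn2 _ 2) ?re_norm_ge0 // -(inj_eq (fmorph_inj (@ofR R K))).
by rewrite -!mul_sconj involutive_subproof mulrC.
Qed.

Lemma re_mulr_sconjC (z w : K) : re (z * sconj K w) = re (w * sconj K z).
Proof. by rewrite -re_sconj rmorphM /= involutive_subproof mulrC. Qed.

(** The products on [L2] are Bochner integrals with values in [K]; this instance brings them under
    the theory of Hilbert spaces. *)
Lemma hilbert_scalars : @hilbert R K K^o (fun z w => re (z * sconj K w)).
Proof.
split.
- split.
  + exact: re_mulr_sconjC.
  + by move=> x y z; rewrite mulrDl reD.
  + by move=> a x y; rewrite -[ofR a *: x]/(ofR a * x) -mulrA re_ofRM.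
  + move=> k x; rewrite -[k *: x]/(k * x) rmorphM /= mulrACA !mul_sconj.
    by rewrite re_ofRM re_ofR.
  + move=> x x0; rewrite mul_sconj re_ofR exprn_gt0 // lt_neqAle re_norm_ge0 andbT eq_sym.
    by rewrite -(fmorph_eq0 (@ofR R K)) re_normK normr_eq0.
- by move=> x; rewrite mul_sconj re_ofR.
- by move=> u cu; have [l hl] := scalars_complete cu; exists l.
Qed.

Lemma re_bounded_functional : @bounded_functional R K K^o 1 re.
Proof.
split.
- exact: reD.
- by move=> a x; rewrite -[ofR a *: x]/(ofR a * x) re_ofRM.
- by move=> x; rewrite mul1r; exact: ler_re_norm.
Qed.

Lemma bochner_sconj (f : R -> K^o) : bochner_integrable f ->
  bochner_integrable (fun t => sconj K (f t) : K^o) ->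
  bochner (fun t => sconj K (f t) : K^o) = sconj K (bochner f).
Proof.
move=> jf jg; apply: (bochner_eqP hilbert_scalars) => // w.
rewrite -re_sconj rmorphM /= !involutive_subproof.
have := bochner_ip hilbert_scalars (sconj K w) jf.
rewrite involutive_subproof => ->; apply: eq_Rint => t _.
by rewrite -[RHS]re_sconj rmorphM /= !involutive_subproof.
Qed.

End ScalarBochner.

Section BochnerLinear.
Context {R : realType} {K : scalars R} {V : normedModType K} {q : V -> V -> R}.
Hypothesis hV : hilbert q.
Notation mu := (@lebesgue_measure R).
Notation I := (`[-1, 0]%classic : set R).

Lemma rip_polarize (k : K) x y : q (k *: x) (k *: y) = re `|k| ^+ 2 * q x y.
Proof.
have hq := hilbert_ip hV.
have := rip_sqrZ hq k (x + y); rewrite scalerDr !(ripDl hq) !(ripDr hq) !(rip_sqrZ hq).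
by rewrite (rip_sym hq y x) (rip_sym hq (k *: y) (k *: x)); lra.
Qed.

Lemma bochnerD (f g : R -> V) : bochner_integrable f -> bochner_integrable g ->
  bochner (fun t => f t + g t) = bochner f + bochner g.
Proof.
move=> jf jg; have hq := hilbert_ip hV.
apply: (bochner_eqP hV) => [|w]; first exact: bochner_integrableD.
have bw := bounded_functional_ip hV w.
rewrite (ripDl hq) !(bochner_ip hV) // -RintD //;
  [|exact: bfun_integrable bw jf|exact: bfun_integrable bw jg].
by apply: eq_Rint => t _; rewrite (ripDl hq).
Qed.

Lemma bochnerZ (k : K) (f : R -> V) : bochner_integrable f ->
  bochner (fun t => k *: f t) = k *: bochner f.
Proof.
move=> jf; have hq := hilbert_ip hV.
apply: (bochner_eqP hV) => [|w]; first exact: bochner_integrable_scale.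
have [->|k0] := eqVneq k 0.
  rewrite scale0r (rip0l hq) (eq_Rint (g := fun=> 0)) ?Rintegral_cst_itv ?mul0r ?lerN10 //.
  by move=> t _; rewrite scale0r (rip0l hq).
(* [q] is bilinear over the reals only, so [k] cannot leave one argument alone; with [w] written as
   a multiple by [k], it leaves both at once. *)
have -> : w = k *: (k^-1 *: w) by rewrite scalerA divff // scale1r.
have bw := bounded_functional_ip hV (k^-1 *: w).
rewrite rip_polarize (bochner_ip hV) // -RintZ //; last exact: bfun_integrable bw jf.
by apply: eq_Rint => t _; rewrite rip_polarize.
Qed.

End BochnerLinear.

(** * Weighted inner products on the product space *)

Section WeightedProduct.
Context {R : realType} {K : scalars R} {V : normedModType K}.
Variable ip : {dot V for sconj K}.
Local Notation q := (fun x y : V => re (ip x y)).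
Hypothesis hV : hilbert q.
Notation mu := (@lebesgue_measure R).
Notation I := (`[-1, 0]%classic : set R).

Lemma dot_sym x y : ip x y = sconj K (ip y x).
Proof. by have := @hermitian_subproof K V false (sconj K) ip x y; rewrite expr0 mul1r. Qed.

(** [hilbert_cs] controls real parts only. It is applied to [sconj K (ip x y) *: x], whose product
    with [y] is the real number $|\langle x,y\rangle|^2$. *)
Lemma dot_cs x y : re `|ip x y| <= nrm x * nrm y.
Proof.
have [->|z0] := eqVneq (re `|ip x y|) 0; first by rewrite mulr_ge0 ?nrm_ge0.
have zp : 0 < re `|ip x y| by rewrite lt_neqAle eq_sym z0 re_norm_ge0.
have := le_trans (ler_norm _) (hilbert_cs hV (sconj K (ip x y) *: x) y).
rewrite linearZl_LR /= mulrC mul_sconj re_ofR nrmZ re_norm_sconj -mulrA expr2.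
by rewrite ler_pM2l.
Qed.

Lemma strongly_measurable_dot (f g : R -> V) : strongly_measurable f ->
  strongly_measurable g -> strongly_measurable (fun t => ip (f t) (g t) : K^o).
Proof.
move=> mf mg; refine (@strongly_measurable_comp2 R K K K V V K^o (fun x y => ip x y) f g _ mf mg).
move=> u w x y ux wy e e0.
pose C := nrm x + nrm y + 1.
have C0 : 0 < C by rewrite ltr_wpDl // addr_ge0 // nrm_ge0.
pose d := Num.min 1 (e / (2 * C)).
have d0 : 0 < d by rewrite lt_min ltr01 divr_gt0 // mulr_gt0.
have [n1 h1] := ux d d0; have [n2 h2] := wy d d0.
exists (maxn n1 n2) => n; rewrite geq_max => /andP[/h1 xn /h2 yn].
have -> : ip (u n) (w n) - ip x y = ip (u n - x) (w n) + ip x (w n - y).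
  by rewrite linearBl linearBr /= addrA subrK.
apply: le_trans (re_normD _ _) _.
have c1 := dot_cs (u n - x) (w n); have c2 := dot_cs x (w n - y).
have wn : nrm (w n) <= C.
  have := nrmD (w n - y) y; rewrite subrK; have := nrm_ge0 x.
  have : d <= 1 by rewrite ge_min lexx.
  by rewrite /C; lra.
have xC : nrm x <= C by rewrite /C; have := nrm_ge0 y; lra.
have dC : d * C <= e / 2.
  rewrite -ler_pdivlMr // -mulrA -invfM /d ge_min lexx orbT //.
have t1 : nrm (u n - x) * nrm (w n) <= d * C by apply: ler_pM; rewrite ?nrm_ge0.
have t2 : nrm x * nrm (w n - y) <= C * d by apply: ler_pM; rewrite ?nrm_ge0.
by lra.
Qed.

Variables (tau : R -> R) (M : R).
Hypotheses (mtau : measurable_fun I tau) (tau_bnd : forall t, I t -> 1 <= tau t <= M).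

Definition weighted_product (f g : L2 V) : K :=
  bochner (fun t => ofR (tau t) *: (ip (L2rep f t) (L2rep g t) : K^o)).

Lemma dot_bochner_integrable (f g : R -> V) : sq_integrable f -> sq_integrable g ->
  bochner_integrable (fun t => ofR (tau t) *: (ip (f t) (g t) : K^o)).
Proof.
move=> [mf jf] [mg jg].
have mI : measurable I by exact: measurable_itv.
apply: (bochner_integrableZ (C := M)) => //.
  by move=> t It; have /andP[h1 h2] := tau_bnd It; rewrite ger0_norm // (le_trans ler01).
apply: (bochner_integrable_le (h := fun t => nrm (f t) ^+ 2 + nrm (g t) ^+ 2)).
- exact: strongly_measurable_dot.
- move=> t _; apply: le_trans (dot_cs _ _) _.
  have := sqr_ge0 (nrm (f t) - nrm (g t)); have := nrm_ge0 (f t); have := nrm_ge0 (g t).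
  by rewrite sqrrB; move: (nrm (f t)) (nrm (g t)) => a b b0 a0; nra.
- exact: integrable_onD.
Qed.

Let wint f g := dot_bochner_integrable (L2rep_sq_integrable f) (L2rep_sq_integrable g).

Lemma weighted_productD f g h :
  weighted_product (f + g) h = weighted_product f h + weighted_product g h.
Proof.
rewrite /weighted_product -(bochnerD hilbert_scalars (wint f h) (wint g h)).
apply: (ae_eq_bochner hilbert_scalars); [exact: wint|exact: bochner_integrableD|].
by apply: aeS (L2repD f g) => t + It => /(_ It) ->; rewrite linearDl scalerDr.
Qed.

Lemma weighted_productZ (k : K) f g :
  weighted_product (k *: f) g = k * weighted_product f g.
Proof.
rewrite /weighted_product -[RHS](bochnerZ hilbert_scalars k (wint f g)).
apply: (ae_eq_bochner hilbert_scalars); [exact: wint|exact: bochner_integrable_scale|].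
by apply: aeS (L2repZ k f) => t + It => /(_ It) ->; rewrite linearZl_LR /= scalerA mulrC -scalerA.
Qed.

Lemma weighted_product_sym f g :
  weighted_product f g = sconj K (weighted_product g f).
Proof.
have E : (fun t => ofR (tau t) *: (ip (L2rep f t) (L2rep g t) : K^o)) =
    (fun t => sconj K (ofR (tau t) *: (ip (L2rep g t) (L2rep f t) : K^o)) : K^o).
  by apply/funext => t; rewrite -[_ *: _ in RHS]/(_ * _) rmorphM /= sconj_ofR -dot_sym.
have jE := wint f g; rewrite E in jE.
by rewrite /weighted_product E; exact: bochner_sconj (wint g f) jE.
Qed.

Lemma re_weighted_product f g : re (weighted_product f g) =
  \int[mu]_(t in I) (tau t * re (ip (L2rep f t) (L2rep g t))).
Proof.
rewrite /weighted_product (bochner_functional hilbert_scalars re_bounded_functional (wint f g)).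
by apply: eq_Rint => t _; rewrite -[_ *: _]/(_ * _) re_ofRM.
Qed.

Lemma re_weighted_product_sqr f : re (weighted_product f f) =
  \int[mu]_(t in I) (tau t * nrm (L2rep f t) ^+ 2).
Proof.
by rewrite re_weighted_product; apply: eq_Rint => t _; rewrite (hilbert_nrm hV).
Qed.

Lemma integrable_weighted (f : L2 V) : integrable_on I (fun t => tau t * nrm (L2rep f t) ^+ 2).
Proof.
have [mf jf] := L2rep_sq_integrable f; have mI : measurable I by exact: measurable_itv.
apply: (integrable_on_le (g := fun t => M * nrm (L2rep f t) ^+ 2)) => //.
- apply: measurable_funM => //; exact: integrable_on_measurable jf.
- move=> t It; have /andP[h1 h2] := tau_bnd It.
  have t0 : 0 <= tau t by apply: le_trans h1.
  have n0 := sqr_ge0 (nrm (L2rep f t)).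
  by rewrite ger0_norm; [exact: ler_wpM2r|exact: mulr_ge0].
- exact: integrable_onZ.
Qed.

(** The lower bound [1 <= tau] carries the definiteness of the product and, later, the completeness
    of its norm; both bounds together give the equivalence with the canonical norm. *)
Lemma weighted_product_bounds (f : L2 V) :
  \int[mu]_(t in I) (nrm (L2rep f t) ^+ 2) <= re (weighted_product f f) <=
  M * \int[mu]_(t in I) (nrm (L2rep f t) ^+ 2).
Proof.
have [mf jf] := L2rep_sq_integrable f; have mI : measurable I by exact: measurable_itv.
have jw := integrable_weighted f.
rewrite re_weighted_product_sqr -RintZ //; apply/andP; split; apply: le_Rint => //.
- move=> t It; have /andP[h1 h2] := tau_bnd It.
  by rewrite ler_peMl // sqr_ge0.
- exact: integrable_onZ.
- move=> t It; have /andP[h1 h2] := tau_bnd It.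
  by rewrite ler_wpM2r // sqr_ge0.
Qed.

Lemma L2_sqr_eq0 (f : L2 V) : \int[mu]_(t in I) (nrm (L2rep f t) ^+ 2) = 0 -> f = 0.
Proof.
move=> f0; have [mf jf] := L2rep_sq_integrable f.
apply: (L2_eq (V := V)); have := ge0_Rintegral_eq0 (fun t _ => sqr_ge0 (nrm (L2rep f t))) jf f0.
move=> h; apply: aeS2 h (@L2rep0 R K V) => t h1 h2 It; rewrite h2 //.
by apply: nrm_eq0; apply/eqP; rewrite -sqrf_eq0 h1.
Qed.

Lemma weighted_dot_exists : exists ip' : {dot (V * L2 V)%type for sconj K},
  forall u v, ip' u v = ip u.1 v.1 + weighted_product u.2 v.2.
Proof.
apply: dot_exists => [[x f] [y g] [z h]|k [x f] [y g]|[x f] [y g]|[x f]] /=.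
- by rewrite linearDl weighted_productD addrACA.
- by rewrite linearZl_LR /= weighted_productZ mulrDr.
- by rewrite rmorphD /= -dot_sym -weighted_product_sym.
- move=> xf0; rewrite reD -(hilbert_nrm hV).
  have /andP[h1 _] := weighted_product_bounds f.
  have E0 : 0 <= \int[mu]_(t in I) (nrm (L2rep f t) ^+ 2).
    by apply: Rintegral_ge0 => t _; exact: sqr_ge0.
  rewrite lt_neqAle; apply/andP; split; last by rewrite addr_ge0 ?sqr_ge0 // (le_trans E0).
  rewrite eq_sym; apply: contra xf0 => /eqP s0; have n0 := sqr_ge0 (nrm x).
  have x0 : nrm x ^+ 2 = 0 by lra.
  have f0 : \int[mu]_(t in I) (nrm (L2rep f t) ^+ 2) = 0 by lra.
  move/eqP: x0; rewrite sqrf_eq0 => /eqP/nrm_eq0 ->.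
  by rewrite (L2_sqr_eq0 f0).
Qed.

End WeightedProduct.

(** * Variation and Stieltjes integrals *)

Section Variation.
Context {R : realType} {K : scalars R} {X : normedModType K}.
Notation I := (`[-1, 0]%classic : set R).
Implicit Types zeta : R -> X -> X.

(** What is retained of the variation function. Jumps are allowed, and monotonicity on the whole
    line yields measurability. *)
Record variation_bound zeta (V : R -> R) : Prop := VariationBound {
  vb_left : V (-1) = 0 ;
  vb_mono : forall s t, s <= t -> V s <= V t ;
  vb_le : forall s t x, -1 <= s -> s <= t -> t <= 0 ->
    nrm (zeta t x - zeta s x) <= (V t - V s) * nrm x }.

Lemma nrm_opnorm (L : X -> X) x : bounded_operator nrm L ->
  0 <= opnorm nrm L /\ nrm (L x) <= opnorm nrm L * nrm x.
Proof.
move=> [linL [C hC]]; set S := [set nrm (L y) | y in [set y | nrm y <= 1]].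
have ubS : has_ubound S.
  exists `|C| => _ [y y1 <-]; apply: le_trans (hC y) _.
  by apply: le_trans (ler_norm _) _; rewrite normrM (ger0_norm (nrm_ge0 y)) ler_piMr.
have L0 : L 0 = 0 by have := linL (-1) 0 0; rewrite scaler0 addr0 scaleN1r addNr.
have LZ k y : L (k *: y) = k *: L y.
  by have := linL k y 0; rewrite !addr0 L0 addr0.
have S0 : S 0 by exists 0; [rewrite /= nrm0|rewrite L0 nrm0].
have o0 : 0 <= opnorm nrm L by exact: ub_le_sup S0.
split=> //; have [x0|x0] := eqVneq (nrm x) 0.
  by rewrite (nrm_eq0 x0) L0 nrm0 mulr0.
have xp : 0 < nrm x by rewrite lt_neqAle eq_sym x0 nrm_ge0.
rewrite -ler_pdivrMr //; apply: (ub_le_sup ubS).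
exists (ofR (nrm x)^-1 *: x).
  by rewrite /= nrm_ofRZ ger0_norm ?invr_ge0 ?nrm_ge0 // mulVf.
by rewrite LZ nrm_ofRZ ger0_norm ?invr_ge0 ?nrm_ge0 // mulrC.
Qed.

Lemma bounded_operatorB (L M : X -> X) : bounded_operator nrm L ->
  bounded_operator nrm M -> bounded_operator nrm (L - M).
Proof.
move=> [lL [C hC]] [lM [D hD]]; split.
  move=> k x y; rewrite -[LHS]/(L (k *: x + y) - M (k *: x + y)) lL lM.
  by rewrite -[in RHS]/(L x - M x) scalerBr opprD addrACA.
exists (C + D) => y; rewrite -[(L - M) y]/(L y - M y).
by apply: le_trans (nrmD _ _) _; rewrite nrmN mulrDl lerD.
Qed.

Lemma op_variation_rcons zeta s t :
  op_variation zeta (rcons s t) = op_variation zeta s +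
    opnorm nrm (zeta t - zeta (last (-1) s)).
Proof.
rewrite /op_variation size_rcons big_nat_recr //=; congr (_ + opnorm _ (zeta _ - zeta _)).
- apply: eq_big_nat => i /andP[_ si]; congr (opnorm _ (zeta _ - zeta _)).
    by rewrite nth_rcons si.
  by case: i si => //= i si; rewrite nth_rcons ltnW.
- by rewrite nth_rcons ltnn eqxx.
- case: (lastP s) => // s' x; rewrite size_rcons last_rcons /=.
  by rewrite nth_rcons size_rcons leqnn nth_rcons ltnn eqxx.
Qed.

(** On [[-1, 0]] the function is the supremum of the variations over partitions of [[-1, t]];
    appending one point to a partition gives the estimate for increments. *)
Lemma variation_bound_exists zeta :
  (forall s, -1 <= s <= 0 -> bounded_operator nrm (zeta s)) ->
  op_bounded_variation zeta -> exists V, variation_bound zeta V.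
Proof.
move=> hb [M hM].
have opn s t : -1 <= s <= 0 -> -1 <= t <= 0 -> forall x,
    0 <= opnorm nrm (zeta t - zeta s) /\
    nrm (zeta t x - zeta s x) <= opnorm nrm (zeta t - zeta s) * nrm x.
  by move=> hs ht x; apply: nrm_opnorm; apply: bounded_operatorB; exact: hb.
pose P t := [set op_variation zeta s | s in itv_partition (-1) t].
have last_ge s : path <%R (-1 : R) s -> -1 <= last (-1) s.
  move=> ps; have : itv_partition (-1) (last (-1) s) s by split.
  exact: itv_partition_le.
have PM t v : -1 <= t <= 0 -> P t v -> v <= M.
  move=> tI [s [ps /eqP ls] <-].
  have [t0|t0] := eqVneq t 0; first by apply: hM; exists s => //; split => //; rewrite ls t0.
  have tn : t < 0 by rewrite lt_neqAle t0; case/andP: tI.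
  (* A partition that ends before [0] is completed by the point [0], so that the global bound
     applies to it. *)
  have : op_variation zeta (rcons s 0) <= M.
    by apply: hM; exists (rcons s 0) => //; split; rewrite ?last_rcons // rcons_path ps ls.
  rewrite op_variation_rcons ls; apply: le_trans; rewrite lerDl.
  by have [] := opn t 0 tI _ 0; rewrite ?lexx ?lerN10.
have P0 : P (-1) 0.
  by exists [::]; [split|rewrite /op_variation big_nil].
have Pne t : -1 <= t <= 0 -> P t !=set0.
  move=> /andP[t1 t0]; have [->|tn] := eqVneq t (-1); first by exists 0.
  exists (op_variation zeta [:: t]), [:: t] => //; split => //=.
  by rewrite lt_neqAle eq_sym tn t1.
have Pub t : -1 <= t <= 0 -> has_sup (P t).
  by move=> tI; split; [exact: Pne|exists M => v; exact: PM].
pose W t := sup (P t).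
have Wle s t : -1 <= s -> s < t -> t <= 0 ->
    W s + opnorm nrm (zeta t - zeta s) <= W t.
  move=> s1 st t0.
  have sI : -1 <= s <= 0 by rewrite s1 /= (le_trans (ltW st)).
  have tI : -1 <= t <= 0 by rewrite t0 (le_trans s1 (ltW st)).
  rewrite -lerBrDr; apply: ge_sup; first exact: Pne.
  move=> _ [r [pr /eqP lr] <-]; rewrite lerBrDr.
  apply: (ub_le_sup (Pub t tI).2); exists (rcons r t).
    by split; rewrite ?last_rcons // rcons_path pr lr.
  by rewrite op_variation_rcons lr.
(* Clamping to [[-1, 0]] extends [W] to a monotone function on the line. *)
pose cl (t : R) : R := Num.max (-1) (Num.min t 0).
have clI t : -1 <= cl t <= 0.
  by rewrite /cl le_max lexx /= ge_max lerN10 /= ge_min lexx orbT.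
have clE t : -1 <= t -> t <= 0 -> cl t = t.
  by move=> t1 t0; rewrite /cl min_l // max_r.
have W0 : W (-1) = 0.
  apply/eqP; rewrite eq_le; apply/andP; split; last first.
    by apply: (ub_le_sup (Pub _ _).2) => //; rewrite lexx lerN10.
  apply: ge_sup; first by exists 0.
  by move=> _ [s /itv_partitionxx -> <-]; rewrite /op_variation big_nil.
exists (fun t => W (cl t)); split.
- by rewrite clE ?lerN10.
- move=> s t st; have clst : cl s <= cl t.
    rewrite /cl ge_max !le_max lexx /=.
    by rewrite [X in _ || X]le_min !ge_min st lexx /= !orbT.
  move: clst; rewrite le_eqVlt => /orP[/eqP -> //|clst].
  have /andP[s1 s0] := clI s; have /andP[t1 t0] := clI t.
  have := Wle _ _ s1 clst t0; apply: le_trans; rewrite lerDl.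
  by have [] := opn _ _ (clI s) (clI t) 0.
- move=> s t x s1 st t0.
  have tI : -1 <= t <= 0 by rewrite t0 (le_trans s1 st).
  have sI : -1 <= s <= 0 by rewrite s1 /= (le_trans st).
  rewrite !clE ?(le_trans s1 st) ?(le_trans st t0) //.
  move: st; rewrite le_eqVlt => /orP[/eqP ->|st]; first by rewrite !subrr nrm0 mul0r.
  have [_ h1] := opn s t sI tI x; apply: le_trans h1 _.
  by rewrite ler_wpM2r ?nrm_ge0 // lerBrDl; exact: Wle.
Qed.

End Variation.

Section StieltjesSums.
Context {R : realType}.
Notation I := (`[-1, 0]%classic : set R).

Lemma uniform_partition (n : nat) : let p := nth (0 : R) (-1 :: mkseq (fun i => -1 + i.+1%:R / n.+1%:R) n.+1) in
  itv_partition (-1 : R) 0 (mkseq (fun i => -1 + i.+1%:R / n.+1%:R) n.+1) /\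
  forall i, (i <= n.+1)%N -> p i = -1 + i%:R / n.+1%:R.
Proof.
move=> p; have pE i : (i <= n.+1)%N -> p i = -1 + i%:R / n.+1%:R.
  case: i => [|i] hi; rewrite /p; first by rewrite /= mul0r addr0.
  by rewrite /= nth_mkseq.
split=> //; split.
  apply/(pathP 0) => i; rewrite size_mkseq => hi.
  have -> : nth 0 (-1 :: mkseq (fun i => -1 + i.+1%:R / n.+1%:R) n.+1) i = p i by [].
  rewrite pE ?(ltnW hi) // nth_mkseq // ltrD2l ltr_pM2r ?invr_gt0 //.
  by rewrite ltr_nat.
by rewrite (last_nth 0) size_mkseq -/p pE // divff // addNr.
Qed.

Lemma partition_nth (s : seq R) : itv_partition (-1 : R) 0 s -> let p := nth 0 (-1 :: s) in
  [/\ p 0%N = -1, p (size s) = 0, forall i, (i < size s)%N -> p i <= p i.+1 &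
    forall i, (i <= size s)%N -> -1 <= p i <= 0].
Proof.
move=> hs p; split=> //.
- exact: itv_partition_nth_size.
- by move=> i si; have [/(pathP 0)/(_ i si) /ltW] := hs.
- move=> i si.
  by rewrite (itv_partition_nth_ge _ hs) ?(itv_partition_nth_le _ hs).
Qed.

Context {K : scalars R} {X : normedModType K}.
Implicit Types (zeta : R -> X -> X) (f : R -> X).

Lemma fine_partition (d : R) : 0 < d -> exists2 s : seq R, itv_partition (-1 : R) 0 s &
  let p := nth 0 (-1 :: s) in forall i, (i < size s)%N -> p i.+1 - p i < d.
Proof.
move=> d0; have d2 : 0 < d / 2 by rewrite divr_gt0.
have [n hn] := invS_small d2.
have [hp pE] := uniform_partition n.
exists (mkseq (fun i => -1 + i.+1%:R / n.+1%:R) n.+1) => // p i.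
rewrite size_mkseq => hi; rewrite /p !pE ?(ltnW hi) // opprD addrACA subrr add0r -mulrBl.
rewrite -natrB // subSnn mul1r; apply: le_lt_trans (hn n (leqnn n)) _.
by rewrite ltr_pdivrMr // ltr_pMr // ltr1n.
Qed.

Lemma is_stieltjes_unique zeta f v w : is_stieltjes zeta f v -> is_stieltjes zeta f w -> v = w.
Proof.
move=> hv hw; apply/eqP; rewrite -subr_eq0; apply/eqP; apply: nrm_eq0.
apply/eqP; rewrite eq_le nrm_ge0 andbT; apply/ler_addgt0Pl => e e0; rewrite addr0.
have e2 : 0 < e / 2 by rewrite divr_gt0.
have [d1 d10 h1] := hv _ e2; have [d2 d20 h2] := hw _ e2.
have dm : 0 < Num.min d1 d2 by rewrite lt_min d10.
have [s hs sd] := fine_partition dm.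
have [p0 pn pm pI] := partition_nth hs.
have {}h1 := h1 s (nth 0 (-1 :: s)) hs _; have {}h2 := h2 s (nth 0 (-1 :: s)) hs _.
apply: le_trans (nrmB_le _ _ _) _; last first.
  rewrite nrm_sub; apply: le_trans (lerD (ltW (h1 _)) (ltW (h2 _))) _; last lra.
    by move=> i si; have := sd i si; rewrite lt_min => /andP[sd1 sd2]; rewrite sd1 lexx pm.
  by move=> i si; have := sd i si; rewrite lt_min => /andP[sd1 sd2]; rewrite sd2 lexx pm.
Qed.

Lemma stieltjesE zeta f v : is_stieltjes zeta f v -> stieltjes zeta f = v.
Proof.
move=> hv; refine (is_stieltjes_unique _ hv).
have : [set v | is_stieltjes zeta f v] (stieltjes zeta f) by apply: xgetPex; exists v.
by [].
Qed.

(** Right end points are legitimate tags, so it suffices to bound these sums. [B] may depend on the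
    partition, because in the application to Young's inequality it contains a Stieltjes sum
    itself. *)
Lemma is_stieltjes_le (zeta : R -> X -> X) f v (B : seq R -> R) (w : R) :
  is_stieltjes zeta f v ->
  (forall e : R, 0 < e -> exists2 d : R, 0 < d & forall s, itv_partition (-1) 0 s ->
    let p := nth 0 (-1 :: s) in
    (forall i, (i < size s)%N -> p i.+1 - p i < d) -> B s < w + e) ->
  (forall s, itv_partition (-1) 0 s -> nrm (\sum_(0 <= i < size s)
    (zeta (nth 0 (-1 :: s) i.+1) - zeta (nth 0 (-1 :: s) i)) (f (nth 0 (-1 :: s) i.+1))) <= B s) ->
  nrm v <= w.
Proof.
move=> hv hB hs; apply/ler_addgt0Pl => e e0.
have e2 : 0 < e / 2 by rewrite divr_gt0.
have [d1 d10 h1] := hv _ e2; have [d2 d20 h2] := hB _ e2.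
have dm : 0 < Num.min d1 d2 by rewrite lt_min d10.
have [s ps sd] := fine_partition dm.
have [p0 pn pm pI] := partition_nth ps.
have {}h1 := h1 s (fun i => nth 0 (-1 :: s) i.+1) ps.
have /h1 {}h1 : forall i, (i < size s)%N -> nth 0 (-1 :: s) i.+1 - nth 0 (-1 :: s) i < d1 /\
    nth 0 (-1 :: s) i <= nth 0 (-1 :: s) i.+1 <= nth 0 (-1 :: s) i.+1.
  by move=> i si; have := sd i si; rewrite lt_min => /andP[sd1 sd2]; rewrite sd1 lexx pm.
have {}h2 : B s < w + e / 2.
  by apply: h2 => // i si; have := sd i si; rewrite lt_min => /andP[].
have h3 := hs s ps.
move: h1 h3; move: (\sum_(_ <= _ < _) _) => S h1 h3.
have := nrmB_le v 0 S; rewrite subr0 nrm_sub subr0; lra.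
Qed.

End StieltjesSums.

(** * Existence of the Stieltjes integral by integration by parts *)

Section Stieltjes.
Context {R : realType} {K : scalars R} {X : normedModType K} {q : X -> X -> R}.
Hypothesis hX : hilbert q.
Notation mu := (@lebesgue_measure R).
Notation I := (`[-1, 0]%classic : set R).
Variables (zeta : R -> X -> X) (V : R -> R).
Hypothesis zD : forall t x y, I t -> zeta t (x + y) = zeta t x + zeta t y.
Hypothesis zZ : forall t (a : R) x, I t -> zeta t (ofR a *: x) = ofR a *: zeta t x.
Variable C0 : R.
Hypothesis C0_ge0 : 0 <= C0.
Hypothesis zC : forall t x, I t -> nrm (zeta t x) <= C0 * nrm x.
Hypothesis hV : variation_bound zeta V.
Let hq := hilbert_ip hX.

Let I0 : I 0. Proof. by rewrite /= in_itv /= lexx lerN10. Qed.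
Lemma zetaB t x y : I t -> zeta t (x - y) = zeta t x - zeta t y.
Proof.
move=> It; rewrite zD //; congr (_ + _).
by rewrite -[- y]scaleN1r -(rmorphN1 (@ofR R K)) zZ // rmorphN1 scaleN1r.
Qed.

Lemma V_ge0 t : I t -> 0 <= V t.
Proof.
by rewrite /= in_itv /= => /andP[t1 t0]; rewrite -(vb_left hV); exact: (vb_mono hV).
Qed.

Lemma V_le t : I t -> V t <= V 0.
Proof. by rewrite /= in_itv /= => /andP[t1 t0]; exact: (vb_mono hV). Qed.

Lemma measurable_V (D : set R) : measurable D -> measurable_fun D V.
Proof.
by move=> mD; apply: nondecreasing_measurable => // s t; exact: (vb_mono hV).
Qed.

Lemma zeta_diff x s t : I s -> I t -> nrm (zeta s x - zeta t x) <= `|V s - V t| * nrm x.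
Proof.
rewrite /= !in_itv /= => /andP[s1 s0] /andP[t1 t0].
have [st|ts] := leP s t.
  rewrite nrm_sub distrC; apply: le_trans (vb_le hV x s1 st t0) _.
  by rewrite ler_wpM2r ?nrm_ge0 // ler_norm.
apply: le_trans (vb_le hV x t1 (ltW ts) s0) _.
by rewrite ler_wpM2r ?nrm_ge0 // ler_norm.
Qed.

(** [zeta] may be discontinuous in [t], but [zeta_diff] bounds its differences by those of [V];
    sampling along the level sets of [V] therefore approximates it. *)
Lemma strongly_measurable_zeta (g : R -> X) : strongly_measurable g ->
  strongly_measurable (fun t => zeta t (g t)).
Proof.
move=> mg; have mI : measurable I by exact: measurable_itv.
apply: (strongly_measurable_grid (F := zeta) (W := V) (M := V 0)) => //.
- exact: measurable_V.
- by move=> t It; rewrite V_ge0 // V_le.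
- by move=> t It x y; exact: zetaB.
- by exists C0 => t It x; exact: zC.
- move=> t x It e e0.
  have x1 : 0 < nrm x + 1 by rewrite ltr_wpDl // nrm_ge0.
  exists (e / (nrm x + 1)); first by rewrite divr_gt0.
  move=> s Is; rewrite ler_pdivlMr // => hs.
  have main := zeta_diff x Is It.
  apply: le_trans main (le_trans _ hs).
  by rewrite ler_wpM2l // lerDl.
Qed.

Lemma zeta_bochner_integrable (g : R -> X) : bochner_integrable g ->
  bochner_integrable (fun t => zeta t (g t)).
Proof.
move=> [mg jg]; apply: (bochner_integrable_le (h := fun t => C0 * nrm (g t))).
- exact: strongly_measurable_zeta.
- by move=> t It; exact: zC.
- by apply: integrable_onZ; first exact: measurable_itv.
Qed.

Section OneFunction.
Variables (F g H : R -> X).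
Hypotheses (sg : sq_integrable g) (pF : primitive (q := q) F g).
Hypothesis pH : primitive (q := q) H (fun t => zeta t (g t)).
Let jg := sq_integrable_bochner sg.

Lemma integrable_V_diff c : I c ->
  integrable_on I (fun r => `|V c - V r| * nrm (g r)).
Proof.
move=> Ic; have mI : measurable I by exact: measurable_itv.
apply: (integrable_on_le (g := fun r => V 0 * nrm (g r))) => //.
- apply: measurable_funM; last exact: strongly_measurable_nrm' jg.1.
  apply: measurableT_comp => //; apply: measurable_funB => //; exact: measurable_V.
- move=> r Ir; rewrite ger0_norm ?mulr_ge0 ?nrm_ge0 // ler_wpM2r ?nrm_ge0 //.
  rewrite ler_norml; have := V_ge0 Ic; have := V_ge0 Ir; have := V_le Ic; have := V_le Ir.
  by move=> h1 h2 h3 h4; apply/andP; split; lra.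
- by apply: integrable_onZ => //; exact: jg.2.
Qed.

(** With [c] frozen, [zeta c (F r) - H r] is a primitive of [zeta c (g r) - zeta r (g r)]. *)
Lemma stieltjes_piece c s t : I c -> -1 <= s -> s <= t -> t <= 0 ->
  nrm (zeta c (F t - F s) - (H t - H s)) <=
  \int[mu]_(r in `[s, t]) (`|V c - V r| * nrm (g r)).
Proof.
move=> Ic s1 st t0.
have mI : measurable I by exact: measurable_itv.
have sI := sub_itvI s1 t0.
have jz := zeta_bochner_integrable jg.
have jc : bochner_integrable (fun r => zeta c (g r)).
  apply: (bochner_integrable_le (h := fun t => C0 * nrm (g t))).
  - apply: (strongly_measurable_comp (h := zeta c)) jg.1 => u x ux e e0.
    have D0 : 0 < C0 + 1 by rewrite ltr_wpDl.
    have [n0 hn] := ux _ (divr_gt0 e0 D0); exists n0 => n nn; rewrite -zetaB //.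
    apply: le_trans (zC _ Ic) _; have := hn n nn; rewrite ler_pdivlMr //.
    by have := nrm_ge0 (u n - x); move: (nrm _) => a; nra.
  - by move=> r Ir; exact: zC.
  - by apply: integrable_onZ => //; exact: jg.2.
have pc : primitive (q := q) (fun r => zeta c (F r)) (fun r => zeta c (g r)).
  by apply: (primitive_map hX (C := C0)) pF => //; [move=> *; exact: zD|move=> *; exact: zZ|move=> *; exact: zC].
have jd := bochner_integrableB jc jz.
have pd : primitive (q := q) (fun r => zeta c (F r) - H r) (fun r => zeta c (g r) - zeta r (g r)).
  move=> w a b a1 ab b0; rewrite subrACA (ripBl hq) pc // pH //.
  have bw := bounded_functional_ip hX w.
  rewrite -RintB //; last 2 first.
  - by apply: integrable_on_itv => //; exact: bfun_integrable bw jc.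
  - by apply: integrable_on_itv => //; exact: bfun_integrable bw jz.
  by apply: eq_Rint => r _; rewrite (ripBl hq).
rewrite zetaB // -subrACA; apply: le_trans (nrm_primitive hX jd pd s1 st t0) _.
apply: le_Rint => //.
- exact: integrable_on_itv jd.2.
- by apply: integrable_on_itv => //; exact: integrable_V_diff.
- by move=> r /sI Ir; exact: zeta_diff.
Qed.

(* [t |-> zeta t (F t) - H t] is the indefinite Stieltjes integral of [F], by
   integration by parts. *)
Lemma stieltjes_local s t xi : -1 <= s -> s <= xi -> xi <= t -> t <= 0 ->
  nrm (zeta t (F xi) - zeta s (F xi) -
    (zeta t (F t) - H t - (zeta s (F s) - H s))) <=
  (V t - V s) * \int[mu]_(r in `[s, t]) nrm (g r).
Proof.
move=> s1 sx xt t0.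
have st := le_trans sx xt; have x1 := le_trans s1 sx; have x0 := le_trans xt t0.
have It : I t by rewrite /= in_itv /= t0 (le_trans s1 st).
have Is : I s by rewrite /= in_itv /= s1 (le_trans st t0).
have h1 := stieltjes_piece It x1 xt t0; have h2 := stieltjes_piece Is s1 sx x0.
(* The tag splits the interval: [zeta t] is frozen to its right and [zeta s] to its left. *)
have -> : zeta t (F xi) - zeta s (F xi) - (zeta t (F t) - H t - (zeta s (F s) - H s)) =
  - (zeta t (F t - F xi) - (H t - H xi)) - (zeta s (F xi - F s) - (H xi - H s)).
  rewrite !zetaB //; move: (zeta t (F t)) (zeta t (F xi)) (zeta s (F xi)) (zeta s (F s)) => a b c d.
  move: (H t) (H s) (H xi) => u v w; rewrite !opprB.
  rewrite [RHS]addrACA [u - w + _]addrA subrK.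
  by rewrite [LHS](AC (2*(2*2)) ((5*4)*((1*6)*(3*2)))).
apply: le_trans (nrmD _ _) _; rewrite !nrmN.
apply: le_trans (lerD h1 h2) _.
have jn (a b : R) : -1 <= a -> b <= 0 -> integrable_on `[a, b] (fun r => nrm (g r)).
  by move=> a1 b0; apply: integrable_on_itv => //; exact: jg.2.
have i0 := Rintegral_split (jn s t s1 t0) (introT andP (conj sx xt)).
have k1 : \int[mu]_(r in `[xi, t]) (`|V t - V r| * nrm (g r)) <=
    (V t - V s) * \int[mu]_(r in `[xi, t]) nrm (g r).
  rewrite -RintZ //; last exact: jn.
  apply: le_Rint => //.
  - by apply: integrable_on_itv => //; exact: integrable_V_diff.
  - by apply: integrable_onZ => //; exact: jn.
  move=> r; rewrite /= in_itv /= => /andP[r1 r2]; rewrite ler_wpM2r ?nrm_ge0 //.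
  rewrite ger0_norm ?subr_ge0; last exact: (vb_mono hV).
  by rewrite lerD2l lerN2; apply: (vb_mono hV); exact: le_trans r1.
have k2 : \int[mu]_(r in `[s, xi]) (`|V s - V r| * nrm (g r)) <=
    (V t - V s) * \int[mu]_(r in `[s, xi]) nrm (g r).
  rewrite -RintZ //; last exact: jn.
  apply: le_Rint => //.
  - by apply: integrable_on_itv => //; exact: integrable_V_diff.
  - by apply: integrable_onZ => //; exact: jn.
  move=> r; rewrite /= in_itv /= => /andP[r1 r2]; rewrite ler_wpM2r ?nrm_ge0 //.
  rewrite distrC ger0_norm ?subr_ge0; last exact: (vb_mono hV).
  by rewrite lerD2r; apply: (vb_mono hV); exact: le_trans xt.
by rewrite i0 mulrDr addrC; exact: lerD.
Qed.

(** The indefinite integral telescopes. Each piece errs by at most the increment of [V] times the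
    integral of [nrm (g r)] over a short interval. The latter is uniformly small, so a large jump of
    [V] inside one piece does no harm. *)
Lemma is_stieltjes_primitive : is_stieltjes zeta F
  (zeta 0 (F 0) - zeta (-1) (F (-1)) - (H 0 - H (-1))).
Proof.
move=> e e0; have V0 := V_ge0 I0.
have D0 : 0 < 2 * (V 0 + 1) by rewrite mulr_gt0 // ltr_wpDl.
have e'0 := divr_gt0 e0 D0; have [e' E'] : exists e', e' = e / (2 * (V 0 + 1)) by exists (e / (2 * (V 0 + 1))).
rewrite -E' in e'0.
have [d d0 hd] := Rint_small (fun t _ => nrm_ge0 (g t)) jg.2 sg.2 e'0.
exists d => // s xi p hs hp.
have [p0 pn pm pI] := partition_nth hs.
have inI i : (i <= size s)%N -> I (p i) by move=> si; rewrite /= in_itv /= pI.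
pose J t := zeta t (F t) - H t.
have -> : zeta 0 (F 0) - zeta (-1) (F (-1)) - (H 0 - H (-1)) =
    \sum_(0 <= i < size s) (J (p i.+1) - J (p i)).
  by rewrite (telescope_sumr (fun i => J (p i))) // /J /p p0 pn subrACA.
rewrite -sumrB.
have bnd i : (i < size s)%N -> nrm ((zeta (p i.+1) - zeta (p i)) (F (xi i)) -
    (J (p i.+1) - J (p i))) <= (V (p i.+1) - V (p i)) * e'.
  move=> si; have [h1 /andP[h2 h3]] := hp i si.
  have /andP[a1 a0] := pI i (ltnW si); have /andP[b1 b0] := pI i.+1 si.
  apply: le_trans (stieltjes_local a1 h2 h3 b0) _.
  rewrite ler_wpM2l ?subr_ge0 ?(vb_mono hV) ?pm //; apply: hd => //; [exact: pm|exact: ltW].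
have nsum (h : nat -> X) n : nrm (\sum_(0 <= i < n) h i) <= \sum_(0 <= i < n) nrm (h i).
  elim: n => [|n ih]; first by rewrite !big_nil nrm0.
  by rewrite !big_nat_recr //=; apply: le_trans (nrmD _ _) _; rewrite lerD2r.
apply: le_lt_trans (nsum _ _) _.
apply: (@le_lt_trans _ _ (\sum_(0 <= i < size s) (V (p i.+1) - V (p i)) * e')).
  by rewrite big_nat [leRHS]big_nat; apply: ler_sum => i /andP[_ si]; exact: bnd.
rewrite -mulr_suml (telescope_sumr (fun i => V (p i))) // /p p0 pn (vb_left hV) subr0.
by rewrite E' mulrA ltr_pdivrMr // mulrC ltr_pM2l //; lra.
Qed.
End OneFunction.

End Stieltjes.

(** * Linearity and bounds of the Stieltjes integral *)

Section StieltjesBounds.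
Context {R : realType} {K : scalars R} {X : normedModType K} {q : X -> X -> R}.
Hypothesis hX : hilbert q.
Notation mu := (@lebesgue_measure R).
Notation I := (`[-1, 0]%classic : set R).
Variables (zeta : R -> X -> X) (V : R -> R).
Hypothesis zD : forall t x y, I t -> zeta t (x + y) = zeta t x + zeta t y.
Hypothesis zZ : forall t (k : K) x, I t -> zeta t (k *: x) = k *: zeta t x.
Variable C0 : R.
Hypothesis C0_ge0 : 0 <= C0.
Hypothesis zC : forall t x, I t -> nrm (zeta t x) <= C0 * nrm x.
Hypothesis hV : variation_bound zeta V.
Let hq := hilbert_ip hX.
Let zZr t (a : R) x : I t -> zeta t (ofR a *: x) = ofR a *: zeta t x := zZ (ofR a) x.
Let I0 : I 0. Proof. by rewrite /= in_itv /= lexx lerN10. Qed.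

Lemma partition_in_I (s : seq R) i : itv_partition (-1) 0 s -> (i <= size s)%N ->
  I (nth 0 (-1 :: s) i).
Proof. by move=> hs si; have [_ _ _ h] := partition_nth hs; rewrite /= in_itv /= h. Qed.

Lemma tag_in_I (s : seq R) (xi : R) i : itv_partition (-1) 0 s -> (i < size s)%N ->
  nth 0 (-1 :: s) i <= xi <= nth 0 (-1 :: s) i.+1 -> I xi.
Proof.
move=> hs si /andP[h1 h2].
have := partition_in_I hs (ltnW si); have := partition_in_I hs si.
rewrite /= !in_itv /= => /andP[_ h3] /andP[h4 _].
by rewrite (le_trans h4 h1) (le_trans h2 h3).
Qed.

Lemma is_stieltjes_exists F g : sq_integrable g -> primitive (q := q) F g ->
  exists v, is_stieltjes zeta F v.
Proof.
move=> sg pF.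
have [H pH] := primitive_exists hX (zeta_bochner_integrable zD zZr zC hV (sq_integrable_bochner sg)).
exists (zeta 0 (F 0) - zeta (-1) (F (-1)) - (H 0 - H (-1))).
exact: (is_stieltjes_primitive hX zD zZr C0_ge0 zC hV sg pF pH).
Qed.

Lemma is_stieltjes_lin (k : K) F G H v w : (forall t, I t -> H t = k *: F t + G t) ->
  is_stieltjes zeta F v -> is_stieltjes zeta G w -> is_stieltjes zeta H (k *: v + w).
Proof.
move=> HE hv hw e e0.
have D0 : 0 < 2 * (re `|k| + 1) by rewrite mulr_gt0 // ltr_wpDl // re_norm_ge0.
have [d1 d10 h1] := hv _ (divr_gt0 e0 D0).
have e2 : 0 < e / 2 by rewrite divr_gt0.
have [d2 d20 h2] := hw _ e2.
exists (Num.min d1 d2); first by rewrite lt_min d10.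
move=> s xi p hs hp.
have {}h1 := h1 s xi hs; have {}h2 := h2 s xi hs; cbv zeta in h1, h2.
have /h1 {}h1 : forall i, (i < size s)%N -> p i.+1 - p i < d1 /\ p i <= xi i <= p i.+1.
  by move=> i si; have [] := hp i si; rewrite lt_min => /andP[].
have /h2 {}h2 : forall i, (i < size s)%N -> p i.+1 - p i < d2 /\ p i <= xi i <= p i.+1.
  by move=> i si; have [] := hp i si; rewrite lt_min => /andP[].
have -> : \sum_(0 <= i < size s) (zeta (p i.+1) - zeta (p i)) (H (xi i)) =
    k *: (\sum_(0 <= i < size s) (zeta (p i.+1) - zeta (p i)) (F (xi i))) +
    \sum_(0 <= i < size s) (zeta (p i.+1) - zeta (p i)) (G (xi i)).
  rewrite scaler_sumr -big_split /=; apply: eq_big_nat => i /andP[_ si].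
  have [_ hx] := hp i si; have Ix := tag_in_I hs si hx.
  have Ip := partition_in_I hs (ltnW si); have Ip' := partition_in_I hs si.
  rewrite -![(zeta _ - zeta _) _]/(zeta _ _ - zeta _ _) HE // !zD // !zZ //.
  by rewrite scalerBr opprD addrACA.
move: h1 h2; move: (\sum_(_ <= _ < _) _) (\sum_(_ <= _ < _) _) => S T h1 h2.
rewrite opprD addrACA -scalerBr; apply: le_lt_trans (nrmD _ _) _; rewrite nrmZ.
have k0 := re_norm_ge0 k.
rewrite ltr_pdivlMr // in h1.
have n0 := nrm_ge0 (S - v).
move: (re _) (nrm (S - v)) (nrm (T - w)) k0 n0 h1 h2 => a b c a0 b0 h1 h2.
by nra.
Qed.

Lemma is_stieltjes_ext F G v : (forall t, I t -> G t = F t) ->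
  is_stieltjes zeta F v -> is_stieltjes zeta G v.
Proof.
move=> GF hv e e0; have [d d0 h] := hv e e0; exists d => // s xi p hs hp.
rewrite (eq_big_nat _ _ (F2 := fun i => (zeta (p i.+1) - zeta (p i)) (F (xi i)))).
  exact: h.
by move=> i /andP[_ si]; rewrite GF //; have [_] := hp i si; exact: tag_in_I.
Qed.

Lemma nrm_stieltjes_sum (F : R -> X) (s : seq R) : itv_partition (-1) 0 s ->
  nrm (\sum_(0 <= i < size s)
    (zeta (nth 0 (-1 :: s) i.+1) - zeta (nth 0 (-1 :: s) i)) (F (nth 0 (-1 :: s) i.+1))) <=
  \sum_(0 <= i < size s) (V (nth 0 (-1 :: s) i.+1) - V (nth 0 (-1 :: s) i)) *
    nrm (F (nth 0 (-1 :: s) i.+1)).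
Proof.
move=> hs; have nsum (h : nat -> X) n : nrm (\sum_(0 <= i < n) h i) <= \sum_(0 <= i < n) nrm (h i).
  elim: n => [|n ih]; first by rewrite !big_nil nrm0.
  by rewrite !big_nat_recr //=; apply: le_trans (nrmD _ _) _; rewrite lerD2r.
apply: le_trans (nsum _ _) _.
rewrite big_nat [leRHS]big_nat; apply: ler_sum => i /andP[_ si].
have [_ _ pm pI] := partition_nth hs.
have /andP[a1 _] := pI i (ltnW si); have /andP[_ b0] := pI i.+1 si.
by apply: (vb_le hV) => //; exact: pm.
Qed.

Lemma V_telescope (s : seq R) (c : R) : itv_partition (-1) 0 s ->
  \sum_(0 <= i < size s) (V (nth 0 (-1 :: s) i.+1) - V (nth 0 (-1 :: s) i)) * c = V 0 * c.
Proof.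
move=> hs; have [p0 pn _ _] := partition_nth hs.
rewrite -mulr_suml (telescope_sumr (fun i => V (nth 0 (-1 :: s) i))) //.
by rewrite p0 pn (vb_left hV) subr0.
Qed.

Lemma is_stieltjes_bound F v C : is_stieltjes zeta F v ->
  (forall t, I t -> nrm (F t) <= C) -> nrm v <= V 0 * C.
Proof.
move=> hv hC; apply: (is_stieltjes_le (B := fun=> V 0 * C) hv) => [e e0|s hs].
  by exists 1 => // s _ p _; rewrite ltrDl.
apply: le_trans (nrm_stieltjes_sum F hs) _; rewrite -(V_telescope C hs).
rewrite big_nat [leRHS]big_nat; apply: ler_sum => i /andP[_ si].
apply: ler_wpM2l; last by apply: hC; exact: partition_in_I.
by rewrite subr_ge0; apply: (vb_mono hV); have [_ _ h _] := partition_nth hs; exact: h.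
Qed.

(** [V] is regarded as operator valued on the real line, acting by multiplication. Then
    [is_stieltjes_primitive] is integration by parts for [dV], and [V (-1) = 0] removes the boundary
    term on the left. *)
Lemma real_stieltjes (phi dphi : R -> R) :
  @sq_integrable R (real_scalars R) R^o dphi ->
  (forall s t, -1 <= s -> s <= t -> t <= 0 ->
    phi t - phi s = \int[mu]_(r in `[s, t]) dphi r) ->
  @is_stieltjes R (real_scalars R) R^o (fun t (x : R) => V t * x : R) phi
    (V 0 * phi 0 - \int[mu]_(r in I) (V r * dphi r)).
Proof.
move=> sd hphi.
pose z (t : R) (x : R^o) : R^o := V t * x.
have zDr t x y : I t -> z t (x + y) = z t x + z t y by move=> _; rewrite /z mulrDr.
have zZr' t (a : R) x : I t -> z t (ofR (s := real_scalars R) a *: x) = ofR (s := real_scalars R) a *: z t x.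
  by move=> _; rewrite /z; exact: mulrCA.
have V0 : 0 <= V 0 by apply: V_ge0 hV _ I0.
have nE (y : R^o) : @nrm R (real_scalars R) R^o y = `|y : R| by [].
have zCr t x : I t -> @nrm R (real_scalars R) R^o (z t x) <= V 0 * @nrm R (real_scalars R) R^o x.
  move=> It; rewrite !nE /z normrM ler_wpM2r //.
  by rewrite ger0_norm ?(V_ge0 hV It) // (V_le hV It).
have vbr : variation_bound (X := R^o) (K := real_scalars R) z V.
  split; [exact: vb_left hV|exact: (vb_mono hV)|].
  move=> s t x s1 st t0; rewrite !nE /z -mulrBl normrM.
  by rewrite ger0_norm // subr_ge0; exact: (vb_mono hV).
have pphi : @primitive R (real_scalars R) R^o (fun a b : R => a * b) phi dphi.
  move=> w s t s1 st t0; rewrite hphi // mulrC -RintZ //; last first.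
    by apply: integrable_on_itv => //; exact: real_integrable_nrm.
  by apply: eq_Rint => r _; rewrite mulrC.
have jz := @zeta_bochner_integrable R (real_scalars R) R^o z V zDr zZr' (V 0) zCr vbr dphi (sq_integrable_bochner sd).
have [H pH] := primitive_exists (@hilbert_real R) jz.
have := @is_stieltjes_primitive R (real_scalars R) R^o _ (@hilbert_real R) z V zDr zZr' (V 0) V0 zCr vbr _ _ _ sd pphi pH.
have := pH 1 (-1) 0 (lexx _) (@lerN10 R) (lexx _); rewrite mulr1 => ->.
have zE x : z (-1) x = 0 by rewrite /z (vb_left hV) mul0r.
rewrite zE subr0.
rewrite (eq_Rint (f := fun r => z r (dphi r) * 1) (g := fun r => V r * dphi r)) //.
by move=> r _; rewrite mulr1.
Qed.

Lemma sq_integrable_energy F g : sq_integrable g -> primitive (q := q) F g ->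
  @sq_integrable R (real_scalars R) R^o (fun r => 2 * q (g r) (F r)).
Proof.
move=> sg pF; have mI : measurable I by exact: measurable_itv.
have jg := sq_integrable_bochner sg.
have [C hC] := primitive_bounded hX jg pF.
have mF := primitive_strongly_measurable hX sg pF.
have m : @strongly_measurable R (real_scalars R) R^o (fun r => 2 * q (g r) (F r)).
  refine (@strongly_measurable_comp2 R K K (real_scalars R) X X R^o (fun x y => 2 * q x y) g F _ sg.1 mF).
  move=> u w x y ux wy e e0.
  pose D := nrm x + nrm y + 1.
  have D0 : 0 < D by rewrite ltr_wpDl // addr_ge0 // nrm_ge0.
  pose d := Num.min 1 (e / (4 * D)).
  have d0 : 0 < d by rewrite lt_min ltr01 divr_gt0 // mulr_gt0.
  have [n1 h1] := ux d d0; have [n2 h2] := wy d d0.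
  exists (maxn n1 n2) => n; rewrite geq_max => /andP[/h1 xn /h2 yn].
  rewrite -[leLHS]/(`|2 * q (u n) (w n) - 2 * q x y|).
  have -> : 2 * q (u n) (w n) - 2 * q x y = 2 * (q (u n - x) (w n) + q x (w n - y)).
    by rewrite (ripBl hq) (ripBr hq); ring.
  have c1 := hilbert_cs hX (u n - x) (w n); have c2 := hilbert_cs hX x (w n - y).
  have wn : nrm (w n) <= D.
    have := nrmD (w n - y) y; rewrite subrK; have := nrm_ge0 x.
    have : d <= 1 by rewrite ge_min lexx.
    by rewrite /D; lra.
  have xD : nrm x <= D by rewrite /D; have := nrm_ge0 y; lra.
  have dD : d * D <= e / 4.
    by rewrite -ler_pdivlMr // -mulrA -invfM /d ge_min lexx orbT.
  have t1 : nrm (u n - x) * nrm (w n) <= d * D by apply: ler_pM; rewrite ?nrm_ge0.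
  have t2 : nrm x * nrm (w n - y) <= D * d by apply: ler_pM; rewrite ?nrm_ge0.
  rewrite normrM ger0_norm //; have := ler_normD (q (u n - x) (w n)) (q x (w n - y)).
  by lra.
apply: (sq_integrable_le (k := fun r => 4 * C ^+ 2 * nrm (g r) ^+ 2)) => //.
  move=> r Ir; rewrite -[leLHS]/(`|2 * q (g r) (F r)| ^+ 2).
  have h1 := hilbert_cs hX (g r) (F r); have h2 := hC r Ir.
  have h3 : nrm (g r) * nrm (F r) <= nrm (g r) * C by rewrite ler_wpM2l ?nrm_ge0.
  have -> : 4 * C ^+ 2 * nrm (g r) ^+ 2 = (2 * (nrm (g r) * C)) ^+ 2 by ring.
  have C1 : 0 <= C by apply: le_trans h2; exact: nrm_ge0.
  apply: lerXn2r; rewrite ?nnegrE ?mulr_ge0 ?nrm_ge0 //.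
  by rewrite normrM ger0_norm // ler_pM2l //; exact: le_trans h1 h3.
by apply: integrable_onZ => //; exact: sg.2.
Qed.

(* Young's inequality on the right-tagged sums, with [nrm x] replaced by a positive
   parameter since it may vanish. *)
Lemma is_stieltjes_young F g v (x : X) : sq_integrable g -> primitive (q := q) F g ->
  is_stieltjes zeta F v ->
  2 * (nrm v * nrm x) <= V 0 * nrm x ^+ 2 +
    (V 0 * nrm (F 0) ^+ 2 - \int[mu]_(r in I) (V r * (2 * q (g r) (F r)))).
Proof.
move=> sg pF hv.
have V0 : 0 <= V 0 by apply: V_ge0 hV _ I0.
have [jr rule] := primitive_rule hX sg sg pF pF.
have := @real_stieltjes (fun t => nrm (F t) ^+ 2) _ (sq_integrable_energy sg pF).
have hphi s t : -1 <= s -> s <= t -> t <= 0 -> nrm (F t) ^+ 2 - nrm (F s) ^+ 2 =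
    \int[mu]_(r in `[s, t]) (2 * q (g r) (F r)).
  move=> s1 st t0; rewrite !(hilbert_nrm hX) rule //.
  by apply: eq_Rint => r _; rewrite (rip_sym hq (F r)); ring.
move=> /(_ hphi) hW; set W := _ - _ in hW *.
have main a : 0 < a -> 2 * (nrm v * a) <= V 0 * a ^+ 2 + W.
  move=> a0.
  (* Termwise [b <= (a + b ^+ 2 / a) / 2]. The squares form a Stieltjes sum of [nrm (F t) ^+ 2]
     against [V], which converges to [W]. *)
  pose B (s : seq R) := \sum_(0 <= i < size s) (V (nth 0 (-1 :: s) i.+1) - V (nth 0 (-1 :: s) i)) *
    ((a + nrm (F (nth 0 (-1 :: s) i.+1)) ^+ 2 / a) / 2).
  have BE s : itv_partition (-1) 0 s -> B s = (V 0 * a + (\sum_(0 <= i < size s)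
      (V (nth 0 (-1 :: s) i.+1) - V (nth 0 (-1 :: s) i)) * nrm (F (nth 0 (-1 :: s) i.+1)) ^+ 2) / a) / 2.
    move=> hs; rewrite -(V_telescope a hs) mulr_suml -big_split /= mulr_suml.
    apply: eq_bigr => i _; rewrite mulrA mulrDr [in LHS]mulrA //.
  have : nrm v <= (V 0 * a + W / a) / 2.
    apply: (is_stieltjes_le (B := B) hv) => [e e0|s hs].
      have ea : 0 < e * a by rewrite mulr_gt0.
      have [d d0 hd] := hW _ ea; exists d => // s hs p hp.
      have {}hd := hd s (fun i => p i.+1) hs; cbv zeta in hd.
      have /hd {}hd : forall i, (i < size s)%N -> p i.+1 - p i < d /\ p i <= p i.+1 <= p i.+1.
        move=> i si; split; first exact: hp.
        by rewrite lexx andbT; have [_ _ h _] := partition_nth hs; exact: h.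
      rewrite BE //.
      have SE : \sum_(0 <= i < size s) ((fun t (x : R) => V t * x : R) (p i.+1) - (fun t (x : R) => V t * x : R) (p i)) (nrm (F (p i.+1)) ^+ 2) =
        \sum_(0 <= i < size s) (V (p i.+1) - V (p i)) * nrm (F (p i.+1)) ^+ 2.
        by apply: eq_bigr => i _; rewrite mulrBl.
      move: hd; rewrite SE -/p; move: (\sum_(_ <= _ < _) _) => S hd.
      have {}hd : `|S - W| < e * a by [].
      have : S < W + e * a by have := ler_norm (S - W); lra.
      rewrite -(ltr_pM2r (x := a^-1)) ?invr_gt0 // mulrDl mulfK ?gt_eqF //.
      by move: (S / a) (W / a) => S' W' h; lra.
    apply: le_trans (nrm_stieltjes_sum F hs) _; rewrite /B big_nat [leRHS]big_nat.
    apply: ler_sum => i /andP[_ si]; apply: ler_wpM2l.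
      by rewrite subr_ge0; apply: (vb_mono hV); have [_ _ h _] := partition_nth hs; exact: h.
    move: (nrm (F _)) => b.
    rewrite ler_pdivlMr // -(ler_pM2r a0) mulrDl divfK ?gt_eqF //.
    by have := sqr_ge0 (b - a); rewrite sqrrB !expr2; lra.
  move=> h; have := ler_wpM2r (ltW (mulr_gt0 (ltr0Sn R 1) a0)) h.
  have -> : (V 0 * a + W / a) / 2 * (2 * a) = V 0 * a ^+ 2 + W.
    by field; rewrite gt_eqF.
  by rewrite mulrCA.
have [x0|x0] := eqVneq (nrm x) 0; last first.
  by apply: main; rewrite lt_neqAle eq_sym x0 nrm_ge0.
(* For [nrm x = 0] the claim is [0 <= W], obtained by letting [a] tend to zero. *)
rewrite x0 expr0n /= !mulr0 add0r; apply/ler_addgt0Pl => e e0.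
have D0 : 0 < V 0 + 1 by rewrite ltr_wpDl.
pose a := Num.min 1 (e / (V 0 + 1)).
have a0 : 0 < a by rewrite lt_min ltr01 divr_gt0.
have a1 : a <= 1 by rewrite ge_min lexx.
have a2 : a * (V 0 + 1) <= e by rewrite -ler_pdivlMr // /a ge_min lexx orbT.
have := main a a0; have : 0 <= nrm v * a by rewrite mulr_ge0 ?nrm_ge0 // ltW.
move: (nrm v * a) => u u0 h.
have : V 0 * a ^+ 2 <= e.
  rewrite expr2 mulrA; apply: (@le_trans _ _ (V 0 * a)).
    by rewrite ler_piMr // mulr_ge0 // ltW.
  by apply: le_trans a2; rewrite mulrDr mulr1 mulrC lerDl ltW.
by lra.
Qed.

End StieltjesBounds.

(** * Generators of contraction semigroups *)

Lemma continuous_antiderivative (R : realType) (f : R -> R) : continuous f ->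
  (forall x : R, x <= 0 -> f x = f 0) ->
  exists F : R -> R, forall x : R, is_derive x 1 F (f x).
Proof.
move=> cf f0.
have cf0 : continuous (fun x : R => f x - f 0).
  by move=> x; apply: cvgB; [exact: cf|exact: cvg_cst].
have [|F [dF _ _]] := primitive_from_left cf0.
  by move=> x x0; rewrite f0 // subrr.
exists (F + (fun x : R => f 0 * x)) => x.
have -> : f x = (f x - f 0) + f 0 * 1 by rewrite mulr1 subrK.
exact: is_deriveD (dF x) (is_deriveZ (f 0) (is_derive_id x 1)).
Qed.

(** Multiply by [1 - u], as for [expR_le_1D2x]. The quadratic remainder is what makes the difference
    quotient of [expR (lam * h)] at [0] converge to [lam]. *)
Lemma expR_le_quadratic (R : realType) (u : R) : 0 <= u -> u <= 1 / 2 ->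
  expR u <= 1 + u + 2 * u ^+ 2.
Proof.
move=> u0 u2; have u1 : 0 < 1 - u by lra.
have h := expR_ge1Dx (- u).
have h1 : expR u * (1 - u) <= 1.
  by rewrite -[leRHS](expRxMexpNx_1 u) ler_wpM2l ?expR_ge0.
rewrite -(ler_pM2r u1); apply: le_trans h1 _.
have -> : (1 + u + 2 * u ^+ 2) * (1 - u) = 1 + u ^+ 2 * (1 - 2 * u) by ring.
by rewrite lerDl mulr_ge0 ?sqr_ge0 //; lra.
Qed.

Section FixedPoint.
Context {R : realType} {K : scalars R} {Y : lmodType K} {q : Y -> Y -> R}.
Hypotheses (hq : real_ip q) (q_complete : ncomplete (qnorm q)).

(** A Neumann series, summed by iterating [x] to [y + L x]. *)
Lemma contraction_range (L : Y -> Y) (c : R) : 0 <= c < 1 ->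
  (forall x y, L (x - y) = L x - L y) -> (forall x, qnorm q (L x) <= c * qnorm q x) ->
  forall y, exists x, x - L x = y.
Proof.
move=> c01 LB Lc y; have /andP[c0 c1] := c01.
pose u := fix u n := if n is n'.+1 then y + L (u n') else y : Y.
have step n : qnorm q (u n.+1 - u n) <= qnorm q (L y) * c ^+ n.
  elim: n => [|n ih]; first by rewrite /= addrC addKr expr0 mulr1.
  rewrite [u n.+2]/= [in X in _ - X]/= opprD addrACA subrr add0r -LB.
  apply: le_trans (Lc _) _; rewrite exprS mulrCA ler_wpM2l //.
have [x hx] := q_complete (geometric_ncauchy hq (qnorm_ge0 _ _) c01 (ex_intro _ 0%N (fun n _ => step n))).
exists x; have hLx := nlim_bnd c0 LB Lc hx.
have hs : nlim (qnorm q) (fun n => u n.+1) x.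
  by move=> e e0; have [n0 hn] := hx e e0; exists n0 => n nn; apply: hn; exact: leqW.
have h2 : nlim (qnorm q) (fun n => u n.+1) (y + L x).
  exact: nlimD (nlim_cst hq y) hLx.
by rewrite {1}(nlim_unique hq hs h2) addrK.
Qed.

End FixedPoint.

Section ContractionGenerator.
Context {R : realType} {K : scalars R} {X : normedModType K} {q : X -> X -> R}.
Hypothesis hX : hilbert q.
Notation mu := (@lebesgue_measure R).
Notation I := (`[-1, 0]%classic : set R).
Let hq := hilbert_ip hX.
Variables (B : operator X) (S : R -> X -> X) (m : R).
Hypothesis S_c0 : c0_semigroup nrm S.
Hypothesis S_gen : generator nrm S B.
Hypothesis S_contr : forall t, 0 <= t -> opnorm nrm (S t) <= expR (m * t).
Implicit Types x y z : X.

Lemma S_lin t (k : K) x y : 0 <= t -> S t (k *: x + y) = k *: S t x + S t y.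
Proof. by move=> /(c0_bounded S_c0) [h _]; exact: h. Qed.

Lemma S_0 t : 0 <= t -> S t 0 = 0.
Proof. by move=> t0; have := S_lin (-1) 0 0 t0; rewrite scaler0 addr0 scaleN1r addNr. Qed.

Lemma S_scale t (k : K) x : 0 <= t -> S t (k *: x) = k *: S t x.
Proof. by move=> t0; have := S_lin k x 0 t0; rewrite !addr0 S_0 // addr0. Qed.

Lemma S_B t x y : 0 <= t -> S t (x - y) = S t x - S t y.
Proof.
by move=> t0; have := S_lin (-1) y x t0; rewrite !scaleN1r ![- _ + _]addrC.
Qed.

Lemma S_D t x y : 0 <= t -> S t (x + y) = S t x + S t y.
Proof. by move=> t0; have := S_lin 1 x y t0; rewrite !scale1r. Qed.

Lemma S_le t x : 0 <= t -> nrm (S t x) <= expR (m * t) * nrm x.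
Proof.
move=> t0; have [_ h] := nrm_opnorm x (c0_bounded S_c0 t0).
by apply: le_trans h _; rewrite ler_wpM2r ?nrm_ge0 // S_contr.
Qed.

Lemma generatorE x z : (dom B x /\ Defs.oapp B x = z) <->
  forall e : R, 0 < e -> exists2 d, 0 < d & forall h, 0 < h < d ->
    nrm (ofR h^-1 *: (S h x - x) - z) <= e.
Proof.
split=> [/S_gen /cvg_right0P hx e e0|hx].
  have [d d0 hd] := hx e e0; exists d => // h hh.
  exact: le_trans (ler_norm _) (hd h hh).
apply/S_gen; apply/cvg_right0P => e e0; have [d d0 hd] := hx e e0.
by exists d => // h hh; rewrite ger0_norm ?nrm_ge0 // hd.
Qed.

Lemma generator_linear (k : K) x y : dom B x -> dom B y ->
  dom B (k *: x + y) /\ Defs.oapp B (k *: x + y) = k *: Defs.oapp B x + Defs.oapp B y.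
Proof.
move=> Dx Dy; apply/generatorE => e e0.
have D0 : 0 < 2 * (re `|k| + 1) by rewrite mulr_gt0 // ltr_wpDl // re_norm_ge0.
have /generatorE hx := conj Dx (erefl (Defs.oapp B x)).
have /generatorE hy := conj Dy (erefl (Defs.oapp B y)).
have e2 : 0 < e / 2 by rewrite divr_gt0.
have [d1 d10 h1] := hx _ (divr_gt0 e0 D0); have [d2 d20 h2] := hy _ e2.
exists (Num.min d1 d2); first by rewrite lt_min d10.
move=> h /andP[h0]; rewrite lt_min => /andP[hd1 hd2].
have {}h1 := h1 h; have {}h2 := h2 h; rewrite h0 hd1 in h1; rewrite h0 hd2 in h2.
have {}h1 := h1 isT; have {}h2 := h2 isT.
rewrite S_lin ?(ltW h0) //.
have -> : ofR h^-1 *: (k *: S h x + S h y - (k *: x + y)) - (k *: Defs.oapp B x + Defs.oapp B y) =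
  k *: (ofR h^-1 *: (S h x - x) - Defs.oapp B x) + (ofR h^-1 *: (S h y - y) - Defs.oapp B y).
  rewrite opprD addrACA -scalerBr scalerDr opprD addrACA; congr (_ + _).
  by rewrite [RHS]scalerBr !scalerA mulrC.
apply: le_trans (nrmD _ _) _; rewrite nrmZ.
rewrite ler_pdivlMr // in h1; have k0 := re_norm_ge0 k.
move: h1 h2; move: (nrm _) (nrm_ge0 (ofR h^-1 *: (S h x - x) - Defs.oapp B x)) (nrm _) => a a0 b h1 h2.
by move: (re _) k0 h1 => r r0 h1; nra.
Qed.

(** By the growth bound, [q (S h x - x) x] is at most [expR (m * h) - 1] times [q x x]. The factor
    [2] and the absolute value come from estimating this exponential by $1 + 2h|m|$ for small
    [h]. *)
Lemma generator_dissipative x : dom B x ->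
  q (Defs.oapp B x) x <= 2 * `|m| * q x x.
Proof.
move=> Dx; have /generatorE hx := conj Dx (erefl (Defs.oapp B x)).
apply/ler_addgt0Pl => e e0.
have x1 : 0 < nrm x + 1 by rewrite ltr_wpDl // nrm_ge0.
have [d d0 hd] := hx _ (divr_gt0 e0 x1).
have m1 : 0 < 2 * (`|m| + 1) by rewrite mulr_gt0 // ltr_wpDl.
pose h := Num.min (d / 2) (1 / (2 * (`|m| + 1))).
have h0 : 0 < h by rewrite lt_min !divr_gt0.
have hdd : h < d by rewrite /h gt_min ltr_pdivrMr // ltr_pMr // ltr1n.
have hm : h * `|m| <= 1 / 2.
  have : h * (2 * (`|m| + 1)) <= 1 by rewrite -ler_pdivlMr // /h ge_min lexx orbT.
  by have := normr_ge0 m; have := h0; nra.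
have {}hd := hd h; rewrite h0 hdd in hd; have {}hd := hd isT.
set z := ofR h^-1 *: (S h x - x) in hd.
have -> : Defs.oapp B x = z - (z - Defs.oapp B x) by rewrite opprB addrC subrK.
rewrite (ripBl hq).
have c1 := hilbert_cs hX (z - Defs.oapp B x) x.
have c2 : nrm (z - Defs.oapp B x) * nrm x <= e.
  move: hd; rewrite ler_pdivlMr // => hd; apply: le_trans hd.
  by rewrite ler_wpM2l ?nrm_ge0 // lerDl.
have c3 := ler_norm (- q (z - Defs.oapp B x) x); rewrite normrN in c3.
have c4 : q z x <= 2 * `|m| * q x x.
  rewrite /z (ripZl hq) (ripBl hq) -(ler_pM2l h0) mulrA divff ?gt_eqF // mul1r.
  have d1 := le_trans (ler_norm _) (hilbert_cs hX (S h x) x).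
  have d2 := S_le x (ltW h0).
  have d3 : expR (m * h) <= 1 + 2 * (h * `|m|).
    apply: (@le_trans _ _ (expR (h * `|m|))).
      by rewrite ler_expR mulrC ler_wpM2l ?(ltW h0) // ler_norm.
    by apply: expR_le_1D2x => //; rewrite mulr_ge0 // ltW.
  have n0 := nrm_ge0 x.
  have d4 : nrm (S h x) * nrm x <= expR (m * h) * nrm x * nrm x by rewrite ler_wpM2r.
  have d5 : expR (m * h) * nrm x * nrm x <= (1 + 2 * (h * `|m|)) * nrm x * nrm x.
    by rewrite !ler_wpM2r.
  rewrite -(hilbert_nrm hX) expr2.
  have -> : h * (2 * `|m| * (nrm x * nrm x)) = (1 + 2 * (h * `|m|)) * nrm x * nrm x - nrm x * nrm x by ring.
  by lra.
by lra.
Qed.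

(** * Surjectivity of [lam - B] *)

Section Resolvent.
Variable lam : R.
Hypothesis lam_ge : `|m| + 1 <= lam.

Let lam0 : 0 < lam. Proof. by apply: lt_le_trans lam_ge; rewrite ltr_wpDl. Qed.
Let mlam : m - lam <= - 1. Proof. by have := ler_norm m; move: lam_ge; lra. Qed.

(** Since [lam] exceeds [m] by at least one, the rescaled semigroup decays like [expR (- t)]; in
    particular [U 1] is a strict contraction. *)
Let U t x := ofR (expR (- (lam * t))) *: S t x.

Let U_le t x : 0 <= t -> nrm (U t x) <= expR (- t) * nrm x.
Proof.
move=> t0; rewrite nrm_ofRZ ger0_norm ?expR_ge0 //.
apply: le_trans (ler_wpM2l (expR_ge0 _) (S_le x t0)) _.
rewrite mulrA -expRD ler_wpM2r ?nrm_ge0 // ler_expR.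
by have := mlam; nra.
Qed.

Let U_contr t x : 0 <= t -> nrm (U t x) <= nrm x.
Proof.
move=> t0; apply: le_trans (U_le x t0) _.
by rewrite ler_piMl ?nrm_ge0 // -[leRHS]expR0 ler_expR oppr_le0.
Qed.

Let U_add s t x : 0 <= s -> 0 <= t -> U (s + t) x = U s (U t x).
Proof.
move=> s0 t0; rewrite /U (c0_add S_c0) // S_scale // scalerA -rmorphM /= -expRD.
by congr (ofR (expR _) *: _); ring.
Qed.

Let U_B t x y : 0 <= t -> U t (x - y) = U t x - U t y.
Proof. by move=> t0; rewrite /U S_B // scalerBr. Qed.

Let U_0 x : U 0 x = x.
Proof. by rewrite /U mulr0 oppr0 expR0 rmorph1 scale1r (c0_id S_c0). Qed.

Let U_small x (e : R) : 0 < e -> exists2 d : R, 0 < d & forall r, 0 <= r <= d -> nrm (U r x - x) <= e.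
Proof.
move=> e0; have x1 : 0 < 2 * lam * (nrm x + 1).
  by rewrite !mulr_gt0 // ltr_wpDl // nrm_ge0.
have e2 : 0 < e / 2 by rewrite divr_gt0.
have := c0_continuous S_c0 x (lexx 0); move/cvgrPdist_le => /(_ _ e2).
move=> /nbhs_ballP[d1 /= d10 hd].
exists (Num.min (d1 / 2) (e / (2 * lam * (nrm x + 1)))).
  by rewrite lt_min !divr_gt0.
move=> r /andP[r0]; rewrite le_min => /andP[rd]; rewrite ler_pdivlMr // => re'.
have h1 : nrm (S r x - x) <= e / 2.
  have := hd r; rewrite sub0r normrN (c0_id S_c0) ger0_norm ?nrm_ge0 //; apply => //.
  rewrite /ball /= sub0r normrN ger0_norm //; apply: le_lt_trans rd _.
  by rewrite ltr_pdivrMr // ltr_pMr // ltr1n.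
have -> : U r x - x = ofR (expR (- (lam * r))) *: (S r x - x) + ofR (expR (- (lam * r)) - 1) *: x.
  by rewrite rmorphB /= rmorph1 scalerBl scale1r scalerBr addrA subrK.
apply: le_trans (nrmD _ _) _; rewrite !nrm_ofRZ ger0_norm ?expR_ge0 //.
have x0 := nrm_ge0 x.
have l1 : expR (- (lam * r)) <= 1 by rewrite -[leRHS]expR0 ler_expR oppr_le0 mulr_ge0 // ltW.
have l2 := expR_ge1Dx (- (lam * r)).
have h2 : expR (- (lam * r)) * nrm (S r x - x) <= e / 2.
  by apply: le_trans h1; rewrite ler_piMl ?nrm_ge0.
have h3 : `|expR (- (lam * r)) - 1| * nrm x <= lam * r * nrm x.
  by rewrite ler_wpM2r // ler0_norm; lra.
have h4 : lam * r * nrm x <= e / 2.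
  have : 0 <= lam * r by rewrite mulr_ge0 // ltW.
  have E : r * (2 * lam * (nrm x + 1)) = 2 * (lam * r * nrm x) + 2 * (lam * r) by ring.
  by lra.
by lra.
Qed.

(** Frozen at negative times, so that orbits are continuous on the whole line and paired orbits have
    antiderivatives there. *)
Let Ue t x := U (Num.max t 0) x.

Let Ue_uniform x (e : R) : 0 < e -> exists2 d : R, 0 < d &
  forall s t, `|s - t| <= d -> nrm (Ue s x - Ue t x) <= e.
Proof.
move=> e0; have [d d0 hd] := U_small x e0; exists d => // s t.
have main a b : b <= a -> a - b <= d -> 0 <= b -> nrm (U a x - U b x) <= e.
  move=> ba abd b0; have ab0 : 0 <= a - b by rewrite subr_ge0.
  have -> : U a x = U b (U (a - b) x) by rewrite -U_add // addrC subrK.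
  rewrite -U_B //; apply: le_trans (U_contr _ b0) _; apply: hd.
  by rewrite ab0.
wlog ts : s t / t <= s.
  move=> h; have [ts|/ltW st] := leP t s; first exact: h.
  by rewrite nrm_sub distrC; exact: h.
rewrite ger0_norm ?subr_ge0 // => st; apply: main.
- by rewrite ge_max !le_max ts lexx !orbT.
- by have [t0|t0] := leP t 0; have [s0|s0] := leP s 0; lra.
- by rewrite le_max lexx orbT.
Qed.

(* Here [z] is the integral of [U r y] over [0,1]; tested against a vector, [U h z]
   becomes an increment of a real antiderivative. *)
Lemma orbit_integral y : exists z, forall h, 0 <= h -> forall (e : R),
  (forall r, 0 <= r <= h -> nrm (U r (U 1 y - y) - (U 1 y - y)) <= e) ->
  nrm (U h z - z - ofR h *: (U 1 y - y)) <= h * e.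
Proof.
(* Bochner integrals live on [[-1, 0]], so the orbit over [[0, 1]] is traversed backwards. *)
pose u s := Ue (- s) y.
have ju : bochner_integrable u.
  apply: (bochner_integrable_le (h := fun=> nrm y)).
  - apply: (strongly_measurable_modulus (W := fun t => t + 1) (M := 1)).
    + by apply: measurable_funD => //; exact: measurable_id.
    + by move=> t; rewrite /= in_itv /= => /andP[t1 t0]; apply/andP; split; lra.
    + move=> t It e e0; have [d d0 hd] := Ue_uniform y e0; exists d => // s _.
      by rewrite opprD addrACA subrr addr0 => sd; apply: hd; rewrite -opprD normrN.
  - by move=> t _; apply: U_contr; rewrite le_max lexx orbT.
  - exact: integrable_on_cst.
exists (bochner u) => h h0 e he.
set z := bochner u; set v := U 1 y - y; set x := U h z - z - ofR h *: v.
pose f t := q (Ue t y) x.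
have cf : continuous f.
  move=> t; apply/cvgrPdist_le => e' e'0.
  have x1 : 0 < nrm x + 1 by rewrite ltr_wpDl // nrm_ge0.
  have [d d0 hd] := Ue_uniform y (divr_gt0 e'0 x1).
  apply/nbhs_ballP; exists d => //= s st.
  rewrite /f -(ripBl hq); apply: le_trans (hilbert_cs hX _ _) _.
  have := hd t s (ltW st); rewrite ler_pdivlMr //; apply: le_trans.
  by rewrite ler_wpM2l ?nrm_ge0 // lerDl.
have [F dF] : exists F : R -> R, forall x : R, is_derive x 1 F (f x).
  apply: continuous_antiderivative cf _ => t t0.
  by rewrite /f /Ue max_r // max_l.
have cF : continuous F by move=> t; exact: is_derive_continuous (dF t).
have shift c : 0 <= c -> q (U c z) x = F (c + 1) - F c.
  move=> c0.
  have E t : I t -> U c (u t) = Ue (c - t) y.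
    rewrite /= in_itv /= => /andP[t1 t0].
    by rewrite /u /Ue -U_add ?le_max ?lexx ?orbT // !max_l //; lra.
  have bl : bounded_functional (nrm x) (fun w => q (U c w) x).
    split.
    - by move=> a b; rewrite -(ripDl hq) /U S_D // scalerDr.
    - move=> a w; rewrite /U S_scale // scalerA -rmorphM mulrC rmorphM -scalerA.
      by rewrite (ripZl hq).
    - move=> w; apply: le_trans (hilbert_cs hX _ _) _; rewrite mulrC ler_wpM2l ?nrm_ge0 //.
      exact: U_contr.
  rewrite (bochner_functional hX bl ju).
  rewrite (eq_Rint (g := fun t => f (c - t))); last by move=> t It; rewrite /f E.
  have dG (t : R) : is_derive t 1 (fun t => - F (c - t)) (f (c - t)).
    have h1 : is_derive t 1 (fun t : R => c - t) (0 - 1).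
      by apply: is_deriveB.
    have := is_deriveN (@is_derive1_comp R F (fun t => c - t) t _ _ (dF (c - t)) h1).
    by rewrite sub0r mulrN1 opprK.
  rewrite (Rintegral_derive (@lerN10 R) dG); last first.
    by move=> t; apply: continuous_comp; [apply: cvgB; [exact: cvg_cst|exact: cvg_id]|exact: cf].
  by rewrite subr0 !opprK addrC.
have q0 : q x x = F (h + 1) - F h - (F (0 + 1) - F 0) - h * q v x.
  have q1 := shift 0 (lexx _); rewrite U_0 in q1.
  by rewrite -q1 -shift // -(ripZl hq) -!(ripBl hq).
(* [G h - G 0] is [q x x], and by the mean value theorem it is [h] times [q (U c v - v) x] for some
   [c] in between; one factor [nrm x] then cancels. *)
pose G t := F (t + 1) - F t - t * q v x.
have dG (t : R) : is_derive t 1 G (f (t + 1) - f t - q v x).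
  have h1 : is_derive t 1 (fun t : R => t + 1) (1 + 0) by apply: is_deriveD.
  have h2 := @is_derive1_comp R F (fun t => t + 1) t _ _ (dF (t + 1)) h1; rewrite addr0 mulr1 in h2.
  have h3 : is_derive t 1 (fun t : R => t * q v x) (q v x).
    have := is_deriveZ (q v x) (is_derive_id t (1 : R)).
    have -> : (q v x \*: id) = (fun t : R => t * q v x) by apply/funext => r; rewrite /= mulrC.
    by rewrite -[_ *: _]/(_ * _) mulr1.
  exact: is_deriveB (is_deriveB h2 (dF t)) h3.
have cG : continuous G by move=> t; exact: is_derive_continuous (dG t).
have [c /[!in_itv] /= /andP[c0 ch]] := MVT_segment h0 (fun t _ => dG t) (continuous_subspaceT cG).
have -> : G h - G 0 = q x x by rewrite q0 /G mul0r subr0; ring.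
rewrite subr0 => qx.
have fE : f (c + 1) - f c - q v x = q (U c v - v) x.
  rewrite /f /Ue !max_l //; last by rewrite addr_ge0.
  by rewrite -!(ripBl hq) U_add // -U_B.
have h4 := le_trans (ler_norm _) (hilbert_cs hX (U c v - v) x).
have h5 : nrm (U c v - v) <= e by apply: he; rewrite c0 ch.
have x0 := nrm_ge0 x.
have h6 : nrm x * nrm x <= h * e * nrm x.
  rewrite -expr2 (hilbert_nrm hX) qx fE.
  have : q (U c v - v) x <= e * nrm x by apply: le_trans h4 _; rewrite ler_wpM2r.
  by move=> h6; rewrite mulrC -mulrA; apply: ler_wpM2l.
have [xE|xN] := eqVneq (nrm x) 0.
  rewrite xE mulr_ge0 //; apply: le_trans h5; exact: nrm_ge0.
by move: h6; rewrite ler_pM2r // lt_neqAle eq_sym xN.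
Qed.

(** For [z] the integral of the orbit of [y] over [[0, 1]], the derivative of [U] at [z] is
    [U 1 y - y]. Undoing the factor [expR (- (lam * t))] adds [lam] times [z]. *)
Lemma orbit_generator y : exists z, dom B z /\
  Defs.oapp B z = ofR lam *: z + (U 1 y - y).
Proof.
have [z hz] := orbit_integral y; exists z; apply/generatorE => e e0.
set v := U 1 y - y in hz *.
have v0 := nrm_ge0 v; have z0 := nrm_ge0 z.
pose C := lam * nrm v + lam ^+ 2 * nrm z.
have C0 : 0 <= C by rewrite addr_ge0 // mulr_ge0 // ?sqr_ge0 // ltW.
have C1 : 0 < 4 * (C + 1) by rewrite mulr_gt0 // ltr_wpDl.
have e4 : 0 < e / 4 by rewrite divr_gt0.
have [d1 d10 hd] := U_small v e4.
exists (Num.min d1 (Num.min (e / (4 * (C + 1))) (1 / (2 * lam)))).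
  by rewrite !lt_min d10 !divr_gt0 // mulr_gt0.
move=> h /andP[h0]; rewrite !lt_min => /and3P[/ltW hd1 /ltW he /ltW hl].
rewrite ler_pdivlMr // in he; rewrite ler_pdivlMr ?mulr_gt0 // in hl.
have u0 : 0 <= lam * h by rewrite mulr_ge0 // ltW.
have u2 : lam * h <= 1 / 2 by lra.
pose E := expR (lam * h).
have E1 : 1 + lam * h <= E by exact: expR_ge1Dx.
have E2 : E <= 1 + lam * h + 2 * (lam * h) ^+ 2 by exact: expR_le_quadratic.
(* The three terms are the error of the quotient for [U], the deviation of [E] from one, and the
   second order remainder of [E]. *)
have -> : ofR h^-1 *: (S h z - z) - (ofR lam *: z + v) =
    ofR (h^-1 * E) *: (U h z - z - ofR h *: v) + ofR (E - 1) *: v +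
    ofR (h^-1 * (E - 1 - lam * h)) *: z.
  have -> : S h z = ofR E *: U h z.
    by rewrite /U scalerA -rmorphM /= -expRD subrr expR0 rmorph1 scale1r.
  have hE : h^-1 * E * h = E by rewrite mulrAC mulVf ?mul1r // gt_eqF.
  have hl' : h^-1 * (E - 1 - lam * h) = h^-1 * E - h^-1 - lam.
    by field; rewrite gt_eqF.
  rewrite hl' 2!scalerBr [ofR (h^-1 * E) *: (ofR h *: v)]scalerA -rmorphM /= hE.
  rewrite [ofR (E - 1)]rmorphB rmorph1 scalerBl scale1r.
  rewrite (rmorphB _ (h^-1 * E - h^-1)) (rmorphB _ (h^-1 * E)) /= !scalerBl scalerBr scalerA -rmorphM /=.
  move: (ofR (h^-1 * E) *: U h z) (ofR (h^-1 * E) *: z) (ofR h^-1 *: z) (ofR lam *: z) (ofR E *: v) => a b c d g.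
  rewrite opprD addrA -[in RHS](addrA (a - b)) [- g + _]addrA addNr add0r.
  by rewrite -[b - c - d]addrA [RHS]addrA [a - b - v + b]addrAC subrK [RHS]addrAC addrA.
have n1 := hz h (ltW h0) (e / 4) (fun r hr => hd r (introT andP (conj (proj1 (andP hr)) (le_trans (proj2 (andP hr)) hd1)))).
apply: le_trans (nrmD _ _) _; apply: le_trans (lerD (nrmD _ _) (lexx _)) _.
rewrite !nrm_ofRZ !ger0_norm; [|by rewrite mulr_ge0 ?invr_ge0 ?(ltW h0) //; lra|lra|by rewrite mulr_ge0 ?invr_ge0 ?(ltW h0) ?expR_ge0].
have E3 : E <= 2 by have : (lam * h) ^+ 2 <= 1 / 2 * (1 / 2); [rewrite expr2; exact: ler_pM|lra].
have b1 : h^-1 * E * nrm (U h z - z - ofR h *: v) <= e / 2.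
  apply: (@le_trans _ _ (h^-1 * E * (h * (e / 4)))).
    by rewrite ler_wpM2l // mulr_ge0 ?invr_ge0 ?(ltW h0) ?expR_ge0.
  have -> : h^-1 * E * (h * (e / 4)) = E * (e / 4) by field; rewrite gt_eqF.
  by have := ler_wpM2r (ltW e4) E3; lra.
have b2 : (E - 1) * nrm v <= 2 * h * (lam * nrm v).
  have : E - 1 <= 2 * (lam * h) by have : (lam * h) ^+ 2 <= 1 / 2 * (lam * h); [rewrite expr2; exact: ler_wpM2r|lra].
  move=> h5; have := ler_wpM2r v0 h5; lra.
have b3 : h^-1 * (E - 1 - lam * h) * nrm z <= 2 * h * (lam ^+ 2 * nrm z).
  have -> : 2 * h * (lam ^+ 2 * nrm z) = h^-1 * (2 * (lam * h) ^+ 2) * nrm z by field; rewrite gt_eqF.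
  by rewrite ler_wpM2r // ler_wpM2l ?invr_ge0 ?(ltW h0) //; lra.
have : 2 * h * C <= e / 2 by have := h0; lra.
by rewrite /C; lra.
Qed.

(** By [orbit_generator] the range of [lam - B] contains every [x - U 1 x] up to sign, and these
    exhaust the space because [U 1] has norm at most [expR (-1)]. An integral over one unit of time
    thus replaces the Laplace transform over the half-line. *)
Lemma generator_range y : exists2 z, dom B z & ofR lam *: z - Defs.oapp B z = y.
Proof.
have qE : qnorm q = (nrm : X -> R) by apply/funext; exact: qnorm_nrm.
have e10 : 0 <= expR (-1 : R) by exact: expR_ge0.
have e11 : expR (-1 : R) < 1 by rewrite expR_lt1 oppr_lt0.
have e1 := introT andP (conj e10 e11).
have cmp : ncomplete (qnorm q) by rewrite qE; exact: hilbert_complete hX.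
have U1 x : qnorm q (U 1 x) <= expR (-1) * qnorm q x by rewrite qE; exact: U_le.
have [x hx] := contraction_range hq cmp e1 (fun x y => U_B x y ler01) U1 y.
have [z [Dz hz]] := orbit_generator x; exists z => //.
by rewrite hz opprD addrA subrr add0r opprB.
Qed.

End Resolvent.
End ContractionGenerator.

(** * The delay operator *)

Section PrimitiveScale.
Context {R : realType} {K : scalars R} {V : normedModType K} {q : V -> V -> R}.
Hypothesis hV : hilbert q.
Notation mu := (@lebesgue_measure R).
Notation I := (`[-1, 0]%classic : set R).

Lemma sq_integrableZ (phi : R -> R) (f : R -> V) : continuous phi -> sq_integrable f ->
  sq_integrable (fun t => ofR (phi t) *: f t).
Proof.
move=> cphi [mf jf]; have [C hC] := continuous_bounded_itv cphi.
apply: (sq_integrable_le (k := fun t => C ^+ 2 * nrm (f t) ^+ 2)).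
- by apply: strongly_measurableZ hC mf; exact: measurable_continuous.
- move=> t It; rewrite nrm_ofRZ exprMn ler_wpM2r ?sqr_ge0 //.
  have h := hC t It; apply: lerXn2r; rewrite ?nnegrE //.
  exact: le_trans h.
- by apply: integrable_onZ => //; exact: measurable_itv.
Qed.

Lemma primitive_scale (a a' : R -> R) (G g : R -> V) :
  (forall t : R, is_derive t 1 a (a' t)) -> continuous a' ->
  sq_integrable g -> primitive (q := q) G g ->
  primitive (q := q) (fun t => ofR (a t) *: G t)
    (fun t => ofR (a' t) *: G t + ofR (a t) *: g t).
Proof.
move=> da ca' sg pG w s t s1 st t0; have hq := hilbert_ip hV.
have jg := sq_integrable_bochner sg.
have [_ h] := primitive_rule (@hilbert_real R) (sq_integrable_continuous ca')
  (sq_integrable_ip_real hV w sg) (primitive_derive da ca') (primitive_ip_real hV w jg pG).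
rewrite (ripBl hq) !(ripZl hq) h //; apply: eq_Rint => r _.
by rewrite (ripDl hq) !(ripZl hq).
Qed.

End PrimitiveScale.

Section HilbertSpace.
Context {R : realType} {K : scalars R} {X : completeNormedModType K}.
Variable ip : {dot X for sconj K}.
Hypothesis ip_norm : forall x : X, `|x| ^+ 2 = ip x x.

Lemma hilbert_dot : hilbert (fun x y : X => re (ip x y)).
Proof.
split; first exact: real_ip_dot.
  move=> x; rewrite -ip_norm -ofR_nrm -rmorphXn /= re_ofR //.
move=> u cu.
have cv : cvg (u @ \oo).
  apply/cauchy_cvgP; apply/cauchy_ballP => e e0.
  have eE : e = ofR (re `|e|) by rewrite re_normK ger0_norm // ltW.
  have re0 : 0 < re `|e|.
    rewrite lt_neqAle re_norm_ge0 andbT eq_sym.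
    by apply/eqP => r0; move: e0; rewrite eE r0 rmorph0 ltxx.
  have [n0 hn] := cu _ (divr_gt0 re0 (ltr0Sn R 1)).
  exists (u @` [set n | (n0 <= n)%N], u @` [set n | (n0 <= n)%N]).
    by split; exists n0 => // n nn; exists n.
  move=> [_ _] /= [[m hm <-] [n hn' <-]].
  rewrite -ball_normE /ball_ /= -ofR_nrm eE lt_neqAle ler_ofR (inj_eq (fmorph_inj _)) -lt_neqAle.
  apply: le_lt_trans (hn m n hm hn') _.
  by rewrite ltr_pdivrMr // ltr_pMr // ltr1n.
by exists (lim (u @ \oo)); apply/nlim_nrmP.
Qed.

End HilbertSpace.

Section DelaySemigroup.
Context {R : realType} {K : scalars R} {X : completeNormedModType K}.
Notation mu := (@lebesgue_measure R).
Notation I := (`[-1, 0]%classic : set R).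
Variable ip : {dot X for sconj K}.
Hypothesis ip_norm : forall x : X, `|x| ^+ 2 = ip x x.
Local Notation q := (fun x y : X => re (ip x y)).
Let hX : hilbert q := hilbert_dot ip_norm.
Let hq := hilbert_ip hX.

Variable zeta : R -> X -> X.
Hypothesis zeta_bounded : forall s, -1 <= s <= 0 -> bounded_operator nrm (zeta s).
Variable V : R -> R.
Hypothesis hV : variation_bound zeta V.

Let I0 : I 0. Proof. by rewrite /= in_itv /= lexx lerN10. Qed.
Let V0 : 0 <= V 0. Proof. exact: V_ge0 hV _ I0. Qed.

Let zD t x y : I t -> zeta t (x + y) = zeta t x + zeta t y.
Proof.
by rewrite /= in_itv /= => /zeta_bounded [l _]; have := l 1 x y; rewrite !scale1r.
Qed.

Let zZ t (k : K) x : I t -> zeta t (k *: x) = k *: zeta t x.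
Proof.
move=> It; have z0 : zeta t 0 = 0.
  by apply: (addrI (zeta t 0)); rewrite -zD // !addr0.
by move: It; rewrite /= in_itv /= => /zeta_bounded [l _]; have := l k x 0; rewrite z0 !addr0.
Qed.

(** A bound for [zeta (-1)] plus the total variation [V 0] serves for all [t]. *)
Let zC_exists : exists2 C, 0 <= C & forall t x, I t -> nrm (zeta t x) <= C * nrm x.
Proof.
have [_ [C hC]] := @zeta_bounded (-1) (introT andP (conj (lexx _) (@lerN10 R))).
exists (`|C| + V 0); first by rewrite addr_ge0.
move=> t x; rewrite /= in_itv /= => /andP[t1 t0].
have h1 := vb_le hV x (lexx (-1)) t1 t0; rewrite (vb_left hV) subr0 in h1.
have h2 := nrmD (zeta t x - zeta (-1) x) (zeta (-1) x); rewrite subrK in h2.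
have x0 := nrm_ge0 x.
have h3 : C * nrm x <= `|C| * nrm x by rewrite ler_wpM2r // ler_norm.
have h4 : V t * nrm x <= V 0 * nrm x by rewrite ler_wpM2r // (vb_mono hV).
by have h5 := hC x; lra.
Qed.

Let st_exists F g : sq_integrable g -> primitive (q := q) F g ->
  exists v, is_stieltjes zeta F v.
Proof.
by have [C C0 hC] := zC_exists; exact: (is_stieltjes_exists hX zD zZ C0 hC hV).
Qed.

(** [Phi] is defined by choice; for Sobolev functions the limit of the sums exists by integration by
    parts, so the chosen value is the integral. *)
Lemma PhiP (f : L2 X) : W12 f -> is_stieltjes zeta (crep f) (Phi zeta f).
Proof.
move=> /(W12P hX) [pf _]; have [v hv] := st_exists (L2rep_sq_integrable _) pf.
by rewrite /Phi (stieltjesE hv).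
Qed.

Lemma Phi_lin (k : K) (f g : L2 X) : W12 f -> W12 g ->
  Phi zeta (k *: f + g) = k *: Phi zeta f + Phi zeta g.
Proof.
move=> Wf Wg; have [_ _ E] := W12_lin hX k Wf Wg.
apply: stieltjesE; refine (is_stieltjes_lin zD zZ E (PhiP Wf) (PhiP Wg)).
Qed.

Local Notation tau := (fun t : R => 1 + V t).
Local Notation M := (1 + V 0).

Lemma weight_measurable : measurable_fun I tau.
Proof.
by apply: measurable_funD => //; apply: (measurable_V hV); exact: measurable_itv.
Qed.

Lemma weight_bounds t : I t -> 1 <= tau t <= M.
Proof.
by move=> It; have h1 := V_ge0 hV It; have h2 := V_le hV It; apply/andP; split; lra.
Qed.

Variable ip' : {dot (X * L2 X)%type for sconj K}.
Hypothesis ip'E : forall u v, ip' u v = ip u.1 v.1 + weighted_product ip tau u.2 v.2.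
Local Notation q' := (fun u v : X * L2 X => re (ip' u v)).
Let hq' : real_ip q' := real_ip_dot ip'.
Local Notation E h := (\int[mu]_(t in I) nrm (L2rep h t) ^+ 2).

Let E_ge0 (f : L2 X) : 0 <= E f.
Proof. by apply: Rintegral_ge0 => t _; exact: sqr_ge0. Qed.

Lemma product_norm_bounds (u : X * L2 X) :
  nrm u.1 ^+ 2 + E u.2 <= q' u u <= M * (nrm u.1 ^+ 2 + E u.2).
Proof.
have /andP[h1 h2] := weighted_product_bounds hX weight_measurable weight_bounds u.2.
rewrite ip'E reD -(hilbert_nrm hX); have := sqr_ge0 (nrm u.1).
by move=> h3; apply/andP; split; [lra|rewrite mulrDr; apply: lerD => //; rewrite ler_peMl // lerDl].
Qed.

Lemma product_complete : ncomplete (qnorm q').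
Proof.
move=> u cu.
have bnd (v : X * L2 X) (e : R) : qnorm q' v <= e -> nrm v.1 <= e /\ E v.2 <= e ^+ 2.
  move=> h; have /andP[h1 _] := product_norm_bounds v.
  have n0 := qnorm_ge0 q' v; have e0 := le_trans n0 h.
  have h2 : qnorm q' v ^+ 2 <= e ^+ 2 by apply: lerXn2r; rewrite ?nnegrE.
  rewrite (sqr_qnorm hq') in h2; have h3 := sqr_ge0 (nrm v.1); have h4 := E_ge0 v.2.
  split; last by lra.
  by rewrite -ler_sqr ?nnegrE ?nrm_ge0 //; lra.
have c1 : ncauchy nrm (fun n => (u n).1).
  move=> e e0; have [n0 hn] := cu e e0; exists n0 => m n hm hn'.
  by have [] := bnd _ _ (hn m n hm hn').
have [x hx] := hilbert_complete hX c1.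
have [f hf] : exists l, forall e : R, 0 < e -> exists n0, forall n, (n0 <= n)%N ->
     E ((u n).2 - l) <= e.
  apply: (L2_complete hX (f := fun n => (u n).2)) => e e0.
  have s0 : 0 < Num.sqrt e by rewrite sqrtr_gt0.
  have [n0 hn] := cu _ s0; exists n0 => m n hm hn'.
  by have [_] := bnd _ _ (hn m n hm hn'); rewrite sqr_sqrtr // ltW.
exists (x, f) => e e0.
have M0 : 0 < M by rewrite ltr_wpDr.
have e1 : 0 < e ^+ 2 / (2 * M) by rewrite divr_gt0 ?exprn_gt0 // mulr_gt0.
have s0 : 0 < Num.sqrt (e ^+ 2 / (2 * M)) by rewrite sqrtr_gt0.
have [n1 h1] := hx _ s0; have [n2 h2] := hf _ e1.
exists (maxn n1 n2) => n; rewrite geq_max => /andP[/h1 xn /h2 fn].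
rewrite -ler_sqr ?nnegrE ?qnorm_ge0 ?(ltW e0) // (sqr_qnorm hq').
have /andP[_ h] := product_norm_bounds (u n - (x, f)); apply: le_trans h _ => /=.
have h3 : nrm ((u n).1 - x) ^+ 2 <= e ^+ 2 / (2 * M).
  by rewrite -[leRHS]sqr_sqrtr ?(ltW e1) // lerXn2r ?nnegrE ?nrm_ge0 ?sqrtr_ge0.
have -> : e ^+ 2 = M * (e ^+ 2 / (2 * M) + e ^+ 2 / (2 * M)) by field; rewrite gt_eqF.
by rewrite ler_wpM2l ?(ltW M0) // lerD.
Qed.

Lemma product_equivalent : equivalent_inner_products (canonical_ip ip) ip'.
Proof.
have M1 : 1 <= M by rewrite lerDl.
have cE (u : X * L2 X) : re (canonical_ip ip u u) = nrm u.1 ^+ 2 + E u.2.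
  rewrite /canonical_ip reD -(hilbert_nrm hX); congr (_ + _).
  (* The canonical product is the weighted one for the constant weight [1]. *)
  have m1 : measurable_fun I (fun=> 1 : R) by exact: measurable_cst.
  have j := dot_bochner_integrable hX (M := 1) m1
    (fun t _ => introT andP (conj (lexx 1) (lexx 1))) (L2rep_sq_integrable u.2) (L2rep_sq_integrable u.2).
  have jE : (fun t => ofR (1 : R) *: (ip (L2rep u.2 t) (L2rep u.2 t) : K^o)) =
      (fun t => ip (L2rep u.2 t) (L2rep u.2 t) : K^o).
    by apply/funext => t; rewrite rmorph1 scale1r.
  rewrite jE in j.
  rewrite (bochner_functional hilbert_scalars re_bounded_functional j).
  by apply: eq_Rint => t _; rewrite (hilbert_nrm hX).
exists 1, M; split; [by []|exact: lt_le_trans M1|] => u.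
have /andP[h1 h2] := product_norm_bounds u.
rewrite /ipnorm cE mul1r; apply/andP; split; first by rewrite ler_wsqrtr.
have s0 : 0 <= nrm u.1 ^+ 2 + E u.2 by rewrite addr_ge0 ?sqr_ge0.
(* The ratio of the norms is at most the square root of [M], and [M >= 1] allows [M] itself as the
   constant. *)
rewrite -[X in X * _]ger0_norm ?(le_trans ler01) // -sqrtr_sqr -sqrtrM ?sqr_ge0 //.
rewrite ler_wsqrtr //; apply: le_trans h2 _.
by rewrite ler_wpM2r // expr2 ler_peMr // (le_trans ler01).
Qed.

Variables (B : operator X) (S : R -> X -> X) (m : R).
Hypothesis S_c0 : c0_semigroup nrm S.
Hypothesis S_gen : generator nrm S B.
Hypothesis S_contr : forall t, 0 <= t -> opnorm nrm (S t) <= expR (m * t).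
Local Notation A := (delay_operator B zeta).

Let B_lin := generator_linear S_c0 S_gen.
Let B_diss := generator_dissipative hX S_c0 S_gen S_contr.

Lemma delay_linear (k : K) u v : dom A u -> dom A v ->
  dom A (k *: u + v) /\ Defs.oapp A (k *: u + v) = k *: Defs.oapp A u + Defs.oapp A v.
Proof.
case: u v => [x f] [y g] /= [/= Dx Wf fx] [/= Dy Wg gy].
have [D1 D2] := B_lin k Dx Dy; have [W1 W2 W3] := W12_lin hX k Wf Wg.
split; first by split; rewrite /= ?W3 ?fx ?gy.
rewrite -[RHS]/(k *: (Defs.oapp B x + Phi zeta f) + (Defs.oapp B y + Phi zeta g),
  k *: wderiv f + wderiv g).
by rewrite D2 W2 Phi_lin // scalerDr addrACA.
Qed.

(** Origin of the constant: $2|m|$ comes from [B], and [V 0] is half of $2V(0)$ in Young's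
    inequality, where $f(0)=x$. The summand [1] covers the half of $|x|^2$ left by the boundary term
    at [0]; the boundary term at [-1] has the favourable sign. *)
Lemma delay_dissipative u : dom A u ->
  q' (Defs.oapp A u) u <= (2 * `|m| + V 0 + 1) * q' u u.
Proof.
case: u => [x f] /= [/= Dx Wf fx].
have [pF fF] := W12P hX Wf; set F := crep f in pF fF fx *; set g := L2rep (wderiv f) in pF.
have sg := L2rep_sq_integrable (wderiv f); have jg := sq_integrable_bochner sg.
have mI : measurable I by exact: measurable_itv.
have mF := primitive_strongly_measurable hX sg pF.
have [j2 rule] := primitive_rule hX sg sg pF pF.
have {}j2 : integrable_on I (fun r => 2 * q (g r) (F r)).
  by apply: eq_integrable j2 => // r _ /=; rewrite (rip_sym hq (F r)); congr (_%:E); ring.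
have {}rule : \int[mu]_(r in I) (2 * q (g r) (F r)) = nrm x ^+ 2 - nrm (F (-1)) ^+ 2.
  have := rule (-1) 0 (lexx _) (@lerN10 R) (lexx _); rewrite fx -!(hilbert_nrm hX) => ->.
  by apply: eq_Rint => r _; rewrite (rip_sym hq (F r)); ring.
have mV : measurable_fun I V by exact: measurable_V hV _ _.
have jV : integrable_on I (fun r => V r * (2 * q (g r) (F r))).
  apply: (integrable_on_le (g := fun r => V 0 * `|2 * q (g r) (F r)|)) => //.
  - by apply: measurable_funM => //; exact: integrable_on_measurable j2.
  - move=> r Ir; rewrite normrM ler_wpM2r // ger0_norm ?(V_ge0 hV Ir) //; exact: V_le hV _ Ir.
  - by apply: integrable_onZ => //; exact: integrable_on_norm.
have jT : integrable_on I (fun r => tau r * q (g r) (F r)).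
  have := integrable_onZ 2^-1 mI (integrable_onD mI j2 jV).
  by apply: eq_integrable => // r _ /=; congr (_%:E); field.
have TE : \int[mu]_(r in I) (tau r * q (g r) (F r)) =
    2^-1 * (nrm x ^+ 2 - nrm (F (-1)) ^+ 2 + \int[mu]_(r in I) (V r * (2 * q (g r) (F r)))).
  rewrite -rule -RintD // -RintZ //; last exact: integrable_onD.
  by apply: eq_Rint => r _; field.
have wE : re (weighted_product ip tau (wderiv f) f) = \int[mu]_(r in I) (tau r * q (g r) (F r)).
  rewrite (re_weighted_product hX weight_measurable weight_bounds).
  apply/esym; apply: (proj2 (ae_eq_Rintegral jT _ _)).
    apply: measurable_funM; first exact: weight_measurable.
    exact: (measurable_ip hX (L2rep_sq_integrable (wderiv f)).1 (L2rep_sq_integrable f).1).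
  by apply: aeS fF => r + Ir => /(_ Ir) ->.
have young := is_stieltjes_young hX hV x sg pF (PhiP Wf).
rewrite fx in young.
have h1 := B_diss Dx; have h2 := le_trans (ler_norm _) (hilbert_cs hX (Phi zeta f) x).
have /andP[h3 _] := product_norm_bounds (x, f); rewrite /= in h3.
rewrite ip'E reD /= (ripDl hq) wE TE.
have c0 : 0 <= 2 * `|m| + V 0 + 1 by rewrite !addr_ge0 // mulr_ge0.
have h4 := ler_wpM2l c0 h3.
have h5 : (2 * `|m| + V 0 + 1) * (nrm x ^+ 2 + E f) =
    2 * `|m| * nrm x ^+ 2 + V 0 * nrm x ^+ 2 + nrm x ^+ 2 + (2 * `|m| + V 0 + 1) * E f by ring.
have h6 : 0 <= (2 * `|m| + V 0 + 1) * E f by rewrite mulr_ge0.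
rewrite -(hilbert_nrm hX) in h1.
have h7 := sqr_ge0 (nrm (F (-1))); have h8 := sqr_ge0 (nrm x).
move: h1 h2 young h4 h5 h6 h7 h8.
move: (\int[mu]_(_ in _) (_ * (_ * _))) => W.
move: (q (Defs.oapp B x) x) (q (Phi zeta f) x) (nrm (Phi zeta f) * nrm x) => a b c.
move: (nrm (F (-1)) ^+ 2) (V 0 * nrm x ^+ 2) (2 * `|m| * nrm x ^+ 2) (nrm x ^+ 2) => d e e' k.
by lra.
Qed.

Section Range.
Variable lam : R.
Hypothesis lam_ge : 2 * `|m| + 2 * V 0 + 2 <= lam.

Let lam0 : 0 < lam.
Proof. by have := normr_ge0 m; move: lam_ge V0; lra. Qed.

Let lam_m : `|m| + 1 <= lam.
Proof. by have := normr_ge0 m; move: lam_ge V0; lra. Qed.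

(** Dissipativity bounds the left factor by $\lambda - 2|m|$, which the choice of [lam] keeps above
    $2V(0)+2$: the resolvent, multiplied by [V 0], then has norm at most [1 / 2]. *)
Lemma resolvent_bound x : dom B x ->
  (2 * V 0 + 2) * nrm x <= nrm (ofR lam *: x - Defs.oapp B x).
Proof.
move=> Dx; have h1 := B_diss Dx.
have h2 := le_trans (ler_norm _) (hilbert_cs hX (ofR lam *: x - Defs.oapp B x) x).
rewrite (ripBl hq) (ripZl hq) in h2; rewrite -(hilbert_nrm hX) in h1 h2.
have [->|x0] := eqVneq (nrm x) 0; first by rewrite mulr0 nrm_ge0.
have xp : 0 < nrm x by rewrite lt_neqAle eq_sym x0 nrm_ge0.
rewrite -(ler_pM2r xp); apply: le_trans h2.
have : (2 * V 0 + 2) * nrm x * nrm x <= (lam - 2 * `|m|) * nrm x * nrm x.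
  by do 2! (apply: ler_wpM2r; first exact: nrm_ge0); move: lam_ge; lra.
have -> : (lam - 2 * `|m|) * nrm x * nrm x = lam * nrm x ^+ 2 - 2 * `|m| * nrm x ^+ 2 by ring.
by lra.
Qed.

(** Preimages under [lam - B] are chosen; the choice respects differences because [resolvent_bound]
    makes them unique. *)
Lemma resolvent_exists : exists res : X -> X,
  [/\ forall z, dom B (res z), forall z, ofR lam *: res z - Defs.oapp B (res z) = z,
    forall z z', res (z - z') = res z - res z' &
    forall z, (2 * V 0 + 2) * nrm (res z) <= nrm z].
Proof.
have [res hres] : exists res : X -> X, forall z, dom B (res z) /\
    ofR lam *: res z - Defs.oapp B (res z) = z.
  have ran z : exists x, dom B x /\ ofR lam *: x - Defs.oapp B x = z.
    by have [x Dx hx] := generator_range hX S_c0 S_gen S_contr lam_m z; exists x.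
  by exists (fun z => projT1 (cid (ran z))) => z; exact: projT2 (cid (ran z)).
have DB x y : dom B x -> dom B y -> dom B (x - y) /\
    Defs.oapp B (x - y) = Defs.oapp B x - Defs.oapp B y.
  by move=> Dx Dy; have := B_lin (-1) Dy Dx; rewrite !scaleN1r ![- _ + _]addrC.
exists res; split.
- by move=> z; have [] := hres z.
- by move=> z; have [] := hres z.
- move=> z z'; have [D1 E1] := hres (z - z'); have [D2 E2] := hres z; have [D3 E3] := hres z'.
  have [D4 E4] := DB _ _ D2 D3; have [D5 E5] := DB _ _ D1 D4.
  have := resolvent_bound D5; rewrite E5 E4 !scalerBr.
  rewrite subrACA E1 [ofR lam *: res z - _ - _]subrACA E2 E3 subrr nrm0.
  rewrite pmulr_rle0; last by move: V0; lra.
  move=> h; apply/eqP; rewrite -subr_eq0; apply/eqP; apply: nrm_eq0; apply/eqP.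
  by rewrite eq_le h nrm_ge0.
- by move=> z; have [D1 E1] := hres z; have := resolvent_bound D1; rewrite E1.
Qed.

Local Notation ex := (fun t : R => expR (lam * t)).
Local Notation ex' := (fun t : R => lam * expR (lam * t)).

Let dex (t : R) : is_derive t 1 ex (ex' t).
Proof.
have h1 : is_derive t 1 (fun t : R => lam * t) lam.
  by have := is_deriveZ lam (is_derive_id t (1 : R)); rewrite -[_ *: 1]/(_ * _) mulr1.
by have := @is_derive1_comp R expR (fun t => lam * t) t _ _ (is_derive_expR _) h1; rewrite mulrC.
Qed.

Let cex : continuous ex. Proof. by move=> t; exact: is_derive_continuous (dex t). Qed.

Let cex' : continuous ex'.
Proof. by move=> t; apply: cvgM; [exact: cvg_cst|exact: cex]. Qed.

Lemma exp_primitive (G g : R -> X) : sq_integrable g -> primitive (q := q) G g ->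
  sq_integrable (fun t => ofR (ex' t) *: G t + ofR (ex t) *: g t) /\
  primitive (q := q) (fun t => ofR (ex t) *: G t)
    (fun t => ofR (ex' t) *: G t + ofR (ex t) *: g t).
Proof.
move=> sg pG; split; last exact: (primitive_scale hX dex cex' sg pG).
have sG := primitive_sq_integrable hX sg pG.
exact: (sq_integrableD (sq_integrableZ cex' sG) (sq_integrableZ cex sg)).1.
Qed.

(** The second equation is solved by $F_x(t) = e^{\lambda t}(x + \int_t^0 e^{-\lambda s}k(s)\,ds)$,
    for every [x]. In the first one the unknown is $z = \lambda x - Bx$ instead of [x]: with
    [x = res z] it reads $z - \Phi(e^{\lambda\cdot}\,\mathrm{res}\,z) = y + \Phi(F_0)$, a fixed
    point problem free of unbounded operators. *)
Lemma delay_range (w : X * L2 X) : exists2 u, dom A u & ofR lam *: u - Defs.oapp A u = w.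
Proof.
case: w => y k.
have [res [res_dom resE resB res_le]] := resolvent_exists.
have inI (t : R) : I t -> -1 <= t /\ t <= 0 by rewrite /= in_itv /= => /andP[].
pose Fe (x : X) t := ofR (ex t) *: x.
have s0 : sq_integrable (fun=> 0 : X).
  split; first exact: fsimple_strongly_measurable (simple_cst _).
  by rewrite nrm0 expr0n; exact: integrable_on_cst.
have pcst (x : X) : primitive (q := q) (fun=> x) (fun=> 0).
  move=> w s t s1 st t0; rewrite subrr (rip0l hq) Rintegral_cst_itv // mul0r //.
have st_Fe x : is_stieltjes zeta (Fe x) (stieltjes zeta (Fe x)).
  have [sg pg] := exp_primitive s0 (pcst x); have [v hv] := st_exists sg pg.
  by rewrite (stieltjesE hv).
have FeB x x' : stieltjes zeta (Fe (x - x')) = stieltjes zeta (Fe x) - stieltjes zeta (Fe x').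
  have -> : stieltjes zeta (Fe x) - stieltjes zeta (Fe x') =
      -1 *: stieltjes zeta (Fe x') + stieltjes zeta (Fe x) by rewrite scaleN1r addrC.
  apply: stieltjesE.
  refine (is_stieltjes_lin zD zZ _ (st_Fe x') (st_Fe x)) => t _.
  by rewrite /Fe scalerBr scaleN1r addrC.
have Fe_le x : nrm (stieltjes zeta (Fe x)) <= V 0 * nrm x.
  apply: (is_stieltjes_bound hV (st_Fe x)) => t /inI[_ t0].
  rewrite nrm_ofRZ ger0_norm ?expR_ge0 // ler_piMl ?nrm_ge0 //.
  by rewrite -[leRHS]expR0 ler_expR pmulr_rle0.
pose kap := L2rep k.
pose p t := ofR (expR (- (lam * t))) *: kap t.
have cnex : continuous (fun t : R => expR (- (lam * t))).
  move=> t; apply: continuous_comp; last exact: continuous_expR.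
  by apply: cvgN; apply: cvgM; [exact: cvg_cst|exact: cvg_id].
have sp : sq_integrable p by exact: sq_integrableZ cnex (L2rep_sq_integrable k).
have [P pP] := primitive_exists hX (sq_integrable_bochner sp).
have sNp : sq_integrable (fun t => -1 *: p t) by exact: sq_integrable_scale.
pose G x t := x + (P 0 - P t).
have pG x : primitive (q := q) (G x) (fun t => -1 *: p t).
  move=> w s t s1 st t0.
  have -> : G x t - G x s = - (P t - P s).
    by rewrite /G [in LHS]opprD addrACA subrr add0r subrACA subrr sub0r.
  rewrite (ripNl hq) pP // -RintegralN //; last first.
    by apply: integrable_on_itv => //; exact: bfun_integrable (bounded_functional_ip hX w) (sq_integrable_bochner sp).
  by apply: eq_Rint => r _; rewrite scaleN1r (ripNl hq).
pose F x t := ofR (ex t) *: G x t.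
have st_F0 : is_stieltjes zeta (F 0) (stieltjes zeta (F 0)).
  have [sg pg] := exp_primitive sNp (pG 0); have [v hv] := st_exists sg pg.
  by rewrite (stieltjesE hv).
have qE : qnorm q = (nrm : X -> R) by apply/funext; exact: qnorm_nrm.
have cmp : ncomplete (qnorm q) by rewrite qE; exact: hilbert_complete hX.
pose L z := stieltjes zeta (Fe (res z)).
have LB z z' : L (z - z') = L z - L z' by rewrite /L resB FeB.
(* [V 0] bounds the integral of an exponential, which is at most one on [[-1, 0]], and
   [V 0 / (2 * V 0 + 2) <= 1 / 2]. *)
have Lc z : qnorm q (L z) <= 1 / 2 * qnorm q z.
  rewrite qE; apply: le_trans (Fe_le _) _; have := res_le z; have := nrm_ge0 (res z).
  by lra.
have c0 : 0 <= 1 / 2 :> R by lra.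
have c1 : 1 / 2 < 1 :> R by lra.
have c01 := introT andP (conj c0 c1).
have [z hz] := contraction_range hq cmp c01 LB Lc (y + stieltjes zeta (F 0)).
set x := res z.
have [sg pg] := exp_primitive sNp (pG x).
have [f [Wf fF fg cf]] := W12_primitive hX sg pg.
(* The exponentials cancel in the last term, so the derivative of [F x] is [lam] times [F x] minus
   [kap], as the second equation demands. *)
have gE t : ofR (ex' t) *: G x t + ofR (ex t) *: (-1 *: p t) = ofR lam *: F x t - kap t.
  rewrite /F scalerA -rmorphM scaleN1r scalerN /p scalerA -rmorphM /= -expRD subrr expR0.
  by rewrite rmorph1 scale1r.
have xE : crep f 0 = x.
  by rewrite cf //= /G subrr addr0 mulr0 expR0 rmorph1 scale1r.
have PhiE : Phi zeta f = L z + stieltjes zeta (F 0).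
  apply: stieltjesE; rewrite -[L z]scale1r.
  apply: (is_stieltjes_ext (F := F x)); first by move=> t It; rewrite cf.
  refine (is_stieltjes_lin zD zZ _ (st_Fe x) st_F0) => t _.
  by rewrite scale1r /F /Fe /G add0r scalerDr.
exists (x, f); first by split => //=; exact: res_dom.
rewrite -[LHS]/(ofR lam *: x - (Defs.oapp B x + Phi zeta f), ofR lam *: f - wderiv f).
congr pair.
  rewrite PhiE opprD addrA resE opprD addrA hz addrK //.
apply: L2_eq.
have h1 := aeS2 (fun t a b => conj a b) (L2repB (ofR lam *: f) (wderiv f)) (L2repZ (ofR lam) f).
have h2 := aeS2 (fun t a b => conj a b) fF fg.
apply: aeS2 h1 h2 => t [a1 a2] [a3 a4] It.
rewrite a1 // a2 // a3 // a4 // gE /F opprB addrC subrK //.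
Qed.
End Range.

Lemma delay_generates :
  generates_generalized_contraction_semigroup (ipnorm ip') A.
Proof.
have m0 := normr_ge0 m.
pose Lam := 2 * `|m| + 2 * V 0 + 2.
have Lam0 : 0 < Lam by rewrite /Lam; move: V0; lra.
have L0 : 0 < 2 * Lam by rewrite mulr_gt0.
(* [Lam] serves twice: [h <= (2 * Lam)^-1] makes [h^-1] admissible in [delay_range], and the step
   condition holds because $2|m| + V(0) + 1$ is at most [Lam]. *)
apply: (@lumer_phillips R K _ q' hq' product_complete A delay_linear
  (2 * `|m| + V 0 + 1) (2 * Lam)^-1).
- by move: V0; lra.
- by rewrite invr_gt0.
- by rewrite mulrC ler_pdivrMr // /Lam; move: V0; lra.
- exact: delay_dissipative.
move=> h w /andP[h0 hL].
have hi : Lam <= h^-1.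
  apply: (@le_trans _ _ (2 * Lam)); first by lra.
  by rewrite -[2 * Lam]invrK lef_pV2 ?posrE ?invr_gt0.
have [u Du hu] := delay_range hi (ofR h^-1 *: w).
exists u => //; have -> : w = ofR h *: (ofR h^-1 *: w).
  by rewrite scalerA -rmorphM /= divff ?rmorph1 ?scale1r // gt_eqF.
by rewrite -hu scalerBr scalerA -rmorphM /= divff ?rmorph1 ?scale1r // gt_eqF.
Qed.

End DelaySemigroup.

Theorem theorem3p7 (R : realType) (K : scalars R)
    (X : completeNormedModType K) (ip : {dot X for sconj K})
    (ip_norm : forall x : X, `|x| ^+ 2 = ip x x)
    (B : operator X) (B_c0 : generates_c0_semigroup nrm B)
    (zeta : R -> X -> X)
    (zeta_bounded : forall s, -1 <= s <= 0 -> bounded_operator nrm (zeta s))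
    (zeta_bv : op_bounded_variation zeta)
    (B_contr : generates_generalized_contraction_semigroup nrm B) :
  exists ip' : {dot (X * L2 X)%type for sconj K},
    equivalent_inner_products (canonical_ip ip) ip' /\
    generates_generalized_contraction_semigroup (ipnorm ip')
      (delay_operator B zeta).
Proof.
have hX := hilbert_dot ip_norm.
have [V hV] := variation_bound_exists zeta_bounded zeta_bv.
have [ip' ip'E] := weighted_dot_exists hX (weight_measurable hV) (weight_bounds hV).
have [S [S_c0 S_gen [m S_contr]]] := B_contr.
exists ip'; split; first exact: (product_equivalent ip_norm hV ip'E).
exact: (delay_generates ip_norm zeta_bounded hV ip'E S_c0 S_gen S_contr).
Qed.
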